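(* Every oriented $4$-dimensional complete gradient steady Ricci soliton $(M^4,g,f)$ with nonnegative isotropic curvature has $2$-nonnegative Ricci curvature and bounded curvature $$|Rm|\le R\le 1,$$ where $g$ is normalized so that $R+|\nabla f|^2=1$.
   Context: A gradient steady Ricci soliton $(M^4,g,f)$ is a complete Riemannian manifold with a smooth function $f$ such that $Rc+\nabla^2 f=0$. On such a soliton $R+|\nabla f|^2$ is constant, and the metric is scaled so that this constant equals $1$. Let $(M^4,g)$ be an oriented Riemannian $4$-manifold with curvature tensor $R_{ijkl}$ (sign convention: $R_{ijij}$ is the sectional curvature of the plane spanned by orthonormal $e_i,e_j$), scalar curvature $R$ and Weyl curvature $W=W^++W^-$. Equip $\wedge^2(M)$ with the inner product for which $\{e_i\wedge e_j\}_{i<j}$ is orthonormal whenever $\{e_i\}$ is, and view the curvature operator as $Rm(e_i\wedge e_j,e_k\wedge e_l)=R_{ijkl}$; $|Rm|$ is its Hilbert–Schmidt norm on $\wedge^2(M)$. With respect to $\wedge^2(M)=\wedge^+(M)\oplus\wedge^-(M)$ the diagonal blocks of $Rm$ are $A=W^++\frac{R}{12}I$ and $C=W^-+\frac{R}{12}I$, with eigenvalues $A_1\le A_2\le A_3$ and $C_1\le C_2\le C_3$. Nonnegative isotropic curvature means $A_1+A_2\ge0$ and $C_1+C_2\ge0$ everywhere; equivalently $R_{1313}+R_{1414}+R_{2323}+R_{2424}-2R_{1234}\ge0$ for all orthonormal four-frames. The Ricci curvature is $2$-nonnegative if the sum of the two smallest eigenvalues of $Rc$ is $\ge0$ everywhere.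 *)

(* Defs.v *)
From HB Require Import structures.
From mathcomp Require Import all_boot all_order all_algebra.
From mathcomp Require Import all_classical all_reals all_analysis.

Set Implicit Arguments.
Unset Strict Implicit.
Unset Printing Implicit Defensive.
Import Order.TTheory GRing.Theory Num.Theory.
Import numFieldNormedType.Exports.

Local Open Scope classical_set_scope.
Local Open Scope ring_scope.

(** Coordinate functions are total; only their values on the relevant open set
    are meaningful (derivatives at a point of it depend only on the germ). *)

Definition partial (R : realType) (n : nat) (i : 'I_n.+1)
    (f : 'rV[R]_n.+1 -> R) : 'rV[R]_n.+1 -> R :=
  fun x => 'D_(delta_mx 0 i) f x.

Definition iter_partial (R : realType) (n : nat) (s : seq 'I_n.+1)
    (f : 'rV[R]_n.+1 -> R) : 'rV[R]_n.+1 -> R :=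
  foldr (@partial R n) f s.

(** C^oo: all iterated partial derivatives exist and are continuous. *)
Definition smooth_on (R : realType) (n : nat) (U : set 'rV[R]_n.+1)
    (f : 'rV[R]_n.+1 -> R) : Prop :=
  forall (s : seq 'I_n.+1) (x : 'rV[R]_n.+1), U x ->
    {for x, continuous (iter_partial s f)} /\
    forall i : 'I_n.+1, derivable (iter_partial s f) x (delta_mx 0 i).

Record smooth_atlas (R : realType) (n : nat) (M : topologicalType) :=
  SmoothAtlas {
    chart_index : Type;
    chart_dom : chart_index -> set M;
    chart : chart_index -> M -> 'rV[R]_n.+1;
    chart_inv : chart_index -> 'rV[R]_n.+1 -> M;
    chart_cover : forall p : M, exists a, chart_dom a p;
    chart_dom_open : forall a, open (chart_dom a);
    chart_cod_open : forall a, open (chart a @` chart_dom a);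
    chartK : forall a p, chart_dom a p -> chart_inv a (chart a p) = p;
    chart_continuous : forall a p, chart_dom a p ->
      {for p, continuous (chart a)};
    chart_inv_continuous : forall a x, (chart a @` chart_dom a) x ->
      {for x, continuous (chart_inv a)};
    transition_smooth : forall a b (j : 'I_n.+1),
      smooth_on (chart a @` (chart_dom a `&` chart_dom b))
                (fun x => chart b (chart_inv a x) 0 j)
  }.

Definition chart_cod (R : realType) (n : nat) (M : topologicalType)
    (A : smooth_atlas R n M) (a : chart_index A) : set 'rV[R]_n.+1 :=
  chart a @` chart_dom a.

Definition transition (R : realType) (n : nat) (M : topologicalType)
    (A : smooth_atlas R n M) (a b : chart_index A) :
    'rV[R]_n.+1 -> 'rV[R]_n.+1 :=
  chart b \o chart_inv a.

(** An orientation is given by an atlas whose transition maps all preserve the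
    standard orientation of R^(n+1). *)
Definition oriented_atlas (R : realType) (n : nat) (M : topologicalType)
    (A : smooth_atlas R n M) : Prop :=
  forall (a b : chart_index A) (p : M), chart_dom a p -> chart_dom b p ->
    0 < \det ('J (transition a b) (chart a p)).

Definition smooth_function (R : realType) (n : nat) (M : topologicalType)
    (A : smooth_atlas R n M) (f : M -> R) : Prop :=
  forall a : chart_index A, smooth_on (chart_cod a) (f \o chart_inv a).

(** [metric g a x i j] is g(d_i, d_j) in the chart [a] at the point with
    coordinates [x].  Since ['J F x i j] is the i-th partial derivative of the
    j-th component of F, the last axiom is the transformation rule of a
    covariant 2-tensor. *)

Record riemannian_metric (R : realType) (n : nat) (M : topologicalType)
    (A : smooth_atlas R n M) := RiemannianMetric {
  metric : chart_index A -> 'rV[R]_n.+1 -> 'M[R]_n.+1;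
  metric_smooth : forall (a : chart_index A) (i j : 'I_n.+1),
    smooth_on (chart_cod a) (fun x => metric a x i j);
  metric_sym : forall (a : chart_index A) x, chart_cod a x ->
    (metric a x)^T = metric a x;
  metric_posdef : forall (a : chart_index A) x, chart_cod a x ->
    forall v : 'rV[R]_n.+1, v != 0 -> 0 < (v *m metric a x *m v^T) 0 0;
  metric_compat : forall (a b : chart_index A) (p : M),
    chart_dom a p -> chart_dom b p ->
    metric a (chart a p) =
      'J (transition a b) (chart a p) *m metric b (chart b p)
        *m ('J (transition a b) (chart a p))^T
}.

(** From here on [g] is the matrix of components of a metric on an open subset of
    R^(n+1), and [f] a function on it, unless [g] is a [riemannian_metric]. *)

(** [christoffel g k i j] is Gamma^k_ij, the Levi-Civita connection. *)
Definition christoffel (R : realType) (n : nat)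
    (g : 'rV[R]_n.+1 -> 'M[R]_n.+1) (k i j : 'I_n.+1) (x : 'rV[R]_n.+1) : R :=
  2^-1 * \sum_(l < n.+1) invmx (g x) k l *
    (partial i (fun y => g y j l) x + partial j (fun y => g y i l) x
     - partial l (fun y => g y i j) x).

(** The d_m component of R(d_i, d_j) d_k, where
    R(X, Y) Z = D_X D_Y Z - D_Y D_X Z - D_[X,Y] Z. *)
Definition riemann_up (R : realType) (n : nat)
    (g : 'rV[R]_n.+1 -> 'M[R]_n.+1) (i j k m : 'I_n.+1) (x : 'rV[R]_n.+1) : R :=
  partial i (christoffel g m j k) x - partial j (christoffel g m i k) x
  + \sum_(l < n.+1) (christoffel g m i l x * christoffel g l j k x
                     - christoffel g m j l x * christoffel g l i k x).

(** R_ijkl = g(R(d_i, d_j) d_l, d_k), so that R_ijij is the sectional curvature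
    in an orthonormal frame. *)
Definition riemann (R : realType) (n : nat)
    (g : 'rV[R]_n.+1 -> 'M[R]_n.+1) (i j k l : 'I_n.+1) (x : 'rV[R]_n.+1) : R :=
  \sum_(m < n.+1) g x k m * riemann_up g i j l m x.

Definition ricci (R : realType) (n : nat)
    (g : 'rV[R]_n.+1 -> 'M[R]_n.+1) (x : 'rV[R]_n.+1) : 'M[R]_n.+1 :=
  \matrix_(i, k) \sum_(j < n.+1) \sum_(l < n.+1)
    invmx (g x) j l * riemann g i j k l x.

Definition scalar_curvature (R : realType) (n : nat)
    (g : 'rV[R]_n.+1 -> 'M[R]_n.+1) (x : 'rV[R]_n.+1) : R :=
  \sum_(i < n.+1) \sum_(k < n.+1) invmx (g x) i k * ricci g x i k.

Definition hessian (R : realType) (n : nat)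
    (g : 'rV[R]_n.+1 -> 'M[R]_n.+1) (f : 'rV[R]_n.+1 -> R) (x : 'rV[R]_n.+1) :
    'M[R]_n.+1 :=
  \matrix_(i, j) (partial i (partial j f) x
                  - \sum_(k < n.+1) christoffel g k i j x * partial k f x).

Definition grad_norm_sq (R : realType) (n : nat)
    (g : 'rV[R]_n.+1 -> 'M[R]_n.+1) (f : 'rV[R]_n.+1 -> R) (x : 'rV[R]_n.+1) :
    R :=
  \sum_(i < n.+1) \sum_(j < n.+1)
    invmx (g x) i j * partial i f x * partial j f x.

Definition geodesic (R : realType) (n : nat) (M : topologicalType)
    (A : smooth_atlas R n M) (g : riemannian_metric A) (c : R -> M) : Prop :=
  continuous c /\
  forall (a : chart_index A) (t : R), chart_dom a (c t) ->
    let u : R -> 'rV[R]_n.+1 := chart a \o c in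
    [/\ derivable u t 1, derivable (derive1 u) t 1 &
        forall k : 'I_n.+1,
          (derive1 (derive1 u) t) 0 k +
          \sum_(i < n.+1) \sum_(j < n.+1)
            christoffel (metric g a) k i j (u t)
              * (derive1 u t) 0 i * (derive1 u t) 0 j = 0].

(** Geodesic completeness: every initial velocity is that of a geodesic defined
    on the whole real line (by Hopf-Rinow, the same as metric completeness when
    [M] is connected). *)
Definition complete_metric (R : realType) (n : nat) (M : topologicalType)
    (A : smooth_atlas R n M) (g : riemannian_metric A) : Prop :=
  forall (a : chart_index A) (p : M) (v : 'rV[R]_n.+1), chart_dom a p ->
    exists c : R -> M,
      [/\ geodesic g c, c 0 = p & derive1 (chart a \o c) 0 = v].

Definition gradient_steady_soliton (R : realType) (n : nat)
    (M : topologicalType) (A : smooth_atlas R n M) (g : riemannian_metric A)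
    (f : M -> R) : Prop :=
  [/\ complete_metric g, smooth_function A f &
      forall (a : chart_index A) x, chart_cod a x ->
        ricci (metric g a) x + hessian (metric g a) (f \o chart_inv a) x = 0].

Definition normalized_soliton (R : realType) (n : nat)
    (M : topologicalType) (A : smooth_atlas R n M) (g : riemannian_metric A)
    (f : M -> R) : Prop :=
  forall (a : chart_index A) x, chart_cod a x ->
    scalar_curvature (metric g a) x
    + grad_norm_sq (metric g a) (f \o chart_inv a) x = 1.

(** The i-th row of [E] holds the coordinates of e_i; in an oriented atlas the
    sign of the determinant expresses that the frame is positively oriented. *)
Definition oriented_orthonormal (R : realType) (n : nat)
    (G E : 'M[R]_n.+1) : Prop :=
  E *m G *m E^T = 1%:M /\ 0 < \det E.

Definition riemann_frame (R : realType) (n : nat)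
    (g : 'rV[R]_n.+1 -> 'M[R]_n.+1) (x : 'rV[R]_n.+1) (E : 'M[R]_n.+1)
    (i j k l : 'I_n.+1) : R :=
  \sum_(i' < n.+1) \sum_(j' < n.+1) \sum_(k' < n.+1) \sum_(l' < n.+1)
    E i i' * E j j' * E k k' * E l l' * riemann g i' j' k' l' x.

Definition ricci_frame (R : realType) (n : nat)
    (g : 'rV[R]_n.+1 -> 'M[R]_n.+1) (x : 'rV[R]_n.+1) (E : 'M[R]_n.+1) :
    'M[R]_n.+1 :=
  E *m ricci g x *m E^T.

(** Hilbert-Schmidt norm of the curvature operator on 2-vectors, in the
    orthonormal basis e_i /\ e_j, i < j. *)
Definition Rm_norm (R : realType) (n : nat)
    (g : 'rV[R]_n.+1 -> 'M[R]_n.+1) (x : 'rV[R]_n.+1) (E : 'M[R]_n.+1) : R :=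
  Num.sqrt (\sum_(i < n.+1) \sum_(j < n.+1 | (i < j)%N)
            \sum_(k < n.+1) \sum_(l < n.+1 | (k < l)%N)
              riemann_frame g x E i j k l ^+ 2).

(** Eigenvalues counted with multiplicity, in nondecreasing order. *)
Definition ordered_eigenvalues (R : realType) (m : nat) (S : 'M[R]_m)
    (s : seq R) : Prop :=
  sorted <=%R s /\ char_poly S = \prod_(z <- s) ('X - z%:P).

Definition two_smallest_nonneg (R : realType) (m : nat) (S : 'M[R]_m) : Prop :=
  exists2 s : seq R, ordered_eigenvalues S s & 0 <= s`_0 + s`_1.

(** With indices in {0,1,2,3}, the 2-vectors
      (e_0 /\ e_(r+1) + sg e_(p r) /\ e_(q r)) / sqrt 2,    r = 0, 1, 2,
    where (p r, q r) = (2,3), (3,1), (1,2), form an orthonormal basis of the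
    self-dual 2-vectors for sg = 1, and of the anti-self-dual ones for
    sg = -1. *)

Definition dual_fst (r : 'I_3) : 'I_4 := inord (nth 0%N [:: 2; 3; 1]%N r).
Definition dual_snd (r : 'I_3) : 'I_4 := inord (nth 0%N [:: 3; 1; 2]%N r).

Definition Rm_block (R : realType) (g : 'rV[R]_4 -> 'M[R]_4) (x : 'rV[R]_4)
    (E : 'M[R]_4) (sg : R) : 'M[R]_3 :=
  \matrix_(r, t)
    (2^-1 *
      (riemann_frame g x E ord0 (lift ord0 r) ord0 (lift ord0 t)
       + sg * riemann_frame g x E ord0 (lift ord0 r) (dual_fst t) (dual_snd t)
       + sg * riemann_frame g x E (dual_fst r) (dual_snd r) ord0 (lift ord0 t)
       + sg ^+ 2 * riemann_frame g x E (dual_fst r) (dual_snd r)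
                                       (dual_fst t) (dual_snd t))).

(** A = W^+ + (R/12) I and C = W^- + (R/12) I. *)
Definition block_A (R : realType) (g : 'rV[R]_4 -> 'M[R]_4) (x : 'rV[R]_4)
    (E : 'M[R]_4) : 'M[R]_3 := Rm_block g x E 1.
Definition block_C (R : realType) (g : 'rV[R]_4 -> 'M[R]_4) (x : 'rV[R]_4)
    (E : 'M[R]_4) : 'M[R]_3 := Rm_block g x E (-1).

Definition nonneg_isotropic_curvature (R : realType) (M : topologicalType)
    (A : smooth_atlas R 3 M) (g : riemannian_metric A) : Prop :=
  forall (a : chart_index A) x (E : 'M[R]_4), chart_cod a x ->
    oriented_orthonormal (metric g a x) E ->
    two_smallest_nonneg (block_A (metric g a) x E) /\
    two_smallest_nonneg (block_C (metric g a) x E).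

Definition two_nonneg_ricci (R : realType) (n : nat) (M : topologicalType)
    (A : smooth_atlas R n M) (g : riemannian_metric A) : Prop :=
  forall (a : chart_index A) x (E : 'M[R]_n.+1), chart_cod a x ->
    oriented_orthonormal (metric g a x) E ->
    two_smallest_nonneg (ricci_frame (metric g a) x E).

(* Main.v *)
Require Import Defs.
From HB Require Import structures.
From mathcomp Require Import all_boot all_order all_algebra.
From mathcomp Require Import all_classical all_reals all_analysis.
From mathcomp Require Import ring lra.

Set Implicit Arguments.
Unset Strict Implicit.
Unset Printing Implicit Defensive.
Import Order.TTheory GRing.Theory Num.Theory.
Import numFieldNormedType.Exports.

Local Open Scope classical_set_scope.
Local Open Scope ring_scope.

(** Let u be minus the sum of the two lowest eigenvalues of Rc. On a steady soliton
    Rc satisfies an elliptic equation for the drift Laplacian, whose reaction term is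
    controlled by nonnegative isotropic curvature: where u > 0, the drift Laplacian
    of u is at least u^2 in the barrier sense. This is localized by the cut-off
    (rho^2 - d(p, .)^2)^2. The barrier for d(p, .)^2 is the second variation of energy
    along a geodesic from p, with fields s e_k; since Rc = - Hess f, the curvature term
    integrates to the derivative of f, which is at most 1 because R >= 0 and
    R + |grad f|^2 = 1. Hence u(p) = O(1/rho) for all rho, so u <= 0.

    The distance function is avoided: (rho^2 - |v|^2)^2 u(exp_p v) is maximized over
    tangent vectors |v| <= rho, and the Hopf-Rinow theorem turns a broken path from p
    into a tangent vector that is not longer. The inequality |Rm| <= R is then
    linear algebra: |A|^2 <= 3 (tr A)^2, |C|^2 <= 3 (tr C)^2 with tr A = tr C = R/4,
    and |Rc|^2 <= R^2 bounds the off-diagonal block. *)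

(** * Calculus in R^n *)

(** The exponent of the cut-off is dictated by the inequality. When second derivatives of u are at
    least u^2, the natural barrier is a multiple of r^-2 with r = rho^2 - |v|^2: its second
    derivative and its square both scale as r^-4. The slope of f at the far end of the geodesic
    enters twice, through the drift term at the maximum and through the integration by parts in the
    second variation, and it cancels; only its lower bound -|v| survives, so a bound of order rho^3
    faces rho^4.

    Two obstacles shape the rest. Geodesics are known only through the completeness hypothesis: no
    flow, no parallel transport, no smoothness of exp. Continuity of exp and uniqueness come from
    comparing two geodesics in a chart; parallel frames are replaced by Euler steps with
    orthonormalization, and near the end point by polynomial fields. Integrals are replaced by
    increments of functions whose derivative dominates the integrand, chained along [0, 1]. Finally,
    the eigenvalue sum is not differentiable; at the maximum it is compared with the value of Rc on
    one pair of fields, through forms homogeneous in the pair. *)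

Section ScalarRules.
Context {R : realType}.
Implicit Types (f g : R -> R) (t a b k : R).

Lemma dEq f t a b : is_derive t 1 f a -> a = b -> is_derive t 1 f b.
Proof. by move=> H <-. Qed.

Lemma dC k t : is_derive t 1 (fun=> k) 0.
Proof. exact: is_derive_cst. Qed.

Lemma dI t : is_derive t 1 (fun s : R => s) 1.
Proof. exact: is_derive_id. Qed.

Lemma dD f g t a b : is_derive t 1 f a -> is_derive t 1 g b ->
  is_derive t 1 (fun s => f s + g s) (a + b).
Proof. by move=> H1 H2; exact: (@is_deriveD _ _ _ f g). Qed.

Lemma dN f t a : is_derive t 1 f a -> is_derive t 1 (fun s => - f s) (- a).
Proof. by move=> H1; exact: (@is_deriveN _ _ _ f). Qed.

Lemma dB f g t a b : is_derive t 1 f a -> is_derive t 1 g b ->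
  is_derive t 1 (fun s => f s - g s) (a - b).
Proof. by move=> H1 H2; exact: (@is_deriveB _ _ _ f g). Qed.

Lemma dM f g t a b : is_derive t 1 f a -> is_derive t 1 g b ->
  is_derive t 1 (fun s => f s * g s) (a * g t + f t * b).
Proof.
move=> H1 H2; have := @is_deriveM _ _ f g t 1 a b H1 H2; move/dEq; apply.
by rewrite addrC /GRing.scale /= [g t * a]mulrC.
Qed.

Lemma dZ f k t a : is_derive t 1 f a -> is_derive t 1 (fun s => k * f s) (k * a).
Proof. by move=> H; apply: dEq (dM (dC k t) H) _; rewrite mul0r add0r. Qed.

Lemma dX2 f t a : is_derive t 1 f a -> is_derive t 1 (fun s => f s ^+ 2) (2 * f t * a).
Proof. by move=> H; apply: dEq (dM H H) _; ring. Qed.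

Lemma dSum (I : Type) (r : seq I) (P : pred I) (f : I -> R -> R) (df : I -> R) t :
  (forall i, is_derive t 1 (f i) (df i)) ->
  is_derive t 1 (fun s => \sum_(i <- r | P i) f i s) (\sum_(i <- r | P i) df i).
Proof.
move=> H; elim: r => [|i r IH].
  rewrite big_nil (_ : (fun s => _) = fun=> 0); first exact: dC.
  by apply/funext => s; rewrite big_nil.
rewrite big_cons (_ : (fun s => _) = fun s => if P i then f i s + \sum_(i <- r | P i) f i s else
   \sum_(i <- r | P i) f i s); last by apply/funext => s; rewrite big_cons.
by case: ifP => _ //; apply: dD.
Qed.

Lemma dComp f g t a b : is_derive t 1 f a -> is_derive (f t) 1 g b ->
  is_derive t 1 (fun s => g (f s)) (b * a).
Proof.
move=> [df <-] [dg <-]; have df' : differentiable f t by exact/derivable1_diffP.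
have dg' : differentiable g (f t) by exact/derivable1_diffP.
apply: DeriveDef; first by apply/derivable1_diffP; exact: (differentiable_comp df').
rewrite -!derive1E.
exact: (@derive1_comp R f g t df dg).
Qed.

Lemma dAffine g t k b d : is_derive (k * t + b) 1 g d ->
  is_derive t 1 (fun s => g (k * s + b)) (k * d).
Proof.
move=> H; apply: dEq (dComp (f := fun s => k * s + b) (dD (dZ k (dI t)) (dC b t)) H) _.
by rewrite mulr1 addr0 mulrC.
Qed.

End ScalarRules.

Section Curves.
Context {R : realType}.
Implicit Types (f df : R -> R) (a b t K : R).

Lemma MVT_closed f df a b : a < b ->
  (forall t, a <= t <= b -> is_derive t 1 f (df t)) ->
  exists2 t, a < t < b & f b - f a = df t * (b - a).
Proof.
move=> ab H.
have [c cab e] : exists2 c, c \in `]a, b[%R & f b - f a = df c * (b - a).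
  apply: MVT => // [x|]; first by rewrite in_itv /= => /andP[x1 x2]; apply: H; rewrite !ltW.
  apply: derivable_within_continuous => x; rewrite in_itv /= => xab.
  by have [] := H x xab.
by exists c => //; rewrite in_itv in cab.
Qed.

Lemma derive_ge0_le f df a b : a <= b ->
  (forall t, a <= t <= b -> is_derive t 1 f (df t)) ->
  (forall t, a < t < b -> 0 <= df t) -> f a <= f b.
Proof.
rewrite le_eqVlt => /predU1P[->//|ab] H H0.
have [c cab e] := MVT_closed ab H.
by rewrite -subr_ge0 e mulr_ge0 ?H0 // subr_ge0 ltW.
Qed.

Lemma derive_bounded f df a b K : a <= b ->
  (forall t, a <= t <= b -> is_derive t 1 f (df t)) ->
  (forall t, a < t < b -> `|df t| <= K) -> `|f b - f a| <= K * (b - a).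
Proof.
rewrite le_eqVlt => /predU1P[->|ab] H H0; first by rewrite !subrr normr0 mulr0.
have [c cab ->] := MVT_closed ab H.
have ba : 0 <= b - a by rewrite subr_ge0 ltW.
by rewrite normrM [`|b - a|]ger0_norm // ler_wpM2r // H0.
Qed.

Lemma is_derive_cts f t d : is_derive t 1 f d -> {for t, continuous f}.
Proof. by move=> [h _]; apply/differentiable_continuous/derivable1_diffP. Qed.

End Curves.

Section RowVectors.
Context {R : realType} {n : nat}.
Implicit Types (v w : 'rV[R]_n) (c : R -> 'rV[R]_n).

Lemma rv_norm_le v K : 0 <= K -> (forall i, `|v 0 i| <= K) -> `|v| <= K.
Proof.
move=> K0 H; rewrite /Num.Def.normr /= mx_normrE; apply: bigmax_le => // -[i j] _ /=.
by rewrite ord1.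
Qed.

Lemma rv_coord_le v i : `|v 0 i| <= `|v|.
Proof.
by rewrite [leRHS]/Num.Def.normr /= mx_normrE; exact: (le_bigmax _ (fun ij => `|v ij.1 ij.2|) (0, i)).
Qed.

Lemma is_derive_rv c (t : R) v : is_derive t 1 c v <->
  forall i, is_derive t 1 (fun s => c s 0 i) (v 0 i).
Proof.
split=> [[dc <-] i|H].
  by apply: DeriveDef; [exact: ((derivable_mxP _ _ _).1 dc)|rewrite derive_mx // mxE].
have dc : derivable c t 1.
  by apply/derivable_mxP => i j; rewrite ord1; case: (H j).
apply: DeriveDef => //; rewrite derive_mx //; apply/rowP => i.
by rewrite mxE; case: (H i).
Qed.

Lemma is_derive_rv_cts c (t : R) v : is_derive t 1 c v -> {for t, continuous c}.
Proof. by move=> [h _]; apply/differentiable_continuous/derivable1_diffP. Qed.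

Lemma rv_derive_bounded c (dc : R -> 'rV[R]_n) (a b K : R) : a <= b ->
  (forall t, a <= t <= b -> is_derive t 1 c (dc t)) ->
  (forall t, a < t < b -> `|dc t| <= K) -> 0 <= K -> `|c b - c a| <= K * (b - a).
Proof.
move=> ab H H0 K0; apply: rv_norm_le => [|i]; first by rewrite mulr_ge0 // subr_ge0.
rewrite !mxE; apply: (derive_bounded (f := fun s => c s 0 i) (df := fun s => dc s 0 i)) => // t tab.
  by apply: (is_derive_rv c t (dc t)).1; exact: H.
exact: le_trans (rv_coord_le _ _) (H0 _ tab).
Qed.

End RowVectors.

Lemma cvg_sumR {R : realType} {T : Type} (F : set_system T) {FF : Filter F} (I : Type)
    (r : seq I) (P : pred I) (f : I -> T -> R) (l : I -> R) :
  (forall i, f i x @[x --> F] --> l i) ->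
  (\sum_(i <- r | P i) f i x) @[x --> F] --> \sum_(i <- r | P i) l i.
Proof.
move=> H; elim: r => [|i r IH].
  rewrite big_nil (_ : (fun x => _) = fun=> 0); first exact: cvg_cst.
  by apply/funext => s; rewrite big_nil.
rewrite big_cons (_ : (fun x => _) = fun x => if P i then f i x + \sum_(i <- r | P i) f i x else
   \sum_(i <- r | P i) f i x); last by apply/funext => s; rewrite big_cons.
by case: ifP => _ //; apply: cvgD.
Qed.

(** * Partial derivatives and differentiability *)

Section Partials.
Context {R : realType} {n : nat}.
Local Notation V := 'rV[R]_n.+1.
Implicit Types (f : V -> R) (x y v h : V).

Lemma line_derive f x v (s : R) d : is_derive (x + s *: v) v f d ->
  is_derive s 1 (fun s => f (x + s *: v)) d.
Proof.
move=> [df <-].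
have E : (fun h : R => h^-1 *: (((fun s : R => f (x + s *: v)) \o shift s) (h *: (1 : R)) - f (x + s *: v)))
   = (fun h : R => h^-1 *: ((f \o shift (x + s *: v)) (h *: v) - f (x + s *: v))).
  apply/funext => h /=; congr (_ *: (f _ - _)).
  by rewrite [h%:A]mulr1 scalerDl addrC addrAC addrA.
by apply: DeriveDef; rewrite ?/derivable ?/derive E.
Qed.

Lemma partialP f x i : derivable f x (delta_mx 0 i) ->
  is_derive x (delta_mx 0 i) f (partial i f x).
Proof. exact: derivableP. Qed.

Lemma line_derive_partial f x i (s : R) :
  derivable f (x + s *: delta_mx 0 i) (delta_mx 0 i) ->
  is_derive s 1 (fun s => f (x + s *: delta_mx 0 i)) (partial i f (x + s *: delta_mx 0 i)).
Proof. by move=> H; apply: line_derive; exact: partialP. Qed.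

(** Vertices of the staircase from 0 to h that changes one coordinate at a time. *)
Definition trunc_row (k : nat) h : V := \row_i (if (i < k)%N then h 0 i else 0).

Lemma trunc_rowS (k : 'I_n.+1) h :
  trunc_row k.+1 h = trunc_row k h + h 0 k *: delta_mx 0 k.
Proof.
apply/rowP => i; rewrite !mxE ltnS leq_eqVlt eqxx /=.
case: (eqVneq i k) => [->|ne]; first by rewrite eqxx ltnn /= mulr1 add0r.
have /negPf -> : (i != k :> nat) by apply: contra ne => /eqP/val_inj->.
by rewrite /= mulr0 addr0.
Qed.

Lemma trunc_row_full h : trunc_row n.+1 h = h.
Proof. by apply/rowP => i; rewrite !mxE ltn_ord. Qed.

(** Climbs the staircase [trunc_row k h]. On each edge the mean value theorem is applied to f minus
    its linear part at x; in the sup norm no point of the staircase is farther from x than x + h can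
    be. *)
Lemma partial_increment f x (e r : R) : 0 < e -> 0 < r ->
  (forall y, `|y - x| < r -> forall i, derivable f y (delta_mx 0 i) /\
     `|partial i f y - partial i f x| <= e) ->
  forall h, `|h| < r ->
  `|f (x + h) - f x - \sum_i h 0 i * partial i f x| <= n.+1%:R * e * `|h|.
Proof.
move=> e0 r0 H h hr.
have hcat : forall h' : V, `|h'| < r -> `|x + h' - x| < r by move=> h'; rewrite [x + _]addrC addrK.
suff E : forall k, (k <= n.+1)%N ->
    `|f (x + trunc_row k h) - f x - \sum_(i < n.+1 | (i < k)%N) h 0 i * partial i f x|
    <= k%:R * e * `|h|.
  by have := E n.+1 (leqnn _); rewrite trunc_row_full (eq_bigl xpredT) // => i; rewrite ltn_ord.
elim=> [_|k IH kn].
  rewrite (_ : trunc_row 0 h = 0) ?addr0 ?subrr ?big_pred0 ?subr0 ?normr0 ?mul0r //.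
  by apply/rowP => i; rewrite !mxE.
have {}IH := IH (ltnW kn); pose ko := Ordinal kn.
have -> : trunc_row k.+1 h = trunc_row k h + h 0 ko *: delta_mx 0 ko by rewrite (trunc_rowS ko).
rewrite (bigD1 ko) //= (eq_bigl (fun i : 'I_n.+1 => (i < k)%N)); last first.
  move=> i; rewrite ltnS leq_eqVlt; case: (eqVneq i ko) => [->|ne] /=; first by rewrite eqxx /= ltnn.
  have /negPf -> : (i != k :> nat) by apply: contra ne => /eqP e'; apply/eqP/val_inj.
  by rewrite andbT.
set z := x + trunc_row k h; pose g (s : R) := f (z + s *: delta_mx 0 ko).
have sub : forall s : R, `|s| <= `|h 0 ko| -> `|trunc_row k h + s *: delta_mx 0 ko| < r.
  move=> s sh; apply: le_lt_trans hr; apply: rv_norm_le => // i; rewrite !mxE eqxx /=.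
  case: (eqVneq i ko) => [->|ne]; first by rewrite ltnn add0r mulr1 (le_trans sh) // rv_coord_le.
  by rewrite mulr0 addr0; case: ifP; rewrite ?normr0 // rv_coord_le.
have key : `|g (h 0 ko) - g 0 - h 0 ko * partial ko f x| <= e * `|h 0 ko|.
  pose g2 (s : R) := g s - s * partial ko f x.
  have dg : forall s : R, `|s| <= `|h 0 ko| ->
      is_derive s 1 g2 (partial ko f (z + s *: delta_mx 0 ko) - partial ko f x).
    move=> s sh; apply: dB.
      apply: line_derive_partial; rewrite /z -addrA.
      by have [] := H _ (hcat _ (sub _ sh)) ko.
    by apply: dEq (dM (dI s) (dC _ s)) _; rewrite mul1r mulr0 addr0.
  have -> : g (h 0 ko) - g 0 - h 0 ko * partial ko f x = g2 (h 0 ko) - g2 0.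
    by rewrite /g2 mul0r subr0 addrAC.
  have bd : forall s : R, `|s| <= `|h 0 ko| ->
      `|partial ko f (z + s *: delta_mx 0 ko) - partial ko f x| <= e.
    move=> s sh; rewrite /z -addrA.
    by have [] := H _ (hcat _ (sub _ sh)) ko.
  case: (lerP 0 (h 0 ko)) => h0.
    rewrite (_ : `|h 0 ko| = h 0 ko - 0); last by rewrite ger0_norm // subr0.
    apply: (derive_bounded (df := fun s => partial ko f (z + s *: delta_mx 0 ko) - partial ko f x)) => // s /andP[s1 s2].
      by apply: dg; rewrite !ger0_norm.
    by apply: bd; rewrite !ger0_norm // ltW.
  rewrite distrC (_ : `|h 0 ko| = 0 - h 0 ko); last by rewrite ltr0_norm // sub0r.
  apply: (derive_bounded (df := fun s => partial ko f (z + s *: delta_mx 0 ko) - partial ko f x)) => [|s /andP[s1 s2]|s /andP[s1 s2]]; first exact: ltW.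
    by apply: dg; rewrite !ler0_norm ?lerN2 // ltW.
  by apply: bd; rewrite !ler0_norm ?lerN2 // ltW.
have -> : f (x + (trunc_row k h + h 0 ko *: delta_mx 0 ko)) = g (h 0 ko).
  by rewrite /g /z addrA.
rewrite -natr1 !mulrDl mul1r.
have e1 : g 0 = f (x + trunc_row k h) by rewrite /g scale0r addr0.
have -> : forall S, g (h 0 ko) - f x - (h 0 ko * partial ko f x + S) =
  (f (x + trunc_row k h) - f x - S) + (g (h 0 ko) - g 0 - h 0 ko * partial ko f x).
  by move=> S; rewrite e1; ring.
apply: le_trans (ler_normD _ _) _; apply: lerD => //.
by apply: le_trans key _; rewrite ler_pM2l // rv_coord_le.
Qed.

Lemma C1_differentiable f x :
  (\forall y \near x, forall i, derivable f y (delta_mx 0 i)) ->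
  (forall i, {for x, continuous (partial i f)}) ->
  differentiable f x /\ forall v, 'd f x v = \sum_i v 0 i * partial i f x.
Proof.
move=> Hd Hc.
pose d v : R := \sum_i v 0 i * partial i f x.
have lin_d : linear d.
  move=> a u v; rewrite /d scaler_sumr -big_split /=; apply: eq_bigr => i _.
  by rewrite !mxE mulrDl -mulrA.
pose dM := GRing.isLinear.Build _ _ _ _ _ lin_d.
pose dL : {linear V -> R^o} := HB.pack d dM.
have dc : continuous dL.
  move=> v; apply: (@cvg_sumR R V (nbhs v) (nbhs_filter v)) => i; apply: cvgM; last exact: cvg_cst.
  exact: coord_continuous.
have dE : f \o shift x = cst (f x) + dL +o_ (0 : V) id.
  apply/eqaddoP => e e0.
  have e'0 : 0 < e / n.+1%:R by rewrite divr_gt0.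
  have : \forall y \near x, forall i, derivable f y (delta_mx 0 i) /\
     `|partial i f y - partial i f x| <= e / n.+1%:R.
    near=> y => i; split; first by move: i; near: y; exact: Hd.
    rewrite distrC; move: i; near: y; apply: filter_forall => i.
    by have /cvgrPdist_le := Hc i; apply.
  rewrite -nbhs_nearE => /nbhs_ballP[r /= r0 Hr].
  near=> h.
  have hr : `|h| < r by near: h; apply: (@nbhs0_lt R V).
  have := @partial_increment f x _ r e'0 r0 _ h hr.
  rewrite mulrCA divff ?mulr1 ?pnatr_eq0 // => E.
  have <- : f (x + h) - f x - d h = (f \o shift x - (cst (f x) + dL)) h.
    by rewrite [x + h]addrC -addrA -opprD.
  by apply: E => y yr; apply: Hr; rewrite -ball_normE /= distrC.
have dfx : 'd f x = d :> (V -> R) by exact: (diff_unique dc dE).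
split; last by move=> v; rewrite dfx.
by apply/diff_locallyP; rewrite dfx.
Unshelve. all: by end_near. Qed.

Lemma is_derive_comp_curve f (c : R -> V) (t : R) v : differentiable f (c t) ->
  is_derive t 1 c v -> is_derive t 1 (f \o c) ('d f (c t) v).
Proof.
move=> df [dc cv].
have dc' : differentiable c t by exact/derivable1_diffP.
have H : differentiable (f \o c) t by exact: differentiable_comp.
apply: DeriveDef; first exact/derivable1_diffP.
by rewrite deriveE // diff_comp //= -cv deriveE.
Qed.

End Partials.
Global Opaque partial.

Lemma nbhs_norm_ex {R : realType} {n : nat} (x : 'rV[R]_n.+1) (P : set 'rV[R]_n.+1) :
  nbhs x P -> exists2 r : R, 0 < r & forall y, `|y - x| < r -> P y.
Proof.
move=> /nbhs_ballP[r /= r0 Hr]; exists r => // y yr.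
by apply: Hr; rewrite -ball_normE /= distrC.
Qed.

(** * Closure properties of smooth functions and symmetry of second partials *)

Section SmoothFunctions.
Context {R : realType} {n : nat}.
Local Notation V := 'rV[R]_n.+1.
Implicit Types (f g : V -> R) (x : V) (i j : 'I_n.+1).
Variable U : set V.
Hypothesis oU : open U.

Lemma open_near x : U x -> \forall y \near x, U y.
Proof. by move=> Ux; exact: open_nbhs_nbhs. Qed.

Lemma partial_eq_on f g : (forall y, U y -> f y = g y) ->
  forall i y, U y -> partial i f y = partial i g y.
Proof.
move=> E i y Uy; apply: near_eq_derive; near=> z; apply: E.
by near: z; exact: open_near.
Unshelve. all: by end_near. Qed.

Lemma smooth_continuous f x : smooth_on U f -> U x -> {for x, continuous f}.
Proof. by move=> H Ux; have [] := H [::] x Ux. Qed.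

Lemma smooth_derivable f x i : smooth_on U f -> U x -> derivable f x (delta_mx 0 i).
Proof. by move=> H Ux; have [_] := H [::] x Ux; apply. Qed.

Lemma smooth_partial f i : smooth_on U f -> smooth_on U (partial i f).
Proof.
move=> H s x Ux.
have -> : iter_partial s (partial i f) = iter_partial (rcons s i) f.
  by rewrite /iter_partial foldr_rcons.
exact: H.
Qed.

(** Every member has first partials that agree on U with members, so smoothness of sums, products
    and quotients follows by induction on the list of derivatives, with no Leibniz formula for
    iterated partials. [sc_ext] is there because functions are total while derivatives are known on
    U only. *)
Inductive smooth_closure : (V -> R) -> Prop :=
| sc_base f : smooth_on U f -> smooth_closure f
| sc_cst (c : R) : smooth_closure (fun=> c)
| sc_add f g : smooth_closure f -> smooth_closure g ->
    smooth_closure (fun x => f x + g x)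
| sc_mul f g : smooth_closure f -> smooth_closure g ->
    smooth_closure (fun x => f x * g x)
| sc_inv f : smooth_closure f -> (forall x, U x -> f x != 0) ->
    smooth_closure (fun x => (f x)^-1)
| sc_ext f g : smooth_closure f -> (forall x, U x -> f x = g x) ->
    smooth_closure g.

Lemma smooth_closure_cts f : smooth_closure f ->
  forall x, U x -> {for x, continuous f}.
Proof.
elim=> {f} [f sf|c|f g _ Hf _ Hg|f g _ Hf _ Hg|f _ Hf f0|f g _ Hf E] x Ux.
- exact: smooth_continuous.
- exact: cst_continuous.
- by apply: continuousD; [exact: Hf|exact: Hg].
- by apply: continuousM; [exact: Hf|exact: Hg].
- by apply: continuousV; [exact: f0|exact: Hf].
- have H : f y @[y --> x] --> f x := Hf x Ux.
  rewrite /prop_for /continuous_at -(E x Ux).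
  apply: cvg_trans H; apply: (@near_eq_cvg _ _ (nbhs x) (nbhs_filter x) f g).
  near=> y; apply: E.
  by near: y; exact: open_near.
Unshelve. all: by end_near. Qed.

Lemma smooth_closure_partial f i : smooth_closure f ->
  exists2 g, smooth_closure g & forall x, U x -> is_derive x (delta_mx 0 i) f (g x).
Proof.
elim=> {f} [f sf|c|f1 f2 s1 [g1 h1 H1] s2 [g2 h2 H2]|f1 f2 s1 [g1 h1 H1] s2 [g2 h2 H2]|f s [g h H] f0|f g s [g' h H] E].
- exists (partial i f); first by apply: sc_base; exact: smooth_partial.
  by move=> x Ux; apply: partialP; exact: smooth_derivable.
- by exists (fun=> 0); [exact: sc_cst|move=> x Ux; exact: is_derive_cst].
- exists (fun x => g1 x + g2 x); first exact: sc_add.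
  by move=> x Ux; apply: (@is_deriveD _ _ _ f1 f2); [exact: H1|exact: H2].
- exists (fun x => f1 x * g2 x + f2 x * g1 x); first by apply: sc_add; exact: sc_mul.
  move=> x Ux; have := @is_deriveM _ _ f1 f2 x (delta_mx 0 i) (g1 x) (g2 x) (H1 x Ux) (H2 x Ux).
  exact.
- exists (fun x => - 1 * ((f x)^-1 * (f x)^-1 * g x)).
    apply: sc_mul; first exact: sc_cst.
    by apply: sc_mul => //; apply: sc_mul; exact: sc_inv.
  move=> x Ux; have [dfx vfx] := H x Ux.
  apply: DeriveDef; first by apply: derivableV => //; exact: f0.
  rewrite deriveV ?f0 // vfx /GRing.scale /= mulN1r mulNr; congr (- (_ * _)).
  by rewrite -invfM expr2.
- exists g' => // x Ux; apply: near_eq_is_derive (H x Ux); near=> y; apply: E.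
  by near: y; exact: open_near.
Unshelve. all: by end_near. Qed.

Lemma smooth_closureP f : smooth_closure f -> smooth_on U f.
Proof.
move=> sf s; move: s f sf; elim/last_ind => [|s i IH] f sf x Ux.
  split; first exact: (smooth_closure_cts sf).
  by move=> i; have [g _ /(_ x Ux) []] := smooth_closure_partial i sf.
have [g sg Hg] := smooth_closure_partial i sf.
have E : forall y, U y -> partial i f y = g y by move=> y Uy; have [] := Hg y Uy.
have -> : iter_partial (rcons s i) f = iter_partial s (partial i f).
  by rewrite /iter_partial foldr_rcons.
apply: IH => //; apply: sc_ext sg _ => y Uy.
by rewrite E.
Qed.

Lemma smooth_cst (c : R) : smooth_on U (fun=> c).
Proof. by apply: smooth_closureP; exact: sc_cst. Qed.

Lemma smooth_add f g : smooth_on U f -> smooth_on U g -> smooth_on U (fun x => f x + g x).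
Proof. by move=> sf sg; exact: (smooth_closureP (sc_add (sc_base sf) (sc_base sg))). Qed.

Lemma smooth_mul f g : smooth_on U f -> smooth_on U g -> smooth_on U (fun x => f x * g x).
Proof. by move=> sf sg; exact: (smooth_closureP (sc_mul (sc_base sf) (sc_base sg))). Qed.

Lemma smooth_inv f : smooth_on U f -> (forall x, U x -> f x != 0) ->
  smooth_on U (fun x => (f x)^-1).
Proof. by move=> sf f0; apply: smooth_closureP; apply: sc_inv => //; exact: sc_base. Qed.

Lemma smooth_ext f g : smooth_on U f -> (forall x, U x -> f x = g x) -> smooth_on U g.
Proof. by move=> sf E; apply: smooth_closureP; apply: sc_ext E; exact: sc_base. Qed.

Lemma smooth_opp f : smooth_on U f -> smooth_on U (fun x => - f x).
Proof.
move=> sf; apply: smooth_ext (smooth_mul (smooth_cst (-1)) sf) _ => x _.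
by rewrite mulN1r.
Qed.

Lemma smooth_sub f g : smooth_on U f -> smooth_on U g -> smooth_on U (fun x => f x - g x).
Proof. by move=> sf sg; exact: (smooth_add sf (smooth_opp sg)). Qed.

Lemma smooth_sum (I : Type) (r : seq I) (P : pred I) (F : I -> V -> R) :
  (forall k, smooth_on U (F k)) -> smooth_on U (fun x => \sum_(k <- r | P k) F k x).
Proof.
move=> H; elim: r => [|k r IH].
  by apply: smooth_ext (smooth_cst 0) _ => x _; rewrite big_nil.
case Pk : (P k).
  by apply: smooth_ext (smooth_add (H k) IH) _ => x _; rewrite big_cons Pk.
by apply: smooth_ext IH _ => x _; rewrite big_cons Pk.
Qed.

Lemma smooth_prod (I : Type) (r : seq I) (P : pred I) (F : I -> V -> R) :
  (forall k, smooth_on U (F k)) -> smooth_on U (fun x => \prod_(k <- r | P k) F k x).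
Proof.
move=> H; elim: r => [|k r IH].
  by apply: smooth_ext (smooth_cst 1) _ => x _; rewrite big_nil.
case Pk : (P k).
  by apply: smooth_ext (smooth_mul (H k) IH) _ => x _; rewrite big_cons Pk.
by apply: smooth_ext IH _ => x _; rewrite big_cons Pk.
Qed.

Lemma smooth_det m (A : V -> 'M[R]_m) : (forall k l, smooth_on U (fun x => A x k l)) ->
  smooth_on U (fun x => \det (A x)).
Proof.
move=> H; rewrite /determinant; apply: smooth_sum => s.
by apply: smooth_mul; [exact: smooth_cst|apply: smooth_prod].
Qed.

(** Cramer's rule: the cofactors are determinants, hence polynomial in the entries. *)
Lemma smooth_invmx m (A : V -> 'M[R]_m) : (forall k l, smooth_on U (fun x => A x k l)) ->
  (forall x, U x -> A x \in unitmx) ->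
  forall k l, smooth_on U (fun x => invmx (A x) k l).
Proof.
move=> H HU i j.
have H1 : smooth_on U (fun x => (\det (A x))^-1 * cofactor (A x) j i).
  apply: smooth_mul.
    by apply: smooth_inv; [exact: smooth_det|move=> x /HU; rewrite unitmxE unitfE].
  rewrite /cofactor; apply: smooth_mul; first exact: smooth_cst.
  apply: smooth_det => k l.
  by apply: smooth_ext (H (lift j k) (lift i l)) _ => x _; rewrite !mxE.
by apply: smooth_ext H1 _ => x /HU Ux; rewrite /invmx Ux !mxE.
Qed.

Lemma smooth_differentiable f x : smooth_on U f -> U x ->
  differentiable f x /\ forall v, 'd f x v = \sum_i v 0 i * partial i f x.
Proof.
move=> sf Ux; apply: C1_differentiable.
  near=> y => i; apply: smooth_derivable => //.
  by near: y; exact: open_near.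
by move=> i; exact: (smooth_continuous (smooth_partial i sf) Ux).
Unshelve. all: by end_near. Qed.

Lemma smooth_curve f (c : R -> V) (t : R) (v : V) : smooth_on U f -> U (c t) ->
  is_derive t 1 c v ->
  is_derive t 1 (fun s => f (c s)) (\sum_i v 0 i * partial i f (c t)).
Proof.
move=> sf Uc dc; have [df E] := smooth_differentiable sf Uc.
by rewrite -E; exact: (is_derive_comp_curve df dc).
Qed.

(** The mean value theorem twice: in direction i for the difference of f along two parallel
    segments, then in direction j for the partial derivative so obtained. *)
Lemma second_difference f x (r h : R) i j : smooth_on U f -> i != j ->
  (forall y, `|y - x| < r -> U y) -> 0 < h -> h < r ->
  exists2 y, `|y - x| <= h &
    f (x + h *: delta_mx 0 i + h *: delta_mx 0 j) - f (x + h *: delta_mx 0 i)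
     - f (x + h *: delta_mx 0 j) + f x = h ^+ 2 * partial j (partial i f) y.
Proof.
move=> sf ij HU h0 hr.
have near2 : forall a b : R, 0 <= a <= h -> 0 <= b <= h ->
    `|x + a *: delta_mx 0 i + b *: delta_mx 0 j - x| <= h.
  move=> a b /andP[a0 ah] /andP[b0 bh]; rewrite -[x + _ + _]addrA [x + _]addrC addrK.
  apply: rv_norm_le => [|k]; first exact: ltW.
  rewrite !mxE eqxx /=; case: (eqVneq k i) => [->|_].
    by rewrite (negPf ij) mulr0 addr0 mulr1 ger0_norm.
  rewrite mulr0 add0r; case: eqP => _; rewrite ?mulr1 ?mulr0 ?normr0 ?(ltW h0) //.
  by rewrite ger0_norm.
have UU a b : 0 <= a <= h -> 0 <= b <= h -> U (x + a *: delta_mx 0 i + b *: delta_mx 0 j).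
  by move=> Ha Hb; apply: HU; apply: le_lt_trans hr; exact: near2.
have hh : 0 <= h <= h by rewrite lexx ltW.
have h00 : 0 <= (0 : R) <= h by rewrite lexx ltW.
have D1 b a : 0 <= b <= h -> 0 <= a <= h ->
    is_derive a 1 (fun s : R => f (x + b *: delta_mx 0 j + s *: delta_mx 0 i))
      (partial i f (x + b *: delta_mx 0 j + a *: delta_mx 0 i)).
  move=> Hb Ha; apply: line_derive_partial; apply: smooth_derivable => //.
  by rewrite addrAC; exact: UU.
have [a ah E1] := @MVT_closed R
  (fun s => f (x + h *: delta_mx 0 j + s *: delta_mx 0 i) - f (x + 0 *: delta_mx 0 j + s *: delta_mx 0 i))
  _ 0 h h0 (fun t tt => dB (D1 h t hh tt) (D1 0 t h00 tt)).
have ah' : 0 <= a <= h by case/andP: ah => ? ?; rewrite !ltW.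
have D2 b : 0 <= b <= h ->
    is_derive b 1 (fun s : R => partial i f (x + a *: delta_mx 0 i + s *: delta_mx 0 j))
      (partial j (partial i f) (x + a *: delta_mx 0 i + b *: delta_mx 0 j)).
  move=> Hb; apply: line_derive_partial; apply: smooth_derivable; last exact: UU.
  exact: smooth_partial.
have [b bh E2] := @MVT_closed R _ _ 0 h h0 (fun t tt => D2 t tt).
have bh' : 0 <= b <= h by case/andP: bh => ? ?; rewrite !ltW.
exists (x + a *: delta_mx 0 i + b *: delta_mx 0 j); first exact: near2.
rewrite expr2 -mulrA [h * partial _ _ _]mulrC -[X in _ * X]/(partial j (partial i f) _ * _).
move: E1 E2; rewrite !scale0r !addr0 !subr0 => E1 E2.
rewrite -E2 mulrC; rewrite ![x + h *: delta_mx 0 j + _]addrAC ![x + a *: _ + _]addrAC in E1 *.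
by rewrite -E1; ring.
Qed.

(** The second difference is symmetric in i and j, so on every small square the two mixed partials
    agree at a pair of points; their continuity at x concludes. *)
Lemma partialC f x i j : smooth_on U f -> U x ->
  partial i (partial j f) x = partial j (partial i f) x.
Proof.
move=> sf Ux; case: (eqVneq i j) => [->//|ij].
have ji : j != i by rewrite eq_sym.
have cij := smooth_continuous (smooth_partial i (smooth_partial j sf)) Ux.
have cji := smooth_continuous (smooth_partial j (smooth_partial i sf)) Ux.
apply/eqP; rewrite -subr_eq0 -normr_le0; apply/ler_addgt0Pr => e e0; rewrite add0r.
have e2 : 0 < e / 2 by rewrite divr_gt0.
have Nij : \forall y \near x, `|partial i (partial j f) x - partial i (partial j f) y| <= e / 2.
  exact: ((cvgrPdist_le (partial i (partial j f)) _).1 cij _ e2).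
have Nji : \forall y \near x, `|partial j (partial i f) x - partial j (partial i f) y| <= e / 2.
  exact: ((cvgrPdist_le (partial j (partial i f)) _).1 cji _ e2).
have [r r0 Hr] := nbhs_norm_ex (filterI (open_near Ux) (filterI Nij Nji)).
have HU y : `|y - x| < r -> U y.
  move=> yr.
  by case: (Hr y yr).
have h0 : 0 < r / 2 by rewrite divr_gt0.
have hr : r / 2 < r by rewrite ltr_pdivrMr // mulr2n mulrDr mulr1 ltrDl.
have [y1 y1r E1] := second_difference sf ij HU h0 hr.
have [y2 y2r E2] := second_difference sf ji HU h0 hr.
have E : partial j (partial i f) y1 = partial i (partial j f) y2.
  apply: (@mulfI _ ((r / 2) ^+ 2)); first by rewrite expf_neq0 // gt_eqF.
  apply: etrans (esym E1) (etrans _ E2).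
  rewrite [x + (r / 2) *: delta_mx 0 j + (r / 2) *: delta_mx 0 i]addrAC.
  by congr (_ + _); rewrite -!addrA; congr (_ + _); rewrite addrC.
have [_ [_ B1]] := Hr y1 (le_lt_trans y1r hr).
have [_ [B2 _]] := Hr y2 (le_lt_trans y2r hr).
rewrite (splitr e).
have -> : partial i (partial j f) x - partial j (partial i f) x =
  (partial i (partial j f) x - partial i (partial j f) y2) -
  (partial j (partial i f) x - partial j (partial i f) y1).
  by rewrite E opprB addrA; rewrite subrK.
exact: (le_trans (ler_normB _ _) (lerD B2 B1)).
Qed.

End SmoothFunctions.

(** * Curvature identities in a differential ring *)

Section SolitonAlgebra.
Variables (K : comPzRingType) (n : nat).
Local Notation I := 'I_n.+1.
Implicit Types (i j k l a b c m : I) (x y : K).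
(** Tensor calculus is done over an abstract commutative ring with commuting derivations, where no
    smoothness conditions arise and [ring] applies. The smooth functions of a chart are substituted
    in [hessian_laplacian_at]. *)
Variable d : I -> K -> K.
Hypothesis dA : forall i x y, d i (x + y) = d i x + d i y.
Hypothesis dL : forall i x y, d i (x * y) = d i x * y + x * d i y.
Hypothesis dC : forall i j x, d i (d j x) = d j (d i x).
Hypothesis two_cancel : forall x, x + x = 0 -> x = 0.

Lemma der0 i : d i 0 = 0.
Proof. by apply: (addrI (d i 0)); rewrite -dA !addr0. Qed.

Lemma derN i x : d i (- x) = - d i x.
Proof. by apply/eqP; rewrite -addr_eq0 -dA addNr der0. Qed.

Lemma derB i x y : d i (x - y) = d i x - d i y.
Proof. by rewrite dA derN. Qed.

Lemma der_sum i (J : Type) (r : seq J) (P : pred J) (F : J -> K) :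
  d i (\sum_(k <- r | P k) F k) = \sum_(k <- r | P k) d i (F k).
Proof. exact: (big_morph (d i) (dA i) (der0 i)). Qed.

Variables (g gi : 'M[K]_n.+1) (Gam : I -> 'M[K]_n.+1) (th : I -> K).
Hypothesis g_sym : forall i j, g i j = g j i.
Hypothesis gi_sym : forall i j, gi i j = gi j i.
Hypothesis g_gi : g *m gi = 1%:M.
Hypothesis torsion : forall i j k, Gam i j k = Gam j i k.

(** Correction of a covariant derivative for one lower index; [Gam k i b] is the Christoffel symbol
    with upper index b. *)
Definition ga k i (X : I -> K) := \sum_b Gam k i b * X b.
Definition con (X : I -> I -> K) := \sum_i \sum_j gi i j * X i j.

Hypothesis metric_parallel : forall k i j, d k (g i j) = ga k i (g^~ j) + ga k j (g i).
Hypothesis th_closed : forall i j, d i (th j) = d j (th i).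

Lemma gaD k i X Y : ga k i (fun b => X b + Y b) = ga k i X + ga k i Y.
Proof. by rewrite /ga -big_split; apply: eq_bigr => b _; rewrite mulrDr. Qed.

Lemma gaN k i X : ga k i (fun b => - X b) = - ga k i X.
Proof. by rewrite /ga -sumrN; apply: eq_bigr => b _; rewrite mulrN. Qed.

Lemma gaB k i X Y : ga k i (fun b => X b - Y b) = ga k i X - ga k i Y.
Proof. by rewrite gaD gaN. Qed.

Lemma gaZ k i x X : ga k i (fun b => x * X b) = x * ga k i X.
Proof. by rewrite /ga big_distrr; apply: eq_bigr => b _; rewrite mulrCA. Qed.

Lemma eq_ga k i X Y : (forall b, X b = Y b) -> ga k i X = ga k i Y.
Proof. by move=> E; apply: eq_bigr => b _; rewrite E. Qed.

Lemma ga_sym k i X : ga k i X = ga i k X.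
Proof. by apply: eq_bigr => b _; rewrite torsion. Qed.

Lemma conD X Y : con (fun i j => X i j + Y i j) = con X + con Y.
Proof.
rewrite /con -big_split; apply: eq_bigr => i _ /=.
by rewrite -big_split; apply: eq_bigr => j _; rewrite mulrDr.
Qed.

Lemma conN X : con (fun i j => - X i j) = - con X.
Proof.
rewrite /con -sumrN; apply: eq_bigr => i _ /=.
by rewrite -sumrN; apply: eq_bigr => j _; rewrite mulrN.
Qed.

Lemma conB X Y : con (fun i j => X i j - Y i j) = con X - con Y.
Proof. by rewrite conD conN. Qed.

Lemma conZ x X : con (fun i j => x * X i j) = x * con X.
Proof.
rewrite /con big_distrr; apply: eq_bigr => i _ /=.
by rewrite big_distrr; apply: eq_bigr => j _; rewrite mulrCA.
Qed.

Lemma eq_con X Y : (forall i j, X i j = Y i j) -> con X = con Y.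
Proof. by move=> E; apply: eq_bigr => i _; apply: eq_bigr => j _; rewrite E. Qed.

Lemma con_sym X : con (fun i j => X j i) = con X.
Proof.
rewrite /con exchange_big; apply: eq_bigr => i _; apply: eq_bigr => j _.
by rewrite gi_sym.
Qed.

Lemma con_sum (X : I -> I -> I -> K) (r : seq I) :
  con (fun i j => \sum_(b <- r) X b i j) = \sum_(b <- r) con (X b).
Proof.
elim: r => [|b r IH].
  rewrite big_nil /con big1 // => i _; rewrite big1 // => j _.
  by rewrite big_nil mulr0.
rewrite big_cons -IH -conD; apply: eq_con => i j.
by rewrite big_cons.
Qed.

Lemma con_con (X : I -> I -> I -> I -> K) :
  con (fun i j => con (X i j)) = con (fun k l => con (fun i j => X i j k l)).
Proof.
transitivity (con (fun i j => \sum_k \sum_l gi k l * X i j k l)) => //.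
rewrite con_sum; apply: eq_bigr => k _.
by rewrite con_sum; apply: eq_bigr => l _; rewrite conZ.
Qed.

Lemma ga_con k i (X : I -> I -> I -> K) :
  ga k i (fun b => con (X b)) = con (fun m a => ga k i (fun b => X b m a)).
Proof. by rewrite /ga con_sum; apply: eq_bigr => b _; rewrite conZ. Qed.

Lemma gi_g : gi *m g = 1%:M.
Proof. exact: mulmx1C. Qed.

(** The inverse metric is parallel: differentiate [gi *m g = 1%:M], insert [metric_parallel] and
    multiply by [gi] on the right. *)
Lemma der_gi k i j : d k (gi i j) = - (\sum_b gi i b * Gam k b j) - \sum_b Gam k b i * gi b j.
Proof.
have D : forall p q, \sum_b (d k (gi p b) * g b q) =
    - \sum_b gi p b * (\sum_a Gam k b a * g a q + \sum_a Gam k q a * g b a).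
  move=> p q; apply/eqP; rewrite -addr_eq0 -big_split /=.
  have -> : \sum_b (d k (gi p b) * g b q + gi p b * (\sum_a Gam k b a * g a q + \sum_a Gam k q a * g b a))
      = d k ((gi *m g) p q).
    rewrite mxE der_sum; apply: eq_bigr => b _.
    by rewrite dL metric_parallel.
  rewrite gi_g mxE; case: (p == q); rewrite ?mulr0n ?der0 //.
  by apply/eqP; rewrite mulr1n; apply: (addrI (d k 1)); rewrite addr0 -{3}(mulr1 1) dL mulr1 mul1r.
have -> : d k (gi i j) = \sum_q (\sum_b d k (gi i b) * g b q) * gi q j.
  under eq_bigr do rewrite big_distrl /=.
  rewrite exchange_big /=.
  have E b : \sum_q d k (gi i b) * g b q * gi q j = d k (gi i b) * (b == j)%:R.
    have -> : (b == j)%:R = \sum_q g b q * gi q j.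
      by have := congr1 (fun M : 'M[K]_(n.+1) => M b j) g_gi; rewrite !mxE => <-.
    rewrite big_distrr /=.
    by apply: eq_bigr => q _; rewrite mulrA.
  under eq_bigr do rewrite E.
  rewrite (bigD1 j) //= eqxx mulr1 big1 ?addr0 // => b /negPf ->.
  by rewrite mulr0.
under eq_bigr do rewrite D mulNr.
rewrite sumrN -opprD; congr (- _).
under eq_bigr do rewrite big_distrl /=.
have -> : \sum_q \sum_b gi i b * (\sum_a Gam k b a * g a q + \sum_a Gam k q a * g b a) * gi q j
  = \sum_b gi i b * (\sum_q (\sum_a Gam k b a * g a q) * gi q j) +
    \sum_q (\sum_b gi i b * (\sum_a Gam k q a * g b a)) * gi q j.
  rewrite exchange_big /= [X in _ + X](_ : _ = \sum_b \sum_q gi i b * (\sum_a Gam k q a * g b a) * gi q j).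
    rewrite -big_split; apply: eq_bigr => b _ /=.
    rewrite big_distrr -big_split; apply: eq_bigr => q _ /=.
    by rewrite mulrDr mulrDl -mulrA.
  by rewrite exchange_big; apply: eq_bigr => q _; rewrite big_distrl.
congr (_ + _).
  apply: eq_bigr => b _; congr (_ * _).
  transitivity ((Gam k *m g *m gi) b j); last by rewrite -mulmxA g_gi mulmx1.
  by rewrite mxE; apply: eq_bigr => q _; rewrite mxE.
apply: eq_bigr => q _; congr (_ * _).
transitivity ((Gam k *m (gi *m g)^T) q i); last by rewrite gi_g trmx1 mulmx1.
rewrite mxE; under [RHS]eq_bigr do rewrite !mxE big_distrr /=.
rewrite exchange_big; apply: eq_bigr => b _ /=.
by rewrite big_distrr; apply: eq_bigr => a _ /=; rewrite mulrCA.
Qed.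

(** Because the inverse metric is parallel, the derivative of a trace is the trace of the covariant
    derivative. *)
Lemma der_con k (X : I -> I -> K) :
  d k (con X) = con (fun i j => d k (X i j) - ga k i (X^~ j) - ga k j (X i)).
Proof.
rewrite /con der_sum; under eq_bigr do rewrite der_sum.
have -> : \sum_i \sum_j d k (gi i j * X i j) =
    con (fun i j => d k (X i j)) + \sum_i \sum_j d k (gi i j) * X i j.
  rewrite /con -big_split; apply: eq_bigr => i _ /=; rewrite -big_split.
  by apply: eq_bigr => j _ /=; rewrite dL addrC.
rewrite -/(con _) !conB -addrA; congr (_ + _); rewrite -opprD.
have -> : \sum_i \sum_j d k (gi i j) * X i j =
   - (\sum_i \sum_j (\sum_b Gam k b i * gi b j) * X i j + \sum_i \sum_j (\sum_b gi i b * Gam k b j) * X i j).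
  rewrite -big_split -sumrN; apply: eq_bigr => i _ /=; rewrite -big_split -sumrN.
  apply: eq_bigr => j _ /=; rewrite der_gi; ring.
congr (- (_ + _)).
  rewrite /con exchange_big [RHS]exchange_big; apply: eq_bigr => j _ /=.
  under eq_bigr do rewrite big_distrl /=.
  rewrite exchange_big; apply: eq_bigr => b _ /=.
  by rewrite /ga big_distrr; apply: eq_bigr => a _ /=; ring.
rewrite /con; apply: eq_bigr => i _ /=.
under eq_bigr do rewrite big_distrl /=.
rewrite exchange_big; apply: eq_bigr => b _ /=.
by rewrite /ga big_distrr; apply: eq_bigr => a _ /=; ring.
Qed.

Definition curv i j : 'M[K]_n.+1 := \matrix_(k, m)
  (d i (Gam j k m) - d j (Gam i k m) + \sum_l (Gam i l m * Gam j k l - Gam j l m * Gam i k l)).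

Definition Rl i j k l := \sum_m g k m * curv i j l m.

Definition cov2 k (X : I -> I -> K) i j := d k (X i j) - ga k i (X^~ j) - ga k j (X i).
Definition cov3 k (X : I -> I -> I -> K) h i j :=
  d k (X h i j) - ga k h (fun b => X b i j) - ga k i (fun b => X h b j) - ga k j (X h i).
Definition cov4 k (X : I -> I -> I -> I -> K) h i j l :=
  d k (X h i j l) - ga k h (fun b => X b i j l) - ga k i (fun b => X h b j l)
   - ga k j (fun b => X h i b l) - ga k l (X h i j).

(** With [th] in the role of the differential of the potential, [Hs], [T] and [N] are its Hessian
    and the first two covariant derivatives of the Hessian; [nR] is the covariant derivative of the
    curvature tensor. *)
Definition Hs i j := d i (th j) - ga i j th.
Definition T i := cov2 i Hs.
Definition N k := cov3 k T.
Definition nR k := cov4 k Rl.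

Lemma ga_exch i j k l (X : I -> I -> K) :
  ga i j (fun b => ga k l (X b)) = ga k l (fun c => ga i j (X^~ c)).
Proof.
rewrite /ga; under eq_bigr do rewrite big_distrr /=.
rewrite exchange_big; apply: eq_bigr => c _ /=.
by rewrite big_distrr; apply: eq_bigr => b _; rewrite mulrCA.
Qed.

Lemma der_ga k i j (X : I -> K) :
  d k (ga i j X) = \sum_b d k (Gam i j b) * X b + ga i j (fun b => d k (X b)).
Proof. by rewrite /ga der_sum -big_split; apply: eq_bigr => b _; rewrite dL. Qed.

Lemma curvE i j k (X : I -> K) : \sum_m curv i j k m * X m =
  \sum_m d i (Gam j k m) * X m - \sum_m d j (Gam i k m) * X m
  + ga j k (fun l => ga i l X) - ga i k (fun l => ga j l X).
Proof.
under eq_bigr do rewrite mxE mulrDl mulrBl big_distrl /=.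
rewrite big_split sumrB /= -[RHS]addrA; congr (_ + _).
rewrite exchange_big /= -sumrB; apply: eq_bigr => l _.
rewrite /ga !big_distrr /= -sumrB; apply: eq_bigr => m _; ring.
Qed.

Lemma curv_anti i j k m : curv i j k m = - curv j i k m.
Proof.
rewrite !mxE opprD opprB; congr (_ + _).
by rewrite -sumrN; apply: eq_bigr => l _; rewrite opprB.
Qed.

Lemma Hs_sym i j : Hs i j = Hs j i.
Proof. by rewrite /Hs th_closed ga_sym. Qed.

Lemma T_sym i j l : T i j l = T i l j.
Proof.
rewrite /T /cov2 Hs_sym addrAC; congr (_ - _ - _); apply: eq_ga => b; exact: Hs_sym.
Qed.

(** Ricci identity for a 1-form. In the expansion [TE] everything symmetric in a and b drops out of
    the difference, and [curvE] recognizes the remainder. *)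
Lemma commute_th i j l : T i j l - T j i l = - \sum_m curv i j l m * th m.
Proof.
have TE a b : T a b l = d a (d b (th l)) - \sum_m d a (Gam b l m) * th m
   - ga b l (fun m => d a (th m)) - ga a b (Hs^~ l) - ga a l (fun m => d b (th m))
   + ga a l (fun m => ga b m th).
  rewrite /T /cov2 {1}/Hs derB der_ga.
  have -> : ga a l (Hs b) = ga a l (fun m => d b (th m)) - ga a l (fun m => ga b m th) by rewrite -gaB.
  by ring.
rewrite curvE !TE (dC i j (th l)) (ga_sym j i (Hs^~ l)).
by ring.
Qed.

Lemma commute_H k j i l : N k j i l - N j k i l =
  - (\sum_m curv k j i m * Hs m l) - \sum_m curv k j l m * Hs i m.
Proof.
have NE a b : N a b i l = d a (d b (Hs i l))
   - (\sum_m d a (Gam b i m) * Hs m l + ga b i (fun m => d a (Hs m l)))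
   - (\sum_m d a (Gam b l m) * Hs i m + ga b l (fun m => d a (Hs i m)))
   - ga a b (fun m => T m i l)
   - (ga a i (fun m => d b (Hs m l)) - ga a i (fun m => ga b m (Hs^~ l)) - ga a i (fun m => ga b l (Hs m)))
   - (ga a l (fun m => d b (Hs i m)) - ga a l (fun m => ga b i (Hs^~ m)) - ga a l (fun m => ga b m (Hs i))).
  by rewrite -!gaB -!der_ga /N /cov3 {1}/T /cov2 !derB.
rewrite !curvE !NE (dC k j (Hs i l)) (ga_sym j k (fun m => T m i l)).
rewrite (ga_exch k i j l Hs) (ga_exch j i k l Hs).
by ring.
Qed.

Lemma lower_curv (X : I -> K) i j l : \sum_m curv i j l m * X m = con (fun m a => X a * Rl i j m l).
Proof.
rewrite /con exchange_big /=.
transitivity (\sum_a X a * curv i j l a); first by apply: eq_bigr => a _; rewrite mulrC.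
apply: eq_bigr => a _; under eq_bigr do rewrite mulrCA.
rewrite -big_distrr /=; congr (_ * _).
rewrite /Rl; under eq_bigr do rewrite big_distrr /=.
rewrite exchange_big /=.
transitivity (\sum_j0 (g *m gi) j0 a * curv i j l j0).
  rewrite g_gi (bigD1 a) //= [1%:M a a]mxE eqxx mul1r big1 ?addr0 // => b /negPf ba.
  by rewrite [1%:M b a]mxE ba mul0r.
apply: eq_bigr => b _; rewrite mxE big_distrl; apply: eq_bigr => c _ /=.
by rewrite (g_sym c b); ring.
Qed.

Lemma Rl_anti12 i j k l : Rl i j k l = - Rl j i k l.
Proof. by rewrite /Rl -sumrN; apply: eq_bigr => m _; rewrite curv_anti mulrN. Qed.

(** The antisymmetry expresses that the second derivatives of [g k l] commute, once both are
    expanded with [metric_parallel]. *)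
Lemma Rl_anti34 i j k l : Rl i j k l = - Rl i j l k.
Proof.
apply/eqP; rewrite -addr_eq0; apply/eqP.
have E p q : Rl i j p q = \sum_m curv i j q m * g m p.
  by apply: eq_bigr => m _; rewrite g_sym mulrC.
rewrite !E !curvE.
have mp a b c : d a (g b c) = ga a b (g^~ c) + ga a c (g^~ b).
  by rewrite metric_parallel; congr (_ + _); apply: eq_ga => e.
have C : d i (d j (g k l)) = d j (d i (g k l)) by rewrite dC.
have X a b : d a (ga b l (g^~ k)) = \sum_m d a (Gam b l m) * g m k + ga b l (fun m => ga a m (g^~ k)) + ga b l (fun m => ga a k (g^~ m)).
  by rewrite der_ga -addrA; congr (_ + _); rewrite -gaD; apply: eq_ga => m; rewrite mp.
have Y a b : d a (ga b k (g^~ l)) = \sum_m d a (Gam b k m) * g m l + ga b k (fun m => ga a m (g^~ l)) + ga b k (fun m => ga a l (g^~ m)).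
  by rewrite der_ga -addrA; congr (_ + _); rewrite -gaD; apply: eq_ga => m; rewrite mp.
rewrite !mp !dA !X !Y in C.
have Z a b p q : ga a p (fun m => ga b q (g^~ m)) = ga b q (fun m => ga a p (g^~ m)).
  rewrite ga_exch; apply: eq_ga => m; apply: eq_ga => e; exact: g_sym.
move/eqP: C; rewrite -subr_eq0 => /eqP C.
rewrite -[RHS]C (Z j i l k) (Z j i k l); ring.
Qed.

Lemma Rl_bianchi1 i j k l : Rl i j k l + Rl j l k i + Rl l i k j = 0.
Proof.
rewrite /Rl -!big_split /= big1 // => m _; rewrite -!mulrDr.
suff -> : curv i j l m + curv j l i m + curv l i j m = 0 by rewrite mulr0.
rewrite !mxE (torsion l j) (torsion l i) (torsion j i) !sumrB.
have E a b c : \sum_l0 Gam a l0 m * Gam b c l0 = \sum_l0 Gam a l0 m * Gam c b l0.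
  by apply: eq_bigr => e _; rewrite (torsion b c).
by rewrite (E i l j) (E j l i) (E l j i); ring.
Qed.

(** Octahedron argument: four instances of the first Bianchi identity combine, by antisymmetry in
    each pair, to twice the difference; [two_cancel] removes the factor. *)
Lemma Rl_pair i j k l : Rl i j k l = Rl k l i j.
Proof.
apply/eqP; rewrite -subr_eq0; apply/eqP/two_cancel.
have A := Rl_anti12; have B := Rl_anti34; have C := Rl_bianchi1.
have e1 := C i j k l; have e2 := C i j l k; have e3 := C k l i j; have e4 := C k l j i.
rewrite (B i j l k) (A j k l i) (B k i l j) in e2.
rewrite (A l j i k) (B j l i k) (A j k i l) (B k j i l) in e3.
rewrite (B k l j i) (B l i j k) (A i k j l) in e4.
transitivity ((Rl i j k l + Rl j l k i + Rl l i k j) - (- Rl i j k l - Rl k j l i - Rl k i j l)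
  - (Rl k l i j - - Rl j l k i - - Rl k j l i) + (- Rl k l i j - Rl l i k j - Rl k i j l)); first ring.
by rewrite e1 e2 e3 e4 !subr0 addr0.
Qed.

(** Lowering an index commutes with covariant differentiation, so the second Bianchi identity may be
    proved for the matrices [curv i j]. *)
Lemma cov4_curv a i j k l : nR a i j k l =
  \sum_m g k m * (d a (curv i j l m) - ga a i (fun b => curv b j l m) - ga a j (fun b => curv i b l m)
     - ga a l (fun b => curv i j b m) + \sum_b curv i j l b * Gam a b m).
Proof.
rewrite /nR /cov4 {1}/Rl der_sum; under eq_bigr do rewrite dL metric_parallel.
have E X : ga a k (fun b => \sum_m g b m * X m) = \sum_m ga a k (g^~ m) * X m.
  rewrite /ga; under eq_bigr do rewrite big_distrr /=.
  rewrite exchange_big; apply: eq_bigr => m _ /=.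
  by rewrite big_distrl; apply: eq_bigr => b _; rewrite /= mulrA.
have E2 c (X : I -> I -> K) : ga a c (fun b => \sum_m g k m * X b m) = \sum_m g k m * ga a c (X^~ m).
  rewrite /ga; under eq_bigr do rewrite big_distrr /=.
  rewrite exchange_big; apply: eq_bigr => m _ /=.
  by rewrite big_distrr; apply: eq_bigr => b _; rewrite /= mulrCA.
rewrite /Rl (E2 i) (E2 j (fun b m => curv i b l m)) (E (curv i j l)) (E2 l (curv i j)).
have E3 : \sum_m ga a m (g k) * curv i j l m = \sum_m g k m * \sum_b curv i j l b * Gam a b m.
  rewrite /ga; under eq_bigr do rewrite big_distrl /=.
  rewrite exchange_big; apply: eq_bigr => m _ /=.
  by rewrite big_distrr; apply: eq_bigr => b _ /=; ring.
under [RHS]eq_bigr do rewrite mulrDr !mulrBr.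
rewrite [RHS]big_split /= !sumrB /= -E3.
under [in LHS]eq_bigr do rewrite mulrDl.
by rewrite !big_split /=; ring.
Qed.

Definition dm i (A : 'M[K]_n.+1) : 'M[K]_n.+1 := map_mx (d i) A.

Lemma dm_add i A B : dm i (A + B) = dm i A + dm i B.
Proof. by apply/matrixP => p q; rewrite !mxE dA. Qed.

Lemma dm_opp i A : dm i (- A) = - dm i A.
Proof. by apply/matrixP => p q; rewrite !mxE derN. Qed.

Lemma dm_mul i A B : dm i (A *m B) = dm i A *m B + A *m dm i B.
Proof.
apply/matrixP => p q; rewrite !mxE der_sum -big_split; apply: eq_bigr => b _ /=.
by rewrite dL !mxE.
Qed.

Lemma dm_comm i j A : dm i (dm j A) = dm j (dm i A).
Proof. by apply/matrixP => p q; rewrite !mxE dC. Qed.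

Lemma curv_mx i j : curv i j =
  dm i (Gam j) + - dm j (Gam i) + Gam j *m Gam i + - (Gam i *m Gam j).
Proof.
apply/matrixP => k m; rewrite !mxE -addrA; congr (_ + _).
by rewrite -sumrB; apply: eq_bigr => l _; ring.
Qed.

(** Bianchi identity of a connection with matrices [Gam]. They act on row vectors, so commutators
    appear in reverse order; after exchanging second derivatives all terms cancel in pairs. *)
Lemma curv_bianchi2 a i j :
  (dm a (curv i j) + - (Gam a *m curv i j) + curv i j *m Gam a) +
  (dm i (curv j a) + - (Gam i *m curv j a) + curv j a *m Gam i) +
  (dm j (curv a i) + - (Gam j *m curv a i) + curv a i *m Gam j) = 0.
Proof.
rewrite !curv_mx !(dm_add, dm_opp, dm_mul, mulmxDl, mulmxDr, mulmxN, mulNmx, mulmxA).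
rewrite (dm_comm i a (Gam j)) (dm_comm j a (Gam i)) (dm_comm j i (Gam a)).
have addE (A B : 'M[K]_n.+1) p q : (A + B) p q = A p q + B p q by rewrite mxE.
have oppE (A : 'M[K]_n.+1) p q : (- A) p q = - A p q by rewrite mxE.
apply/matrixP => p q; rewrite !(addE, oppE) [RHS]mxE; ring.
Qed.

(** The connection terms for the two form indices do not occur in [curv_bianchi2]; in the cyclic sum
    they cancel because there is no torsion. *)
Lemma Rl_bianchi2 a i j k l : nR a i j k l + nR i j a k l + nR j a i k l = 0.
Proof.
rewrite !cov4_curv -!big_split /= big1 // => m _; rewrite -!mulrDr.
have := congr1 (fun A : 'M[K]_(n.+1) => A l m) (curv_bianchi2 a i j).
have addE (A B : 'M[K]_n.+1) p q : (A + B) p q = A p q + B p q by rewrite mxE.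
have oppE (A : 'M[K]_n.+1) p q : (- A) p q = - A p q by rewrite mxE.
have dmE b A p q : dm b A p q = d b (A p q) by rewrite mxE.
have mulE (A B : 'M[K]_n.+1) p q : (A *m B) p q = \sum_b A p b * B b q by rewrite mxE.
rewrite !(addE, oppE, dmE, mulE) [RHS]mxE -/(ga a l _) => E.
have anti b c e : ga b c (fun p => curv p e l m) = - ga b c (fun p => curv e p l m).
  by rewrite -gaN; apply: eq_ga => p; rewrite curv_anti.
rewrite (anti a i j) (anti i j a) (anti j a i) (ga_sym i a) (ga_sym j i) (ga_sym j a).
rewrite -[RHS](mulr0 (g k m)); congr (_ * _).
by rewrite -[RHS]E /ga; ring.
Qed.

Definition Rc i k := con (fun j l => Rl i j k l).
Hypothesis soliton : forall i k, Rc i k + Hs i k = 0.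

Lemma nR_pair a i j k l : nR a i j k l = nR a k l i j.
Proof.
rewrite /nR /cov4 Rl_pair.
rewrite (eq_ga (X := fun b => Rl b j k l) a i (fun b => Rl_pair b j k l)).
rewrite (eq_ga (X := fun b => Rl i b k l) a j (fun b => Rl_pair i b k l)).
rewrite (eq_ga (X := fun b => Rl i j b l) a k (fun b => Rl_pair i j b l)).
rewrite (eq_ga (X := Rl i j k) a l (fun b => Rl_pair i j k b)).
ring.
Qed.

Lemma nR_anti12 a i j k l : nR a i j k l = - nR a j i k l.
Proof.
rewrite /nR /cov4 Rl_anti12 derN.
rewrite (eq_ga (X := fun b => Rl b j k l) a i (fun b => Rl_anti12 b j k l)).
rewrite (eq_ga (X := fun b => Rl i b k l) a j (fun b => Rl_anti12 i b k l)).
rewrite (eq_ga (X := fun b => Rl i j b l) a k (fun b => Rl_anti12 i j b l)).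
rewrite (eq_ga (X := Rl i j k) a l (fun b => Rl_anti12 i j k b)).
rewrite !gaN; ring.
Qed.

Lemma nR_anti34 a i j k l : nR a i j k l = - nR a i j l k.
Proof. by rewrite nR_pair nR_anti12 -nR_pair. Qed.

Lemma T_Rc i j l : T i j l = - con (fun m a => nR i j m l a).
Proof.
have HE b c : Hs b c = - Rc b c by apply/eqP; rewrite -addr_eq0 addrC soliton.
rewrite /T /cov2 HE derN (eq_ga i j (fun b => HE b l)) (eq_ga i l (HE j)) !gaN /Rc der_con !ga_con.
rewrite -!conN -!conD; apply: eq_con => m a.
by rewrite /nR /cov4; ring.
Qed.

Lemma T_anti i j l : T i j l - T j i l = - con (fun m a => th a * Rl i j m l).
Proof. by rewrite commute_th lower_curv. Qed.

(* Divergence of the curvature tensor: [div Rm = Rm (grad f)] on a soliton. *)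
Lemma div_Rl a i k : con (fun j l => nR j a i k l) = - con (fun m b => th b * Rl a i m k).
Proof.
have E : con (fun j l => nR a i j k l) + con (fun j l => nR i j a k l) + con (fun j l => nR j a i k l) = 0.
  rewrite -!conD -(mul0r (con gi)) -conZ; apply: eq_con => p q.
  by rewrite Rl_bianchi2 mul0r.
have E2 : con (fun j l => nR i j a k l) = T i a k.
  by rewrite T_Rc -conN; apply: eq_con => p q; rewrite nR_anti12.
have E3 : con (fun j l => nR a i j k l) = - T a i k by rewrite T_Rc opprK.
rewrite -T_anti; apply/eqP; rewrite -subr_eq0; apply/eqP.
by rewrite -[RHS]E E2 E3; ring.
Qed.

Definition S l := con (fun k i => T k i l).

(** Trace of [div_Rl]. As the divergence of Rc is half the gradient of R, this is the identity grad
    R = 2 Rc(grad f). *)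
Lemma S_th i : S i = con (fun m b => th b * Hs i m).
Proof.
have HE b c : Hs b c = - Rc b c by apply/eqP; rewrite -addr_eq0 addrC soliton.
have E : con (fun a k => con (fun j l => nR j a i k l)) =
         con (fun a k => - con (fun m b => th b * Rl a i m k)).
  by apply: eq_con => a k; exact: div_Rl.
rewrite conN con_con in E.
transitivity (- con (fun j l => con (fun a k => nR j a i k l))).
  rewrite /S -conN; apply: eq_con => j l; rewrite T_sym T_Rc; congr (- _).
  apply: eq_con => a k; by rewrite nR_pair nR_anti12 nR_anti34 opprK -nR_pair nR_pair.
rewrite E opprK con_con; apply: eq_con => m b.
rewrite conZ (HE i m); congr (_ * _).
rewrite /Rc -conN; apply: eq_con => a k.
by rewrite Rl_anti12.
Qed.

Lemma der_S j l : d j (S l) - ga j l S = con (fun k i => N j k i l).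
Proof.
rewrite /S der_con ga_con -conB; apply: eq_con => k i.
by rewrite /N /cov3.
Qed.

Lemma cov_T_anti k i j l : N k i j l - N k j i l =
  - con (fun m a => Hs k a * Rl i j m l + th a * nR k i j m l).
Proof.
pose A i j l := con (fun m a => th a * Rl i j m l).
have E b c e : T b c e - T c b e = - A b c e by exact: T_anti.
have E1 : N k i j l - N k j i l = - (d k (A i j l) - ga k i (fun b => A b j l)
    - ga k j (fun b => A i b l) - ga k l (A i j)).
  have e0 : d k (T i j l) - d k (T j i l) = - d k (A i j l) by rewrite -derB E derN.
  have e1 : ga k i (fun b => T b j l) - ga k i (fun b => T j b l) = - ga k i (fun b => A b j l).
    by rewrite -gaB -gaN; apply: eq_ga => b.
  have e2 : ga k j (fun b => T i b l) - ga k j (fun b => T b i l) = - ga k j (fun b => A i b l).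
    by rewrite -gaB -gaN; apply: eq_ga => b.
  have e3 : ga k l (T i j) - ga k l (T j i) = - ga k l (A i j).
    by rewrite -gaB -gaN; apply: eq_ga => b.
  transitivity ((d k (T i j l) - d k (T j i l)) -
    (ga k i (fun b => T b j l) - ga k i (fun b => T j b l)) -
    (ga k j (fun b => T i b l) - ga k j (fun b => T b i l)) - (ga k l (T i j) - ga k l (T j i))).
    by rewrite /N /cov3; ring.
  by rewrite e0 e1 e2 e3; ring.
rewrite E1; congr (- _); rewrite /A der_con !ga_con -!conB; apply: eq_con => m a.
have e4 : ga k a (fun b => th b * Rl i j m l) = ga k a th * Rl i j m l.
  by rewrite -[RHS]mulrC -gaZ; apply: eq_ga => b; rewrite mulrC.
rewrite e4 dL !gaZ /nR /cov4 /Hs.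
set x1 := ga k m _; set x2 := ga k a _; set x3 := ga k i _; set x4 := ga k j _; set x5 := ga k l _.
move: (d k (Rl i j m l)) (d k (th a)) (Rl i j m l) (th a) x1 x2 x3 x4 x5 => *.
ring.
Qed.

Lemma cov_S j l : d j (S l) - ga j l S = con (fun m b => Hs j b * Hs l m + th b * T j l m).
Proof.
rewrite S_th (eq_ga _ _ S_th) der_con ga_con -conB; apply: eq_con => m b.
have e4 : ga j b (fun b => th b * Hs l m) = ga j b th * Hs l m.
  by rewrite -[RHS]mulrC -gaZ; apply: eq_ga => c; rewrite mulrC.
have e5 : Hs j b = d j (th b) - ga j b th by [].
rewrite e4 dL !gaZ e5 /T /cov2.
move: (d j (Hs l m)) (d j (th b)) (Hs l m) (th b) (ga _ _ _) (ga _ _ _) (ga _ _ _) => *.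
ring.
Qed.

(** Moves the index j to the front: [cov_T_anti] exchanges it with i and [commute_H] with k, after
    which the trace is the derivative of the divergence [S]. Each exchange costs one [Q]. The terms
    quadratic in [Hs] cancel by [E4], and the terms [X], quadratic in [th], cancel between [E3] and
    [E5]. *)
Lemma soliton_laplacian j l :
  con (fun k i => N k i j l) = con (fun m a => th a * T m j l)
   - (1 + 1) * con (fun k i => con (fun m a => Hs i a * Rl k j m l)).
Proof.
have HE b c : Hs b c = - Rc b c by apply/eqP; rewrite -addr_eq0 addrC soliton.
pose Q := con (fun k i => con (fun m a => Hs i a * Rl k j m l)).
pose Y i j k l := con (fun m a => th a * con (fun p b => th b * Rl i j k l)).
pose X := con (fun m a => th a * con (fun p b => th b * Rl j m p l)).
have E1 : con (fun k i => N k i j l) = con (fun k i => N k j i l) - Q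
    - con (fun k i => con (fun m a => th a * nR k i j m l)).
  have -> : Q = con (fun k i => con (fun m a => Hs k a * Rl i j m l)) by rewrite /Q -con_sym.
  rewrite -!conB; apply: eq_con => k i.
  by rewrite -[N k i j l](subrK (N k j i l)) cov_T_anti conD; ring.
have E2 : con (fun k i => N k j i l) = con (fun k i => N j k i l)
    - con (fun m a => Hs a l * Hs j m) - Q.
  have -> : con (fun m a => Hs a l * Hs j m) = con (fun k i => con (fun m a => Hs a l * Rl k j m i)).
    rewrite con_con; apply: eq_con => m a; rewrite conZ (HE j m); congr (_ * _).
    by rewrite /Rc -conN; apply: eq_con => k i; rewrite [RHS]Rl_anti12.
  rewrite -!conB; apply: eq_con => k i.
  rewrite -[N k j i l](subrK (N j k i l)) commute_H (lower_curv (Hs^~ l)) (lower_curv (Hs i)).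
  ring.
have E3 : con (fun k i => N j k i l) = con (fun m b => Hs j b * Hs l m) +
    (con (fun m a => th a * T m j l) - X).
  rewrite -der_S cov_S conD; congr (_ + _); rewrite -conB; apply: eq_con => m a.
  rewrite -mulrBr T_sym; congr (_ * _); apply/eqP; rewrite -subr_eq0 opprB addrC.
  have := T_anti j m l => /eqP; rewrite -subr_eq0 => /eqP <-; apply/eqP; ring.
have E4 : con (fun m b => Hs j b * Hs l m) = con (fun m a => Hs a l * Hs j m).
  rewrite -con_sym; apply: eq_con => m a; rewrite (Hs_sym l a); ring.
have E5 : con (fun k i => con (fun m a => th a * nR k i j m l)) = - X.
  rewrite con_con.
  transitivity (con (fun m a => th a * con (fun p b => th b * Rl p j m l))).
    apply: eq_con => m a; rewrite conZ; congr (_ * _).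
    transitivity (- con (fun k i => nR k m l j i)).
      by rewrite -conN; apply: eq_con => k i; rewrite nR_pair nR_anti34.
    by rewrite div_Rl opprK; apply: eq_con => p b; rewrite Rl_pair.
  rewrite (eq_con (Y := fun m a => con (fun p b => th a * (th b * Rl p j m l)))); last first.
    by move=> m a; rewrite conZ.
  rewrite con_con /X -conN; apply: eq_con => p b.
  rewrite -mulrN -conN -conZ; apply: eq_con => m a.
  by rewrite (Rl_anti12 j p); ring.
rewrite E1 E2 E3 E4 E5 -/Q; ring.
Qed.

End SolitonAlgebra.

(** * The soliton identity in a chart *)

Section SmoothFunctionRing.
Context {R : realType} {n : nat}.
Local Notation V := 'rV[R]_n.+1.
Variables (U : set V) (x0 : V).

Definition sfun_pred : {pred (V -> R)} :=
  fun f => `[< smooth_on U f /\ forall x, ~ U x -> f x = f x0 >].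

(* Functions smooth on [U], made constant outside [U] so that equality on [U] is
   equality; the proofs [oU], [Ux0] are parameters of the type so that the ring
   instance can use them. *)
Record sfun (oU : open U) (Ux0 : U x0) := Sfun { sfun_val : V -> R; _ : sfun_val \in sfun_pred }.

Section Instances.
Variables (oU : open U) (Ux0 : U x0).
Local Notation K := (sfun oU Ux0).

HB.instance Definition _ := [isSub for (@sfun_val oU Ux0)].
HB.instance Definition _ := [Choice of K by <:].

Lemma sfun_subring : subring_closed sfun_pred.
Proof.
split.
- by apply/asboolP; split=> //; exact: smooth_cst.
- move=> f g /asboolP[sf ef] /asboolP[sg eg]; apply/asboolP; split.
    exact: (smooth_sub oU sf sg).
  by move=> x Ux; rewrite -[(f - g) x]/(f x - g x) -[(f - g) x0]/(f x0 - g x0) ef ?eg.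
- move=> f g /asboolP[sf ef] /asboolP[sg eg]; apply/asboolP; split.
    exact: (smooth_mul oU sf sg).
  by move=> x Ux; rewrite -[(f * g) x]/(f x * g x) -[(f * g) x0]/(f x0 * g x0) ef ?eg.
Qed.

HB.instance Definition _ := GRing.SubChoice_isSubComPzRing.Build _ sfun_pred K sfun_subring.

Lemma sfun_smooth (f : K) : smooth_on U (sfun_val f).
Proof. by case: f => f /= /asboolP[]. Qed.

Lemma sfun_eq (f g : K) : (forall x, U x -> sfun_val f x = sfun_val g x) -> f = g.
Proof.
move=> E; apply: val_inj; apply/funext => x /=.
case: (pselect (U x)) => [/E//|nU].
case: f g E => f fp [g gp] /= E; have /asboolP[_ ef] := fp; have /asboolP[_ eg] := gp.
by rewrite ef // eg //; exact: E.
Qed.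

Lemma emb_subproof (f : V -> R) (sf : smooth_on U f) :
  (fun x => if `[< U x >] then f x else f x0) \in sfun_pred.
Proof.
apply/asboolP; split.
  by apply: (smooth_ext oU sf) => x Ux; case: asboolP.
by move=> x nU; case: asboolP => // _; case: asboolP.
Qed.

Definition emb (f : V -> R) (sf : smooth_on U f) : K := Sfun oU Ux0 (emb_subproof sf).

Lemma embE (f : V -> R) (sf : smooth_on U f) x : U x -> sfun_val (emb sf) x = f x.
Proof. by move=> Ux /=; case: asboolP. Qed.

Definition sder i (f : K) : K := emb (smooth_partial i (sfun_smooth f)).

Lemma sderE i (f : K) x : U x -> sfun_val (sder i f) x = partial i (sfun_val f) x.
Proof. exact: embE. Qed.

Opaque emb sder.

Lemma sfunD (f g : K) x : sfun_val (f + g) x = sfun_val f x + sfun_val g x.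
Proof. by []. Qed.

Lemma sfunM (f g : K) x : sfun_val (f * g) x = sfun_val f x * sfun_val g x.
Proof. by []. Qed.

Lemma sfunN (f : K) x : sfun_val (- f) x = - sfun_val f x.
Proof. by []. Qed.

Lemma sfunB (f g : K) x : sfun_val (f - g) x = sfun_val f x - sfun_val g x.
Proof. by []. Qed.

Lemma sfun1 x : sfun_val (1 : K) x = 1.
Proof. by []. Qed.

Lemma sfun0 x : sfun_val (0 : K) x = 0.
Proof. by []. Qed.

Lemma sfun_sum (I : Type) (r : seq I) (P : pred I) (F : I -> K) x :
  sfun_val (\sum_(i <- r | P i) F i) x = \sum_(i <- r | P i) sfun_val (F i) x.
Proof. by apply: (big_morph (fun f : K => sfun_val f x)). Qed.

Lemma sderA i (f g : K) : sder i (f + g) = sder i f + sder i g.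
Proof.
apply: sfun_eq => x Ux; rewrite (sderE _ (f + g) Ux) sfunD (sderE _ f Ux) (sderE _ g Ux).
have df := partialP (smooth_derivable (i := i) (sfun_smooth f) Ux).
have dg := partialP (smooth_derivable (i := i) (sfun_smooth g) Ux).
have [_ E] := @is_deriveD _ _ _ (sfun_val f) (sfun_val g) _ _ _ _ df dg.
exact: E.
Qed.

Lemma sderM i (f g : K) : sder i (f * g) = sder i f * g + f * sder i g.
Proof.
apply: sfun_eq => x Ux; rewrite (sderE _ (f * g) Ux) sfunD (sfunM (sder i f)) (sfunM f) (sderE _ f Ux) (sderE _ g Ux).
have df := partialP (smooth_derivable (i := i) (sfun_smooth f) Ux).
have dg := partialP (smooth_derivable (i := i) (sfun_smooth g) Ux).
have [_ E] := @is_deriveM _ _ (sfun_val f) (sfun_val g) _ _ _ _ df dg.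
rewrite addrC [partial i (sfun_val f) x * _]mulrC.
exact: E.
Qed.

Lemma sderC i j (f : K) : sder i (sder j f) = sder j (sder i f).
Proof.
apply: sfun_eq => x Ux; rewrite (sderE i (sder j f) Ux) (sderE j (sder i f) Ux).
rewrite (partial_eq_on oU (fun y Uy => sderE j f Uy) i Ux).
rewrite (partial_eq_on oU (fun y Uy => sderE i f Uy) j Ux).
exact: (partialC oU _ _ (sfun_smooth f) Ux).
Qed.

Lemma sfun_two_cancel (f : K) : f + f = 0 -> f = 0.
Proof.
move=> E; apply: sfun_eq => x Ux; have := congr1 (fun h : K => sfun_val h x) E.
rewrite sfunD sfun0 => {}E; lra.
Qed.

End Instances.
End SmoothFunctionRing.

(** * Tensor fields of a metric in a chart *)

Section TensorFields.
Context {R : realType} {n : nat}.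
Local Notation V := 'rV[R]_n.+1.
Variables (U : set V) (g : V -> 'M[R]_n.+1).
Hypothesis oU : open U.
Hypothesis sg : forall i j, smooth_on U (fun x => g x i j).
Hypothesis g_sym : forall x, U x -> (g x)^T = g x.
Hypothesis g_unit : forall x, U x -> g x \in unitmx.
Implicit Types (i j k l m : 'I_n.+1).

Lemma smooth_ginv i j : smooth_on U (fun x => invmx (g x) i j).
Proof. exact: smooth_invmx. Qed.

Lemma smooth_christoffel k i j : smooth_on U (christoffel g k i j).
Proof.
apply: (smooth_mul oU); first exact: smooth_cst.
apply: (smooth_sum oU) => l; apply: (smooth_mul oU); first exact: smooth_ginv.
apply: (smooth_sub oU); last exact: (smooth_partial l (sg i j)).
by apply: (smooth_add oU); [exact: (smooth_partial i (sg j l))|exact: (smooth_partial j (sg i l))].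
Qed.

Lemma smooth_riemann_up i j k m : smooth_on U (riemann_up g i j k m).
Proof.
have sc := smooth_christoffel.
apply: (smooth_add oU); first apply: (smooth_sub oU).
- exact: (smooth_partial i (sc m j k)).
- exact: (smooth_partial j (sc m i k)).
apply: (smooth_sum oU) => l; apply: (smooth_sub oU); apply: (smooth_mul oU); exact: sc.
Qed.

Lemma smooth_riemann i j k l : smooth_on U (riemann g i j k l).
Proof.
apply: (smooth_sum oU) => m; apply: (smooth_mul oU); first exact: sg.
exact: smooth_riemann_up.
Qed.

Lemma smooth_ricci i k : smooth_on U (fun x => ricci g x i k).
Proof.
apply: (smooth_ext oU (f := fun x => \sum_j \sum_l invmx (g x) j l * riemann g i j k l x)).
  apply: (smooth_sum oU) => j; apply: (smooth_sum oU) => l; apply: (smooth_mul oU).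
    exact: smooth_ginv.
  exact: smooth_riemann.
by move=> x _; rewrite mxE.
Qed.

Lemma metric_symE x i j : U x -> g x i j = g x j i.
Proof. by move=> Ux; rewrite -{1}(g_sym Ux) mxE. Qed.

Lemma ginv_symE x i j : U x -> invmx (g x) i j = invmx (g x) j i.
Proof. by move=> Ux; rewrite -{1}(g_sym Ux) -trmx_inv mxE. Qed.

Lemma partial_metric_sym x k i j : U x ->
  partial k (fun y => g y i j) x = partial k (fun y => g y j i) x.
Proof. by move=> Ux; apply: (partial_eq_on oU) => // y Uy; exact: metric_symE. Qed.

Lemma christoffel_sym k i j x : U x -> christoffel g k i j x = christoffel g k j i x.
Proof.
move=> Ux; rewrite /christoffel; congr (_ * _); apply: eq_bigr => l _; congr (_ * _).
by rewrite (partial_metric_sym l i j Ux) [X in X - _]addrC.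
Qed.

(** Koszul formula: contraction with the metric undoes the inverse in [christoffel]. *)
Lemma christoffel_lower i k j x : U x ->
  \sum_b christoffel g b k i x * g x b j =
  2^-1 * (partial k (fun y => g y i j) x + partial i (fun y => g y k j) x
          - partial j (fun y => g y k i) x).
Proof.
move=> Ux; pose P l := partial k (fun y => g y i l) x + partial i (fun y => g y k l) x
          - partial l (fun y => g y k i) x.
transitivity (2^-1 * \sum_l (\sum_b g x j b * invmx (g x) b l) * P l).
  rewrite big_distrr /=; under [RHS]eq_bigr do rewrite mulrA big_distrr big_distrl /=.
  rewrite exchange_big; apply: eq_bigr => b _ /=.
  rewrite /christoffel -/P big_distrr big_distrl /=; apply: eq_bigr => l _.
  rewrite -/(P l) (metric_symE b j Ux).
  move: (P l) (invmx _ _ _) (g _ _ _) => *; ring.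
congr (_ * _); rewrite (bigD1 j) //= [X in _ + X]big1 => [|l lj].
  have := congr1 (fun A : 'M[R]_(n.+1) => A j j) (mulmxV (g_unit Ux)).
  by rewrite !mxE eqxx => ->; rewrite mul1r addr0.
have := congr1 (fun A : 'M[R]_(n.+1) => A j l) (mulmxV (g_unit Ux)).
by rewrite !mxE eq_sym (negPf lj) => ->; rewrite mul0r.
Qed.

Lemma metric_compatible k i j x : U x -> partial k (fun y => g y i j) x =
  \sum_b christoffel g b k i x * g x b j + \sum_b christoffel g b k j x * g x i b.
Proof.
move=> Ux; have -> : \sum_b christoffel g b k j x * g x i b = \sum_b christoffel g b k j x * g x b i.
  by apply: eq_bigr => b _; rewrite (metric_symE i b Ux).
rewrite !christoffel_lower // (partial_metric_sym k j i Ux) (partial_metric_sym j k i Ux).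
rewrite (partial_metric_sym i k j Ux) (partial_metric_sym j i k Ux).
rewrite (partial_metric_sym i j k Ux).
move: (partial k _ x) (partial i _ x) (partial j _ x) => *; lra.
Qed.

Definition cov_deriv2 (X : 'I_n.+1 -> 'I_n.+1 -> V -> R) h i j (x : V) : R :=
  partial h (X i j) x - \sum_b christoffel g b h i x * X b j x
  - \sum_b christoffel g b h j x * X i b x.

Definition cov_deriv3 (X : 'I_n.+1 -> 'I_n.+1 -> 'I_n.+1 -> V -> R) k h i j (x : V) : R :=
  partial k (X h i j) x - \sum_b christoffel g b k h x * X b i j x
  - \sum_b christoffel g b k i x * X h b j x - \sum_b christoffel g b k j x * X h i b x.

Lemma smooth_cov_deriv2 X : (forall i j, smooth_on U (X i j)) ->
  forall h i j, smooth_on U (cov_deriv2 X h i j).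
Proof.
move=> sX h i j; have sc := smooth_christoffel.
apply: (smooth_sub oU); first apply: (smooth_sub oU).
- exact: (smooth_partial h (sX i j)).
- by apply: (smooth_sum oU) => b; apply: (smooth_mul oU); [exact: sc|exact: sX].
- by apply: (smooth_sum oU) => b; apply: (smooth_mul oU); [exact: sc|exact: sX].
Qed.

Variable f : V -> R.
Hypothesis sf : smooth_on U f.

Lemma smooth_hessian i j : smooth_on U (fun x => hessian g f x i j).
Proof.
apply: (smooth_ext oU (f := fun x => partial i (partial j f) x - \sum_k christoffel g k i j x * partial k f x)).
  apply: (smooth_sub oU); first exact: (smooth_partial i (smooth_partial j sf)).
  apply: (smooth_sum oU) => b; apply: (smooth_mul oU); first exact: smooth_christoffel.
  exact: smooth_partial.
by move=> x _; rewrite mxE.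
Qed.

Section AtPoint.
Variables (x0 : V) (Ux0 : U x0).
Local Notation K := (sfun oU Ux0).
Local Notation d := (@sder R n U x0 oU Ux0).
Local Notation E := (@embE R n U x0 oU Ux0).

(** The point x0 at which the identities are read also serves as base point of [sfun], so that all
    objects of the chart live in one ring. *)
Let G : 'M[K]_n.+1 := \matrix_(i, j) emb oU Ux0 (sg i j).
Let Gi : 'M[K]_n.+1 := \matrix_(i, j) emb oU Ux0 (smooth_ginv i j).
Let Gam i : 'M[K]_n.+1 := \matrix_(j, k) emb oU Ux0 (smooth_christoffel k i j).
Let th i : K := emb oU Ux0 (smooth_partial i sf).

Let Gam_E i j k x : U x -> sfun_val (Gam i j k) x = christoffel g k i j x.
Proof. by move=> Ux; rewrite mxE E. Qed.

Let G_sym i j : G i j = G j i.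
Proof. by apply: sfun_eq => x Ux; rewrite !mxE !E // metric_symE. Qed.

Let Gi_sym i j : Gi i j = Gi j i.
Proof. by apply: sfun_eq => x Ux; rewrite !mxE !E // ginv_symE. Qed.

Let G_Gi : G *m Gi = 1%:M.
Proof.
apply/matrixP => i j; apply: sfun_eq => x Ux.
have := congr1 (fun A : 'M[R]_(n.+1) => A i j) (mulmxV (g_unit Ux)).
rewrite !mxE sfun_sum => H.
have -> : sfun_val ((i == j)%:R : K) x = (i == j)%:R by case: (i == j).
by rewrite -H; apply: eq_bigr => b _; rewrite !mxE sfunM !E.
Qed.

Let Gam_torsion i j k : Gam i j k = Gam j i k.
Proof. by apply: sfun_eq => x Ux; rewrite !Gam_E // christoffel_sym. Qed.

Let d_E i (F : K) h x : U x -> (forall y, U y -> sfun_val F y = h y) ->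
  sfun_val (d i F) x = partial i h x.
Proof. by move=> Ux H; rewrite sderE //; exact: (partial_eq_on oU). Qed.

Let ga_E k i X h x : U x -> (forall b, sfun_val (X b) x = h b) ->
  sfun_val (ga Gam k i X) x = \sum_b christoffel g b k i x * h b.
Proof.
move=> Ux H; rewrite /ga sfun_sum; apply: eq_bigr => b _.
by rewrite sfunM Gam_E // H.
Qed.

Let con_E X h x : U x -> (forall i j, sfun_val (X i j) x = h i j) ->
  sfun_val (con Gi X) x = \sum_i \sum_j invmx (g x) i j * h i j.
Proof.
move=> Ux H; rewrite /con sfun_sum; apply: eq_bigr => i _.
by rewrite sfun_sum; apply: eq_bigr => j _; rewrite sfunM mxE E // H.
Qed.

Let G_parallel k i j : d k (G i j) = ga Gam k i (G^~ j) + ga Gam k j (G i).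
Proof.
apply: sfun_eq => x Ux; rewrite sfunD.
rewrite (d_E (h := fun y => g y i j) k Ux); last by move=> y Uy; rewrite mxE E.
rewrite (ga_E (h := fun b => g x b j) k i Ux); last by move=> b; rewrite mxE E.
rewrite (ga_E (h := fun b => g x i b) k j Ux); last by move=> b; rewrite mxE E.
exact: metric_compatible.
Qed.

Let th_E i x : U x -> sfun_val (th i) x = partial i f x.
Proof. by move=> Ux; rewrite E. Qed.

Let th_closed i j : d i (th j) = d j (th i).
Proof.
apply: sfun_eq => x Ux; rewrite (d_E i Ux (th_E j)) (d_E j Ux (th_E i)).
exact: (partialC oU).
Qed.

Let curv_E i j k m x : U x -> sfun_val (curv d Gam i j k m) x = riemann_up g i j k m x.
Proof.
move=> Ux; rewrite mxE sfunD sfunD sfunN sfun_sum.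
rewrite (d_E i Ux (fun y => @Gam_E j k m y)) (d_E j Ux (fun y => @Gam_E i k m y)).
rewrite /riemann_up; congr (_ + _); apply: eq_bigr => l _.
by rewrite sfunD sfunN !sfunM !Gam_E.
Qed.

Let Rl_E i j k l x : U x -> sfun_val (Rl d G Gam i j k l) x = riemann g i j k l x.
Proof.
move=> Ux; rewrite /Rl sfun_sum; apply: eq_bigr => m _.
by rewrite sfunM curv_E // mxE E.
Qed.

Let Hs_E i j x : U x -> sfun_val (Hs d Gam th i j) x = hessian g f x i j.
Proof.
move=> Ux; rewrite sfunD sfunN mxE (d_E i Ux (th_E j)).
by rewrite (ga_E i j Ux (fun b => th_E b Ux)).
Qed.

Let T_E i j l x : U x -> sfun_val (T d Gam th i j l) x =
  cov_deriv2 (fun p q y => hessian g f y p q) i j l x.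
Proof.
move=> Ux; rewrite /T /cov2 sfunB sfunB.
rewrite (d_E i Ux (fun y Uy => Hs_E j l Uy)).
rewrite (ga_E i j Ux (fun b => Hs_E b l Ux)).
by rewrite (ga_E i l Ux (fun b => Hs_E j b Ux)).
Qed.

Let N_E k i j l x : U x -> sfun_val (N d Gam th k i j l) x =
  cov_deriv3 (cov_deriv2 (fun p q y => hessian g f y p q)) k i j l x.
Proof.
move=> Ux; rewrite /N /cov3 sfunB sfunB sfunB.
congr (_ - _ - _ - _).
- exact: (d_E k Ux (fun y Uy => T_E i j l Uy)).
- exact: (ga_E k i Ux (fun b => T_E b j l Ux)).
- exact: (ga_E k j Ux (fun b => T_E i b l Ux)).
- exact: (ga_E k l Ux (fun b => T_E i j b Ux)).
Qed.

Lemma riemann_anti12_at i j k l : riemann g i j k l x0 = - riemann g j i k l x0.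
Proof.
by rewrite -!Rl_E // -sfunN; congr (sfun_val _ _); exact: Rl_anti12.
Qed.

Lemma riemann_pair_at i j k l : riemann g i j k l x0 = riemann g k l i j x0.
Proof.
rewrite -!Rl_E //; congr (sfun_val _ _).
exact: (Rl_pair (@sderA _ _ _ _ _ _) (@sderM _ _ _ _ _ _) (@sderC _ _ _ _ _ _)
  (@sfun_two_cancel _ _ _ _ _ _) G_sym Gam_torsion G_parallel).
Qed.

Lemma hessian_laplacian_at : (forall x, U x -> ricci g x + hessian g f x = 0) ->
  forall j l,
  \sum_k \sum_i invmx (g x0) k i *
    cov_deriv3 (cov_deriv2 (fun p q y => hessian g f y p q)) k i j l x0 =
  \sum_m \sum_a invmx (g x0) m a *
     (partial a f x0 * cov_deriv2 (fun p q y => hessian g f y p q) m j l x0)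
  - 2 * \sum_k \sum_i invmx (g x0) k i * \sum_m \sum_a invmx (g x0) m a *
     (hessian g f x0 i a * riemann g k j m l x0).
Proof.
move=> sol j l.
have Rc_Hs i k : Rc d G Gi Gam i k + Hs d Gam th i k = 0.
  apply: sfun_eq => x Ux; rewrite sfunD sfun0 Hs_E //.
  rewrite (con_E Ux (fun p q => Rl_E i p k q Ux)).
  have := congr1 (fun A : 'M[R]_(n.+1) => A i k) (sol x Ux).
  by rewrite !mxE.
have := soliton_laplacian (@sderA _ _ _ _ oU Ux0) (@sderM _ _ _ _ _ _) (@sderC _ _ _ _ _ _)
  (@sfun_two_cancel _ _ _ _ _ _) G_sym Gi_sym G_Gi Gam_torsion G_parallel th_closed Rc_Hs j l.
move/(congr1 (fun h : K => sfun_val h x0)).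
rewrite sfunD sfunN sfunM sfunD sfun1.
rewrite (con_E Ux0 (fun k i => N_E k i j l Ux0)) => ->.
rewrite (con_E (h := fun m a => partial a f x0 *
   cov_deriv2 (fun p q y => hessian g f y p q) m j l x0) Ux0); last first.
  by move=> m a; rewrite sfunM th_E // T_E.
congr (_ - _ * _).
apply: con_E => // k i; apply: con_E => // m a.
by rewrite sfunM Hs_E // Rl_E.
Qed.

End AtPoint.
End TensorFields.

(** * Bilinear forms on row vectors *)

Section BilinearForms.
Context {R : realType} {n : nat}.
Local Notation V := 'rV[R]_n.+1.
Implicit Types (A B : 'M[R]_n.+1) (u v w : V) (a b K : R).

Definition bil A u v : R := (u *m A *m v^T) 0 0.

Lemma bilE A u v : bil A u v = \sum_i \sum_j u 0 i * v 0 j * A i j.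
Proof.
rewrite /bil mxE exchange_big; apply: eq_bigr => j _ /=.
rewrite !mxE big_distrl; apply: eq_bigr => i _ /=; ring.
Qed.

Lemma bilDl A u v w : bil A (u + v) w = bil A u w + bil A v w.
Proof. by rewrite /bil !mulmxDl mxE. Qed.

Lemma bilDr A u v w : bil A w (u + v) = bil A w u + bil A w v.
Proof. by rewrite /bil linearD /= mulmxDr mxE. Qed.

Lemma bilZl A a u v : bil A (a *: u) v = a * bil A u v.
Proof. by rewrite /bil -!scalemxAl mxE. Qed.

Lemma bilZr A a u v : bil A u (a *: v) = a * bil A u v.
Proof. by rewrite /bil linearZ /= -scalemxAr mxE. Qed.

Lemma bilNl A u v : bil A (- u) v = - bil A u v.
Proof. by rewrite -scaleN1r bilZl mulN1r. Qed.

Lemma bilNr A u v : bil A u (- v) = - bil A u v.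
Proof. by rewrite -scaleN1r bilZr mulN1r. Qed.

Lemma bil0l A v : bil A 0 v = 0.
Proof. by rewrite /bil !mul0mx mxE. Qed.

Lemma bil0r A v : bil A v 0 = 0.
Proof. by rewrite /bil trmx0 mulmx0 mxE. Qed.

Lemma bil_mxD A B u v : bil (A + B) u v = bil A u v + bil B u v.
Proof. by rewrite /bil mulmxDr mulmxDl mxE. Qed.

Lemma bil_mxZ a A u v : bil (a *: A) u v = a * bil A u v.
Proof. by rewrite /bil -scalemxAr -scalemxAl mxE. Qed.

Lemma bil_mxB A B u v : bil (A - B) u v = bil A u v - bil B u v.
Proof. by rewrite bil_mxD -scaleN1r bil_mxZ mulN1r. Qed.

Lemma bilC A u v : A^T = A -> bil A u v = bil A v u.
Proof.
move=> sA; rewrite /bil.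
have -> : v *m A *m u^T = (u *m A *m v^T)^T by rewrite !trmx_mul trmxK sA mulmxA.
by rewrite [RHS]mxE.
Qed.

Lemma sum_norm_le m (F : 'I_m -> R) K : (forall i, `|F i| <= K) ->
  `|\sum_i F i| <= m%:R * K.
Proof.
move=> H; apply: le_trans (ler_norm_sum _ _ _) _.
apply: le_trans (ler_sum _ (fun i _ => H i)) _.
by rewrite sumr_const card_ord -[K *+ m]mulr_natl.
Qed.

Lemma bil_norm_le A u v K : (forall i j, `|A i j| <= K) ->
  `|bil A u v| <= n.+1%:R * (n.+1%:R * K) * `|u| * `|v|.
Proof.
move=> H; rewrite bilE -!mulrA; apply: sum_norm_le => i; apply: sum_norm_le => j.
rewrite !normrM [leRHS]mulrC ler_pM ?mulr_ge0 // ?ler_pM ?rv_coord_le //.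
Qed.

(* Square of the Euclidean norm; [`|v|] is the sup norm. *)
Definition dot u v : R := \sum_i u 0 i * v 0 i.

Lemma dot_ge u : `|u| ^+ 2 <= dot u u.
Proof.
have d0 : 0 <= dot u u by apply: sumr_ge0 => i _; rewrite -expr2 sqr_ge0.
rewrite -[dot u u]sqr_sqrtr // lerXn2r ?nnegrE ?sqrtr_ge0 //.
apply: rv_norm_le => [|i]; first exact: sqrtr_ge0.
rewrite -sqrtr_sqr ler_wsqrtr // /dot (bigD1 i) //= expr2 lerDl.
by apply: sumr_ge0 => j _; rewrite -expr2 sqr_ge0.
Qed.

Lemma dot_le u v : `|dot u v| <= n.+1%:R * (`|u| * `|v|).
Proof. by apply: sum_norm_le => i; rewrite normrM ler_pM // rv_coord_le. Qed.

Lemma quadratic_form_ge0 (l be ga x y : R) : 0 < l -> be ^+ 2 <= 4 * l * ga ->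
  0 <= l * y ^+ 2 - be * (x * y) + ga * x ^+ 2.
Proof.
move=> l0 H; rewrite -(pmulr_rge0 _ (mulr_gt0 (ltr0n R 4) l0)).
have -> : 4 * l * (l * y ^+ 2 - be * (x * y) + ga * x ^+ 2) =
  (2 * l * y - be * x) ^+ 2 + (4 * l * ga - be ^+ 2) * x ^+ 2 by ring.
by rewrite addr_ge0 ?sqr_ge0 // mulr_ge0 ?sqr_ge0 // subr_ge0.
Qed.

Lemma bil_CS A u v : A^T = A -> (forall w, 0 <= bil A w w) ->
  bil A u v ^+ 2 <= bil A u u * bil A v v.
Proof.
move=> sA pA; have H t s : 0 <= t ^+ 2 * bil A u u + 2 * t * s * bil A u v + s ^+ 2 * bil A v v.
  have -> : t ^+ 2 * bil A u u + 2 * t * s * bil A u v + s ^+ 2 * bil A v v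
      = bil A (t *: u + s *: v) (t *: u + s *: v).
    by rewrite !(bilDl, bilDr, bilZl, bilZr) (bilC v u sA); ring.
  exact: pA.
have := pA u; rewrite le_eqVlt => /predU1P[u0|u0].
  have p := pA v; case: (eqVneq (bil A u v) 0) => [->|nz]; first by rewrite -u0 expr0n /= mul0r.
  (* When u is null, this choice makes the form equal to - bil A v v - 2, which is negative. *)
  have := H (- (bil A v v + 1) / bil A u v) 1.
  rewrite -u0 mulr0 add0r expr1n mul1r mulr1 mulrA -mulrA mulVf // mulr1 => H4.
  by exfalso; clear -H4 p; lra.
have := H (- bil A u v) (bil A u u).
have -> : (- bil A u v) ^+ 2 * bil A u u + 2 * - bil A u v * bil A u u * bil A u v
   + bil A u u ^+ 2 * bil A v v = bil A u u * (bil A u u * bil A v v - bil A u v ^+ 2) by ring.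
by rewrite pmulr_rge0 // subr_ge0.
Qed.

End BilinearForms.

Lemma is_derive_lin {R : realType} {n m : nat} (F : 'I_m -> 'rV[R]_n.+1 -> R) (c : 'I_m -> R)
    (x v : 'rV[R]_n.+1) (dF : 'I_m -> R) : (forall i, is_derive x v (F i) (dF i)) ->
  is_derive x v (fun y => \sum_i c i * F i y) (\sum_i c i * dF i).
Proof.
move=> H; elim: (index_enum _) => [|i r IH].
  rewrite big_nil (_ : (fun y => _) = fun=> 0); first exact: is_derive_cst.
  by apply/funext => s; rewrite big_nil.
rewrite big_cons (_ : (fun y => _) = (c i *: F i) + (fun y => \sum_(i <- r) c i * F i y)); last first.
  by apply/funext => s; rewrite big_cons.
apply: is_deriveD; exact: is_deriveZ.
Qed.

(** * Uniform Taylor estimates on small balls *)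

Section LocalBounds.
Context {R : realType} {n : nat}.
Local Notation V := 'rV[R]_n.+1.
Variables (U : set V) (oU : open U).
Implicit Types (f : V -> R) (x y h : V).

Lemma uniform_local_bound (I : finType) (F : I -> V -> R) x0 : U x0 ->
  (forall i, smooth_on U (F i)) ->
  exists r K : R, [/\ 0 < r, 0 < K &
    forall y, `|y - x0| < r -> U y /\ forall i, `|F i y| <= K].
Proof.
move=> Ux sF; pose K := \sum_i (`|F i x0| + 1) + 1.
have KF i : `|F i x0| + 1 <= K.
  rewrite /K (bigD1 i) //= -addrA lerDl; apply: addr_ge0 => //; apply: sumr_ge0 => j _.
  exact: addr_ge0.
have N : \forall y \near x0, U y /\ forall i, `|F i y| <= K.
  apply: filterI; first exact: open_near.
  apply: (@filter_forall _ _ (fun i y => `|F i y| <= K) _ (nbhs_filter x0)) => i.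
  have c := smooth_continuous (sF i) Ux.
  apply: filterS ((cvgrPdist_le (F i) _).1 c 1 ltr01) => y yb.
  apply: le_trans (KF i); rewrite -[F i y](subrK (F i x0)) addrC.
  by apply: le_trans (ler_normD _ _) _; rewrite lerD2l distrC.
have [r r0 Hr] := nbhs_norm_ex N.
exists r, K; split=> //; apply: ltr_wpDl => //; apply: sumr_ge0 => i _.
exact: addr_ge0.
Qed.

Lemma itv_trans (z t : R) : 0 <= z <= t -> t <= 1 -> 0 <= z <= 1.
Proof. by move=> /andP[-> z1] t1; exact: le_trans t1. Qed.

Lemma itvoo_trans (z t : R) : 0 < z < t -> t <= 1 -> 0 <= z <= 1.
Proof. by move=> /andP[z0 z1]; apply: itv_trans; rewrite !ltW. Qed.

(** Three successive mean value estimates on [0, 1]. The constant K in place of K / 6 is good enough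
    for the error terms to come. *)
Lemma taylor_1d (p q s w : R -> R) (K : R) :
  (forall t : R, 0 <= t <= 1 -> [/\ is_derive t 1 p (q t), is_derive t 1 q (s t),
     is_derive t 1 s (w t) & `|w t| <= K]) ->
  `|p 1 - p 0 - q 0 - 2^-1 * s 0| <= K.
Proof.
move=> H.
have K0 : 0 <= K by apply: le_trans (normr_ge0 (w 0)) _; have [] := H 0; rewrite ?lexx ?ler01.
have B1 (t : R) : 0 <= t <= 1 -> `|s t - s 0| <= K.
  move=> /andP[t0 t1]; apply: le_trans (_ : K * (t - 0) <= K); last by rewrite subr0 ler_piMr.
  apply: (derive_bounded (df := w)) => // z zt.
    by have [] := H z (itv_trans zt t1).
  by have [] := H z (itvoo_trans zt t1).
have B2 (t : R) : 0 <= t <= 1 -> `|q t - q 0 - t * s 0| <= K.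
  move=> /andP[t0 t1]; apply: le_trans (_ : K * (t - 0) <= K); last by rewrite subr0 ler_piMr.
  have -> : q t - q 0 - t * s 0 = (q t - t * s 0) - (q 0 - 0 * s 0) by ring.
  apply: (derive_bounded (f := fun t => q t - t * s 0) (df := fun t => s t - s 0)) => // z zt.
    apply: dB; first by have [] := H z (itv_trans zt t1).
    by apply: dEq (dM (dI z) (dC _ z)) _; rewrite mulr0 addr0 mul1r.
  exact: (B1 _ (itvoo_trans zt t1)).
have -> : p 1 - p 0 - q 0 - 2^-1 * s 0 =
   (p 1 - 1 * q 0 - 2^-1 * 1 ^+ 2 * s 0) - (p 0 - 0 * q 0 - 2^-1 * 0 ^+ 2 * s 0) by ring.
apply: le_trans (_ : K * (1 - 0) <= K); last by rewrite subr0 mulr1.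
apply: (derive_bounded (f := fun t => p t - t * q 0 - 2^-1 * t ^+ 2 * s 0) (df := fun t => q t - q 0 - t * s 0)) => // z z01.
  have [//|pz _ _ _] := H z.
  apply: dB; first apply: dB => //.
    by apply: dEq (dM (dI z) (dC _ z)) _; rewrite mulr0 addr0 mul1r.
  by apply: dEq (dM (dZ 2^-1 (dX2 (dI z))) (dC (s 0) z)) _; field.
exact: (B2 _ (itvoo_trans z01 (lexx 1))).
Qed.

Definition grad_along f y h : R := \sum_i h 0 i * partial i f y.

Lemma smooth_grad_along f h : smooth_on U f -> smooth_on U (fun y => grad_along f y h).
Proof.
move=> sf; apply: (smooth_sum oU) => i; apply: (smooth_mul oU); first exact: smooth_cst.
exact: smooth_partial.
Qed.

Lemma is_derive_segment f y h (t : R) : smooth_on U f -> U (y + t *: h) ->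
  is_derive t 1 (fun s : R => f (y + s *: h)) (grad_along f (y + t *: h) h).
Proof.
move=> sf Ut; apply: (smooth_curve (c := fun s : R => y + s *: h) oU sf Ut).
apply/is_derive_rv => i.
rewrite (_ : (fun s : R => (y + s *: h) 0 i) = fun s => y 0 i + s * h 0 i); last first.
  by apply/funext => s; rewrite !mxE.
by apply: dEq (dD (dC _ t) (dM (dI t) (dC _ t))) _; ring.
Qed.

Lemma segment_in_ball x0 y h (r t : R) : `|y - x0| < r -> `|y + h - x0| < r ->
  0 <= t <= 1 -> `|y + t *: h - x0| < r.
Proof.
move=> y0 y1 /andP[t0 t1].
have -> : y + t *: h - x0 = (1 - t) *: (y - x0) + t *: (y + h - x0).
  by apply/rowP => i; rewrite !mxE; ring.
apply: le_lt_trans (ler_normD _ _) _; rewrite !normrZ (ger0_norm t0) ger0_norm ?subr_ge0 //.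
have -> : r = (1 - t) * r + t * r by ring.
move: t0; rewrite le_eqVlt => /predU1P[<-|t0].
  by rewrite !mul0r subr0 !mul1r !addr0.
by rewrite ler_ltD // ?ltr_pM2l // ler_wpM2l ?subr_ge0 // ltW.
Qed.

Lemma grad_along_le f y h K : (forall i, `|partial i f y| <= K) ->
  `|grad_along f y h| <= n.+1%:R * K * `|h|.
Proof.
move=> H; rewrite -mulrA; apply: sum_norm_le => i.
by rewrite normrM mulrC ler_pM // rv_coord_le.
Qed.

Lemma local_taylor f x0 (r K : R) : smooth_on U f ->
  (forall y, `|y - x0| < r -> U y /\
     [/\ forall i, `|partial i f y| <= K,
         forall i j, `|partial i (partial j f) y| <= K &
         forall i j k, `|partial i (partial j (partial k f)) y| <= K]) ->
  forall y h, `|y - x0| < r -> `|y + h - x0| < r ->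
  [/\ `|f (y + h) - f y| <= n.+1%:R * K * `|h|,
      `|f (y + h) - f y - grad_along f y h| <= n.+1%:R ^+ 2 * K * `|h| ^+ 2 &
      `|f (y + h) - f y - grad_along f y h - 2^-1 * grad_along (fun z => grad_along f z h) y h|
        <= n.+1%:R ^+ 3 * K * `|h| ^+ 3].
Proof.
move=> sf H y h y0 y1.
pose N : R := n.+1%:R; have N0 : 0 <= N by [].
have seg (t : R) : 0 <= t <= 1 -> `|y + t *: h - x0| < r by move=> t01; exact: segment_in_ball.
have US (t : R) : 0 <= t <= 1 -> U (y + t *: h) by move=> /seg/H[].
have s1 := smooth_grad_along h sf; have s2 := smooth_grad_along h s1.
have pE z i : U z -> partial i (fun z => grad_along f z h) z = \sum_k h 0 k * partial i (partial k f) z.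
  move=> Uz; have [_ E] := @is_derive_lin _ _ _ (fun k => partial k f) (h 0) z (delta_mx 0 i) _
    (fun k => partialP (smooth_derivable (i := i) (smooth_partial k sf) Uz)).
  exact: E.
have pE2 z i : U z -> partial i (fun z => grad_along (fun z => grad_along f z h) z h) z =
    \sum_k h 0 k * \sum_l h 0 l * partial i (partial k (partial l f)) z.
  move=> Uz; have [_ E] := @is_derive_lin _ _ _ (fun k => partial k (fun z => grad_along f z h)) (h 0) z (delta_mx 0 i) _
    (fun k => partialP (smooth_derivable (i := i) (smooth_partial k s1) Uz)).
  apply: etrans E _; apply: eq_bigr => k _; congr (_ * _).
  rewrite (partial_eq_on oU (fun y Uy => pE y k Uy) i Uz).
  have [_ E] := @is_derive_lin _ _ _ (fun l => partial k (partial l f)) (h 0) z (delta_mx 0 i) _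
    (fun l => partialP (smooth_derivable (i := i) (smooth_partial k (smooth_partial l sf)) Uz)).
  exact: E.
have hK a c : `|a| <= c -> forall l, `|h 0 l * a| <= c * `|h|.
  by move=> ac l; rewrite normrM mulrC ler_pM // rv_coord_le.
have B1 (t : R) : 0 <= t <= 1 -> `|grad_along f (y + t *: h) h| <= N * K * `|h|.
  by move=> /seg/H[_ [H1 _ _]]; exact: grad_along_le.
have B2 (t : R) : 0 <= t <= 1 -> `|grad_along (fun z => grad_along f z h) (y + t *: h) h| <= N ^+ 2 * K * `|h| ^+ 2.
  move=> t01; have [Ut [_ H2 _]] := H _ (seg t t01).
  have -> : N ^+ 2 * K * `|h| ^+ 2 = N * (N * (K * `|h|)) * `|h| by rewrite !expr2; ring.
  apply: grad_along_le => i; rewrite (pE _ i Ut); apply: sum_norm_le => k.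
  by apply: (hK); exact: H2.
have B3 (t : R) : 0 <= t <= 1 -> `|grad_along (fun z => grad_along (fun z => grad_along f z h) z h) (y + t *: h) h|
    <= N ^+ 3 * K * `|h| ^+ 3.
  move=> t01; have [Ut [_ _ H3]] := H _ (seg t t01).
  have -> : N ^+ 3 * K * `|h| ^+ 3 = N * (N * (N * (K * `|h|) * `|h|)) * `|h| by rewrite !exprS !expr0; ring.
  apply: grad_along_le => i; rewrite (pE2 _ i Ut); apply: sum_norm_le => k.
  apply: (hK); apply: sum_norm_le => l.
  by apply: (hK); exact: H3.
have D1 (t : R) : 0 <= t <= 1 -> is_derive t 1 (fun s : R => f (y + s *: h)) (grad_along f (y + t *: h) h).
  by move=> t01; exact: (is_derive_segment sf (US t t01)).
have D2 (t : R) : 0 <= t <= 1 -> is_derive t 1 (fun s : R => grad_along f (y + s *: h) h)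
    (grad_along (fun z => grad_along f z h) (y + t *: h) h).
  by move=> t01; exact: (is_derive_segment s1 (US t t01)).
have D3 (t : R) : 0 <= t <= 1 -> is_derive t 1 (fun s : R => grad_along (fun z => grad_along f z h) (y + s *: h) h)
    (grad_along (fun z => grad_along (fun z => grad_along f z h) z h) (y + t *: h) h).
  by move=> t01; exact: (is_derive_segment s2 (US t t01)).
have i0 : 0 <= (0 : R) <= 1 by rewrite lexx ler01.
have e0 : y + (0 : R) *: h = y by rewrite scale0r addr0.
have e1 : y + (1 : R) *: h = y + h by rewrite scale1r.
split.
- have := derive_bounded (f := fun s : R => f (y + s *: h)) (K := N * K * `|h|) ler01 D1 _.
  rewrite e0 e1 subr0 mulr1; apply => t t01.
  exact: (B1 _ (itvoo_trans t01 (lexx 1))).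
- have := derive_bounded (f := fun s : R => f (y + s *: h) - s * grad_along f y h)
    (df := fun s => grad_along f (y + s *: h) h - grad_along f y h) (K := N ^+ 2 * K * `|h| ^+ 2) ler01 _ _.
  have -> : (f (y + (1 : R) *: h) - 1 * grad_along f y h) - (f (y + (0 : R) *: h) - 0 * grad_along f y h) =
     f (y + h) - f y - grad_along f y h.
    by rewrite e0 e1 mul0r mul1r subr0 addrAC.
  rewrite subr0 mulr1; apply => t t01.
    apply: dB; first exact: D1.
    by apply: dEq (dM (dI t) (dC _ t)) _; rewrite mulr0 addr0 mul1r.
  case/andP: t01 => t0 t1; have h0 := le_trans (normr_ge0 _) (B2 0 i0).
  have := derive_bounded (f := fun s : R => grad_along f (y + s *: h) h)
     (df := fun t => grad_along (fun z => grad_along f z h) (y + t *: h) h) (K := N ^+ 2 * K * `|h| ^+ 2) (ltW t0) _ _.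
  rewrite e0 subr0 => H'; apply: le_trans (H' _ _) _ => [z zt|z zt|].
  + exact: (D2 _ (itv_trans zt (ltW t1))).
  + exact: (B2 _ (itvoo_trans zt (ltW t1))).
  + by rewrite ler_piMr // ltW.
- have := @taylor_1d (fun s : R => f (y + s *: h)) (fun s => grad_along f (y + s *: h) h)
    (fun t => grad_along (fun z => grad_along f z h) (y + t *: h) h)
    (fun t => grad_along (fun z => grad_along (fun z => grad_along f z h) z h) (y + t *: h) h) (N ^+ 3 * K * `|h| ^+ 3) _.
  rewrite e0 e1; apply => t t01.
  by split; [exact: D1|exact: D2|exact: D3|exact: B3].
Qed.

End LocalBounds.

(** * Geodesics in a chart *)

Record chart_metric {R : realType} {n : nat} (U : set 'rV[R]_n.+1) (g : 'rV[R]_n.+1 -> 'M[R]_n.+1) : Prop :=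
  ChartMetric {
    cm_open : open U;
    cm_smooth : forall i j, smooth_on U (fun x => g x i j);
    cm_sym : forall x, U x -> (g x)^T = g x;
    cm_pos : forall x, U x -> forall v : 'rV[R]_n.+1, v != 0 -> 0 < bil (g x) v v }.

Section ChartGeometry.
Context {R : realType} {n : nat}.
Local Notation V := 'rV[R]_n.+1.
Variables (U : set V) (g : V -> 'M[R]_n.+1).
Hypothesis cm : chart_metric U g.
Implicit Types (x y z u v w p : V).

Lemma posdef_unit (A : 'M[R]_n.+1) : (forall v : V, v != 0 -> 0 < bil A v v) -> A \in unitmx.
Proof.
move=> H; rewrite -row_free_unit -kermx_eq0; apply/rowV0P => v /sub_kermxP vA.
apply/eqP; apply: contraT => /H; by rewrite /bil vA mul0mx mxE ltxx.
Qed.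

Lemma chart_unit x : U x -> g x \in unitmx.
Proof. by move=> Ux; apply: posdef_unit; exact: (cm_pos cm). Qed.

Lemma chart_bilC x u v : U x -> bil (g x) u v = bil (g x) v u.
Proof. by move=> Ux; apply: bilC; exact: (cm_sym cm). Qed.

Lemma chart_bil_ge0 x v : U x -> 0 <= bil (g x) v v.
Proof.
move=> Ux; case: (eqVneq v 0) => [->|v0]; first by rewrite bil0l.
by apply: ltW; exact: (cm_pos cm).
Qed.

Definition Gamv x u v : V := \row_k \sum_i \sum_j christoffel g k i j x * u 0 i * v 0 j.

Lemma GamvDl x u v w : Gamv x (u + v) w = Gamv x u w + Gamv x v w.
Proof.
apply/rowP => k; rewrite !mxE -big_split; apply: eq_bigr => i _ /=.
rewrite -big_split; apply: eq_bigr => j _ /=; rewrite mxE.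
by move: (christoffel _ _ _ _ _) => ?; ring.
Qed.

Lemma GamvDr x u v w : Gamv x w (u + v) = Gamv x w u + Gamv x w v.
Proof.
apply/rowP => k; rewrite !mxE -big_split; apply: eq_bigr => i _ /=.
rewrite -big_split; apply: eq_bigr => j _ /=; rewrite mxE.
by move: (christoffel _ _ _ _ _) => ?; ring.
Qed.

Lemma GamvZl x (a : R) u v : Gamv x (a *: u) v = a *: Gamv x u v.
Proof.
apply/rowP => k; rewrite !mxE big_distrr; apply: eq_bigr => i _ /=.
rewrite big_distrr; apply: eq_bigr => j _ /=; rewrite mxE.
by move: (christoffel _ _ _ _ _) => ?; ring.
Qed.

Lemma GamvZr x (a : R) u v : Gamv x u (a *: v) = a *: Gamv x u v.
Proof.
apply/rowP => k; rewrite !mxE big_distrr; apply: eq_bigr => i _ /=.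
rewrite big_distrr; apply: eq_bigr => j _ /=; rewrite mxE.
by move: (christoffel _ _ _ _ _) => ?; ring.
Qed.

Lemma GamvC x u v : U x -> Gamv x u v = Gamv x v u.
Proof.
move=> Ux; apply/rowP => k; rewrite !mxE exchange_big; apply: eq_bigr => j _ /=.
apply: eq_bigr => i _; rewrite (christoffel_sym (cm_open cm) (cm_sym cm) k i j Ux).
by move: (christoffel _ _ _ _ _) => ?; ring.
Qed.

Definition Dg x w : 'M[R]_n.+1 := \matrix_(i, j) grad_along (fun y => g y i j) x w.
Definition D2g x w : 'M[R]_n.+1 :=
  \matrix_(i, j) grad_along (fun z => grad_along (fun y => g y i j) z w) x w.

Lemma Dg_compat x w u v : U x ->
  bil (Dg x w) u v = bil (g x) (Gamv x w u) v + bil (g x) u (Gamv x w v).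
Proof.
move=> Ux; rewrite !bilE.
pose S1 := \sum_i \sum_j u 0 i * v 0 j * \sum_k w 0 k * \sum_b christoffel g b k i x * g x b j.
pose S2 := \sum_i \sum_j u 0 i * v 0 j * \sum_k w 0 k * \sum_b christoffel g b k j x * g x i b.
transitivity (S1 + S2).
  rewrite /S1 /S2 -big_split; apply: eq_bigr => i _ /=; rewrite -big_split; apply: eq_bigr => j _ /=.
  rewrite -mulrDr mxE /grad_along -big_split; congr (_ * _); apply: eq_bigr => k _ /=.
  by rewrite (metric_compatible (cm_open cm) (cm_sym cm) chart_unit k i j Ux) mulrDr.
congr (_ + _); rewrite /S1 /S2.
  under [RHS]eq_bigr do under eq_bigr do rewrite mxE !big_distrl /=.
  under [RHS]eq_bigr do rewrite exchange_big /=.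
  rewrite exchange_big [RHS]exchange_big /=.
  transitivity (\sum_j \sum_i \sum_k \sum_b u 0 i * v 0 j * (w 0 k * (christoffel g b k i x * g x b j))).
    apply: eq_bigr => j _; apply: eq_bigr => i _; rewrite big_distrr; apply: eq_bigr => k _ /=.
    by rewrite !big_distrr.
  transitivity (\sum_k \sum_j \sum_b \sum_i u 0 i * v 0 j * (w 0 k * (christoffel g b k i x * g x b j))).
    rewrite [RHS]exchange_big; apply: eq_bigr => j _ /=.
    rewrite exchange_big; apply: eq_bigr => k _ /=.
    by rewrite exchange_big.
  apply: eq_bigr => k _ /=; rewrite exchange_big; apply: eq_bigr => b _ /=.
  apply: eq_bigr => j _; rewrite !big_distrl; apply: eq_bigr => i _ /=.
  by move: (christoffel _ _ _ _ _) (g _ _ _) => ? ?; ring.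
apply: eq_bigr => i _.
under [RHS]eq_bigr do rewrite mxE mulrAC big_distrr /=.
rewrite [RHS]exchange_big /=.
transitivity (\sum_k \sum_j \sum_b u 0 i * v 0 j * (w 0 k * (christoffel g b k j x * g x i b))).
  rewrite exchange_big; apply: eq_bigr => j _ /=.
  by rewrite big_distrr; apply: eq_bigr => k _ /=; rewrite !big_distrr.
apply: eq_bigr => k _; rewrite exchange_big; apply: eq_bigr => b _ /=.
rewrite big_distrr; apply: eq_bigr => j _ /=.
by move: (christoffel _ _ _ _ _) (g _ _ _) => ? ?; ring.
Qed.

Lemma is_derive_bil (c u v : R -> V) (t : R) (dc du dv : V) : U (c t) ->
  is_derive t 1 c dc -> is_derive t 1 u du -> is_derive t 1 v dv ->
  is_derive t 1 (fun s => bil (g (c s)) (u s) (v s))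
    (bil (Dg (c t) dc) (u t) (v t) + bil (g (c t)) du (v t) + bil (g (c t)) (u t) dv).
Proof.
move=> Uc Hc /is_derive_rv Hu /is_derive_rv Hv.
rewrite (_ : (fun s => _) = fun s => \sum_i \sum_j u s 0 i * v s 0 j * g (c s) i j); last first.
  by apply/funext => s; rewrite bilE.
rewrite !bilE -!big_split /=.
apply: dSum => i; rewrite -!big_split /=; apply: dSum => j.
apply: dEq (dM (dM (Hu i) (Hv j)) (smooth_curve (cm_open cm) ((cm_smooth cm) i j) Uc Hc)) _.
by rewrite !mxE /grad_along; ring.
Qed.

(** One constant K serves all later estimates in the chart: size and Taylor bounds up to third order
    for the metric, size and Lipschitz bounds for the Christoffel symbols. Vectors are measured in
    the sup norm, and [lam] compares it with the metric. *)
Record good_ball (x0 : V) (r lam K : R) : Prop := GoodBall {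
  gb_r : 0 < r; gb_lam : 0 < lam; gb_K : 0 < K;
  gb_U : forall y, `|y - x0| < r -> U y;
  gb_low : forall y v, `|y - x0| < r -> lam * `|v| ^+ 2 <= bil (g y) v v;
  gb_up : forall y u v, `|y - x0| < r -> `|bil (g y) u v| <= K * `|u| * `|v|;
  gb_Dg : forall y w u v, `|y - x0| < r -> `|bil (Dg y w) u v| <= K * `|w| * `|u| * `|v|;
  gb_Gam : forall y u v, `|y - x0| < r -> `|Gamv y u v| <= K * `|u| * `|v|;
  gb_GamL : forall y z u v, `|y - x0| < r -> `|z - x0| < r ->
    `|Gamv z u v - Gamv y u v| <= K * `|z - y| * `|u| * `|v|;
  gb_gL : forall y z u v, `|y - x0| < r -> `|z - x0| < r ->
    `|bil (g z) u v - bil (g y) u v| <= K * `|z - y| * `|u| * `|v|;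
  gb_g2 : forall y z u v, `|y - x0| < r -> `|z - x0| < r ->
    `|bil (g z) u v - bil (g y) u v - bil (Dg y (z - y)) u v| <= K * `|z - y| ^+ 2 * `|u| * `|v|;
  gb_g3 : forall y z u v, `|y - x0| < r -> `|z - x0| < r ->
    `|bil (g z) u v - bil (g y) u v - bil (Dg y (z - y)) u v - 2^-1 * bil (D2g y (z - y)) u v|
      <= K * `|z - y| ^+ 3 * `|u| * `|v| }.

Lemma family_taylor (J : finType) (F : J -> V -> R) x0 : U x0 -> (forall j, smooth_on U (F j)) ->
  exists r K : R, [/\ 0 < r, 0 < K &
    forall y, `|y - x0| < r -> [/\ U y, forall j, `|F j y| <= K,
      forall j i, `|partial i (F j) y| <= K &
      forall h, `|y + h - x0| < r -> forall j,
      [/\ `|F j (y + h) - F j y| <= K * `|h|,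
      `|F j (y + h) - F j y - grad_along (F j) y h| <= K * `|h| ^+ 2 &
      `|F j (y + h) - F j y - grad_along (F j) y h - 2^-1 * grad_along (fun z => grad_along (F j) z h) y h|
        <= K * `|h| ^+ 3]]].
Proof.
move=> Ux sF.
have [r0 [K0 [r00 K00 H0]]] := uniform_local_bound (cm_open cm) Ux sF.
have [r1 [K1 [r10 K10 H1]]] := @uniform_local_bound _ _ _ (cm_open cm) _ (fun q : J * 'I_n.+1 => partial q.2 (F q.1))
  x0 Ux (fun q => smooth_partial q.2 (sF q.1)).
have [r2 [K2 [r20 K20 H2]]] := @uniform_local_bound _ _ _ (cm_open cm) _
  (fun q : J * 'I_n.+1 * 'I_n.+1 => partial q.2 (partial q.1.2 (F q.1.1)))
  x0 Ux (fun q => smooth_partial q.2 (smooth_partial q.1.2 (sF q.1.1))).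
have [r3 [K3 [r30 K30 H3]]] := @uniform_local_bound _ _ _ (cm_open cm) _
  (fun q : J * 'I_n.+1 * 'I_n.+1 * 'I_n.+1 => partial q.2 (partial q.1.2 (partial q.1.1.2 (F q.1.1.1))))
  x0 Ux (fun q => smooth_partial q.2 (smooth_partial q.1.2 (smooth_partial q.1.1.2 (sF q.1.1.1)))).
pose r := Num.min (Num.min r0 r1) (Num.min r2 r3).
pose K := K0 + K1 + K2 + K3.
have rr y : `|y - x0| < r -> [/\ `|y - x0| < r0, `|y - x0| < r1, `|y - x0| < r2 & `|y - x0| < r3].
  by rewrite /r !lt_min => /andP[/andP[-> ->] /andP[-> ->]].
have Kp : 0 < K by rewrite /K; lra.
have N1 : 1 <= n.+1%:R :> R by rewrite ler1n.
have N0 : 0 <= n.+1%:R :> R by [].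
have N2 : 1 <= n.+1%:R ^+ 2 :> R by rewrite exprn_ege1.
have N3 : 1 <= n.+1%:R ^+ 3 :> R by rewrite exprn_ege1.
have M1 : n.+1%:R <= n.+1%:R ^+ 3 :> R by rewrite exprS ler_peMr.
have M2 : n.+1%:R ^+ 2 <= n.+1%:R ^+ 3 :> R by rewrite exprS ler_peMl // sqr_ge0.
have ball y : `|y - x0| < r -> U y /\ forall j, [/\ forall i, `|partial i (F j) y| <= K,
         forall i k, `|partial i (partial k (F j)) y| <= K &
         forall i k l, `|partial i (partial k (partial l (F j))) y| <= K].
  move=> /rr[/H0[Uy _] /H1[_ B1] /H2[_ B2] /H3[_ B3]]; split=> // j; split.
  - by move=> i; apply: le_trans (B1 (j, i)) _; rewrite /K; lra.
  - by move=> i k; apply: le_trans (B2 (j, k, i)) _; rewrite /K; lra.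
  - by move=> i k l; apply: le_trans (B3 (j, l, k, i)) _; rewrite /K; lra.
exists r, (n.+1%:R ^+ 3 * K); split.
- by rewrite /r !lt_min r00 r10 r20 r30.
- by rewrite mulr_gt0 // exprn_gt0.
move=> y yr; have [Uy By] := ball y yr; split=> //.
- move=> j; have [/H0[_ B0] _ _ _] := rr y yr; apply: le_trans (B0 j) _.
  apply: le_trans (_ : K <= _); first by rewrite /K; lra.
  by rewrite ler_peMl // ltW.
- move=> j i; have [B1 _ _] := By j; apply: le_trans (B1 i) _.
  by rewrite ler_peMl // ltW.
- move=> h hr j; have [] := local_taylor (f := F j) (x0 := x0) (r := r) (K := K) (cm_open cm) (sF j) _ yr hr.
    by move=> z /ball[Uz Bz].
  move=> T1 T2 T3; split=> //.
  + apply: le_trans T1 _; rewrite ler_wpM2r // ler_wpM2r // ltW //.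
  + apply: le_trans T2 _; rewrite ler_wpM2r ?sqr_ge0 // ler_wpM2r // ltW //.
Qed.

(** Compactness of the unit sphere, then homogeneity. *)
Lemma sphere_min (A : 'M[R]_n.+1) : (forall v : V, v != 0 -> 0 < bil A v v) ->
  exists2 m : R, 0 < m & forall v, m * `|v| ^+ 2 <= bil A v v.
Proof.
move=> Apos; pose S : set V := [set v | `|v| = 1].
have cS : compact S.
  apply: bounded_closed_compact.
    by exists 1; split=> // M M1 v /= ->; exact: ltW.
  apply: (@preimage_closed _ _ (fun v : V => `|v|) [set (1 : R)]); last exact: closed_eq.
  by move=> v _; exact: norm_continuous.
have S0 : S !=set0.
  exists (delta_mx 0 0); apply/eqP; rewrite eq_le; apply/andP; split.
    by apply: rv_norm_le => // i; rewrite mxE eqxx /=; case: eqP => _; rewrite ?normr1 ?normr0.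
  by have := rv_coord_le (delta_mx 0 0 : V) 0; rewrite mxE !eqxx /= normr1.
have cf : {within S, continuous (fun v : V => bil A v v)}.
  apply: continuous_subspaceT => v.
  rewrite (_ : (fun v => _) = fun v : V => \sum_i \sum_j v 0 i * v 0 j * A i j); last first.
    by apply/funext => w; rewrite bilE.
  rewrite /continuous_at; apply: (@cvg_sumR R V (nbhs v) (nbhs_filter v)) => i.
  apply: (@cvg_sumR R V (nbhs v) (nbhs_filter v)) => j.
  apply: cvgM; last exact: cvg_cst.
  by apply: cvgM; exact: coord_continuous.
have [m Sm Hm] := EVT_min_rV S0 cS cf.
have m1 : `|m| = 1 by rewrite inE in Sm.
have m0 : m != 0 by rewrite -normr_eq0 m1 oner_eq0.
exists (bil A m m); first exact: Apos.
move=> v; case: (eqVneq v 0) => [->|v0]; first by rewrite normr0 expr0n mulr0 bil0l.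
have nv : 0 < `|v| by rewrite normr_gt0.
have := Hm (`|v|^-1 *: v); rewrite inE /S /= => /(_ _) H.
have {H} : bil A m m <= bil A (`|v|^-1 *: v) (`|v|^-1 *: v).
  by apply: H; rewrite normrZ normfV normr_id mulVf // gt_eqF.
rewrite bilZl bilZr mulrA -expr2 exprVn ler_pdivlMl ?exprn_gt0 // mulrC.
exact.
Qed.

Lemma good_ball_exists x0 : U x0 -> exists r lam K, good_ball x0 r lam K.
Proof.
move=> Ux; pose N : R := n.+1%:R; have N0 : 0 < N by [].
have N1 : 1 <= N by rewrite /N ler1n.
have [r1 [K1 [r10 K10 H1]]] := family_taylor (F := fun q : 'I_n.+1 * 'I_n.+1 => fun x => g x q.1 q.2)
   Ux (fun q => (cm_smooth cm) q.1 q.2).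
have [r2 [K2 [r20 K20 H2]]] := family_taylor
   (F := fun q : 'I_n.+1 * 'I_n.+1 * 'I_n.+1 => christoffel g q.1.1 q.1.2 q.2)
   Ux (fun q => smooth_christoffel (cm_open cm) (cm_smooth cm) chart_unit q.1.1 q.1.2 q.2).
have [m m0 Hm] := sphere_min (@cm_pos _ _ _ _ cm _ Ux).
pose K := N * (N * (N * (K1 + K2))).
have NK : K1 + K2 <= N * (K1 + K2) by rewrite ler_peMl //; lra.
have K12 : 0 <= K1 + K2 by lra.
have N2K : N * (N * (K1 + K2)) <= K by rewrite /K ler_peMl // !mulr_ge0 // ltW.
have Kp : 0 < K by rewrite /K !mulr_gt0 //; lra.
(* The third radius keeps the variation of the metric below half of its lower bound m at x0, whence
   the value m / 2 for [lam]. *)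
pose r := Num.min (Num.min r1 r2) (m / (2 * K)).
have r0 : 0 < r by rewrite /r !lt_min r10 r20 divr_gt0 // mulr_gt0.
have rr y : `|y - x0| < r -> [/\ `|y - x0| < r1, `|y - x0| < r2 & `|y - x0| < m / (2 * K)].
  by rewrite /r !lt_min => /andP[/andP[-> ->] ->].
have zE y z : y + (z - y) = z by rewrite addrC subrK.
have bound a b c : 0 <= b -> a <= N * (N * K1 * b) * c -> 0 <= c -> a <= K * b * c.
  move=> b0 H c0; apply: le_trans H _; rewrite ler_wpM2r //.
  have -> : N * (N * K1 * b) = N * (N * K1) * b by ring.
  rewrite ler_wpM2r //; apply: le_trans N2K; rewrite !ler_wpM2l // ?ltW //; lra.
have mxb (A : 'M[R]_n.+1) u v b : 0 <= b -> (forall i j, `|A i j| <= K1 * b) ->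
   `|bil A u v| <= K * b * `|u| * `|v|.
  move=> b0 H; apply: le_trans (bil_norm_le u v H) _.
  rewrite ler_wpM2r // ler_wpM2r // !mulrA ler_wpM2r // -mulrA.
  by apply: le_trans N2K; rewrite !ler_wpM2l // ?ltW //; lra.
have gL y z u v : `|y - x0| < r -> `|z - x0| < r ->
    `|bil (g z) u v - bil (g y) u v| <= K * `|z - y| * `|u| * `|v|.
  move=> /rr[y1 _ _] /rr[z1 _ _]; rewrite -bil_mxB; apply: mxb => // i j.
  have [_ _ _ H] := H1 y y1; have := H (z - y); rewrite zE => /(_ z1 (i, j)) [+ _ _].
  by rewrite !mxE.
have GamB y u v : `|y - x0| < r -> `|Gamv y u v| <= K * `|u| * `|v|.
  move=> /rr[_ y2 _]; have [_ H _ _] := H2 y y2.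
  apply: rv_norm_le => [|k]; first by rewrite !mulr_ge0 // ltW.
  rewrite mxE; apply: le_trans (_ : N * (N * (K2 * `|u| * `|v|)) <= _).
    apply: sum_norm_le => i; apply: sum_norm_le => j.
    rewrite 2!normrM; apply: ler_pM; rewrite ?mulr_ge0 ?rv_coord_le //.
    by apply: ler_pM; rewrite ?rv_coord_le //; exact: (H (k, i, j)).
  rewrite !mulrA ler_wpM2r // ler_wpM2r // -mulrA.
  by apply: le_trans N2K; rewrite !ler_wpM2l // ?ltW //; lra.
have GamL y z u v : `|y - x0| < r -> `|z - x0| < r ->
    `|Gamv z u v - Gamv y u v| <= K * `|z - y| * `|u| * `|v|.
  move=> /rr[_ y2 _] /rr[_ z2 _]; have [_ _ _ H] := H2 y y2.
  have := H (z - y); rewrite zE => {}H.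
  apply: rv_norm_le => [|k]; first by rewrite !mulr_ge0 // ltW.
  rewrite !mxE -sumrB; apply: le_trans (_ : N * (N * (K2 * `|z - y| * `|u| * `|v|)) <= _).
    apply: sum_norm_le => i; rewrite -sumrB; apply: sum_norm_le => j.
    have [+ _ _] := H z2 (k, i, j); rewrite /=.
    move: (christoffel g k i j z) (christoffel g k i j y) => a b ab.
    rewrite -!mulrBl !normrM; apply: ler_pM; rewrite ?mulr_ge0 ?rv_coord_le //.
    by apply: ler_pM; rewrite ?rv_coord_le.
  rewrite !mulrA ler_wpM2r // ler_wpM2r // ler_wpM2r // -mulrA.
  by apply: le_trans N2K; rewrite !ler_wpM2l // ?ltW //; lra.
exists r, (m / 2), K; split => //.
- by rewrite divr_gt0.
- by move=> y /rr[y1 _ _]; have [] := H1 y y1.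
- move=> y v yr; have x0r : `|x0 - x0| < r by rewrite subrr normr0.
  have := gL _ _ v v x0r yr; have [_ _ y3] := rr y yr; have := Hm v.
  move: (bil _ _ _) (bil _ _ _) => a b H3 H4.
  have : K * `|y - x0| * `|v| * `|v| <= m / 2 * `|v| ^+ 2.
    rewrite expr2 !mulrA ler_wpM2r // ler_wpM2r // mulrC -ler_pdivlMr //.
    by apply: ltW; apply: lt_le_trans y3 _; rewrite invfM mulrA.
  by move=> H5; have := le_trans H4 H5; rewrite ler_norml => /andP[? _]; lra.
- move=> y u v /rr[y1 _ _]; rewrite -[K]mulr1; apply: mxb => // i j.
  by have [_ H _ _] := H1 y y1; rewrite mulr1; exact: (H (i, j)).
- move=> y w u v /rr[y1 _ _]; have [_ _ H _] := H1 y y1.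
  have B i j : `|Dg y w i j| <= N * K1 * `|w|.
    by rewrite mxE; apply: grad_along_le => k; exact: (H (i, j)).
  apply: le_trans (bil_norm_le u v B) _; rewrite ler_wpM2r // ler_wpM2r //.
  rewrite !mulrA ler_wpM2r // /K -!mulrA !ler_wpM2l // ?ltW //; lra.
- move=> y z u v /rr[y1 _ _] /rr[z1 _ _]; rewrite -!bil_mxB; apply: mxb => // i j.
  have [_ _ _ H] := H1 y y1; have := H (z - y); rewrite zE => /(_ z1 (i, j)) [_ + _].
  by rewrite !mxE.
- move=> y z u v /rr[y1 _ _] /rr[z1 _ _]; rewrite -bil_mxZ -!bil_mxB; apply: mxb => [|i j].
    by rewrite exprn_ge0.
  have [_ _ _ H] := H1 y y1; have := H (z - y); rewrite zE => /(_ z1 (i, j)) [_ _ +].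
  by rewrite !mxE.
Qed.

End ChartGeometry.

(** * Calibration and comparison of slow geodesics in a chart *)

Section ChartGeodesics.
Context {R : realType} {n : nat}.
Local Notation V := 'rV[R]_n.+1.
Variables (U : set V) (g : V -> 'M[R]_n.+1).
Hypothesis cm : chart_metric U g.
Implicit Types (x y z u v w p : V).
Local Notation Gamv := (Gamv g).
Local Notation Dg := (Dg g).

Lemma GamvBl x u v w : Gamv x (u - v) w = Gamv x u w - Gamv x v w.
Proof. by rewrite -scaleN1r GamvDl GamvZl scaleN1r. Qed.

Lemma GamvBr x u v w : Gamv x w (u - v) = Gamv x w u - Gamv x w v.
Proof. by rewrite -scaleN1r GamvDr GamvZr scaleN1r. Qed.

Definition chart_geodesic (c p : R -> V) (t : R) : Prop :=
  is_derive t 1 c (p t) /\ is_derive t 1 p (- Gamv (c t) (p t) (p t)).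

(** Metric compatibility: the acceleration cancels, and g(c', q) has derivative g(c', Dq) with Dq
    the covariant derivative along c. *)
Lemma chart_geodesic_bil (c p q : R -> V) (t : R) dq : U (c t) -> chart_geodesic c p t ->
  is_derive t 1 q dq ->
  is_derive t 1 (fun s => bil (g (c s)) (p s) (q s))
    (bil (g (c t)) (p t) (Gamv (c t) (p t) (q t) + dq)).
Proof.
move=> Uc [Hc Hp] Hq; apply: dEq (is_derive_bil cm Uc Hc Hp Hq) _.
rewrite (Dg_compat cm) // bilNl bilDr; ring.
Qed.

Variables (x0 : V) (r lam K : R).
Hypothesis gb : good_ball U g x0 r lam K.
Local Notation N := (n.+1%:R : R).
(** Weight of |y - c|^2 in the calibration. With it the condition (4 mu N)^2 <= 4 lam (mu / 2) on
    the quadratic form in [calibration_ineq] is an equality. *)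
Local Notation mu := (lam / (8 * N ^+ 2)).

(** The two middle bounds let the error terms of [calibration_ineq] be absorbed; the last one
    provides the contraction factor in [two_geodesics]. *)
Definition small_speed (w : R) : Prop :=
  [/\ 0 < w, K * w <= mu * N, K * w ^+ 2 <= mu / 2 & K * w ^+ 2 + 2 * K * w <= 1 / 4].

Lemma mu_gt0 : 0 < mu.
Proof. by rewrite divr_gt0 ?(gb_lam gb) // mulr_gt0 // exprn_gt0. Qed.

Lemma small_speed_exists : exists w : R, small_speed w.
Proof.
have K0 := gb_K gb; have m0 := mu_gt0.
have N0 : 0 < N by [].
have a1 : 0 < mu * N / K by rewrite divr_gt0 // mulr_gt0.
have a2 : 0 < mu / 2 / K by apply: divr_gt0 => //; exact: divr_gt0.
have a3 : 0 < 1 / 12 / K by apply: divr_gt0 => //; exact: divr_gt0.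
(* As w <= 1, K w^2 + 2 K w is at most 3 K w; hence the entry 1 / 12 / K. *)
pose w := Num.min 1 (Num.min (mu * N / K) (Num.min (mu / 2 / K) (1 / 12 / K))).
have w0 : 0 < w by rewrite /w !lt_min ltr01 a1 a2 a3.
have w1 : w <= 1 by rewrite /w ge_min lexx.
have wa : w <= mu * N / K by rewrite /w !ge_min lexx !orbT.
have wb : w <= mu / 2 / K by rewrite /w !ge_min lexx !orbT.
have wc : w <= 1 / 12 / K by rewrite /w !ge_min lexx !orbT.
rewrite ler_pdivlMr // mulrC in wa; rewrite ler_pdivlMr // mulrC in wb; rewrite ler_pdivlMr // mulrC in wc.
have w2 : K * w ^+ 2 <= K * w.
  by rewrite ler_wpM2l ?(ltW K0) // expr2 ler_piMr // ltW.
exists w; split => //; first exact: le_trans wb.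
have e : 2 * K * w = 2 * (K * w) by ring.
by rewrite e; move: w2 wc; move: (K * w ^+ 2) (K * w) => *; lra.
Qed.

(* The derivative of [2 g_c(c', y - c) - mu t |y - c|^2] is at most [g_y(y', y') - g_c(c', c')]
   for a slow geodesic c: integrated, this calibrates short geodesics. *)
Lemma calibration_ineq (w : R) c y p eta (t : R) : small_speed w -> `|c - x0| < r -> `|y - x0| < r ->
  `|p| <= w -> 0 <= t <= 1 ->
  bil (g c) p p + 2 * bil (g c) p (Gamv c p (y - c) + eta)
    - mu * dot (y - c) (y - c) - mu * t * (2 * dot (y - c) eta)
  <= bil (g y) (p + eta) (p + eta).
Proof.
move=> [w0 Hw1 Hw2 _] cr yr pw /andP[t0 t1]; set xi := y - c.
have K0 := gb_K gb; have m0 := mu_gt0; have Uc := gb_U gb cr; have Uy := gb_U gb yr.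
have E1 : `|bil (g y) p p - bil (g c) p p - bil (Dg c xi) p p| <= K * (`|xi| ^+ 2 * w ^+ 2).
  apply: le_trans (gb_g2 gb p p cr yr) _; rewrite -!mulrA ler_wpM2l ?(ltW K0) //.
  do 2![apply: ler_wpM2l => //]; by rewrite expr2 ler_pM.
have E2 : `|bil (g y) p eta - bil (g c) p eta| <= K * (w * (`|xi| * `|eta|)).
  apply: le_trans (gb_gL gb p eta cr yr) _; rewrite -!mulrA ler_wpM2l ?(ltW K0) //.
  by rewrite mulrCA ler_wpM2r // mulr_ge0.
have E3 := gb_low gb eta yr.
have E4 : bil (Dg c xi) p p = 2 * bil (g c) p (Gamv c p xi).
  by rewrite (Dg_compat cm) // (chart_bilC cm (Gamv _ _ _) p Uc) (GamvC cm p xi Uc); ring.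
have E5 := dot_ge xi; have E6 := dot_le xi eta.
(* Half of mu |xi|^2 together with lam |eta|^2 pays for four units of mu N |xi| |eta|: two come from
   [E2], which is doubled, and two from [F4]. The other half of mu |xi|^2 pays for [E1]. *)
have Q := @quadratic_form_ge0 _ lam (4 * (mu * N)) (mu / 2) `|xi| `|eta| (gb_lam gb) _.
have {Q} Q : 0 <= lam * `|eta| ^+ 2 - 4 * (mu * N * (`|xi| * `|eta|)) + (mu * `|xi| ^+ 2) / 2.
  have -> : 4 * (mu * N * (`|xi| * `|eta|)) = 4 * (mu * N) * (`|xi| * `|eta|) by ring.
  rewrite [X in _ + X](_ : _ = mu / 2 * `|xi| ^+ 2); last by rewrite mulrAC.
  apply: Q; rewrite le_eqVlt; apply/orP; left; apply/eqP.
  have NN : N != 0 by rewrite pnatr_eq0.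
  by field.
have -> : bil (g y) (p + eta) (p + eta) = bil (g y) p p + 2 * bil (g y) p eta + bil (g y) eta eta.
  by rewrite !(bilDl, bilDr) (chart_bilC cm eta p Uy); ring.
rewrite bilDr.
have F1 : K * (`|xi| ^+ 2 * w ^+ 2) <= (mu * `|xi| ^+ 2) / 2.
  by rewrite mulrCA mulrC [leRHS]mulrAC ler_wpM2r // sqr_ge0.
have F2 : K * (w * (`|xi| * `|eta|)) <= mu * N * (`|xi| * `|eta|).
  by rewrite mulrA ler_wpM2r // mulr_ge0.
have F3 : mu * `|xi| ^+ 2 <= mu * dot xi xi by rewrite ler_wpM2l // ltW.
have F4 : - (mu * t * (2 * dot xi eta)) <= 2 * (mu * N * (`|xi| * `|eta|)).
  have : `|mu * t * (2 * dot xi eta)| <= 2 * (mu * N * (`|xi| * `|eta|)).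
    have -> : mu * t * (2 * dot xi eta) = 2 * (mu * (t * dot xi eta)) by ring.
    rewrite (normrM 2) (ger0_norm (ler0n R 2)) ler_wpM2l // (normrM mu) (gtr0_norm m0) -mulrA.
    rewrite ler_wpM2l ?(ltW m0) // (normrM t) (ger0_norm t0).
    by apply: le_trans E6; rewrite ler_piMl.
  by move=> H; apply: le_trans H; rewrite -normrN; exact: ler_norm.
have {E1 F1} E1 := le_trans E1 F1; have {E2 F2} E2 := le_trans E2 F2.
move: E1 E2 E3 F3 F4 Q; rewrite E4; clear E4 E5 E6 Hw1 Hw2 K0 m0.
move: (mu * `|xi| ^+ 2) (mu * N * (`|xi| * `|eta|)) (lam * `|eta| ^+ 2) (mu * t * (2 * dot xi eta)) (mu * dot xi xi)
  (bil (g y) p p) (bil (g c) p p) (bil (g c) p (Gamv c p xi)) (bil (g y) p eta)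
  (bil (g c) p eta) (bil (g y) eta eta).
clear; move=> X Y Z A B q1 q2 q3 q4 q5 q6.
rewrite !ler_norml => /andP[A1 A2] /andP[B1 B2]; lra.
Qed.

(** [F] is h minus the calibration, and [calibration_ineq] makes its derivative nonnegative. The
    interval is arbitrary because the competitor may be broken: the boundary terms vanish where y
    meets c and telescope at the break. *)
Lemma calibrate (w : R) (c p y dy : R -> V) (h dh : R -> R) (a b e : R) : small_speed w ->
  0 <= a -> a <= b -> b <= 1 ->
  (forall t, a <= t <= b -> [/\ `|c t - x0| < r, chart_geodesic c p t, `|p t| <= w &
      bil (g (c t)) (p t) (p t) = e]) ->
  (forall t, a <= t <= b -> [/\ `|y t - x0| < r, is_derive t 1 y (dy t), is_derive t 1 h (dh t) &
      bil (g (y t)) (dy t) (dy t) <= dh t]) ->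
  e * (b - a) + (2 * bil (g (c b)) (p b) (y b - c b) - mu * b * dot (y b - c b) (y b - c b))
    - (2 * bil (g (c a)) (p a) (y a - c a) - mu * a * dot (y a - c a) (y a - c a))
  <= h b - h a.
Proof.
move=> sw a0 ab b1 Hc Hy.
pose F t := h t - (e * t + (2 * bil (g (c t)) (p t) (y t - c t) - mu * t * dot (y t - c t) (y t - c t))).
pose dF t := dh t - (e + (2 * bil (g (c t)) (p t) (Gamv (c t) (p t) (y t - c t) + (dy t - p t))
   - (mu * dot (y t - c t) (y t - c t) + mu * t * (2 * dot (y t - c t) (dy t - p t))))).
have : F a <= F b.
  apply: (derive_ge0_le (df := dF)) => // t.
    move=> tab; have [ct gt _ _] := Hc t tab; have [_ yt ht _] := Hy t tab.
    have [dc dp] := gt.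
    have dxi : is_derive t 1 (fun s => y s - c s) (dy t - p t) by exact: is_deriveB.
    apply: (dB ht); apply: (dD (f := fun s => e * s) (a := e)).
      by apply: dEq (dZ e (dI t)) _; rewrite mulr1.
    apply: (dB (dZ 2 (chart_geodesic_bil (gb_U gb ct) gt dxi))).
    have dd : is_derive t 1 (fun s => dot (y s - c s) (y s - c s)) (2 * dot (y t - c t) (dy t - p t)).
      rewrite /dot big_distrr /=; apply: dSum => i.
      have H := (is_derive_rv _ _ _).1 dxi i; apply: dEq (dM H H) _.
      by rewrite /=; ring.
    by apply: dEq (dM (dZ mu (dI t)) dd) _; rewrite mulr1.
  move=> tab; have tab' : a <= t <= b by case/andP: tab => ? ?; rewrite !ltW.
  have [ct _ pt Ee] := Hc t tab'; have [yt _ _ yh] := Hy t tab'.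
  have t01 : 0 <= t <= 1.
    by case/andP: tab' => ? ?; rewrite (le_trans a0) //= (le_trans _ b1).
  have := calibration_ineq (dy t - p t) sw ct yt pt t01.
  rewrite [p t + _]addrC subrK Ee /dF subr_ge0 => H; apply: le_trans yh; apply: le_trans H.
  by rewrite opprD !addrA.
rewrite /F; move: (bil _ _ _) (bil _ _ _) (dot _ _) (dot _ _) (h a) (h b) mu => q1 q2 q3 q4 q5 q6 m.
by rewrite -subr_ge0 => H; rewrite -subr_ge0; apply: le_trans H _; rewrite le_eqVlt; apply/orP; left; apply/eqP; ring.
Qed.

Lemma sup_norm_attained (P : R -> V) : (forall t, 0 <= t <= 1 -> {for t, continuous P}) ->
  exists2 t0, 0 <= t0 <= 1 & forall t, 0 <= t <= 1 -> `|P t| <= `|P t0|.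
Proof.
move=> cP.
have cN : {within `[0, 1], continuous (fun t : R => `|P t|)}.
  apply: continuous_in_subspaceT => t; rewrite inE /= in_itv /= => t01.
  by apply: (continuous_comp (cP t t01)); exact: norm_continuous.
have [t0 t0i H] := EVT_max ler01 cN; exists t0; first by rewrite in_itv in t0i.
by move=> t ti; apply: H; rewrite in_itv.
Qed.

(** Replaces Gronwall's inequality. The supremum S of |p1 - p2| is attained; the geodesic equation
    bounds |p1 - p2 - P0| by ep (|D0| + S) with ep <= 1 / 4, so S can be absorbed, and |D0| + S <= 2
    (|D0| + |P0|). *)
Lemma two_geodesics (w : R) (c1 p1 c2 p2 : R -> V) : small_speed w ->
  (forall t, 0 <= t <= 1 -> [/\ `|c1 t - x0| < r, chart_geodesic c1 p1 t & `|p1 t| <= w]) ->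
  (forall t, 0 <= t <= 1 -> [/\ `|c2 t - x0| < r, chart_geodesic c2 p2 t & `|p2 t| <= w]) ->
  forall t, 0 <= t <= 1 ->
  let D0 := c1 0 - c2 0 in let P0 := p1 0 - p2 0 in
  `|c1 t - c2 t - D0 - t *: P0| <= 2^-1 * (`|D0| + `|P0|) /\
  `|p1 t - p2 t - P0| <= 2^-1 * (`|D0| + `|P0|).
Proof.
move=> [w0 _ _ wq] H1 H2 t t01 D0 P0.
pose ep := K * w ^+ 2 + 2 * K * w; have K0 := gb_K gb.
have ep0 : 0 <= ep by rewrite /ep addr_ge0 // !mulr_ge0 // ltW // exprn_gt0.
have ep4 : ep <= 1 / 4 by [].
pose P (s : R) := p1 s - p2 s.
have dP (s : R) : 0 <= s <= 1 -> is_derive s 1 P (- Gamv (c1 s) (p1 s) (p1 s) - - Gamv (c2 s) (p2 s) (p2 s)).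
  by move=> s01; have [_ [_ d1] _] := H1 s s01; have [_ [_ d2] _] := H2 s s01; exact: is_deriveB.
have [s0 s01 HS] := sup_norm_attained (fun s s01' => is_derive_rv_cts (dP s s01')).
set S := `|P s0| in HS; have S0 : 0 <= S by exact: normr_ge0.
have i0 : 0 <= (0 : R) <= 1 by rewrite lexx ler01.
have dD' (s : R) : 0 <= s <= 1 -> is_derive s 1 (fun s => c1 s - c2 s) (P s).
  by move=> s01'; have [_ [d1 _] _] := H1 s s01'; have [_ [d2 _] _] := H2 s s01'; exact: is_deriveB.
have DS (s : R) : 0 <= s <= 1 -> `|c1 s - c2 s| <= `|D0| + S.
  move=> /andP[sa sb].
  have := rv_derive_bounded (c := fun s => c1 s - c2 s) (K := S) sa
    (fun (z : R) zs => dD' z (itv_trans zs sb)) (fun (z : R) zs => HS z (itvoo_trans zs sb)) S0.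
  rewrite subr0 -/D0 => H; rewrite -[c1 s - c2 s](subrK D0) addrC.
  apply: le_trans (ler_normD _ _) _; rewrite lerD2l; apply: le_trans H _.
  by rewrite ler_piMr.
have PS (s : R) : 0 <= s <= 1 -> `|P s - P0| <= ep * (`|D0| + S).
  move=> /andP[sa sb]; have S1 : 0 <= ep * (`|D0| + S) by rewrite mulr_ge0 // addr_ge0.
  have B (z : R) : 0 <= z <= 1 ->
      `|- Gamv (c1 z) (p1 z) (p1 z) - - Gamv (c2 z) (p2 z) (p2 z)| <= ep * (`|D0| + S).
    move=> z01; have [cz1 _ pz1] := H1 z z01; have [cz2 _ pz2] := H2 z z01.
    have -> : - Gamv (c1 z) (p1 z) (p1 z) - - Gamv (c2 z) (p2 z) (p2 z) =
       - ((Gamv (c1 z) (p1 z) (p1 z) - Gamv (c2 z) (p1 z) (p1 z)) + Gamv (c2 z) (P z) (p1 z)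
          + Gamv (c2 z) (p2 z) (P z)).
      rewrite /P GamvBl GamvBr.
      by rewrite !addrA !subrK opprB opprK addrC.
    rewrite normrN.
    have B1 : `|Gamv (c1 z) (p1 z) (p1 z) - Gamv (c2 z) (p1 z) (p1 z)| <= K * w ^+ 2 * (`|D0| + S).
      apply: le_trans (gb_GamL gb (p1 z) (p1 z) cz2 cz1) _.
      rewrite (_ : K * w ^+ 2 * (`|D0| + S) = K * (`|D0| + S) * w * w); last by ring.
      have Kd : K * `|c1 z - c2 z| <= K * (`|D0| + S) by rewrite ler_wpM2l ?(ltW K0) ?DS.
      by apply: ler_pM => //; rewrite ?mulr_ge0 ?(ltW K0) //; apply: ler_pM; rewrite ?mulr_ge0 ?(ltW K0).
    have B2 : `|Gamv (c2 z) (P z) (p1 z)| <= K * w * (`|D0| + S).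
      apply: le_trans (gb_Gam gb (P z) (p1 z) cz2) _.
      rewrite -!mulrA ler_wpM2l ?(ltW K0) // mulrC ler_pM //.
      by apply: le_trans (HS z z01) _; rewrite lerDr.
    have B3 : `|Gamv (c2 z) (p2 z) (P z)| <= K * w * (`|D0| + S).
      apply: le_trans (gb_Gam gb (p2 z) (P z) cz2) _.
      rewrite -!mulrA ler_wpM2l ?(ltW K0) // ler_pM //.
      by apply: le_trans (HS z z01) _; rewrite lerDr.
    apply: le_trans (ler_normD _ _) _; apply: le_trans (lerD (ler_normD _ _) (lexx _)) _.
    have -> : ep * (`|D0| + S) = K * w ^+ 2 * (`|D0| + S) + K * w * (`|D0| + S) + K * w * (`|D0| + S) by rewrite /ep; ring.
    by apply: lerD B3; exact: lerD.
  have := rv_derive_bounded (c := P) (K := ep * (`|D0| + S)) sa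
    (fun (z : R) zs => dP z (itv_trans zs sb)) (fun (z : R) zs => B z (itvoo_trans zs sb)) S1.
  move=> H; apply: le_trans H _; by rewrite subr0 ler_piMr.
have Sb : S <= `|D0| + 2 * `|P0|.
  have := PS s0 s01; have := ler_normD P0 (P s0 - P0); rewrite [P0 + _]addrC subrK -/S.
  have := normr_ge0 D0; have := normr_ge0 P0.
  have : ep * (`|D0| + S) <= 1 / 4 * (`|D0| + S) by rewrite ler_wpM2r // addr_ge0.
  by clear; move: (ep * (`|D0| + S)) (`|P s0 - P0|) (`|P0|) (`|D0|) (S) => *; lra.
have DSb : `|D0| + S <= 2 * (`|D0| + `|P0|) by move: Sb; clear; move: (`|P0|) (`|D0|) (S) => *; lra.
have PSb (s : R) : 0 <= s <= 1 -> `|P s - P0| <= 2 * ep * (`|D0| + `|P0|).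
  by move=> s01'; apply: le_trans (PS s s01') _; rewrite -mulrA mulrCA ler_wpM2l.
have PSh s : 0 <= s <= 1 -> `|P s - P0| <= 2^-1 * (`|D0| + `|P0|).
  by move=> s01'; apply: le_trans (PSb s s01') _; rewrite ler_wpM2r ?addr_ge0 //; lra.
split; last exact: PSh.
case/andP: (t01) => t0 t1; have B0 : 0 <= 2^-1 * (`|D0| + `|P0|) by rewrite mulr_ge0 // ?addr_ge0 // invr_ge0.
have := rv_derive_bounded (c := fun s => c1 s - c2 s - s *: P0) (dc := fun s => P s - P0)
  (K := 2^-1 * (`|D0| + `|P0|)) t0 _ _ B0.
rewrite scale0r !subr0 -/D0 addrAC => H; apply: le_trans (H _ _) _ => [s st|s st|].
- apply: is_deriveB; first exact: (dD' s (itv_trans st t1)).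
  apply/is_derive_rv => k; rewrite (_ : (fun _ => _) = fun s => s * P0 0 k); last first.
    by apply/funext => q; rewrite mxE.
  by apply: dEq (dM (dI s) (dC _ s)) _; rewrite mul1r mulr0 addr0.
- exact: (PSh s (itvoo_trans st t1)).
- by rewrite ler_piMr.
Qed.

End ChartGeodesics.

Lemma nbhs_R_ex {R : realType} (t : R) (P : set R) : nbhs t P ->
  exists2 r : R, 0 < r & forall s, `|s - t| < r -> P s.
Proof.
move=> /nbhs_ballP[r /= r0 Hr]; exists r => // y yr.
by apply: Hr; rewrite -ball_normE /= distrC.
Qed.

(** * Induction along the unit interval *)

Section RealInduction.
Context {R : realType}.

(** The supremum of the times up to which P holds cannot be smaller than 1. *)
Lemma real_induction (P : R -> Prop) : P 0 ->
  (forall t, 0 <= t < 1 -> (forall s, 0 <= s <= t -> P s) ->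
     exists2 de : R, 0 < de & forall s, t < s < t + de -> s <= 1 -> P s) ->
  (forall t, 0 < t <= 1 -> (forall s, 0 <= s < t -> P s) -> P t) ->
  forall t, 0 <= t <= 1 -> P t.
Proof.
move=> P0 Pf Pl; pose S := [set t : R | 0 <= t <= 1 /\ forall s, 0 <= s <= t -> P s].
have S0 : S 0.
  split; first by rewrite lexx ler01.
  by move=> s s0; have -> : s = 0 by apply/eqP; rewrite eq_le andbC.
have hS : has_sup S by split; [exists 0|exists 1 => t [/andP[]]].
pose z := sup S.
have z0 : 0 <= z by apply: sup_upper_bound.
have z1 : z <= 1 by apply: ge_sup; [exists 0|move=> t [/andP[]]].
have Pz' s : 0 <= s < z -> P s.
  move=> /andP[s0 sz].
  have [t [_ tP] st] := sup_adherent (eps := z - s) ltac:(by rewrite subr_gt0) hS.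
  apply: tP; rewrite s0 /=; rewrite subKr in st; exact: ltW.
have Pz : P z.
  move: z0; rewrite le_eqVlt => /predU1P[<-//|z0]; apply: Pl => //; by rewrite z0.
have Pz2 s : 0 <= s <= z -> P s.
  by move=> /andP[s0]; rewrite le_eqVlt => /predU1P[->//|sz]; apply: Pz'; rewrite s0.
suff ez : z = 1 by move=> t; rewrite -ez; exact: Pz2.
apply/eqP; rewrite eq_le z1 /= leNgt; apply/negP => zlt.
have [de de0 Hd] := Pf z ltac:(by rewrite z0) Pz2.
pose y := Num.min (z + de / 2) 1.
have zy : z < y by rewrite /y lt_min zlt ltrDl divr_gt0.
have : S y.
  split; first by rewrite (le_trans z0 (ltW zy)) /y ge_min lexx orbT.
  move=> s /andP[s0 sy]; case: (lerP s z) => [sz|zs]; first by apply: Pz2; rewrite s0.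
  apply: Hd; last by apply: le_trans sy _; rewrite /y ge_min lexx orbT.
  rewrite zs /=; apply: le_lt_trans sy _; rewrite /y gt_min; apply/orP; left.
  by rewrite ltrD2l ltr_pdivrMr // mulr2n mulrDr mulr1 ltrDl.
move/(sup_upper_bound hS); rewrite -/z leNgt zy; exact.
Qed.

(** Substitute for a finite subdivision of [0, 1]: T will be an implication or an estimate that
    composes along adjacent intervals. *)
Lemma interval_chain (T : R -> R -> Prop) :
  (forall a b c, 0 <= a -> a < b -> b < c -> c <= 1 -> T a b -> T b c -> T a c) ->
  (forall t, 0 <= t <= 1 -> exists2 de : R, 0 < de & forall a b, 0 <= a -> a < b -> b <= 1 ->
     `|a - t| < de -> `|b - t| < de -> T a b) ->
  T 0 1.
Proof.
move=> Tt Tl.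
suff : forall t, 0 <= t <= 1 -> t = 0 \/ T 0 t.
  by move=> /(_ 1 ltac:(by rewrite ler01 lexx))[/eqP|//]; rewrite oner_eq0.
apply: real_induction; first by left.
- move=> t /andP[t0 t1] H; have [de de0 Hd] := Tl t ltac:(by rewrite t0 ltW).
  exists de => // s /andP[ts sd] s1; right.
  have Tts : T t s.
    apply: Hd => //; rewrite ?subrr ?normr0 //.
    by rewrite ger0_norm ?subr_ge0 ?ltW // ltrBlDl.
  move: t0; rewrite le_eqVlt => /predU1P[t0|t0]; first by rewrite t0.
  have [t00|T0t] := H t ltac:(by rewrite ltW // lexx); first by rewrite t00 ltxx in t0.
  exact: (Tt 0 t s).
- move=> t /andP[t0 t1] H; right.
  have [de de0 Hd] := Tl t ltac:(by rewrite ltW).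
  pose s := Num.max 0 (t - de / 2).
  have st : s < t by rewrite /s gt_max t0 /= ltrBlDr ltrDl divr_gt0.
  have s0 : 0 <= s by rewrite /s le_max lexx.
  have Tst : T s t.
    apply: Hd => //; rewrite ?subrr ?normr0 //.
    rewrite ler0_norm ?subr_le0 ?ltW // opprB ltrBlDl -ltrBlDr /s lt_max; apply/orP; right.
    by rewrite ltrD2l ltrN2 ltr_pdivrMr // mulr2n mulrDr mulr1 ltrDl.
  have [s00|T0s] := H s ltac:(by rewrite s0); first by rewrite -s00.
  move: s0; rewrite le_eqVlt => /predU1P[s0|s0]; first by rewrite -s0 in Tst.
  exact: (Tt 0 s t).
Qed.

Lemma limit_norm_le {n : nat} (f : R -> 'rV[R]_n.+1) (t K : R) x : 0 < t -> {for t, continuous f} ->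
  (forall s, 0 <= s < t -> `|f s - x| <= K) -> `|f t - x| <= K.
Proof.
move=> t0 cf H; apply/ler_addgt0Pr => e e0.
have [de de0 Hd] := nbhs_R_ex ((cvgrPdist_le f _).1 cf e e0).
pose s := Num.max 0 (t - de / 2).
have st : s < t by rewrite /s gt_max t0 /= ltrBlDr ltrDl divr_gt0.
have s0 : 0 <= s by rewrite /s le_max lexx.
have : `|f t - f s| <= e.
  apply: Hd; rewrite ler0_norm ?subr_le0 ?ltW // opprB ltrBlDl -ltrBlDr /s lt_max; apply/orP; right.
  by rewrite ltrD2l ltrN2 ltr_pdivrMr // mulr2n mulrDr mulr1 ltrDl.
have := H s ltac:(by rewrite s0).
have := ler_normD (f s - x) (f t - f s); rewrite addrC addrA subrK; lra.
Qed.

End RealInduction.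

Lemma differentiable_rv {R : realType} {n m : nat} (f : 'rV[R]_n.+1 -> 'rV[R]_m.+1) x :
  (forall j, differentiable (fun y => f y 0 j) x) -> differentiable f x.
Proof.
move=> H.
rewrite (_ : f = \sum_(j < m.+1) (fun y => f y 0 j *: delta_mx 0 j)); last first.
  apply/funext => y; rewrite fct_sumE; exact: row_sum_delta.
apply: differentiable_sum => j; exact: differentiableZl.
Qed.

(** * Geodesics and changes of chart *)

Section Manifold.
Context {R : realType} {n : nat} {M : topologicalType}.
Local Notation V := 'rV[R]_n.+1.
Variables (A : smooth_atlas R n M) (g : riemannian_metric A).
Implicit Types (a b : chart_index A) (p q m : M) (c : R -> M).

Lemma chart_cm a : chart_metric (chart_cod a) (metric g a).
Proof.
exact: (ChartMetric (@chart_cod_open R n M A a) (@metric_smooth R n M A g a)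
  (@Defs.metric_sym R n M A g a) (@metric_posdef R n M A g a)).
Qed.

Lemma chart_codI a p : chart_dom a p -> chart_cod a (chart a p).
Proof. by move=> ap; exists p. Qed.

Lemma overlap_open a b : open (chart a @` (chart_dom a `&` chart_dom b)).
Proof.
rewrite openE => x [p [ap bp] <-].
have xa : chart_cod a (chart a p) := chart_codI ap.
have ci := chart_inv_continuous xa.
have b' : nbhs (chart_inv a (chart a p)) (chart_dom b).
  by rewrite (chartK ap); apply: open_nbhs_nbhs; split => //; exact: chart_dom_open.
have N1 : nbhs (chart a p) (fun y => chart_dom b (chart_inv a y)) := ci _ b'.
have N2 : nbhs (chart a p) (chart_cod a) by apply: open_nbhs_nbhs; split => //; exact: chart_cod_open.
suff : nbhs (chart a p) (chart a @` (chart_dom a `&` chart_dom b)) by [].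
apply: filterS (filterI N1 N2) => y [/= yb [m am ym]].
by exists m => //; split => //; rewrite -ym (chartK am) in yb.
Qed.

Lemma transition_diff a b p : chart_dom a p -> chart_dom b p ->
  differentiable (transition a b : V -> V) (chart a p).
Proof.
move=> ap bp; apply: differentiable_rv => j.
have oU := overlap_open (a := a) (b := b).
have Up : (chart a @` (chart_dom a `&` chart_dom b)) (chart a p) by exists p.
by have [] := smooth_differentiable oU (@transition_smooth _ _ _ A a b j) Up.
Qed.

Definition vel a c (t : R) : V := derive1 (chart a \o c) t.

Lemma near_dom a c (t : R) : continuous c -> chart_dom a (c t) -> \forall s \near t, chart_dom a (c s).
Proof.
move=> cc ct; apply: (cc t); apply: open_nbhs_nbhs; split => //; exact: chart_dom_open.
Qed.

Lemma geodesic_chart a c (t : R) : geodesic g c -> chart_dom a (c t) ->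
  chart_geodesic (metric g a) (chart a \o c) (vel a c) t.
Proof.
move=> [_ gc] ct; have [d1 d2 E] := gc a t ct; split.
  by apply: DeriveDef; [exact: d1|rewrite /vel derive1E].
apply: DeriveDef => //; rewrite -derive1E; apply/rowP => k.
rewrite mxE [in RHS]mxE; apply/eqP; rewrite -addr_eq0; apply/eqP.
exact: E.
Qed.

Lemma vel_eq a c (t : R) v : is_derive t 1 (chart a \o c) v -> vel a c t = v.
Proof. by move=> [_ <-]; rewrite /vel derive1E. Qed.

Lemma geodesicI c : continuous c ->
  (forall a (t : R), chart_dom a (c t) -> exists P : R -> V,
     (\forall s \near t, is_derive (s : R) 1 (chart a \o c) (P s)) /\
     is_derive t 1 P (- Gamv (metric g a) (chart a (c t)) (P t) (P t))) -> geodesic g c.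
Proof.
move=> cc H; split=> // a t ct u; have [P [dP dP2]] := H a t ct.
have E : \forall s \near t, P s = derive1 u s.
  by apply: filterS dP => s ds; rewrite -(vel_eq ds).
have Et : derive1 u t = P t by rewrite (nbhs_singleton E).
have D2 : is_derive t 1 (derive1 u) (- Gamv (metric g a) (chart a (c t)) (P t) (P t)).
  exact: near_eq_is_derive dP2.
split.
- by have [] := nbhs_singleton dP.
- by have [] := D2.
move=> k; have [_] := D2; rewrite -derive1E => ->; rewrite Et !mxE.
by rewrite addNr.
Qed.

Lemma vel_transition a b c (t : R) v : continuous c -> chart_dom a (c t) -> chart_dom b (c t) ->
  is_derive t 1 (chart a \o c) v ->
  is_derive t 1 (chart b \o c) (v *m 'J (transition a b) (chart a (c t))).
Proof.
move=> cc ca cb dv; have dT := transition_diff ca cb.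
have [dc ev] := dv; have dc' : differentiable (chart a \o c) t by exact/derivable1_diffP.
have H : is_derive t 1 (transition a b \o (chart a \o c)) (v *m 'J (transition a b) (chart a (c t))).
  have dco : differentiable (transition a b \o (chart a \o c)) t by exact: differentiable_comp.
  apply: DeriveDef; first exact/derivable1_diffP.
  by rewrite deriveE // diff_comp //= -deriveEjacobian // deriveE // -ev deriveE.
apply: near_eq_is_derive H; apply: filterS (near_dom cc ca) => s sa /=.
by rewrite /transition /= (chartK sa).
Qed.

Lemma bil_transition a b p u v : chart_dom a p -> chart_dom b p ->
  bil (metric g b (chart b p)) (u *m 'J (transition a b) (chart a p)) (v *m 'J (transition a b) (chart a p))
  = bil (metric g a (chart a p)) u v.
Proof.
by move=> ap bp; rewrite (metric_compat g ap bp) /bil trmx_mul !mulmxA.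
Qed.

Lemma geodesic_cts c : geodesic g c -> continuous c.
Proof. by case. Qed.

Lemma geodesic_derive a c (t : R) : geodesic g c -> chart_dom a (c t) ->
  is_derive t 1 (chart a \o c) (vel a c t).
Proof. by move=> gc ct; have [] := geodesic_chart gc ct. Qed.

Lemma vel_change a b c t : geodesic g c -> chart_dom a (c t) -> chart_dom b (c t) ->
  vel b c t = vel a c t *m 'J (transition a b) (chart a (c t)).
Proof.
move=> gc ca cb; apply: vel_eq.
exact: (vel_transition (geodesic_cts gc) ca cb (geodesic_derive gc ca)).
Qed.

Lemma gram_change a b c c' t t' : geodesic g c -> geodesic g c' -> c t = c' t' ->
  chart_dom a (c t) -> chart_dom b (c t) ->
  bil (metric g b (chart b (c t))) (vel b c t) (vel b c' t') =
  bil (metric g a (chart a (c t))) (vel a c t) (vel a c' t').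
Proof.
move=> gc gc' e ca cb; rewrite (vel_change gc ca cb) (vel_change (a := a) (b := b) gc') -?e //.
exact: bil_transition.
Qed.

Definition has_speed2 c (e : R) : Prop := forall a t, chart_dom a (c t) ->
  bil (metric g a (chart a (c t))) (vel a c t) (vel a c t) = e.

Lemma has_speed2_at a c t : geodesic g c -> chart_dom a (c t) ->
  has_speed2 c (bil (metric g a (chart a (c t))) (vel a c t) (vel a c t)).
Proof.
(* A chart is chosen at every time. By [gram_change] the resulting energy coincides near each time
   with the one computed in a single chart, where it has derivative 0. *)
move=> gc ca; pose ch s := sval (cid (chart_cover A (c s))).
have chP s : chart_dom (ch s) (c s) := svalP (cid (chart_cover A (c s))).
pose E s := bil (metric g (ch s) (chart (ch s) (c s))) (vel (ch s) c s) (vel (ch s) c s).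
have EE b s : chart_dom b (c s) -> bil (metric g b (chart b (c s))) (vel b c s) (vel b c s) = E s.
  by move=> cb; exact: gram_change.
have dE (s : R) : is_derive s 1 E 0.
  have gs := geodesic_chart gc (chP s); have [_ dv] := gs.
  apply: near_eq_is_derive (dEq (chart_geodesic_bil (chart_cm (ch s)) (chart_codI (chP s)) gs dv) _).
    by apply: filterS (near_dom (geodesic_cts gc) (chP s)) => z; exact: EE.
  by rewrite addrN bil0r.
have cE (x y : R) : x <= y -> E y = E x.
  move=> xy; apply/eqP; rewrite -subr_eq0 -normr_le0 -(mul0r (y - x)).
  by apply: (derive_bounded (df := fun=> 0)) => // z; rewrite normr0.
move=> b s cb; rewrite (EE b s cb) (EE a t ca).
by case: (lerP s t) => [/cE->//|/ltW/cE].
Qed.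

Lemma chart_affine_derive a c (k b s : R) : continuous c -> chart_dom a (c (k * s + b)) ->
  forall v, is_derive (k * s + b) 1 (chart a \o c) v ->
  is_derive s 1 (chart a \o (fun s => c (k * s + b))) (k *: v).
Proof.
move=> cc ca v /is_derive_rv H; apply/is_derive_rv => i; rewrite mxE.
exact: (dAffine (g := fun z => chart a (c z) 0 i)).
Qed.

Lemma affine_cts (k b : R) : continuous (fun s : R => k * s + b).
Proof.
by move=> s; exact: (is_derive_cts (dD (dZ k (dI s)) (dC b s))).
Qed.

Lemma geodesic_affine c (k b : R) : geodesic g c -> geodesic g (fun s => c (k * s + b)).
Proof.
move=> gc; have cc := geodesic_cts gc.
have cc' : continuous (fun s => c (k * s + b)).
  move=> s; apply: (continuous_comp (f := fun s : R => k * s + b) (g := c)); [exact: affine_cts|exact: cc].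
apply: geodesicI => // a t ca; exists (fun s => k *: vel a c (k * s + b)); split.
  apply: filterS (near_dom cc' ca) => s sa.
  exact: (chart_affine_derive cc sa (geodesic_derive gc sa)).
have [_ /is_derive_rv dv] := geodesic_chart gc ca.
apply/is_derive_rv => i.
rewrite GamvZl GamvZr scalerA !mxE.
rewrite (_ : (fun s => _) = fun s => k * (fun z => vel a c z 0 i) (k * s + b)); last first.
  by apply/funext => s; rewrite mxE.
apply: dEq (dZ k (dAffine (g := fun z => vel a c z 0 i) (dv i))) _.
by rewrite !mxE mulrA mulrN.
Qed.

Lemma vel_affine a c (k b s : R) : geodesic g c -> chart_dom a (c (k * s + b)) ->
  vel a (fun s => c (k * s + b)) s = k *: vel a c (k * s + b).
Proof.
move=> gc ca; apply: vel_eq.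
exact: (chart_affine_derive (geodesic_cts gc) ca (geodesic_derive gc ca)).
Qed.

Lemma has_speed2_affine c e (k b : R) : geodesic g c -> has_speed2 c e ->
  has_speed2 (fun s => c (k * s + b)) (k ^+ 2 * e).
Proof.
move=> gc ce a t ca; rewrite vel_affine // bilZl bilZr (ce a _ ca) expr2 mulrA.
by [].
Qed.

Lemma has_speed2_ge0 c e : has_speed2 c e -> 0 <= e.
Proof.
move=> ce; have [a ca] := chart_cover A (c 0); rewrite -(ce a 0 ca).
apply: (chart_bil_ge0 (chart_cm a)); exact: chart_codI.
Qed.

End Manifold.

Lemma near_dist {R : realType} {n : nat} (y : 'rV[R]_n.+1) (e : R) : 0 < e ->
  \forall z \near y, `|y - z| < e.
Proof. by move=> e0; apply/nbhs_ballP; exists e => //= z; rewrite -ball_normE. Qed.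

Lemma dist_continuous {R : realType} {n : nat} (x : 'rV[R]_n.+1) : continuous (fun y : 'rV[R]_n.+1 => `|y - x|).
Proof.
move=> y; apply: (cvgrPdist_le (F := nbhs y) (FF := nbhs_filter y) _ _).2 => e e0.
apply: filterS (near_dist y e0) => z zz.
by apply: le_trans (ler_dist_dist _ _) _; rewrite opprB addrA subrK ltW.
Qed.

(** * Short geodesics near a point: confinement, existence, minimality *)

Section LocalGeodesics.
Context {R : realType} {n : nat} {M : topologicalType}.
Local Notation V := 'rV[R]_n.+1.
Variables (A : smooth_atlas R n M) (g : riemannian_metric A).
Hypothesis Mh : hausdorff_space M.
Hypothesis gcomp : complete_metric g.
Implicit Types (a : chart_index A) (p q m : M) (c : R -> M).

(** Two points within rho of the centre are at most 2 rho apart, and [short_geodesic] shoots with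
    velocities up to twice their distance; [lp_bvp] keeps the energy of such geodesics below lam
    w^2, hence their speed below w. *)
Record local_pkg (q : M) (a : chart_index A) (r lam K w rho : R) : Prop := LocalPkg {
  lp_dom : chart_dom a q;
  lp_gb : good_ball (chart_cod a) (metric g a) (chart a q) r lam K;
  lp_w : small_speed (n := n) lam K w;
  lp_wr : w <= r / 4;
  lp_rho0 : 0 < rho;
  lp_rhor : rho <= r / 4;
  lp_bvp : K * (4 * rho) ^+ 2 <= lam * w ^+ 2 }.

Lemma small_speed_le (lam K w w' : R) : 0 < lam -> 0 < K -> small_speed (n := n) lam K w ->
  0 < w' -> w' <= w -> small_speed (n := n) lam K w'.
Proof.
move=> l0 K0 [w0 H1 H2 H3] w'0 ww'.
have E1 : K * w' <= K * w by rewrite ler_wpM2l // ltW.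
have E2 : K * w' ^+ 2 <= K * w ^+ 2 by rewrite ler_wpM2l ?(ltW K0) // lerXn2r // nnegrE ltW.
split=> //; [exact: le_trans E1 H1|exact: le_trans E2 H2|].
apply: le_trans H3; apply: lerD => //; rewrite -!mulrA ler_wpM2l //.
Qed.

Lemma local_pkg_exists q : exists a r lam K w rho, local_pkg q a r lam K w rho.
Proof.
have [a aq] := chart_cover A q.
have [r [lam [K gb]]] := good_ball_exists (chart_cm g a) (chart_codI aq).
have [w0 sw0] := small_speed_exists gb.
have r0 := gb_r gb; have l0 := gb_lam gb; have K0 := gb_K gb; have w00 : 0 < w0 by case: sw0.
pose w := Num.min w0 (r / 4).
have w0' : 0 < w by rewrite /w lt_min w00 divr_gt0.
have ww : w <= w0 by rewrite /w ge_min lexx.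
have wr : w <= r / 4 by rewrite /w ge_min lexx orbT.
pose k := Num.min 1 (lam / K); have k0 : 0 < k by rewrite /k lt_min ltr01 divr_gt0.
have k1 : k <= 1 by rewrite /k ge_min lexx.
have kl : K * k <= lam by rewrite mulrC -ler_pdivlMr // /k ge_min lexx orbT.
exists a, r, lam, K, w, (k * w / 4); split => //.
- exact: small_speed_le sw0 w0' ww.
- by rewrite divr_gt0 // mulr_gt0.
- apply: le_trans wr; apply: le_trans (_ : k * w <= w); last by rewrite ler_piMl // ltW.
  have : 0 < k * w by rewrite mulr_gt0.
  by move: (k * w) => z z0; lra.
- have -> : 4 * (k * w / 4) = k * w by field.
  rewrite exprMn mulrA ler_wpM2r ?sqr_ge0 //; apply: le_trans kl.
  by rewrite ler_wpM2l ?(ltW K0) // expr2 ler_piMl // ltW.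
Qed.

Section Ball.
Variables (q : M) (a : chart_index A) (r lam K w rho : R).
Hypothesis lp : local_pkg q a r lam K w rho.
Local Notation x0 := (chart a q).
Local Notation gb := (lp_gb lp).

Definition inball (s : R) m := chart_dom a m /\ `|chart a m - x0| < s.

Lemma inball_le s s' m : s <= s' -> inball s m -> inball s' m.
Proof. by move=> ss' [am h]; split => //; exact: lt_le_trans ss'. Qed.

Lemma inball_inj m m' : chart_dom a m -> chart_dom a m' -> chart a m = chart a m' -> m = m'.
Proof. by move=> am am' e; rewrite -(chartK am) e chartK. Qed.

Lemma inball_chart_inv (y : V) : `|y - x0| < r -> chart_dom a (chart_inv a y) /\ chart a (chart_inv a y) = y.
Proof. by move=> /(gb_U gb)[m am <-]; rewrite (chartK am). Qed.

(** Closed in M and not only in the chart: it is the image of a compact ball in a Hausdorff space.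
    This prevents a geodesic from leaving the chart domain at a limit time. *)
Lemma closed_inball (s : R) : s < r -> closed [set m | chart_dom a m /\ `|chart a m - x0| <= s].
Proof.
move=> sr; apply: (compact_closed Mh).
have -> : [set m | chart_dom a m /\ `|chart a m - x0| <= s] = chart_inv a @` [set y | `|y - x0| <= s].
  apply/seteqP; split=> m.
    by move=> [am h]; exists (chart a m) => //; exact: chartK.
  by move=> [y ys <-]; have [h1 h2] := inball_chart_inv (le_lt_trans ys sr); split=> //; rewrite h2.
apply: continuous_compact.
  apply: continuous_in_subspaceT => y; rewrite inE /= => ys.
  by apply: chart_inv_continuous; exact: (gb_U gb (le_lt_trans ys sr)).
apply: bounded_closed_compact.
  exists (`|x0| + s); split=> [|N N1 y /= ys]; first exact: num_real.
  rewrite -[y](subrK x0) addrC; apply: le_trans (ler_normD _ _) _.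
  by apply: ltW; apply: le_lt_trans N1; rewrite lerD2l.
have cN : continuous (fun y : V => `|y - x0|) := @dist_continuous _ _ _.
apply: (@preimage_closed _ _ (fun y : V => `|y - x0|) [set z : R | z <= s]); last exact: closed_le.
by move=> y _; exact: cN.
Qed.

Lemma open_inball (s : R) m : inball s m -> nbhs m (inball s).
Proof.
move=> [am h]; apply: filterI; first by apply: open_nbhs_nbhs; split => //; exact: chart_dom_open.
have c := chart_continuous am.
have e0 : 0 < (s - `|chart a m - x0|) by rewrite subr_gt0.
apply: filterS ((cvgrPdist_lt (chart a) _).1 c _ e0) => m' h'.
rewrite -[chart a m'](subrK (chart a m)) -addrA addrC.
apply: le_lt_trans (ler_normD _ _) _; rewrite distrC in h'.
by rewrite -ltrBrDl.
Qed.

Lemma speed_norm_le (y v : V) (w' : R) : `|y - x0| < r -> 0 <= w' ->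
  bil (metric g a y) v v <= lam * w' ^+ 2 -> `|v| <= w'.
Proof.
move=> yr w0 H; have := le_trans (gb_low gb v yr) H.
by rewrite ler_pM2l ?(gb_lam gb) // ler_pXn2r // nnegrE.
Qed.

(** Induction along [0, 1]: as long as the curve is in the ball its coordinate speed is at most w',
    and at a limit time [closed_inball] shows that it still is in the chart domain. *)
Lemma stay_in_ball c (e w' s : R) : geodesic g c -> has_speed2 g c e -> 0 < w' -> e <= lam * w' ^+ 2 ->
  inball s (c 0) -> s + w' < r ->
  forall t, 0 <= t <= 1 -> [/\ inball (s + w') (c t), `|chart a (c t) - x0| < r,
    `|chart a (c t) - chart a (c 0)| <= w' * t & `|vel a c t| <= w'].
Proof.
move=> gc ce w0 ew [a0 u0] sw.
have wt t : 0 <= t <= 1 -> w' * t <= w' by move=> /andP[? ?]; rewrite ler_piMr // ltW.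
have near0 t : 0 <= t <= 1 -> `|chart a (c t) - chart a (c 0)| <= w' * t -> `|chart a (c t) - x0| < s + w'.
  move=> t01 H; rewrite -[chart a (c t)](subrK (chart a (c 0))) -addrA addrC.
  apply: le_lt_trans (ler_normD _ _) _; apply: ltr_leD u0 _; exact: le_trans (wt t t01).
have velb t : chart_dom a (c t) -> `|chart a (c t) - x0| < r -> `|vel a c t| <= w'.
  by move=> ct tr; apply: (speed_norm_le tr (ltW w0)); rewrite (ce a t ct).
suff P : forall t, 0 <= t <= 1 -> chart_dom a (c t) /\ `|chart a (c t) - chart a (c 0)| <= w' * t.
  move=> t t01; have [ct ut] := P t t01; have h := near0 t t01 ut.
  split=> //; first exact: lt_trans sw.
  by apply: velb => //; exact: lt_trans sw.
apply: real_induction.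
- by split => //; rewrite subrr normr0 mulr0.
- move=> t /andP[t0 t1] H; have [ct ut] := H t ltac:(by rewrite t0 lexx).
  have tr := near0 t ltac:(by rewrite t0 ltW) ut.
  have [de de0 Hd] := nbhs_R_ex (geodesic_cts gc (open_inball (s := s + w') (conj ct tr))).
  exists de => // z /andP[tz zd] z1.
  have B y : t <= y <= z -> inball (s + w') (c y).
    move=> /andP[ty yz]; apply: Hd; rewrite ger0_norm ?subr_ge0 // ltrBlDl.
    exact: le_lt_trans zd.
  split; first by have [] := B z ltac:(by rewrite (ltW tz) lexx).
  have := rv_derive_bounded (c := chart a \o c) (dc := vel a c) (K := w') (ltW tz) _ _ (ltW w0).
  move=> /(_ _ _) F.
  have {}F : `|(chart a \o c) z - (chart a \o c) t| <= w' * (z - t).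
    apply: F => y yt.
      exact: (geodesic_derive gc (B y yt).1).
    have [|cy ry] := B y; first by case/andP: yt => ? ?; rewrite !ltW.
    by apply: velb => //; exact: lt_trans sw.
  have -> : w' * z = w' * (z - t) + w' * t by ring.
  rewrite /= in F.
  rewrite -[chart a (c z)](subrK (chart a (c t))) -addrA.
  by apply: le_trans (ler_normD _ _) _; exact: lerD.
- move=> t /andP[t0 t1] H.
  have ct : chart_dom a (c t).
    have cl := closed_inball sw.
    have cl' : closed (c @^-1` [set m | chart_dom a m /\ `|chart a m - x0| <= s + w']).
      by apply: preimage_closed => // y _; exact: (geodesic_cts gc).
    suff : (c @^-1` [set m | chart_dom a m /\ `|chart a m - x0| <= s + w']) t by move=> [].
    rewrite closure_id in cl'; rewrite cl' => B Bt.
    have [de de0 Hd] := nbhs_R_ex Bt.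
    pose z := Num.max 0 (t - de / 2).
    have zt : z < t by rewrite /z gt_max t0 /= ltrBlDr ltrDl divr_gt0.
    have z0 : 0 <= z by rewrite /z le_max lexx.
    exists z; split.
      have [cz uz] := H z ltac:(by rewrite z0).
      split=> //; apply: ltW; apply: near0 uz; by rewrite z0 (le_trans (ltW zt)).
    apply: Hd; rewrite ler0_norm ?subr_le0 ?ltW // opprB ltrBlDl -ltrBlDr /z lt_max; apply/orP; right.
    by rewrite ltrD2l ltrN2 ltr_pdivrMr // mulr2n mulrDr mulr1 ltrDl.
  split=> //; apply: (limit_norm_le (f := chart a \o c)) => //.
    exact: (is_derive_rv_cts (geodesic_derive gc ct)).
  move=> z /andP[z0 zt] /=; have [_ uz] := H z ltac:(by rewrite z0).
  by apply: le_trans uz _; rewrite ler_pM2l // ltW.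
Qed.

Lemma two_geodesics_local c1 c2 e1 e2 : geodesic g c1 -> geodesic g c2 ->
  has_speed2 g c1 e1 -> has_speed2 g c2 e2 -> e1 <= lam * w ^+ 2 -> e2 <= lam * w ^+ 2 ->
  inball (r / 2) (c1 0) -> inball (r / 2) (c2 0) ->
  forall t, 0 <= t <= 1 ->
  let D0 := chart a (c1 0) - chart a (c2 0) in let P0 := vel a c1 0 - vel a c2 0 in
  `|chart a (c1 t) - chart a (c2 t) - D0 - t *: P0| <= 2^-1 * (`|D0| + `|P0|) /\
  `|vel a c1 t - vel a c2 t - P0| <= 2^-1 * (`|D0| + `|P0|).
Proof.
move=> g1 g2 s1 s2 l1 l2 i1 i2; have r0 := gb_r gb; have wr := lp_wr lp.
have w0 : 0 < w by case: (lp_w lp).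
have ww : r / 2 + w < r by lra.
have S1 := stay_in_ball g1 s1 w0 l1 i1 ww; have S2 := stay_in_ball g2 s2 w0 l2 i2 ww.
have B1 z : 0 <= z <= 1 -> [/\ `|(chart a \o c1) z - x0| < r,
     chart_geodesic (metric g a) (chart a \o c1) (vel a c1) z & `|vel a c1 z| <= w].
  by move=> z01; have [[cz _] B _ D] := S1 z z01; split; [exact: B|exact: geodesic_chart|exact: D].
have B2 z : 0 <= z <= 1 -> [/\ `|(chart a \o c2) z - x0| < r,
     chart_geodesic (metric g a) (chart a \o c2) (vel a c2) z & `|vel a c2 z| <= w].
  by move=> z01; have [[cz _] B _ D] := S2 z z01; split; [exact: B|exact: geodesic_chart|exact: D].
exact: (two_geodesics gb (lp_w lp) B1 B2).
Qed.

(** A choice from [complete_metric]; the constant curve is the default when p lies outside the chart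
    domain of a. *)
Definition geo p v : R -> M :=
  sval (cid (match pselect (chart_dom a p) return exists c : R -> M, chart_dom a p ->
    [/\ geodesic g c, c 0 = p & derive1 (chart a \o c) 0 = v] with
    | left h => let: ex_intro c Hc := gcomp v h in ex_intro _ c (fun _ => Hc)
    | right h => ex_intro _ (fun=> p) (fun h' => False_ind _ (h h')) end)).

Lemma geoP p v : chart_dom a p -> [/\ geodesic g (geo p v), geo p v 0 = p & vel a (geo p v) 0 = v].
Proof. by rewrite /geo; case: cid. Qed.

Arguments geoP [p] v _.

Lemma geo_speed2 p v : chart_dom a p -> has_speed2 g (geo p v) (bil (metric g a (chart a p)) v v).
Proof.
move=> ap; have [gg g0 gv] := geoP v ap.
by have := has_speed2_at gg (t := 0) (a := a); rewrite g0 gv; exact.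
Qed.

Arguments geo_speed2 [p] v _.

(** Shooting. The end point map [E] differs from a translation by a 1/2-Lipschitz map. Instead of
    iterating a contraction, |E v - Z| is minimized over a compact ball: the Newton step v1 at the
    minimizer would halve the value, so the minimum is 0. *)
Lemma short_geodesic y z : inball (r / 4) y -> inball (r / 4) z ->
  K * (2 * `|chart a z - chart a y|) ^+ 2 <= lam * w ^+ 2 ->
  exists c, [/\ geodesic g c, c 0 = y, c 1 = z & `|vel a c 0| <= 2 * `|chart a z - chart a y|].
Proof.
move=> [ay yr] [az zr]; set d := `|_ - _| => dw.
have r0 := gb_r gb; have K0 := gb_K gb; have l0 := gb_lam gb; have wr := lp_wr lp.
have w0 : 0 < w by case: (lp_w lp).
have d0 : 0 <= d by exact: normr_ge0.
have yr' : `|chart a y - x0| < r by lra.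
have yr2 : inball (r / 2) y by split => //; lra.
pose Y := chart a y; pose Z := chart a z.
have sp v : `|v| <= 2 * d -> bil (metric g a (chart a y)) v v <= lam * w ^+ 2.
  move=> v2; apply: le_trans dw; apply: le_trans (ler_norm _) _.
  apply: le_trans (gb_up gb v v yr') _; rewrite -mulrA ler_wpM2l ?(ltW K0) //.
  by rewrite expr2 ler_pM.
have ww : r / 2 + w < r by lra.
have ST (v : V) : `|v| <= 2 * d -> forall t, 0 <= t <= 1 ->
    [/\ inball (r / 2 + w) (geo y v t), `|chart a (geo y v t) - x0| < r & `|vel a (geo y v) t| <= w].
  move=> v2 t t01; have [g1 g10 _] := geoP v ay.
  by have [] := stay_in_ball g1 (geo_speed2 v ay) w0 (sp v v2) (s := r / 2) ltac:(by rewrite g10) ww t01.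
pose E v := chart a (geo y v 1).
have i1 : 0 <= (1 : R) <= 1 by rewrite ler01 lexx.
have EL v v' : `|v| <= 2 * d -> `|v'| <= 2 * d -> `|E v - E v' - (v - v')| <= 2^-1 * `|v - v'|.
  move=> v2 v2'; have [g1 g10 g1v] := geoP v ay; have [g2 g20 g2v] := geoP v' ay.
  have := two_geodesics_local g1 g2 (geo_speed2 v ay) (geo_speed2 v' ay) (sp v v2) (sp v' v2') _ _ i1.
  rewrite g10 g20 g1v g2v => /(_ yr2 yr2) /= [+ _].
  by rewrite subrr normr0 add0r subr0 scale1r.
have E0 v : `|v| <= 2 * d -> `|E v - Y - v| <= 2^-1 * `|v|.
  move=> v2; have [g1 g10 g1v] := geoP v ay.
  have sw := lp_w lp.
  have B1 t : 0 <= t <= 1 -> [/\ `|(chart a \o geo y v) t - x0| < r,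
     chart_geodesic (metric g a) (chart a \o geo y v) (vel a (geo y v)) t & `|vel a (geo y v) t| <= w].
    by move=> t01; have [[cz _] B D] := ST v v2 t t01; split; [exact: B|exact: geodesic_chart|exact: D].
  (* The second geodesic of the comparison is the constant one at Y. *)
  have B2 (t : R) : 0 <= t <= 1 -> [/\ `|(fun=> Y) t - x0| < r,
     chart_geodesic (metric g a) (fun=> Y) (fun=> 0) t & `|(fun=> 0 : V) t| <= w].
    move=> t01; split => //; last by rewrite normr0 ltW.
    split; first exact: is_derive_cst.
    by rewrite (_ : - _ = 0); [exact: is_derive_cst|rewrite -(scale0r (0 : V)) GamvZl scale0r oppr0 scale0r].
  have [+ _] := two_geodesics gb sw B1 B2 i1.
  by rewrite /= g10 g1v subrr normr0 !subr0 add0r scale1r.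
have [v0 v02 Ev0] : exists2 v0, `|v0| <= 2 * d & E v0 = Z.
  pose B : set V := [set v | `|v| <= 2 * d].
  have B0 : B !=set0 by exists 0; rewrite /B /= normr0 mulr_ge0.
  have cB : compact B.
    apply: bounded_closed_compact.
      exists (2 * d); split=> [|N N1 v /= vd]; first exact: num_real.
      exact: le_trans vd (ltW N1).
    apply: (@preimage_closed _ _ (fun y : V => `|y|) [set z : R | z <= 2 * d]); last exact: closed_le.
    by move=> v _; exact: norm_continuous.
  have cf : {within B, continuous (fun v => `|E v - Z|)}.
    apply/subspace_continuousP => v Bv; apply/cvgrPdist_le => e e0.
    have e2 : 0 < e / 2 by rewrite divr_gt0.
    rewrite near_withinE; near=> v' => Bv'.
    apply: le_trans (ler_dist_dist _ _) _.
    have -> : E v - Z - (E v' - Z) = (E v - E v' - (v - v')) + (v - v').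
      by rewrite opprB addrA subrK subrK.
    apply: le_trans (ler_normD _ _) _.
    have := EL v v' Bv Bv'.
    have : `|v - v'| <= e / 2.
      by apply: ltW; near: v'; exact: near_dist.
    by move: (`|v - v'|) (`|_ - _|) => *; lra.
  have [v0 Bv0 Hm] := EVT_min_rV B0 cB cf; rewrite inE in Bv0.
  (* The Newton step stays in the ball of radius 2 d: |Z - Y| is d and the error in [E0] is at most
     |v0| / 2 <= d. *)
  exists v0 => //; pose v1 := v0 + (Z - E v0).
  have v1d : `|v1| <= 2 * d.
    have -> : v1 = (Z - Y) - (E v0 - Y - v0).
      by apply/rowP => i; rewrite !mxE; ring.
    apply: le_trans (ler_normB _ _) _; have := E0 v0 Bv0; rewrite -/d.
    by have : `|v0| <= 2 * d := Bv0; move: (`|E v0 - Y - v0|) (`|v0|) => *; lra.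
  have := Hm v1; rewrite inE => /(_ v1d) /=.
  have := EL v1 v0 v1d Bv0.
  have -> : v1 - v0 = Z - E v0 by rewrite /v1 addrC addrA addNr add0r.
  have -> : E v1 - E v0 - (Z - E v0) = E v1 - Z by rewrite opprB addrA subrK.
  rewrite [X in _ <= _ * X -> _]distrC => H1 H2.
  have : `|E v0 - Z| <= 0 by move: H1 H2; move: (`|E v1 - Z|) (`|E v0 - Z|) (normr_ge0 (E v0 - Z)) => *; lra.
  by rewrite normr_le0 subr_eq0 => /eqP.
have [g1 g10 g1v] := geoP v0 ay.
exists (geo y v0); split => //; last by rewrite g1v.
have [[c1 _] _ _] := ST v0 v02 1 i1.
exact: (inball_inj c1 az Ev0).
Unshelve. all: by end_near. Qed.

(* Energies are not integrated: a bound on the energy of a curve y is the increment of any h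
   with [g(y', y') <= h']. *)
Definition below_energy (e : R) (Y Z : V) : Prop := forall (t0 : R) (y1 dy1 y2 dy2 : R -> V) (h1 dh1 h2 dh2 : R -> R),
  0 <= t0 <= 1 ->
  (forall t, 0 <= t <= t0 -> [/\ `|y1 t - x0| < r, is_derive t 1 y1 (dy1 t), is_derive t 1 h1 (dh1 t) &
      bil (metric g a (y1 t)) (dy1 t) (dy1 t) <= dh1 t]) ->
  (forall t, t0 <= t <= 1 -> [/\ `|y2 t - x0| < r, is_derive t 1 y2 (dy2 t), is_derive t 1 h2 (dh2 t) &
      bil (metric g a (y2 t)) (dy2 t) (dy2 t) <= dh2 t]) ->
  y1 0 = Y -> y1 t0 = y2 t0 -> y2 1 = Z -> e <= (h1 t0 - h1 0) + (h2 1 - h2 t0).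

(** The geodesic of [short_geodesic], calibrated on both pieces of the competitor. One break is
    allowed because the competitors in the triangle inequality for short legs have one. *)
Lemma minimal_geodesic y z : inball rho y -> inball rho z ->
  exists c e, [/\ geodesic g c, has_speed2 g c e, c 0 = y, c 1 = z & below_energy e (chart a y) (chart a z)].
Proof.
move=> iy iz; have rr := lp_rhor lp; have K0 := gb_K gb; have wr := lp_wr lp; have r0 := gb_r gb.
have w0 : 0 < w by case: (lp_w lp).
have [ay yr] := iy; have [az zr] := iz.
have yr' : `|chart a y - x0| < r by lra.
set d := `|chart a z - chart a y|.
have d2 : d <= 2 * rho.
  have -> : d = `|(chart a z - x0) - (chart a y - x0)| by rewrite opprB addrA subrK.
  by apply: le_trans (ler_normB _ _) _; lra.
have dw : K * (2 * d) ^+ 2 <= lam * w ^+ 2.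
  apply: le_trans (lp_bvp lp); rewrite ler_wpM2l ?(ltW K0) // lerXn2r ?nnegrE //.
  - by rewrite mulr_ge0 ?normr_ge0.
  - by rewrite mulr_ge0 // ltW // (lp_rho0 lp).
  - lra.
have [c [gc c0 c1 v0]] := short_geodesic (inball_le rr iy) (inball_le rr iz) dw.
have ca0 : chart_dom a (c 0) by rewrite c0.
have ce := has_speed2_at gc ca0; set e := bil _ _ _ in ce.
have ew : e <= lam * w ^+ 2.
  apply: le_trans dw; apply: le_trans (ler_norm _) _; rewrite /e c0.
  apply: le_trans (gb_up gb _ _ yr') _; rewrite -mulrA ler_wpM2l ?(ltW K0) //.
  by rewrite expr2 ler_pM.
have ww : rho + w < r by lra.
have ic0 : inball rho (c 0) by rewrite c0.
have ST := stay_in_ball gc ce w0 ew ic0 ww.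
exists c, e; split => // t0 y1 dy1 y2 dy2 h1 dh1 h2 dh2 /andP[t00 t01] H1 H2 e1 e2 e3.
have Hc t : 0 <= t <= 1 -> [/\ `|(chart a \o c) t - x0| < r, chart_geodesic (metric g a) (chart a \o c) (vel a c) t,
     `|vel a c t| <= w & bil (metric g a ((chart a \o c) t)) (vel a c t) (vel a c t) = e].
  move=> t01'; have [[ct _] B _ D] := ST t t01'.
  by split; [exact: B|exact: geodesic_chart|exact: D|exact: ce].
have F1 := calibrate (chart_cm g a) gb (lp_w lp) (lexx 0) t00 t01 (fun t tt => Hc t (itv_trans tt t01)) H1.
have Hc2 t : t0 <= t <= 1 -> 0 <= t <= 1 by move=> /andP[tt ->]; rewrite (le_trans t00).
have F2 := calibrate (chart_cm g a) gb (lp_w lp) t00 t01 (lexx 1) (fun t tt => Hc t (Hc2 t tt)) H2.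
move: F1 F2; rewrite e1 e3 e2 /= c0 c1 !subrr !bil0r.
have d00 : dot (0 : V) 0 = 0 by rewrite /dot big1 // => i _; rewrite mxE mul0r.
rewrite d00 !mulr0 !subr0.
by move: (2 * bil _ _ _ - _) => X *; lra.
Qed.

Lemma minimal_geodesic_curve y z e (h dh : R -> R) (Y dY : R -> V) : below_energy e (chart a y) (chart a z) ->
  (forall t, 0 <= t <= 1 -> [/\ `|Y t - x0| < r, is_derive t 1 Y (dY t), is_derive t 1 h (dh t) &
      bil (metric g a (Y t)) (dY t) (dY t) <= dh t]) ->
  Y 0 = chart a y -> Y 1 = chart a z -> e <= h 1 - h 0.
Proof.
move=> be H Y0 Y1; have := be 1 Y dY Y dY h dh h dh.
rewrite ler01 lexx subrr addr0; apply => // t /andP[t1 t2].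
by apply: H; rewrite (le_trans ler01 t1).
Qed.

End Ball.
End LocalGeodesics.

(** * Geodesics on the manifold *)

Section GeodesicFlow.
Context {R : realType} {n : nat} {M : topologicalType}.
Local Notation V := 'rV[R]_n.+1.
Variables (A : smooth_atlas R n M) (g : riemannian_metric A).
Hypothesis Mh : hausdorff_space M.
Hypothesis gcomp : complete_metric g.
Implicit Types (a b : chart_index A) (p q m : M) (c : R -> M).

Lemma jacobianE a b p (v : V) j : chart_dom a p -> chart_dom b p ->
  (v *m 'J (transition a b) (chart a p)) 0 j =
  \sum_i v 0 i * partial i (fun x => chart b (chart_inv a x) 0 j) (chart a p).
Proof.
move=> pa pb; have dT := transition_diff pa pb.
have oU := overlap_open (a := a) (b := b).
have Up : (chart a @` (chart_dom a `&` chart_dom b)) (chart a p) by exists p.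
pose l : R -> V := fun s : R => chart a p + s *: v.
have dl : is_derive (0 : R) 1 l v.
  apply/is_derive_rv => k; rewrite (_ : (fun s => _) = fun s : R => chart a p 0 k + s * v 0 k); last first.
    by apply/funext => s; rewrite !mxE.
  have H : is_derive (0 : R) 1 (fun s : R => chart a p 0 k + s * v 0 k) (0 + (1 * v 0 k + 0 * 0)).
    apply: (dD (dC _ _)); exact: (dM (dI _) (dC _ _)).
  by apply: dEq H _; rewrite add0r mul1r mulr0 addr0.
have l0 : l 0 = chart a p by rewrite /l scale0r addr0.
have dl' : differentiable l 0 by apply/derivable1_diffP; case: dl.
have dT' : differentiable (transition a b : V -> V) (l 0) by rewrite l0.
have H : is_derive (0 : R) 1 ((transition a b : V -> V) \o l) (v *m 'J (transition a b) (chart a p)).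
  rewrite -l0; have [_ el] := dl.
  apply: DeriveDef; first by apply/derivable1_diffP; exact: differentiable_comp.
  have dTl : differentiable ((transition a b : V -> V) \o l) 0 by exact: differentiable_comp.
  rewrite (deriveE _ dTl) (diff_comp dl' dT') /= -(deriveEjacobian _ dT') (deriveE _ dT').
  by rewrite -[in RHS]el (deriveE _ dl').
have H1 := (is_derive_rv _ _ _).1 H j.
have Ul : (chart a @` (chart_dom a `&` chart_dom b)) (l 0) by rewrite l0.
have H2 := smooth_curve oU (@transition_smooth _ _ _ A a b j) Ul dl.
by have [_ <-] := H1; have [_ E2] := H2; rewrite -l0 -E2.
Qed.

Lemma cvg_rv {T : Type} (F : set_system T) {FF : Filter F} (f : T -> V) (l : V) :
  (forall j, (fun t => f t 0 j) @ F --> l 0 j) -> f @ F --> l.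
Proof.
move=> H; apply: (cvgrPdist_le (F := F) (FF := FF) _ _).2 => e e0.
have : \forall t \near F, forall j, `|l 0 j - f t 0 j| <= e.
  apply: (@filter_forall _ _ (fun j t => `|l 0 j - f t 0 j| <= e) _ FF) => j.
  exact: (cvgrPdist_le (F := F) (FF := FF) _ _).1 (H j) e e0.
apply: filterS => t Ht; apply: rv_norm_le; first exact: ltW.
by move=> j; rewrite !mxE.
Qed.

Lemma cvg_coord {T : Type} (F : set_system T) {FF : Filter F} (f : T -> V) (l : V) j :
  f @ F --> l -> (fun t => f t 0 j) @ F --> l 0 j.
Proof.
move=> H; apply: (cvgrPdist_le (F := F) (FF := FF) _ _).2 => e e0.
have := (cvgrPdist_le (F := F) (FF := FF) _ _).1 H e e0.
apply: filterS => t Ht; apply: le_trans Ht.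
by have := rv_coord_le (l - f t) j; rewrite !mxE.
Qed.

Lemma cvg_dist0 {T : Type} (F : set_system T) {FF : Filter F} (f : T -> V) (l : V) :
  f @ F --> l -> (fun t => `|f t - l|) @ F --> (0 : R).
Proof.
move=> H; apply: (cvgrPdist_le (F := F) (FF := FF) _ _).2 => e e0.
apply: filterS ((cvgrPdist_le (F := F) (FF := FF) _ _).1 H e e0) => t.
by rewrite sub0r normrN normr_id distrC.
Qed.

(** The filter on parameters covers two uses: neighbourhoods of an initial velocity give continuity
    of exp, and a constant family gives uniqueness of geodesics. *)
Definition flow_cvg (F : set_system V) (C : V -> R -> M) c (s : R) : Prop :=
  (C^~ s) @ F --> c s /\ forall b, chart_dom b (c s) -> (fun i => vel b (C i) s) @ F --> vel b c s.

Section Family.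
Variables (F : set_system V) (C : V -> R -> M) (c : R -> M).
Hypothesis FF : ProperFilter F.
Hypothesis gC : forall i, geodesic g (C i).
Hypothesis gc : geodesic g c.

Lemma flow_cvgI a s : chart_dom a (c s) -> (C^~ s) @ F --> c s ->
  (fun i => vel a (C i) s) @ F --> vel a c s -> flow_cvg F C c s.
Proof.
move=> ca Cc Cv; split; first exact: Cc.
move=> b cb.
have Na : \forall i \near F, chart_dom a (C i s) /\ chart_dom b (C i s).
  have := Cc (chart_dom a `&` chart_dom b); apply.
  by apply: open_nbhs_nbhs; split; [apply: openI; exact: chart_dom_open|].
have cha : (fun i => chart a (C i s)) @ F --> chart a (c s).
  by apply: (cvg_comp _ _ Cc); exact: chart_continuous.
apply: cvg_rv => j.
have E : \forall i \near F, \sum_k vel a (C i) s 0 k * partial k (fun x => chart b (chart_inv a x) 0 j) (chart a (C i s))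
   = vel b (C i) s 0 j.
  by apply: filterS Na => i [ia ib]; rewrite (vel_change (gC i) ia ib) jacobianE.
apply: (cvg_trans (near_eq_cvg E)).
rewrite (vel_change gc ca cb) jacobianE //.
apply: (@cvg_sumR R _ F _) => k; apply: cvgM; first exact: cvg_coord.
have oU := overlap_open (a := a) (b := b).
apply: (cvg_comp (fun i => chart a (C i s)) (partial k (fun x => chart b (chart_inv a x) 0 j)) cha).
apply: (smooth_continuous (U := chart a @` (chart_dom a `&` chart_dom b))).
  by apply: smooth_partial => //; exact: transition_smooth.
by exists (c s).
Qed.

(** For a short time both geodesics stay in one chart; after rescaling to [0, 1],
    [two_geodesics_local] bounds their deviation at s' by twice their deviation [D] at s. *)
Lemma flow_cvg_step e s s' q a r lam K w rho : local_pkg g q a r lam K w rho ->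
  has_speed2 g c e -> s < s' -> (s' - s) ^+ 2 * (e + 1) <= lam * w ^+ 2 ->
  inball q a (r / 2) (c s) -> flow_cvg F C c s -> flow_cvg F C c s'.
Proof.
move=> lp se ss small ins [Cc Cv]; have r0 := gb_r (lp_gb lp).
have w0 : 0 < w by case: (lp_w lp).
have [ca _] := ins; have Cva := Cv a ca.
have e0 := has_speed2_ge0 se.
have cha : (fun i => chart a (C i s)) @ F --> chart a (c s).
  by apply: (cvg_comp _ _ Cc); exact: chart_continuous.
have Nin : \forall i \near F, inball q a (r / 2) (C i s) by exact: (Cc _ (open_inball ins)).
pose ei i := bil (metric g a (chart a (C i s))) (vel a (C i) s) (vel a (C i) s).
have eic : ei @ F --> e.
  rewrite -(se a s ca) bilE.
  rewrite (_ : ei = fun i => \sum_k \sum_l vel a (C i) s 0 k * vel a (C i) s 0 l * metric g a (chart a (C i s)) k l); last first.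
    by apply/funext => i; rewrite /ei bilE.
  apply: (@cvg_sumR R _ F _) => k; apply: (@cvg_sumR R _ F _) => l.
  apply: cvgM; first by apply: cvgM; exact: cvg_coord.
  apply: (cvg_comp (fun i => chart a (C i s)) (fun x => metric g a x k l) cha).
  by apply: (smooth_continuous (@metric_smooth _ _ _ _ g a k l)); exact: chart_codI.
have Ne : \forall i \near F, ei i <= e + 1.
  have := (cvgrPdist_le (F := F) (FF := @filter_filter _ F FF) _ _).1 eic 1 ltr01.
  apply: filterS => i; rewrite ler_norml => /andP[+ _]; move: (ei i) => z; lra.
pose d := s' - s; have d0 : 0 < d by rewrite subr_gt0.
pose D := fun i => `|chart a (C i s) - chart a (c s)| + d * `|vel a (C i) s - vel a c s|.
have D0 : D @ F --> (0 : R).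
  have N1 : (fun i => `|chart a (C i s) - chart a (c s)|) @ F --> (0 : R).
    exact: cvg_dist0.
  have N2 : (fun i => `|vel a (C i) s - vel a c s|) @ F --> (0 : R).
    exact: cvg_dist0.
  have := cvgD N1 (cvgM (cvg_cst d) N2); rewrite mulr0 addr0; exact.
have S1 c1 e1 : geodesic g c1 -> has_speed2 g c1 e1 -> e1 <= e + 1 ->
   [/\ geodesic g (fun t => c1 (d * t + s)), has_speed2 g (fun t => c1 (d * t + s)) (d ^+ 2 * e1) &
       d ^+ 2 * e1 <= lam * w ^+ 2].
  move=> g1 s1 l1; split; [exact: geodesic_affine|exact: has_speed2_affine|].
  by apply: le_trans small; rewrite ler_wpM2l // sqr_ge0.
have [gc' sc' lc'] := S1 c e gc se ltac:(by rewrite lerDl ler01).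
have ds : d * 1 + s = s' by rewrite mulr1 subrK.
have d0s : d * 0 + s = s by rewrite mulr0 add0r.
have i01 : (0 : R) <= (1 : R) <= (1 : R) by rewrite ler01 /= lexx.
have wr := lp_wr lp.
have ww : r / 2 + w < r by lra.
have [cs' _ _ _] := stay_in_ball Mh lp gc' sc' w0 lc' (s := r / 2) ltac:(by rewrite /= d0s) ww i01.
rewrite ds in cs'; have [ca' _] := cs'.
have Nf : \forall i \near F, chart_dom a (C i s') /\
    `|chart a (C i s') - chart a (c s')| <= 2 * D i /\ d * `|vel a (C i) s' - vel a c s'| <= 2 * D i.
  apply: filterS2 Nin Ne => i Hi He.
  have si : has_speed2 g (C i) (ei i) by apply: has_speed2_at (gC i) _; case: Hi.
  have [gi' si' li'] := S1 _ _ (gC i) si He.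
  have ini : inball q a (r / 2) (C i (d * 0 + s)) by rewrite d0s.
  have inc : inball q a (r / 2) (c (d * 0 + s)) by rewrite d0s.
  have [ii _ _ _] := stay_in_ball Mh lp gi' si' w0 li' ini ww i01.
  have [B1 B2] := two_geodesics_local Mh lp gi' gc' si' sc' li' lc' ini inc i01.
  rewrite ds in ii B1; have [iia _] := ii.
  have va c1 x : geodesic g c1 -> chart_dom a (c1 (d * x + s)) ->
      vel a (fun t => c1 (d * t + s)) x = d *: vel a c1 (d * x + s) by move=> g1; exact: vel_affine g1.
  move: B1 B2; rewrite (va (C i) 0 (gC i)) ?(va (C i) 1 (gC i)) ?(va c 0 gc) ?(va c 1 gc) ?ds ?d0s;
    try first [exact: ca'|exact: iia|exact: ca|exact: (proj1 Hi)].
  rewrite -!scalerBr scale1r => B1 B2; rewrite !(normrZ d) (gtr0_norm d0) in B1 B2.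
  have T1 (X Y : V) : `|X| <= `|X - Y| + `|Y| by rewrite -{1}(subrK Y X) ler_normD.
  have T2 : `|(chart a (C i s) - chart a (c s)) + d *: (vel a (C i) s - vel a c s)| <= D i.
    by apply: le_trans (ler_normD _ _) _; rewrite normrZ (gtr0_norm d0).
  have Dn : 2^-1 * (`|chart a (C i s) - chart a (c s)| + d * `|vel a (C i) s - vel a c s|) = D i / 2.
    by rewrite mulrC.
  have T3 : d * `|vel a (C i) s - vel a c s| <= D i by rewrite /D lerDr.
  split; first exact: iia.
  split.
    have T1' (X Y Z : V) : `|X| <= `|X - Y - Z| + `|Y + Z| by rewrite -addrA -opprD T1.
    have Dp : 0 <= D i by exact: le_trans (normr_ge0 _) T2.
    apply: le_trans (T1' _ _ _) _; apply: le_trans (lerD B1 T2) _.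
    by rewrite Dn; move: (D i) Dp => Di; lra.
  have Dp : 0 <= D i by exact: le_trans (normr_ge0 _) T2.
  have H2 := ler_wpM2l (ltW d0) (T1 (vel a (C i) s' - vel a c s') (vel a (C i) s - vel a c s)).
  rewrite mulrDr in H2; apply: le_trans H2 _; apply: le_trans (lerD B2 T3) _.
  by rewrite Dn; move: (D i) Dp => Di; lra.
have D2 : (fun i => 2 * D i) @ F --> (0 : R).
  by rewrite -(mulr0 2); apply: cvgM => //; exact: cvg_cst.
have sq (G : V -> V) (l : V) k : 0 < k -> (\forall i \near F, k * `|G i - l| <= 2 * D i) -> G @ F --> l.
  move=> k0 HG; apply: (cvgrPdist_le (F := F) (FF := @filter_filter _ F FF) _ _).2 => z z0.
  have := (cvgrPdist_le (F := F) (FF := @filter_filter _ F FF) _ _).1 D2 (k * z) (mulr_gt0 k0 z0).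
  apply: filterS2 HG => i H1; rewrite sub0r normrN => H2.
  rewrite distrC -(ler_pM2l k0); apply: le_trans H1 _; exact: le_trans (ler_norm _) H2.
have cha' : (fun i => chart a (C i s')) @ F --> chart a (c s').
  by apply: (sq _ _ 1) => //; apply: filterS Nf => i [_ [H _]]; rewrite mul1r.
have cv' : (fun i => vel a (C i) s') @ F --> vel a c s'.
  by apply: (sq _ _ d) => //; apply: filterS Nf => i [_ [_ H]].
apply: (flow_cvgI ca') => //.
have E : \forall i \near F, chart_inv a (chart a (C i s')) = C i s'.
  by apply: filterS Nf => i [H _]; rewrite chartK.
apply: (cvg_trans (near_eq_cvg E)); rewrite -(chartK ca').
apply: (cvg_comp (fun i => chart a (C i s')) (chart_inv a) cha').
by apply: chart_inv_continuous; exact: chart_codI.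
Qed.

Lemma flow_cvg_end e : has_speed2 g c e -> flow_cvg F C c 0 -> flow_cvg F C c 1.
Proof.
move=> se; have e0 := has_speed2_ge0 se.
apply: (interval_chain (T := fun s s' => flow_cvg F C c s -> flow_cvg F C c s')).
  by move=> x y z _ _ _ _ H1 H2 /H1; exact: H2.
move=> t0; move: (t0 : R) => t _ {t0}; have [a [r [lam [K [w [rho lp]]]]]] := local_pkg_exists g (c t).
have r0 := gb_r (lp_gb lp); have l0 := gb_lam (lp_gb lp).
have w0 : 0 < w by case: (lp_w lp).
have int : inball (c t) a (r / 2) (c t).
  by split; [exact: lp_dom lp|rewrite subrr normr0 divr_gt0].
have [d1 d10 H1] := nbhs_R_ex (geodesic_cts gc (x := t) (open_inball int)).
pose k := lam * w ^+ 2 / (e + 1).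
have k0 : 0 < k by rewrite /k divr_gt0 ?mulr_gt0 ?exprn_gt0 //; lra.
pose d2 := Num.min 1 k.
have d20 : 0 < d2 by rewrite /d2 lt_min ltr01.
have d21 : d2 <= 1 by rewrite /d2 ge_min lexx.
have d2k : d2 <= k by rewrite /d2 ge_min lexx orbT.
exists (Num.min d1 (d2 / 2)); first by rewrite lt_min d10 divr_gt0.
move=> x y _ xy _; rewrite !lt_min => /andP[x1 x2] /andP[_ y2].
apply: (flow_cvg_step lp se xy); last exact: (H1 x x1).
have H : y - x <= d2 by move: x2 y2; rewrite !ltr_norml => /andP[? ?] /andP[? ?]; lra.
have Hp : 0 <= y - x by rewrite subr_ge0 ltW.
have H2 : (y - x) ^+ 2 <= k.
  by apply: le_trans d2k; rewrite expr2; apply: le_trans (H); rewrite ler_piMr //; exact: le_trans H d21.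
have -> : lam * w ^+ 2 = k * (e + 1) by rewrite /k divfK //; apply: lt0r_neq0; lra.
by apply: ler_wpM2r => //; lra.
Qed.

End Family.

(** Continuous dependence applied to the constant family c1: it converges to c2 at time 0, hence at
    time 1, and limits in M are unique. *)
Lemma geodesic_unique a c1 c2 : geodesic g c1 -> geodesic g c2 -> chart_dom a (c1 0) ->
  c1 0 = c2 0 -> vel a c1 0 = vel a c2 0 -> c1 1 = c2 1.
Proof.
move=> g1 g2 a1 e12 v12; have a2 : chart_dom a (c2 0) by rewrite -e12.
have [H _] : flow_cvg (nbhs (0 : V)) (fun=> c1) c2 1.
  have F1 := flow_cvg_end (F := nbhs (0 : V)) (C := fun=> c1) (nbhs_pfilter _) (fun=> g1) g2 (has_speed2_at g2 a2).
  apply: F1; apply: (flow_cvgI (F := nbhs (0 : V)) (C := fun=> c1) (nbhs_pfilter _) (fun=> g1) g2 a2).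
    by rewrite e12; exact: cvg_cst.
  by rewrite v12; exact: cvg_cst.
by apply: (cvg_unique (T := M) Mh) H; exact: cvg_cst.
Qed.

Lemma geo_cts a p : chart_dom a p -> continuous (fun v => geo gcomp a p v 1).
Proof.
move=> ap v0.
have [H _] : flow_cvg (nbhs v0) (geo gcomp a p) (geo gcomp a p v0) 1; last exact: H.
have [g0 e0 _] := geoP gcomp v0 ap.
have gg v : geodesic g (geo gcomp a p v) by case: (geoP gcomp v ap).
have F1 := flow_cvg_end (F := nbhs (v0 : V)) (C := geo gcomp a p) (nbhs_pfilter _) gg g0 (@geo_speed2 _ _ _ _ g gcomp a p v0 ap).
apply: (F1).
have a0 : chart_dom a (geo gcomp a p v0 0) by rewrite e0.
apply: (flow_cvgI (F := nbhs (v0 : V)) (C := geo gcomp a p) (nbhs_pfilter _) gg g0 a0).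
  rewrite (_ : (fun v => _) = fun=> geo gcomp a p v0 0); first exact: cvg_cst.
  by apply/funext => v; have [_ -> _] := geoP gcomp v ap; rewrite e0.
rewrite (_ : (fun v => _) = id).
  by have [_ _ ->] := geoP gcomp v0 ap; exact: cvg_id.
by apply/funext => v; have [_ _ ->] := geoP gcomp v ap.
Qed.

End GeodesicFlow.

(** * The Hopf-Rinow theorem *)

Section Legs.
Context {R : realType} {n : nat} {M : topologicalType}.
Local Notation V := 'rV[R]_n.+1.
Variables (A : smooth_atlas R n M) (g : riemannian_metric A).
Hypothesis Mh : hausdorff_space M.
Hypothesis gcomp : complete_metric g.
Implicit Types (a : chart_index A) (p q m x y z : M) (c : R -> M) (b L : R).

(** b is only an upper bound for the length, which makes the relation monotone in b. *)
Definition leg y z b : Prop :=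
  exists c e, [/\ geodesic g c, has_speed2 g c e, c 0 = y, c 1 = z & 0 <= b /\ e <= b ^+ 2].

(** Broken geodesics with a bound L for the total length; they take the place of piecewise smooth
    curves and of the distance function. *)
Inductive reach y : M -> R -> Prop :=
| reach_leg z b : leg y z b -> reach y z b
| reach_snoc x z L b : reach y x L -> leg x z b -> reach y z (L + b).

Lemma leg_ge0 y z b : leg y z b -> 0 <= b. Proof. by move=> [c [e [_ _ _ _ []]]]. Qed.

Lemma leg_refl x b : 0 <= b -> leg x x b.
Proof.
move=> b0; have [a ax] := chart_cover A x; have [g0 e0 _] := geoP gcomp (0 : V) ax.
have s0 := @geo_speed2 _ _ _ _ g gcomp a x 0 ax.
exists (fun s => geo gcomp a x 0 (0 * s + 0)), (0 ^+ 2 * bil (metric g a (chart a x)) 0 0); split.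
- exact: geodesic_affine.
- exact: has_speed2_affine.
- by rewrite mul0r addr0.
- by rewrite mul0r addr0.
- by rewrite expr0n mul0r sqr_ge0.
Qed.

Lemma leg_le y z b b' : b <= b' -> leg y z b -> leg y z b'.
Proof.
move=> bb [c [e [gc se c0 c1 [b0 eb]]]]; exists c, e; split=> //; split; first exact: le_trans bb.
by apply: le_trans eb _; rewrite lerXn2r // nnegrE (le_trans b0).
Qed.

Lemma leg_sym y z b : leg y z b -> leg z y b.
Proof.
move=> [c [e [gc se c0 c1 [b0 eb]]]]; exists (fun s => c (-1 * s + 1)), ((-1) ^+ 2 * e); split.
- exact: geodesic_affine.
- exact: has_speed2_affine.
- by rewrite mulr0 add0r.
- by rewrite mulr1 addNr.
- by rewrite sqrrN expr1n mul1r.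
Qed.

Lemma leg_split y z b t : leg y z b -> 0 <= t <= 1 -> exists2 x, leg y x (t * b) & leg x z ((1 - t) * b).
Proof.
move=> [c [e [gc se c0 c1 [b0 eb]]]] /andP[t0 t1]; exists (c t).
  exists (fun s => c (t * s + 0)), (t ^+ 2 * e); split; rewrite ?mulr0 ?mulr1 ?addr0 //.
  - exact: geodesic_affine.
  - exact: has_speed2_affine.
  - by rewrite mulr_ge0 // exprMn ler_wpM2l ?sqr_ge0.
exists (fun s => c ((1 - t) * s + t)), ((1 - t) ^+ 2 * e); split; rewrite ?mulr0 ?mulr1 ?add0r ?subrK //.
- exact: geodesic_affine.
- exact: has_speed2_affine.
- by rewrite mulr_ge0 ?subr_ge0 // exprMn ler_wpM2l ?sqr_ge0.
Qed.

Lemma reach_ge0 y z L : reach y z L -> 0 <= L.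
Proof. by elim=> [{}z b /leg_ge0 //|x {}z {}L b _ L0 /leg_ge0 b0]; exact: addr_ge0. Qed.

Lemma reach_trans y x z L L' : reach y x L -> reach x z L' -> reach y z (L + L').
Proof.
move=> H; elim=> [{}z b l|u {}z {}L' b _ IH l]; first exact: reach_snoc H l.
by rewrite addrA; exact: reach_snoc IH l.
Qed.

Lemma reach_split y z L r : reach y z L -> 0 <= r <= L ->
  exists2 x, reach y x r & reach x z (L - r).
Proof.
move=> H; elim: H r => [{}z b l|x {}z {}L b Hx IH l] r /andP[r0 rL].
  have := leg_ge0 l; rewrite le_eqVlt => /predU1P[b0|b0].
    have r00 : r = 0 by apply/eqP; rewrite eq_le r0 b0 rL.
    by exists y; [apply/reach_leg; exact: leg_refl|rewrite r00 subr0; exact: reach_leg].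
  have [x l1 l2] := leg_split l (t := r / b) ltac:(by rewrite divr_ge0 ?(ltW b0) //= ler_pdivrMr // mul1r).
  exists x; first by apply: reach_leg; rewrite divfK ?gt_eqF in l1.
  by apply: reach_leg; rewrite mulrBl mul1r divfK ?gt_eqF in l2.
have [rl|lr] := leP r L.
  have [u H1 H2] := IH r ltac:(by rewrite r0 rl); exists u => //.
  by rewrite addrAC; exact: reach_snoc H2 l.
have b0 : 0 < b by move: lr rL; lra.
have [u l1 l2] := leg_split l (t := (r - L) / b) ltac:(rewrite divr_ge0 ?subr_ge0 ?(ltW b0) ?(ltW lr) //= ler_pdivrMr // mul1r; lra).
rewrite divfK ?gt_eqF // in l1; rewrite mulrBl mul1r divfK ?gt_eqF // in l2.
exists u; first by rewrite -(subrK L r) addrC; exact: reach_snoc Hx l1.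
by apply: reach_leg; rewrite (_ : L + b - r = b - (r - L)) //; ring.
Qed.

Lemma leg0_eq y z : leg y z 0 -> y = z.
Proof.
move=> [c [e [gc se c0 c1 [_ e0]]]]; have [a [r [lam [K [w [rho lp]]]]]] := local_pkg_exists g y.
have r0 := gb_r (lp_gb lp); have l0 := gb_lam (lp_gb lp); have ay := lp_dom lp.
have iy : inball y a (r / 2) (c 0) by rewrite c0; split; rewrite ?subrr ?normr0 ?divr_gt0.
have i01 : (0 : R) <= (1 : R) <= (1 : R) by rewrite ler01 /= lexx.
have S w' : 0 < w' -> w' < r / 2 -> chart_dom a z /\ `|chart a z - chart a y| <= w'.
  move=> w0 wr; have ew : e <= lam * w' ^+ 2.
    by apply: le_trans e0 _; rewrite expr0n mulr_ge0 ?sqr_ge0 // ltW.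
  have [[az _] _ H _] := stay_in_ball Mh lp gc se w0 ew iy ltac:(move: wr; lra) i01.
  by rewrite c0 c1 in az H; split=> //; rewrite mulr1 in H.
have [az _] := S (r / 4) ltac:(lra) ltac:(lra).
apply: (inball_inj ay az); apply/eqP; rewrite eq_sym -subr_eq0 -normr_le0.
apply/ler_addgt0Pl => w' w0; rewrite addr0.
have [wr|wr] := ltP w' (r / 2); first by case: (S w' w0 wr).
by case: (S (r / 4) ltac:(lra) ltac:(lra)) => _ H; apply: le_trans H _; lra.
Qed.

Lemma leg_geo a p q b : chart_dom a p -> leg p q b <->
  0 <= b /\ exists2 v, bil (metric g a (chart a p)) v v <= b ^+ 2 & geo gcomp a p v 1 = q.
Proof.
move=> ap; split.
  move=> [c [e [gc se c0 c1 [b0 eb]]]]; split=> //; exists (vel a c 0).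
    by move: eb; rewrite -(se a 0) c0.
  have [g0 e0 v0] := geoP gcomp (vel a c 0) ap.
  by rewrite -c1; apply: (geodesic_unique Mh g0 gc (a := a)); rewrite ?e0 ?c0 ?v0.
move=> [b0 [v vb <-]]; have [g0 e0 v0] := geoP gcomp v ap.
exists (geo gcomp a p v), (bil (metric g a (chart a p)) v v); split=> //.
exact: (@geo_speed2 _ _ _ _ g gcomp a p v ap).
Qed.

Definition leg_triangle (de : R) x : Prop := forall y z b1 b2,
  leg x y b1 -> leg y z b2 -> b1 + b2 <= de -> leg x z (b1 + b2).

(** Two short legs form a broken competitor for the geodesic of [minimal_geodesic], all of it inside
    one ball. *)
Lemma leg_triangle_near q : exists2 de : R, 0 < de & \forall x \near q, leg_triangle de x.
Proof.
have [a [r [lam [K [w [rho lp]]]]]] := local_pkg_exists g q.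
have r0 := gb_r (lp_gb lp); have l0 := gb_lam (lp_gb lp); have rho0 := lp_rho0 lp; have rhor := lp_rhor lp.
pose w' := rho / 4; have w0 : 0 < w' by rewrite divr_gt0.
pose k := Num.min 1 lam; have k0 : 0 < k by rewrite lt_min ltr01.
have k1 : k <= 1 by rewrite ge_min lexx. have kl : k <= lam by rewrite ge_min lexx orbT.
exists (k * w'); first exact: mulr_gt0.
have iq : inball q a (rho / 2) q by split; [exact: lp_dom lp|rewrite subrr normr0 divr_gt0].
apply: filterS (open_inball iq) => x ix y z b1 b2 [c1 [e1 [g1 s1 c10 c11 [b10 eb1]]]]
  [c2 [e2 [g2 s2 c20 c21 [b20 eb2]]]] bd.
have small e b : 0 <= b -> b <= b1 + b2 -> e <= b ^+ 2 -> e <= lam * w' ^+ 2.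
  move=> b0 bb eb; apply: le_trans eb _.
  have kw : 0 <= k * w' by exact: mulr_ge0 (ltW k0) (ltW w0).
  have B1 : b ^+ 2 <= (k * w') ^+ 2 by rewrite lerXn2r // ?nnegrE //; exact: le_trans bb bd.
  have B2 : k ^+ 2 <= lam by apply: le_trans kl; rewrite expr2 ler_piMl // ltW.
  by apply: le_trans B1 _; rewrite exprMn ler_wpM2r ?sqr_ge0.
have E1 := small _ _ b10 ltac:(by rewrite lerDl) eb1.
have E2 := small _ _ b20 ltac:(by rewrite lerDr) eb2.
have R1 : rho / 2 + w' < r by rewrite /w'; clear -rho0 rhor r0; lra.
have R2 : rho / 2 + w' + w' < r by rewrite /w'; clear -rho0 rhor r0; lra.
have S1 := stay_in_ball Mh lp g1 s1 w0 E1 (s := rho / 2) ltac:(by rewrite c10) R1.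
have i01 : (0 : R) <= (1 : R) <= (1 : R) by rewrite ler01 /= lexx.
have iy : inball q a (rho / 2 + w') (c2 0) by rewrite c20 -c11; case: (S1 _ i01).
have S2 := stay_in_ball Mh lp g2 s2 w0 E2 iy R2.
have iz : inball q a rho z.
  have [H _ _ _] := S2 _ i01; rewrite c21 in H; apply: inball_le H; rewrite /w'; lra.
have ixr : inball q a rho x by apply: inball_le ix; lra.
have [c [e [gc se cc0 cc1 be]]] := minimal_geodesic Mh gcomp lp ixr iz.
exists c, e; split=> //; split; first exact: addr_ge0.
(* Each leg is run in a time proportional to its length bound plus ep, which nearly minimizes the
   energy of the broken path; ep keeps both times positive and tends to 0 at the end. *)
have main ep : 0 < ep -> e <= (b1 + b2) * (b1 + b2 + 2 * ep).
  move=> ep0; pose S := b1 + b2 + 2 * ep; have S0 : 0 < S by rewrite /S; lra.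
  pose t0 := (b1 + ep) / S; have t00 : 0 < t0 by rewrite divr_gt0 //; lra.
  have t0E : 1 - t0 = (b2 + ep) / S by rewrite /t0 /S; field; apply: lt0r_neq0; move: S0; rewrite /S; lra.
  have t01 : 0 < 1 - t0 by rewrite t0E divr_gt0 //; lra.
  pose k1' := t0^-1; pose k2' := (1 - t0)^-1.
  have := be t0 (chart a \o (fun t => c1 (k1' * t + 0))) (fun t => k1' *: vel a c1 (k1' * t + 0))
     (chart a \o (fun t => c2 (k2' * t + - (k2' * t0)))) (fun t => k2' *: vel a c2 (k2' * t + - (k2' * t0)))
     (fun t => (k1' ^+ 2 * e1) * t) (fun=> k1' ^+ 2 * e1) (fun t => (k2' ^+ 2 * e2) * t) (fun=> k2' ^+ 2 * e2).
  have dlin (kk t : R) : is_derive t 1 (fun s : R => kk * s) kk.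
    by apply: dEq (dZ kk (dI t)) _; rewrite mulr1.
  move=> /(_ ltac:(by rewrite (ltW t00) /=; move: t01; lra)) H.
  have {}H := H _ _ _ _ _.
  have Ha : forall t, 0 <= t <= t0 -> 0 <= k1' * t + 0 <= 1.
    move=> t /andP[ta tb]; rewrite addr0 mulr_ge0 ?invr_ge0 ?(ltW t00) //=.
    by rewrite mulrC ler_pdivrMr // mul1r.
  have Hb : forall t, t0 <= t <= 1 -> 0 <= k2' * t + - (k2' * t0) <= 1.
    move=> t /andP[ta tb]; rewrite -mulrBr mulr_ge0 ?invr_ge0 ?(ltW t01) ?subr_ge0 //=.
    by rewrite mulrC ler_pdivrMr // mul1r lerD2r.
  have {}H := H ltac:(move=> t /Ha ht; have [[cd _] B _ _] := S1 _ ht; split;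
     [exact: B|apply: chart_affine_derive (geodesic_cts g1) cd _ (geodesic_derive g1 cd)|exact: dlin|
      by rewrite bilZl bilZr /= (s1 a) // mulrA expr2]).
  have {}H := H ltac:(move=> t /Hb ht; have [[cd _] B _ _] := S2 _ ht; split;
     [exact: B|apply: chart_affine_derive (geodesic_cts g2) cd _ (geodesic_derive g2 cd)|exact: dlin|
      by rewrite bilZl bilZr /= (s2 a) // mulrA expr2]).
  have {}H := H ltac:(by rewrite /= mulr0 addr0 c10).
  have {}H := H ltac:(by rewrite /= mulVf ?gt_eqF // addr0 c11 subrr c20).
  have {}H := H ltac:(by rewrite /= mulr1 -[X in X - _]mulr1 -mulrBr mulVf ?gt_eqF // c21).
  have F1 : k1' ^+ 2 * e1 * t0 <= b1 * S.
    have -> : k1' ^+ 2 * e1 * t0 = e1 / (b1 + ep) * S.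
      rewrite /k1' /t0; field; apply/andP; split; apply: lt0r_neq0 => //; lra.
    rewrite ler_pM2r // ler_pdivrMr; last by lra.
    apply: le_trans eb1 _; rewrite expr2 ler_wpM2l //; lra.
  have F2 : k2' ^+ 2 * e2 * (1 - t0) <= b2 * S.
    have -> : k2' ^+ 2 * e2 * (1 - t0) = e2 / (b2 + ep) * S.
      rewrite /k2' t0E; field; apply/andP; split; apply: lt0r_neq0 => //; lra.
    rewrite ler_pM2r // ler_pdivrMr; last by lra.
    apply: le_trans eb2 _; rewrite expr2 ler_wpM2l //; lra.
  rewrite mulrDl -/S; apply: le_trans H _.
  rewrite mulr0 subr0 -mulrBr; exact: lerD F1 F2.
have Bd : 0 <= b1 + b2 by exact: addr_ge0.
apply/ler_addgt0Pr => ep ep0.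
pose d := ep / (2 * (b1 + b2 + 1)); have d0 : 0 < d by rewrite divr_gt0 // mulr_gt0 //; lra.
apply: le_trans (main d d0) _; rewrite mulrDr -expr2 lerD2l.
have -> : (b1 + b2) * (2 * d) = (b1 + b2) / (b1 + b2 + 1) * ep by rewrite /d; field; apply: lt0r_neq0; lra.
by rewrite ler_piMl ?(ltW ep0) // ler_pdivrMr; lra.
Qed.

Lemma leg_triangle_le de de' x : de <= de' -> leg_triangle de' x -> leg_triangle de x.
Proof. by move=> dd H y z b1 b2 l1 l2 bd; apply: H l1 l2 _; exact: le_trans dd. Qed.

Lemma reach_collapse de x z L : leg_triangle de x -> reach x z L -> L <= de -> leg x z L.
Proof.
move=> T; elim=> [{}z b //|y {}z {}L b H IH l Ld].
have LL : L <= de by apply: le_trans Ld; rewrite lerDl; exact: leg_ge0 l.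
exact: T (IH LL) l Ld.
Qed.

End Legs.

Section HopfRinow.
Context {R : realType} {n : nat} {M : topologicalType}.
Local Notation V := 'rV[R]_n.+1.
Variables (A : smooth_atlas R n M) (g : riemannian_metric A).
Hypothesis Mh : hausdorff_space M.
Hypothesis gcomp : complete_metric g.
Implicit Types (a : chart_index A) (p q m x y z : M) (c : R -> M) (b L : R).

Lemma four_term_bound (X1 X2 X3 X4 X d1 d2 d3 d4 e1 e2 e3 e4 ka : R) :
  X1 - X <= d1 -> X2 <= d2 -> X3 <= d3 -> X4 <= d4 -> d1 <= e1 -> d2 <= e2 -> d3 <= e3 -> d4 <= e4 ->
  X = 4 - ka -> e1 + e2 + e3 + e4 <= ka / 2 -> X1 + X2 + (X3 + X4) <= 4 - ka / 2.
Proof. lra. Qed.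

Lemma is_derive_line (x v : V) (t : R) : is_derive t 1 (fun u : R => x + u *: v) v.
Proof.
apply/is_derive_rv => k; rewrite (_ : (fun u : R => _) = fun u : R => x 0 k + u * v 0 k); last first.
  by apply/funext => u; rewrite !mxE.
have H := dD (dC (x 0 k) t) (dM (dI t) (dC (v 0 k) t)).
by apply: dEq H _; rewrite add0r mul1r mulr0 addr0.
Qed.

Lemma bil_parallelogram (G : 'M[R]_n.+1) (u v : V) :
  bil G (u + v) (u + v) = 2 * bil G u u + 2 * bil G v v - bil G (u - v) (u - v).
Proof. by rewrite !(bilDl, bilDr, bilNl, bilNr); ring. Qed.

(* Cutting a corner: the chart segment between points at distance s on either side of it
   has squared length s^2 (|P1 + P2|^2 + o(1)) with |P1 + P2| < 2. *)
Lemma corner_shortcut c1 c2 : geodesic g c1 -> geodesic g c2 -> has_speed2 g c1 1 -> has_speed2 g c2 1 ->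
  c1 0 = c2 0 ->
  (exists2 a : chart_index A, chart_dom a (c1 0) & vel a c1 0 = vel a c2 0) \/
  (forall ep : R, 0 < ep -> exists s b : R, [/\ 0 < s, s < ep, b < 2 * s & leg g (c1 (- s)) (c2 s) b]).
Proof.
move=> g1 g2 s1 s2 e12; have [a [r [lam [K [w [rho lp]]]]]] := local_pkg_exists g (c1 0).
have gb := lp_gb lp; have a1 := lp_dom lp; have K0 := gb_K gb.
have rr := lp_rhor lp; have rho0 := lp_rho0 lp; have r0 := gb_r gb.
have a2 : chart_dom a (c2 0) by rewrite -e12.
set P1 := vel a c1 0; set P2 := vel a c2 0.
have [PE|PN] := eqVneq P1 P2; first by left; exists a.
right=> ep ep0; set x0 := chart a (c1 0) in gb.
set G := metric g a x0.
have cm := chart_cm g a; have Ux : chart_cod a x0 by exact: chart_codI.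
have half (z : R) : 0 < z -> z / 2 < z by lra.
have rearr (X Y Z T : V) : X - -1 *: Y - (Z + T) = (X - T) + (Y - Z).
  by apply/rowP => k; rewrite !mxE; move: (X 0 k) (Y 0 k) (Z 0 k) (T 0 k) => *; ring.
have G1 : bil G P1 P1 = 1 by exact: s1.
have G2 : bil G P2 P2 = 1 by rewrite /G /x0 e12; exact: s2.
set ka := bil G (P1 - P2) (P1 - P2).
have ka0 : 0 < ka by apply: (cm_pos cm Ux); rewrite subr_eq0.
pose P := P1 + P2.
have GP : bil G P P = 4 - ka.
  by rewrite /P bil_parallelogram G1 G2 -/ka; move: (ka) => z; ring.
have GP0 : 0 <= 4 - ka by rewrite -GP; exact: (chart_bil_ge0 cm _ Ux).
pose Q := `|P| ^+ 2 + 2 * `|P| + 1.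
have Q0 : 0 < Q by rewrite /Q ltr_wpDl // addr_ge0 ?sqr_ge0 // mulr_ge0.
(* eta bounds both the distance to the corner and the relative error W of [D s]. The last entry
   makes the four error terms of [key], which add up to K Q eta, at most ka / 2. *)
pose eta := Num.min (Num.min 1 rho) (ka / 2 / (K * Q)).
have eta0 : 0 < eta by rewrite /eta !lt_min ltr01 rho0 /= !divr_gt0 // mulr_gt0.
have eta1 : eta <= 1 by rewrite /eta !ge_min lexx.
have etar : eta <= rho by rewrite /eta !ge_min lexx orbT.
have etaK : K * Q * eta <= ka / 2.
  by rewrite mulrC -ler_pdivlMr ?mulr_gt0 // /eta ge_min lexx orbT.
have near_c c : geodesic g c -> c 0 = c1 0 -> exists2 de : R, 0 < de & forall t, `|t| < de ->
    inball (c1 0) a eta (c t) /\ `|vel a c t - vel a c 0| <= eta / 2.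
  move=> gc c0; have ca : chart_dom a (c 0) by rewrite c0.
  have ic : inball (c1 0) a eta (c 0) by rewrite c0; split; rewrite ?subrr ?normr0.
  have [d1 d10 H1] := nbhs_R_ex (geodesic_cts gc (x := 0) (open_inball ic)).
  have [_ dv] := geodesic_chart gc ca.
  have cv := is_derive_rv_cts dv.
  have [d2 d20 H2] := nbhs_R_ex ((cvgrPdist_le (F := nbhs (0 : R)) (FF := nbhs_filter _) _ _).1 cv (eta / 2) ltac:(by rewrite divr_gt0)).
  exists (Num.min d1 d2); first by rewrite lt_min d10.
  move=> t; rewrite lt_min => /andP[t1 t2]; split; first by apply: H1; rewrite subr0.
  by rewrite distrC; apply: H2; rewrite subr0.
have [d1 d10 N1] := near_c c1 g1 erefl.
have [d2 d20 N2] := near_c c2 g2 (esym e12).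
pose s := Num.min (Num.min d1 d2) ep / 2.
have m0 : 0 < Num.min (Num.min d1 d2) ep by rewrite !lt_min d10 d20.
have s0 : 0 < s by rewrite divr_gt0.
have sm : s < Num.min (Num.min d1 d2) ep by exact: half.
have [sd1 sd2 sep] : [/\ s < d1, s < d2 & s < ep].
  by move: sm; rewrite !lt_min => /andP[/andP[-> ->] ->].
have rs t : 0 <= t <= s -> `|t| < d1 /\ `|t| < d2.
  by move=> /andP[t0 ts]; rewrite ger0_norm //; split; exact: le_lt_trans ts _.
pose D := fun t : R => chart a (c2 t) - chart a (c1 (-1 * t + 0)).
pose dD := fun t : R => vel a c2 t - -1 *: vel a c1 (-1 * t + 0).
have n1 t : `|t| < d1 -> `|-1 * t + 0| < d1 by rewrite addr0 mulN1r normrN.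
have HD t : 0 <= t <= s -> is_derive t 1 D (dD t).
  move=> /rs[t1 t2]; have [[c2a _] _] := N2 t t2; have [[c1a _] _] := N1 _ (n1 t t1).
  have h2 := geodesic_derive g2 c2a.
  have h1 := chart_affine_derive (geodesic_cts g1) c1a (geodesic_derive g1 c1a).
  exact: is_deriveB h2 h1.
have DsE : `|D s - s *: P| <= s * eta.
  pose E := fun t : R => D t - t *: P.
  have HE t : 0 <= t <= s -> is_derive t 1 E (dD t - P).
    move=> ts; apply: is_deriveB (HD t ts) _.
    have Hl : is_derive (t : R) 1 (fun u : R => u *: P) (1 *: P + t *: 0).
      rewrite scale1r scaler0 addr0 (_ : (fun u : R => u *: P) = fun u : R => 0 + u *: P).
        exact: is_derive_line.
      by apply/funext => u; rewrite add0r.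
    by rewrite scale1r scaler0 addr0 in Hl.
  have := rv_derive_bounded (ltW s0) HE (K := eta) _ (ltW eta0).
  have E0 : E 0 = 0 by rewrite /E /D mulr0 addr0 e12 subrr scale0r subr0.
  rewrite E0 !subr0 mulrC; apply => t /andP[t0 ts]; have [t1 t2] := rs t ltac:(by rewrite !ltW).
  have [_ B2] := N2 t t2; have [_ B1] := N1 _ (n1 t t1).
  have -> : dD t - P = (vel a c2 t - P2) + (vel a c1 (-1 * t + 0) - P1).
    exact: rearr.
  by apply: le_trans (ler_normD _ _) _; apply: le_trans (lerD B2 B1) _; rewrite -splitr.
have [s1' s2'] := rs s ltac:(by rewrite (ltW s0) lexx).
have [iz _] := N2 s s2'; have [iy _] := N1 _ (n1 s s1').
have yE : -1 * s + 0 = - s by rewrite mulN1r addr0.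
rewrite yE in iy n1.
have [c [e [gc se c0 c1e be]]] := minimal_geodesic Mh gcomp lp (inball_le etar iy) (inball_le etar iz).
have DE : D s = chart a (c2 s) - chart a (c1 (- s)) by rewrite /D yE.
have Wn : exists2 W : V, `|W| <= eta & D s = s *: (P + W).
  exists (s^-1 *: (D s - s *: P)).
    by rewrite normrZ ger0_norm ?invr_ge0 ?(ltW s0) // mulrC ler_pdivrMr // mulrC.
  by rewrite scalerDr scalerA mulfV ?gt_eqF // scale1r addrC subrK.
have [W Wle DW] := Wn.
have er (z : R) : z < eta -> z < r by move=> ze; apply: lt_le_trans ze _; apply: le_trans etar _; apply: le_trans rr _; rewrite ler_pdivrMr // ler_peMr ?(ltW r0) // ler1n.
have key (y : V) : `|y - x0| < eta -> bil (metric g a y) (D s) (D s) <= s ^+ 2 * (4 - ka / 2).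
  move=> yx; have yr : `|y - x0| < r by apply: lt_le_trans yx _; apply: le_trans etar _; apply: le_trans rr _; rewrite ler_pdivrMr // ler_peMr ?(ltW r0) // ler1n.
  rewrite DW bilZl bilZr mulrA -expr2 ler_wpM2l ?sqr_ge0 //.
  have xx : `|x0 - x0| < r by rewrite subrr normr0.
  have B1 := gb_gL gb P P xx yr.
  have B2 := gb_up gb P W yr; have B3 := gb_up gb W W yr; have B4 := gb_up gb W P yr.
  rewrite (bilDl (metric g a y) P W) (bilDr (metric g a y) P W P) (bilDr (metric g a y) P W W).
  have C1 : K * `|y - x0| * `|P| * `|P| <= K * eta * `|P| * `|P|.
    by rewrite !ler_wpM2r // ler_wpM2l ?(ltW K0) // ltW.
  have C2 : K * `|P| * `|W| <= K * `|P| * eta by rewrite ler_wpM2l // mulr_ge0 // ltW.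
  have C3 : K * `|W| * `|W| <= K * eta.
    rewrite -mulrA ler_wpM2l ?(ltW K0) //; apply: le_trans (ler_pM _ _ Wle Wle) _ => //.
    by rewrite ler_piMl // ltW.
  have C4 : K * `|W| * `|P| <= K * eta * `|P| by rewrite ler_wpM2r // ler_wpM2l // ltW.
  have EQ : K * Q * eta = K * eta * `|P| * `|P| + K * `|P| * eta + (K * eta * `|P|) + K * eta by rewrite /Q; ring.
  apply: (four_term_bound (le_trans (ler_norm _) B1) (le_trans (ler_norm _) B2) (le_trans (ler_norm _) B4)
    (le_trans (ler_norm _) B3) C1 C2 C4 C3); [exact: GP|by rewrite -EQ].
pose b := s * Num.sqrt (4 - ka / 2).
have k2 : 0 <= 4 - ka / 2.
  by apply: le_trans GP0 _; rewrite lerD2l lerN2 ltW // half.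
exists s, b; split=> //.
  rewrite /b mulrC ltr_pM2r //.
  have -> : (2 : R) = Num.sqrt (2 ^+ 2) by rewrite sqrtr_sqr ger0_norm.
  rewrite ltr_sqrt ?exprn_gt0 // (_ : 2 ^+ 2 = 4); [by rewrite ltrBlDr ltrDl divr_gt0|by rewrite -natrX].
exists c, e; split => //; split; first by rewrite mulr_ge0 ?sqrtr_ge0 // ltW.
rewrite /b exprMn sqr_sqrtr //.
pose Y := fun t : R => chart a (c1 (- s)) + t *: D s.
have HY t : is_derive (t : R) 1 Y (D s).
  exact: is_derive_line.
have Yb t : 0 <= t <= 1 -> `|Y t - x0| < eta.
  move=> t01; apply: segment_in_ball t01; first by case: iy.
  by rewrite DE [_ + (_ - _)]addrC subrK; case: iz.
have := minimal_geodesic_curve (h := fun t => (s ^+ 2 * (4 - ka / 2)) * t) (dh := fun=> s ^+ 2 * (4 - ka / 2))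
   (Y := Y) (dY := fun=> D s) be.
rewrite mulr1 mulr0 subr0; apply => //.
- move=> t t01; split; [exact: er (Yb t t01)|exact: HY| |exact: key (Yb t t01)].
  by apply: dEq (dZ _ (dI t)) _; rewrite mulr1.
- by rewrite /Y scale0r addr0.
- by rewrite /Y scale1r DE [LHS]addrC subrK.
Qed.

Lemma bil_cts (G : 'M[R]_n.+1) : continuous (fun v : V => bil G v v).
Proof.
move=> v; rewrite (_ : (fun v : V => _) = fun v : V => \sum_i \sum_j v 0 i * v 0 j * G i j); last first.
  by apply/funext => u; rewrite bilE.
rewrite /continuous_at; apply: (@cvg_sumR R V (nbhs v) (nbhs_filter v)) => i.
apply: (@cvg_sumR R V (nbhs v) (nbhs_filter v)) => j.
apply: cvgM; last exact: cvg_cst.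
by apply: cvgM; exact: coord_continuous.
Qed.

Lemma bil_ball_compact (G : 'M[R]_n.+1) (r : R) : (forall v : V, v != 0 -> 0 < bil G v v) ->
  compact [set v : V | bil G v v <= r].
Proof.
move=> Gp; have [m m0 Hm] := sphere_min Gp.
apply: bounded_closed_compact.
  exists (Num.max 1 (r / m)); split; first exact: num_real.
  move=> N; rewrite gt_max => /andP[N1 Nr] v /= vr.
  have vN : `|v| ^+ 2 <= N ^+ 2.
    apply: le_trans (_ : r / m <= _); first by rewrite ler_pdivlMr // mulrC; exact: le_trans vr.
    apply: le_trans (ltW Nr) _; rewrite expr2 ler_peMl ?(ltW N1) //; exact: le_trans ler01 (ltW N1).
  by rewrite -(ler_pXn2r (n := 2)) // nnegrE //; exact: le_trans ler01 (ltW N1).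
apply: (@preimage_closed _ _ (fun v : V => bil G v v) [set x | x <= r]); last exact: closed_le.
by move=> v _; exact: bil_cts.
Qed.

Lemma closed_equalizer {T : topologicalType} (f1 f2 : T -> M) : continuous f1 -> continuous f2 ->
  closed [set t | f1 t = f2 t].
Proof.
move=> c1 c2 t Ht /=; apply: Mh => B1 B2 n1 n2.
have : nbhs t (f1 @^-1` B1 `&` f2 @^-1` B2) by apply: filterI; [exact: c1|exact: c2].
by move=> /Ht[t' [/= e [b1 b2]]]; exists (f1 t'); split=> //; rewrite e.
Qed.

Section Centre.
Variables (a : chart_index A) (p : M).
Hypothesis ap : chart_dom a p.
Local Notation G := (metric g a (chart a p)).
Local Notation len v := (Num.sqrt (bil G v v)).

Lemma exp_compact (r : R) : compact [set x | leg g p x r].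
Proof.
have [r0|r0] := leP 0 r; last first.
  rewrite (_ : [set x | _] = set0); first exact: compact0.
  by apply/seteqP; split=> // x /= /leg_ge0; rewrite leNgt r0.
have -> : [set x | leg g p x r] = (fun v => geo gcomp a p v 1) @` [set v : V | bil G v v <= r ^+ 2].
  apply/seteqP; split=> x /=.
    by move=> /(leg_geo Mh gcomp _ _ ap)[_ [v vr <-]]; exists v.
  by move=> [v vr <-]; apply/(leg_geo Mh gcomp _ _ ap); split=> //; exists v.
apply: continuous_compact.
  by apply: continuous_subspaceT; exact: geo_cts.
exact: bil_ball_compact (cm_pos (chart_cm g a) (chart_codI ap)).
Qed.

(** Every point has a neighbourhood with its own bound; the closed ball is compact, being the image
    under exp of a compact set, so one bound serves all of it. *)
Lemma uniform_triangle (r : R) : exists2 de : R, 0 < de & forall x, leg g p x r -> leg_triangle g de x.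
Proof.
have := (compact_near_coveringP _).1 (exp_compact (r := r)) R (0 : R)^'+ (fun de x => leg_triangle g de x) _.
case.
  move=> x _; have [de de0 H] := leg_triangle_near Mh gcomp x.
  exists ([set x | leg_triangle g de x], [set t : R | t < de]) => /=; first split=> //.
    exact: nbhs_right_lt.
  by move=> [y t] /= [Hy td]; exact: leg_triangle_le (ltW td) Hy.
move=> e /= e0 H; exists (e / 2); first by rewrite divr_gt0.
by apply: H => /=; rewrite ?divr_gt0 // sub0r normrN ger0_norm ?divr_ge0 ?(ltW e0) // ltr_pdivrMr // ltr_pMr // ltr1n.
Qed.

Definition reach_leg_upto (r : R) : Prop := forall q L, reach g p q L -> L <= r -> leg g p q L.

Lemma len_cts : continuous (fun v => len v).
Proof. by move=> v; apply: (cvg_comp (fun v => bil G v v)); [exact: bil_cts|exact: sqrt_continuous]. Qed.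

(** Here b is the speed itself, so that the geodesic can be rescaled to unit speed for
    [corner_shortcut]. *)
Definition exact_leg y z b : Prop :=
  exists c, [/\ geodesic g c, has_speed2 g c (b ^+ 2), c 0 = y, c 1 = z & 0 <= b].

Lemma leg_exact y z b : leg g y z b -> exists2 b', b' <= b & exact_leg y z b'.
Proof.
move=> [c [e [gc se c0 c1 [b0 eb]]]]; have e0 := has_speed2_ge0 se; exists (Num.sqrt e).
  by rewrite -(ger0_norm b0) -sqrtr_sqr ler_wsqrtr.
by exists c; rewrite sqr_sqrtr.
Qed.

Lemma exact_leg_leg y z b : exact_leg y z b -> leg g y z b.
Proof. by move=> [c [gc se c0 c1 b0]]; exists c, (b ^+ 2). Qed.

Lemma leg_between c b (s t : R) : geodesic g c -> has_speed2 g c (b ^+ 2) -> 0 <= b -> s <= t ->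
  leg g (c s) (c t) ((t - s) * b).
Proof.
move=> gc se b0 st; exists (fun u => c ((t - s) * u + s)), ((t - s) ^+ 2 * b ^+ 2); split.
- exact: geodesic_affine.
- exact: has_speed2_affine.
- by rewrite mulr0 add0r.
- by rewrite mulr1 subrK.
- by split; rewrite ?exprMn // mulr_ge0 // subr_ge0.
Qed.

(** The pairs (v, w) in two closed balls with equal images under exp at p and at q form a compact
    set, on which the sum of the lengths attains its minimum. The second leg is shot from q and then
    reversed. *)
Lemma leg_minimizer q (r d : R) : 0 <= r -> 0 <= d ->
  (exists x (c c' : R), [/\ leg g p x c, leg g x q c', c <= r & c' <= d]) ->
  exists x (c c' : R), [/\ exact_leg p x c, exact_leg x q c', c <= r, c' <= d &
    forall x2 (c2 c2' : R), leg g p x2 c2 -> leg g x2 q c2' -> c2 <= r -> c2' <= d -> c + c' <= c2 + c2'].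
Proof.
move=> r0 d0 [x [c [c' [l1 l2 cr cd]]]]; have [b bq] := chart_cover A q.
set G1 := metric g a (chart a p); pose G2 := metric g b (chart b q).
pose E1 v := geo gcomp a p v 1; pose E2 w := geo gcomp b q w 1.
pose N1 (v : V) := Num.sqrt (bil G1 v v); pose N2 (v : V) := Num.sqrt (bil G2 v v).
pose K := ([set v : V | bil G1 v v <= r ^+ 2] `*` [set w : V | bil G2 w w <= d ^+ 2]) `&`
          [set vw : V * V | E1 vw.1 = E2 vw.2].
have G1p := cm_pos (chart_cm g a) (chart_codI ap); have G2p := cm_pos (chart_cm g b) (chart_codI bq).
have cK : compact K.
  apply: compact_closedI; first by apply: compact_setX; exact: bil_ball_compact.
  apply: closed_equalizer => vw.
    by apply: (cvg_comp (fun z : V * V => z.1) E1); [exact: cvg_fst|exact: geo_cts].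
  by apply: (cvg_comp (fun z : V * V => z.2) E2); [exact: cvg_snd|exact: geo_cts].
have mk y e e' : leg g p y e -> leg g y q e' -> e <= r -> e' <= d ->
    exists2 vw, K vw & N1 vw.1 <= e /\ N2 vw.2 <= e'.
  move=> h1 /leg_sym h2 er ed; have e0 := leg_ge0 h1; have e0' := leg_ge0 h2.
  move/(leg_geo Mh gcomp _ _ ap) : h1 => [_ [v vr Ev]].
  move/(leg_geo Mh gcomp _ _ bq) : h2 => [_ [w wr Ew]].
  exists (v, w); split=> /=; rewrite ?/E1 ?/E2 ?Ev ?Ew //.
  - by split; [apply: le_trans vr _|apply: le_trans wr _]; rewrite lerXn2r // nnegrE.
  - by rewrite -(ger0_norm e0) -sqrtr_sqr ler_wsqrtr.
  - by rewrite -(ger0_norm e0') -sqrtr_sqr ler_wsqrtr.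
have K0 : K !=set0 by have [vw Kvw _] := mk _ _ _ l1 l2 cr cd; exists vw.
have Nc : {within K, continuous (fun vw : V * V => N1 vw.1 + N2 vw.2)}.
  apply: continuous_subspaceT => vw; apply: cvgD.
    by apply: (cvg_comp (fun z : V * V => z.1) N1); [exact: cvg_fst|exact: len_cts].
  apply: (cvg_comp (fun z : V * V => z.2) N2); first exact: cvg_snd.
  by apply: (cvg_comp (fun v => bil G2 v v)); [exact: bil_cts|exact: sqrt_continuous].
have [[v w] Kvw Hm] := compact_EVT_min K0 cK Nc.
rewrite inE in Kvw; have [[/= vr wr] Evw] := Kvw.
have p1 : 0 <= bil G1 v v := chart_bil_ge0 (chart_cm g a) v (chart_codI ap).
have p2 : 0 <= bil G2 w w := chart_bil_ge0 (chart_cm g b) w (chart_codI bq).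
have [g1 e1 _] := geoP gcomp v ap; have [g2 e2 _] := geoP gcomp w bq.
exists (E1 v), (N1 v), (N2 w); split.
- exists (geo gcomp a p v); rewrite sqr_sqrtr //; split=> //; [exact: geo_speed2|exact: sqrtr_ge0].
- exists (fun s => geo gcomp b q w (-1 * s + 1)); split.
  + exact: geodesic_affine.
  + have := has_speed2_affine (k := -1) (b := 1) g2 (@geo_speed2 _ _ _ _ g gcomp b q w bq).
    by rewrite sqrrN expr1n mul1r /N2 sqr_sqrtr.
  + by rewrite mulr0 add0r -/(E2 w).
  + by rewrite mulr1 addNr.
  + exact: sqrtr_ge0.
- by rewrite -(ger0_norm r0) -sqrtr_sqr ler_wsqrtr.
- by rewrite -(ger0_norm d0) -sqrtr_sqr ler_wsqrtr.
- move=> x2 c2 c2' h1 h2 h3 h4; have [vw Kv [b1 b2]] := mk _ _ _ h1 h2 h3 h4.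
  by apply: le_trans (Hm vw _) _; [rewrite inE|exact: lerD].
Qed.

(** Take a shortest path p - x - q among those with first leg at most r and second leg at most 3 de.
    If it turned at x, cutting the corner would give a shorter path of the same kind; hence it is a
    single geodesic. *)
Lemma reach_leg_step (r Rad de : R) : 0 < de -> 0 <= r -> r <= Rad ->
  (forall x, leg g p x Rad -> leg_triangle g (3 * de) x) ->
  reach_leg_upto r -> reach_leg_upto (r + de).
Proof.
move=> de0 r0 rR T P q L H Ld; have [Lr|rL] := leP L r; first exact: P.
have [x0 H1 H2] := reach_split gcomp H (r := r) ltac:(by rewrite r0 ltW).
have l1 := P _ _ H1 (lexx r).
have Lde : L - r <= 3 * de by move: Ld; lra.
have l2 : leg g x0 q (L - r) := reach_collapse (T x0 (leg_le rR l1)) H2 Lde.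
have [x1 [c1 [c1' [k1 k1' c1r c1d min1]]]] := leg_minimizer r0 (d := 3 * de) (q := q)
   ltac:(by rewrite mulr_ge0 // ltW) ltac:(by exists x0, r, (L - r)).
have tot : c1 + c1' <= L.
  by apply: le_trans (min1 _ _ _ l1 l2 (lexx r) Lde) _; rewrite addrC subrK.
(* If the second leg is longer than 2 de, the break point moves by de along it, and the first part
   is still within r. With c' <= 2 de there is room de for the shortened path below. *)
have [x [c [c' [k k' cr c2d cm]]]] : exists x (c c' : R), [/\ exact_leg p x c, exact_leg x q c', c <= r, c' <= 2 * de &
    c + c' = c1 + c1'].
  have [small|big] := leP c1' (2 * de); first by exists x1, c1, c1'.
  have [C [gC sC C0 C1 c0']] := k1'.
  have c1p : 0 < c1' by move: big de0; lra.
  have lA := leg_between (s := 0) (t := de / c1') gC sC c0' ltac:(by rewrite divr_ge0 // ltW).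
  have lB := leg_between (s := de / c1') (t := 1) gC sC c0' ltac:(by rewrite ler_pdivrMr // mul1r; move: big de0; lra).
  rewrite subr0 divfK ?gt_eqF // C0 in lA; rewrite mulrBl mul1r divfK ?gt_eqF // C1 in lB.
  have cr' : c1 + de <= r by move: tot big Ld; lra.
  have lP := P _ _ (reach_snoc (reach_leg (exact_leg_leg k1)) lA) cr'.
  have [e el ke] := leg_exact lP; have [e' el' ke'] := leg_exact lB.
  exists (C (de / c1')), e, e'; split=> //.
  - exact: le_trans cr'.
  - by apply: le_trans el' _; move: c1d; lra.
  have := min1 _ _ _ (exact_leg_leg ke) (exact_leg_leg ke') (le_trans el cr') ltac:(by apply: le_trans el' _; move: c1d de0; lra).
  by move: el el' => *; apply/eqP; rewrite eq_le; apply/andP; split; lra.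
apply: leg_le tot _; rewrite -cm.
have [C1 [g1 s1 C10 C11 c0]] := k; have [C2 [g2 s2 C20 C21 c0']] := k'.
move: (c0); rewrite le_eqVlt => /predU1P[c00|cp].
  have kz := exact_leg_leg k; rewrite -c00 in kz; have px := leg0_eq Mh kz.
  by rewrite px -c00 add0r; exact: exact_leg_leg.
move: (c0'); rewrite le_eqVlt => /predU1P[c00|cp'].
  have kz := exact_leg_leg k'; rewrite -c00 in kz; have px := leg0_eq Mh kz.
  by rewrite -px -c00 addr0; exact: exact_leg_leg.
pose D1 s := C1 (c^-1 * s + 1); pose D2 s := C2 (c'^-1 * s + 0).
have gD1 : geodesic g D1 by exact: geodesic_affine.
have gD2 : geodesic g D2 by exact: geodesic_affine.
have sD1 : has_speed2 g D1 1.
  by have := has_speed2_affine (k := c^-1) (b := 1) g1 s1; rewrite -exprMn mulVf ?gt_eqF // expr1n.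
have sD2 : has_speed2 g D2 1.
  by have := has_speed2_affine (k := c'^-1) (b := 0) g2 s2; rewrite -exprMn mulVf ?gt_eqF // expr1n.
have D10 : D1 0 = x by rewrite /D1 mulr0 add0r.
have D20 : D2 0 = x by rewrite /D2 mulr0 addr0.
have D1c : D1 (- c) = p by rewrite /D1 mulrN mulVf ?gt_eqF // addNr.
have D2c : D2 c' = q by rewrite /D2 mulVf ?gt_eqF // addr0.
have [[b b0 vb]|short] := corner_shortcut gD1 gD2 sD1 sD2 (etrans D10 (esym D20)).
  have e1 : D1 c' = q.
    have ez : c' * 0 + 0 = 0 by rewrite mulr0 addr0.
    have b0' : chart_dom b (D2 0) by rewrite D20 -D10.
    have b1 : chart_dom b (D1 (c' * 0 + 0)) by rewrite ez.
    have b2 : chart_dom b (D2 (c' * 0 + 0)) by rewrite ez.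
    have V1 := vel_affine (k := c') (b := 0) (s := 0) gD1 b1.
    have V2 := vel_affine (k := c') (b := 0) (s := 0) gD2 b2.
    rewrite ez vb in V1; rewrite ez in V2.
    have F0 : D1 (c' * 0 + 0) = D2 (c' * 0 + 0) by rewrite ez D10 D20.
    have := geodesic_unique Mh (geodesic_affine c' 0 gD1) (geodesic_affine c' 0 gD2) b1 F0 (etrans V1 (esym V2)).
    by rewrite mulr1 addr0 D2c.
  exists (fun s => D1 ((c + c') * s + - c)), ((c + c') ^+ 2 * 1); split.
  - exact: geodesic_affine.
  - exact: has_speed2_affine.
  - by rewrite mulr0 add0r.
  - by rewrite mulr1 addrAC subrr add0r.
  - by rewrite mulr1; split => //; exact: addr_ge0.
have [s [b [s0 sm bs lb]]] := short (Num.min (Num.min c c') de) ltac:(by rewrite !lt_min cp cp').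
move: sm; rewrite !lt_min => /andP[/andP[sc sc'] sd].
have lx := leg_between (s := -c) (t := -s) gD1 (b := 1) ltac:(by rewrite expr1n) ler01 ltac:(by rewrite lerN2 ltW).
have ly := leg_between (s := s) (t := c') gD2 (b := 1) ltac:(by rewrite expr1n) ler01 (ltW sc').
rewrite D1c mulr1 opprK in lx; rewrite D2c mulr1 in ly.
have lxr : - s + c <= r by move: cr s0; lra.
(* The two legs have bounds b < 2 s and c' - s, in total less than 2 de + s < 3 de, so they merge
   into one. *)
have lz := T _ (leg_le (le_trans lxr rR) lx) _ _ _ _ lb ly ltac:(move: bs sd c2d; lra).
have := min1 _ _ _ lx lz lxr ltac:(move: bs sd c2d; lra).
by move: cm bs; lra.
Qed.

(** The step [de] is uniform on the ball of radius L, so finitely many applications of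
    [reach_leg_step] suffice. *)
Theorem hopf_rinow q L : reach g p q L -> leg g p q L.
Proof.
move=> H; have L0 := reach_ge0 H.
have [d d0 T] := uniform_triangle L.
pose de := d / 3; have de0 : 0 < de by rewrite divr_gt0.
have d3 : 3 * de = d by rewrite mulrC divfK.
have step k : reach_leg_upto (Num.min (k%:R * de) L).
  elim: k => [|k IH].
    rewrite mul0r (min_idPl L0) => q' L' H' L'0.
    apply: (reach_collapse (T p _) H'); first exact: (leg_refl gcomp p L0).
    exact: le_trans (ltW d0).
  have m0 : 0 <= Num.min (k%:R * de) L by rewrite le_min L0 mulr_ge0 // ltW.
  have mL : Num.min (k%:R * de) L <= L by rewrite ge_min lexx orbT.
  have := reach_leg_step de0 m0 mL; rewrite d3 => /(_ T IH) P q' L' H' L'b; apply: P H' _.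
  apply: le_trans L'b _; rewrite -natr1 mulrDl mul1r.
  have [h|h] := leP (k%:R * de) L; first by rewrite ge_min lexx.
  by rewrite ge_min; apply/orP; right; rewrite lerDl ltW.
have [k kL] : exists k : nat, L <= k%:R * de.
  exists (Num.truncn (L / de)).+1; rewrite -ler_pdivrMr //; exact: ltW (truncnS_gt _).
by apply: (step k) H _; rewrite le_min kL lexx.
Qed.

End Centre.
End HopfRinow.

(** * Symmetric matrices *)

Section Spectral.
Context {R : realType} {n : nat}.
Local Notation m := n.+1.
Local Notation V := 'rV[R]_n.+1.
Implicit Types (S T O Q : 'M[R]_m) (i j k : 'I_m).

Lemma bil_rowE S O i j : (O *m S *m O^T) i j = bil S (row i O) (row j O).
Proof.
rewrite bilE mxE; under eq_bigr => k _ do rewrite mxE big_distrl /=.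
rewrite exchange_big /=; apply: eq_bigr => k _; apply: eq_bigr => l _.
by rewrite !mxE mulrAC.
Qed.

Lemma bil_delta S i j : bil S (delta_mx 0 i) (delta_mx 0 j) = S i j.
Proof.
rewrite bilE (bigD1 i) //= [X in _ + X]big1 ?addr0 => [|k ki]; last first.
  by rewrite big1 // => l _; rewrite !mxE (negbTE ki) andbF !mul0r.
rewrite (bigD1 j) //= [X in _ + X]big1 ?addr0 => [|k kj]; last first.
  by rewrite !mxE (negbTE kj) andbF mulr0 mul0r.
by rewrite !mxE !eqxx !mul1r.
Qed.

Lemma orthogonalE O : O *m O^T = 1%:M <-> forall i j, bil 1%:M (row i O) (row j O) = (i == j)%:R.
Proof.
split=> [H i j|H]; first by rewrite -bil_rowE mulmx1 H mxE.
by apply/matrixP => i j; have := bil_rowE 1%:M O i j; rewrite mulmx1 => ->; rewrite H mxE.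
Qed.

Definition plane_rotation i j (c s : R) : 'M[R]_m := \matrix_k
  (if k == i then c *: delta_mx 0 i + s *: delta_mx 0 j
   else if k == j then - s *: delta_mx 0 i + c *: delta_mx 0 j else delta_mx 0 k).

Lemma plane_rotationP i j (c s : R) : i != j -> c ^+ 2 + s ^+ 2 = 1 ->
  plane_rotation i j c s *m (plane_rotation i j c s)^T = 1%:M.
Proof.
move=> ij cs; have ji : (j == i) = false by rewrite eq_sym; exact: negbTE.
have ij' := negbTE ij.
have d k l : bil (1%:M : 'M[R]_m) (delta_mx 0 k) (delta_mx 0 l) = (k == l)%:R by rewrite bil_delta mxE.
apply/orthogonalE => k l; rewrite !rowK.
have [ki|ki] := eqVneq k i; last have [kj|kj] := eqVneq k j.
- rewrite ki; have [li|li] := eqVneq l i; last have [lj|lj] := eqVneq l j.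
  + by rewrite ?li !(bilDl, bilDr, bilZl, bilZr, d, eqxx, ij', ji) /=; transitivity (c ^+ 2 + s ^+ 2); [ring|exact: cs].
  + by rewrite ?lj !(bilDl, bilDr, bilZl, bilZr, d, eqxx, ij', ji) /=; ring.
  + by rewrite !(bilDl, bilDr, bilZl, bilZr, d, eqxx, ij', ji) ![_ == l]eq_sym (negbTE li) (negbTE lj) /= !mulr0 addr0.
- rewrite kj; have [li|li] := eqVneq l i; last have [lj|lj] := eqVneq l j.
  + by rewrite ?li !(bilDl, bilDr, bilZl, bilZr, d, eqxx, ij', ji) /=; ring.
  + by rewrite ?lj !(bilDl, bilDr, bilZl, bilZr, d, eqxx, ij', ji) /=; transitivity (c ^+ 2 + s ^+ 2); [ring|exact: cs].
  + by rewrite !(bilDl, bilDr, bilZl, bilZr, d, eqxx, ij', ji) ![_ == l]eq_sym (negbTE li) (negbTE lj) /= !mulr0 addr0.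
- have [li|li] := eqVneq l i; last have [lj|lj] := eqVneq l j.
  + by rewrite ?li !(bilDl, bilDr, bilZl, bilZr, d, eqxx, ij', ji) (negbTE ki) (negbTE kj) /= !mulr0 addr0.
  + by rewrite ?lj !(bilDl, bilDr, bilZl, bilZr, d, eqxx, ij', ji) (negbTE ki) (negbTE kj) /= !mulr0 addr0.
  + by rewrite !(bilDl, bilDr, bilZl, bilZr, d, eqxx, ij', ji).
Qed.

Lemma orthogonal_entry O i j : O *m O^T = 1%:M -> `|O i j| <= 1.
Proof.
move=> H; have e : (O *m O^T) i i = 1 by rewrite H mxE eqxx.
rewrite -(ler_pXn2r (n := 2)) ?nnegrE // expr1n real_normK ?num_real // -e mxE (bigD1 j) //= mxE -expr2.
by rewrite lerDl sumr_ge0 // => l _; rewrite mxE -expr2 sqr_ge0.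
Qed.

Lemma orthogonal_compact : compact [set v : 'rV[R]_(m * m) | vec_mx v *m (vec_mx v : 'M[R]_m)^T = 1%:M].
Proof.
have cc i j : continuous (fun v : 'rV[R]_(m * m) => (vec_mx v : 'M[R]_m) i j).
  move=> v; rewrite (_ : (fun v : 'rV[R]_(m * m) => _) = fun v => v 0 (mxvec_index i j)); last first.
    by apply/funext => u; rewrite mxE.
  exact: coord_continuous.
apply: bounded_closed_compact.
  exists 1; split=> // N N1 v /= H.
  have b i j : `|(vec_mx v : 'M[R]_m) i j| <= 1.
    exact: orthogonal_entry.
  apply: le_trans (ltW N1); apply: rv_norm_le => // k.
  by case/mxvec_indexP: k => i j; have := b i j; rewrite mxE.
rewrite (_ : [set v | _] = \bigcap_(ij in [set: 'I_m * 'I_m])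
   [set v | (\sum_k (vec_mx v : 'M[R]_m) ij.1 k * (vec_mx v : 'M[R]_m) ij.2 k) = (ij.1 == ij.2)%:R]); last first.
  apply/seteqP; split=> v /= H.
    move=> [i j] _ /=; have := congr1 (fun X : 'M[R]_m => X i j) H; rewrite !mxE => <-.
    by apply: eq_bigr => k _; rewrite [(_^T) _ _]mxE.
  apply/matrixP => i j; rewrite !mxE -(H (i, j)) //=.
  by apply: eq_bigr => k _; rewrite [(_^T) _ _]mxE.
apply: closed_bigI => -[i j] _ /=.
apply: (@preimage_closed _ _ (fun v : 'rV[R]_(m * m) => \sum_k (vec_mx v : 'M[R]_m) i k * (vec_mx v : 'M[R]_m) j k)
  [set (i == j)%:R]); last exact: closed_eq.
move=> v _; apply: (@cvg_sumR R _ (nbhs v) (nbhs_filter v)) => k.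
by apply: cvgM; exact: cc.
Qed.

(** A small rotation in the (i, j) plane changes the weighted trace to first order by a multiple of
    (w i - w j) times the entry (i, j); the weights differ, so at a maximum the entry is 0. *)
Lemma diag_of_maximal S O (w : 'I_m -> R) : S^T = S -> injective w -> O *m O^T = 1%:M ->
  (forall Q, Q *m Q^T = 1%:M -> \sum_k w k * (Q *m S *m Q^T) k k <= \sum_k w k * (O *m S *m O^T) k k) ->
  forall i j, i != j -> (O *m S *m O^T) i j = 0.
Proof.
move=> Ss wi oo mx i j ij; set T := O *m S *m O^T.
have Tij : T j i = T i j.
  have TT : T^T = T by rewrite /T !trmx_mul trmxK Ss mulmxA.
  by rewrite -{1}TT mxE.
have ji : j != i by rewrite eq_sym.
have H c s : c ^+ 2 + s ^+ 2 = 1 -> (w i - w j) * (s ^+ 2 * (T j j - T i i) + 2 * c * s * T i j) <= 0.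
  move=> cs; pose Q := plane_rotation i j c s.
  have QQ : Q *m Q^T = 1%:M by exact: plane_rotationP.
  have QO : (Q *m O) *m (Q *m O)^T = 1%:M by rewrite trmx_mul mulmxA -(mulmxA Q) oo mulmx1.
  have E : (Q *m O) *m S *m (Q *m O)^T = Q *m T *m Q^T by rewrite trmx_mul /T !mulmxA.
  have := mx _ QO; rewrite E -/T; clear E; clearbody T; rewrite (bigD1 i) // [X in _ <= X](bigD1 i) //=.
  rewrite (bigD1 j) // [X in _ <= _ + X](bigD1 j) //=.
  rewrite (eq_bigr (fun k => w k * T k k)); last first.
    by move=> k /andP[ki kj]; rewrite bil_rowE rowK (negbTE ki) (negbTE kj) bil_delta.
  rewrite !bil_rowE !rowK eqxx (negbTE ji) eqxx !(bilDl, bilDr, bilZl, bilZr) !bil_delta Tij.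
  move: (\sum_(_ | _) _) => X.
  move=> H; rewrite -subr_ge0 in H; rewrite -subr_ge0; apply: le_trans H _; rewrite le_eqVlt; apply/orP; left.
  rewrite -subr_eq0; apply/eqP; transitivity ((1 - (c ^+ 2 + s ^+ 2)) * (w i * T i i + w j * T j j)).
    by move: (T i i) (T j j) (T i j) (w i) (w j) => a b d e f; ring.
  by rewrite cs subrr mul0r.
apply/eqP; apply: contraT => t0.
pose X := (w i - w j) * (T j j - T i i); pose Y := 2 * (w i - w j) * T i j.
have Y0 : Y != 0 by rewrite !mulf_neq0 ?subr_eq0 // (inj_eq wi).
(* Tangent of the rotation angle. It gives t^2 X + t Y = (Y / (|X| + 1))^2 (X + |X| + 1), which is
   positive unless Y = 0. *)
pose t := Y / (`|X| + 1); pose z := Num.sqrt (1 + t ^+ 2).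
have z2 : z ^+ 2 = 1 + t ^+ 2 by rewrite sqr_sqrtr // addr_ge0 ?sqr_ge0.
have z0 : 0 < z by rewrite sqrtr_gt0 ltr_wpDr ?sqr_ge0.
have cz : (1 / z) ^+ 2 + (t / z) ^+ 2 = 1.
  by rewrite [(1 / z) ^+ 2]expr_div_n [(t / z) ^+ 2]expr_div_n z2 expr1n -mulrDl mulfV // gt_eqF // ltr_wpDr ?sqr_ge0.
have := H _ _ cz; rewrite [(t / z) ^+ 2]expr_div_n z2.
have -> : (w i - w j) * (t ^+ 2 / (1 + t ^+ 2) * (T j j - T i i) + 2 * (1 / z) * (t / z) * T i j)
   = (t ^+ 2 * X + t * Y) / (1 + t ^+ 2).
  have -> : 2 * (1 / z) * (t / z) * T i j = 2 * t * T i j / z ^+ 2 by field; exact: lt0r_neq0.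
  by rewrite z2 /X /Y; field; rewrite gt_eqF // ltr_wpDr ?sqr_ge0.
rewrite pmulr_lle0 ?invr_gt0 ?ltr_wpDr ?sqr_ge0 //.
have X1 : 0 < `|X| + 1 by rewrite ltr_wpDl.
have -> : t ^+ 2 * X + t * Y = (Y / (`|X| + 1)) ^+ 2 * (X + `|X| + 1).
  by rewrite /t; move: X1; move: (`|X|) => x X1; field; exact: lt0r_neq0.
have P0 : 0 < (Y / (`|X| + 1)) ^+ 2.
  by rewrite exprn_even_gt0 //=; apply: mulf_neq0 => //; rewrite invr_eq0 gt_eqF.
have P1 : 0 < X + `|X| + 1 by rewrite ltr_wpDl // -lerBlDl sub0r -normrN ler_norm.
by rewrite leNgt (mulr_gt0 P0 P1).
Qed.

(** Maximizes the diagonal with the distinct weights k over the compact orthogonal group; matrices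
    are flattened to row vectors for the extreme value theorem. *)
Lemma spectral S : S^T = S -> exists O (d : 'rV[R]_m), O *m O^T = 1%:M /\ O *m S *m O^T = diag_mx d.
Proof.
move=> Ss; pose K := [set v : 'rV[R]_(m * m) | vec_mx v *m (vec_mx v : 'M[R]_m)^T = 1%:M].
pose f (v : 'rV[R]_(m * m)) := \sum_(k < m) k%:R * ((vec_mx v : 'M[R]_m) *m S *m (vec_mx v : 'M[R]_m)^T) k k.
have K0 : K !=set0 by exists (mxvec 1%:M); rewrite /K /= mxvecK trmx1 mulmx1.
have cf : {within K, continuous f}.
  apply: continuous_subspaceT => v.
  rewrite /f (_ : (fun v => _) = fun v : 'rV[R]_(m * m) => \sum_(k < m) k%:R *
     \sum_i \sum_j v 0 (mxvec_index k i) * v 0 (mxvec_index k j) * S i j); last first.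
    apply/funext => u; apply: eq_bigr => k _; rewrite bil_rowE bilE; congr (_ * _).
    by apply: eq_bigr => i _; apply: eq_bigr => j _; rewrite !mxE.
  rewrite /continuous_at; apply: (@cvg_sumR R _ (nbhs v) (nbhs_filter v)) => k.
  apply: cvgM; first exact: cvg_cst.
  apply: (@cvg_sumR R _ (nbhs v) (nbhs_filter v)) => i; apply: (@cvg_sumR R _ (nbhs v) (nbhs_filter v)) => j.
  by apply: cvgM; [apply: cvgM; exact: coord_continuous|exact: cvg_cst].
have [v Kv Hv] := EVT_max_rV K0 orthogonal_compact cf.
rewrite inE in Kv; set O : 'M[R]_m := vec_mx v.
exists O, (\row_k (O *m S *m O^T) k k); split; first exact: Kv.
have H := @diag_of_maximal S O (fun k => k%:R) Ss _ Kv _.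
apply/matrixP => i j; rewrite [RHS]mxE [X in X *+ _]mxE.
have [->|ij] := eqVneq i j; first by rewrite mulr1n.
rewrite mulr0n; apply: H ij.
- by move=> k l /eqP; rewrite eqr_nat => /eqP/val_inj.
- move=> Q QQ; have := Hv (mxvec Q); rewrite /f mxvecK; apply.
  by rewrite inE /K /= mxvecK.
Qed.

Lemma mulmx_entry_le (X Y : 'M[R]_m) (x y : R) i j :
  (forall i j, `|X i j| <= x) -> (forall i j, `|Y i j| <= y) -> 0 <= x -> `|(X *m Y) i j| <= m%:R * (x * y).
Proof.
move=> Hx Hy x0; rewrite mxE; apply: sum_norm_le => k; rewrite normrM.
exact: ler_pM.
Qed.

(** S is the inverse square root of P, and |d^(-1/2) - 1| <= 2 |d - 1| for each eigenvalue d, which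
    is at least 1/2. *)
Lemma orthonormalize (P : 'M[R]_m) (e : R) : P^T = P -> 0 <= e -> m%:R ^+ 2 * e <= 2^-1 ->
  (forall i j, `|P i j - (i == j)%:R| <= e) ->
  exists S : 'M[R]_m, S *m P *m S^T = 1%:M /\ forall i j, `|S i j - (i == j)%:R| <= 2 * m%:R ^+ 4 * e.
Proof.
move=> Ps e0 em Pe; have [U [d [UU Ud]]] := spectral Ps.
have UU' : U^T *m U = 1%:M by exact: mulmx1C.
have De i : `|d 0 i - 1| <= m%:R ^+ 2 * e.
  have -> : d 0 i - 1 = (U *m (P - 1%:M) *m U^T) i i.
    by rewrite mulmxBr mulmxBl mulmx1 UU Ud !mxE eqxx mulr1n.
  have -> : m%:R ^+ 2 * e = m%:R * ((m%:R * (1 * e)) * 1) by ring.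
  apply: mulmx_entry_le => [k l|k l|]; last by rewrite !mulr_ge0.
    apply: mulmx_entry_le => // k' l'; first exact: orthogonal_entry.
    by rewrite !mxE; exact: Pe.
  by rewrite mxE; exact: orthogonal_entry.
have d0 i : 2^-1 <= d 0 i.
  by have := le_trans (De i) em; rewrite ler_norml => /andP[+ _]; move: (d 0 i) => x; lra.
pose s : 'rV[R]_m := \row_i (Num.sqrt (d 0 i))^-1.
have s2 i : s 0 i * (d 0 i * s 0 i) = 1.
  rewrite mxE; have dp : 0 < d 0 i by apply: lt_le_trans (d0 i); rewrite invr_gt0.
  have z0 : Num.sqrt (d 0 i) != 0 by rewrite sqrtr_eq0 -ltNge.
  by rewrite -{2}(sqr_sqrtr (ltW dp)); field.
have se i : `|s 0 i - 1| <= 2 * (m%:R ^+ 2 * e).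
  have dp : 0 < d 0 i by apply: lt_le_trans (d0 i); rewrite invr_gt0.
  set z := Num.sqrt (d 0 i); have z0 : 0 < z by rewrite sqrtr_gt0.
  have zd : z ^+ 2 = d 0 i by rewrite sqr_sqrtr // ltW.
  have -> : s 0 i - 1 = (1 - d 0 i) / (z * (1 + z)).
    by rewrite mxE -/z -zd; field; rewrite ?gt_eqF ?addr_gt0.
  rewrite normrM normfV (gtr0_norm (x := z * _)) ?mulr_gt0 ?addr_gt0 // distrC.
  rewrite ler_pdivrMr ?mulr_gt0 ?addr_gt0 //; apply: le_trans (De i) _.
  have A0 : 0 <= m%:R ^+ 2 * e by rewrite mulr_ge0.
  have y1 : 1 <= 2 * (z * (1 + z)).
    have : 2^-1 <= z ^+ 2 by rewrite zd.
    by rewrite mulrDr mulr1 -expr2; move: z z0 {zd} => x x0 xx; lra.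
  move: (m%:R ^+ 2 * e) (z * (1 + z)) A0 y1 => A' y A0 y1.
  by have := ler_wpM2l A0 y1; rewrite mulr1 mulrA [A' * 2]mulrC.
exists (U^T *m diag_mx s *m U); split.
  have Pd : P = U^T *m diag_mx d *m U by rewrite -Ud !mulmxA UU' mul1mx -mulmxA UU' mulmx1.
  rewrite Pd !trmx_mul trmxK tr_diag_mx !mulmxA.
  rewrite -(mulmxA (U^T *m diag_mx s) U U^T) UU mulmx1.
  rewrite -(mulmxA _ U U^T) UU mulmx1 -(mulmxA U^T) mulmx_diag -(mulmxA U^T) mulmx_diag.
  rewrite (_ : diag_mx _ = 1%:M) ?mulmx1 //.
  by apply/matrixP => i j; rewrite !mxE; case: eqP => [->|//]; rewrite !mulr1n -mulrA; have := s2 j; rewrite !mxE.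
move=> i j; have -> : (U^T *m diag_mx s *m U) i j - (i == j)%:R = (U^T *m (diag_mx s - 1%:M) *m U) i j.
  by rewrite mulmxBr mulmxBl mulmx1 UU' !mxE.
have -> : 2 * m%:R ^+ 4 * e = m%:R * ((m%:R * (1 * (2 * (m%:R ^+ 2 * e)))) * 1) by ring.
apply: mulmx_entry_le => [k l|k l|].
- apply: mulmx_entry_le => // k' l'; first by rewrite mxE; exact: orthogonal_entry.
  rewrite !mxE; case: eqP => [->|_]; first by rewrite mulr1n; have := se l'; rewrite !mxE.
  by rewrite mulr0n subrr normr0 mulr_ge0 // mulr_ge0 // exprn_ge0.
- exact: orthogonal_entry.
- by rewrite !mulr_ge0 // exprn_ge0.
Qed.

End Spectral.

(** * Second variation of energy *)

Section CurvatureForm.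
Context {R : realType} {n : nat}.
Local Notation V := 'rV[R]_n.+1.
Variables (U : set V) (g : V -> 'M[R]_n.+1).
Hypothesis cm : chart_metric U g.
Implicit Types (x y z u v w p q a b c d H Z : V).
Local Notation Gamv := (Gamv g).
Local Notation Dg := (Dg g).
Local Notation D2g := (D2g g).

Definition rm x a b c d : R :=
  \sum_i \sum_j \sum_k \sum_l a 0 i * b 0 j * c 0 k * d 0 l * riemann g i j k l x.

Definition DGam x z u v : V :=
  \row_k \sum_i \sum_j grad_along (christoffel g k i j) x z * u 0 i * v 0 j.

Lemma is_derive_Gamv (c u v : R -> V) (t : R) (dc du dv : V) : U (c t) ->
  is_derive t 1 c dc -> is_derive t 1 u du -> is_derive t 1 v dv ->
  is_derive t 1 (fun s => Gamv (c s) (u s) (v s))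
    (DGam (c t) dc (u t) (v t) + Gamv (c t) du (v t) + Gamv (c t) (u t) dv).
Proof.
move=> Uc Hc /is_derive_rv Hu /is_derive_rv Hv; apply/is_derive_rv => k.
rewrite (_ : (fun s => _) = fun s => \sum_i \sum_j christoffel g k i j (c s) * u s 0 i * v s 0 j); last first.
  by apply/funext => s; rewrite mxE.
rewrite !mxE -!big_split /=.
apply: dSum => i; rewrite -!big_split /=; apply: dSum => j.
have sc := smooth_christoffel (cm_open cm) (cm_smooth cm) (chart_unit cm) k i j.
apply: dEq (dM (dM (smooth_curve (cm_open cm) sc Uc Hc) (Hu i)) (Hv j)) _.
by rewrite -/(grad_along _ _ _); move: (grad_along _ _ _) (christoffel _ _ _ _ _) => ? ?; ring.
Qed.

Lemma is_derive_bil_mx (G : V -> 'M[R]_n.+1) (c : R -> V) (t : R) dc u v :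
  (forall i j, smooth_on U (fun y => G y i j)) -> U (c t) -> is_derive t 1 c dc ->
  is_derive t 1 (fun s => bil (G (c s)) u v)
    (bil (\matrix_(i, j) grad_along (fun y => G y i j) (c t) dc) u v).
Proof.
move=> sG Uc Hc.
rewrite (_ : (fun s => _) = fun s => \sum_i \sum_j u 0 i * v 0 j * G (c s) i j); last first.
  by apply/funext => s; rewrite bilE.
rewrite bilE; apply: dSum => i; apply: dSum => j; rewrite mxE.
exact: dZ (smooth_curve (cm_open cm) (sG i j) Uc Hc).
Qed.

(** Differentiates [Dg_compat] along the line x + s H at s = 0. *)
Lemma D2g_compat x H q : U x ->
  2^-1 * bil (D2g x H) q q = bil (g x) (Gamv x H (Gamv x H q) + DGam x H H q) q
    + bil (g x) (Gamv x H q) (Gamv x H q).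
Proof.
move=> Ux; pose c := fun s : R => x + s *: H.
have c0 : c 0 = x by rewrite /c scale0r addr0.
have dc : is_derive (0 : R) 1 c H by exact: is_derive_line.
have Uc : U (c 0) by rewrite c0.
have sD i j : smooth_on U (fun y => Dg y H i j).
  rewrite (_ : (fun y => _) = fun y => grad_along (fun y => g y i j) y H); last by apply/funext => y; rewrite mxE.
  exact: (smooth_grad_along (cm_open cm) H (cm_smooth cm i j)).
have D1 := is_derive_bil_mx q q sD Uc dc.
have cst v : is_derive (0 : R) 1 (fun=> v) (0 : V) by exact: is_derive_cst.
have D2 := is_derive_bil cm Uc dc (is_derive_Gamv Uc dc (cst H) (cst q)) (cst q).
have E : \forall s \near (0 : R), 2 * bil (g (c s)) (Gamv (c s) H q) q = bil (Dg (c s) H) q q.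
  have : \forall s \near (0 : R), U (c s).
    have cc : c @ (0 : R) --> x by rewrite -c0; exact: is_derive_rv_cts dc.
    exact: cc _ (open_near (cm_open cm) Ux).
  apply: filterS => s Us; rewrite (Dg_compat cm _ _ _ Us) [bil _ q _](chart_bilC cm _ _ Us).
  by rewrite mulr2n mulrDl mul1r.
have D3 := near_eq_is_derive E (dZ 2 D2).
have [_ E1] := D1; have [_ E3] := D3.
have EQ := etrans (esym E1) E3.
have M : D2g x H = \matrix_(i, j) grad_along (fun y => Dg y H i j) x H.
  apply/matrixP => i j; rewrite [LHS]mxE [RHS]mxE.
  have fe : (fun y => Dg y H i j) = (fun z => grad_along (fun y => g y i j) z H).
    by apply/funext => y; rewrite mxE.
  by rewrite fe.
rewrite M; rewrite !c0 in EQ; rewrite EQ mulKf ?pnatr_eq0 // (Dg_compat cm _ _ _ Ux) bil0r addr0.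
have Z1 (X : V) : Gamv x 0 X = 0 by have := GamvZl g x 0 X X; rewrite !scale0r.
have Z2 (X : V) : Gamv x X 0 = 0 by have := GamvZr g x 0 X X; rewrite !scale0r.
by rewrite Z1 Z2 !addr0 bilDl addrAC.
Qed.

Lemma rmE x a b c d : U x -> rm x a b c d = bil (g x)
  (DGam x a b d - DGam x b a d + Gamv x a (Gamv x b d) - Gamv x b (Gamv x a d)) c.
Proof.
move=> Ux; rewrite bilE.
set W := (X in _ = \sum_i \sum_j X 0 i * _ * _).
have HW m : W 0 m = \sum_i \sum_j \sum_l a 0 i * b 0 j * d 0 l * riemann_up g i j l m x.
  pose P i j l := partial i (christoffel g m j l) x.
  pose C k i j := christoffel g k i j x.
  have EP (u v w : V) : \sum_j \sum_l grad_along (christoffel g m j l) x u * v 0 j * w 0 l =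
      \sum_i \sum_j \sum_l u 0 i * v 0 j * w 0 l * P i j l.
    rewrite [RHS]exchange_big; apply: eq_bigr => j _ /=.
    rewrite [RHS]exchange_big; apply: eq_bigr => l _ /=.
    rewrite /grad_along !mulr_suml; apply: eq_bigr => i _.
    by rewrite -/(P i j l); move: (P i j l) => z; ring.
  have EC (u v w : V) : \sum_i \sum_s C m i s * u 0 i * (Gamv x v w) 0 s =
      \sum_i \sum_j \sum_l u 0 i * v 0 j * w 0 l * \sum_s C m i s * C s j l.
    apply: eq_bigr => i _; under eq_bigr => s _ do rewrite mxE mulr_sumr.
    rewrite exchange_big; apply: eq_bigr => j _ /=.
    under eq_bigr => s _ do rewrite mulr_sumr.
    rewrite exchange_big; apply: eq_bigr => l _ /=.
    rewrite mulr_sumr; apply: eq_bigr => s _.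
    by rewrite -/(C s j l); move: (C m i s) (C s j l) => ? ?; ring.
  have sw (u v w : V) (F : 'I_n.+1 -> 'I_n.+1 -> 'I_n.+1 -> R) :
      \sum_i \sum_j \sum_l u 0 i * v 0 j * w 0 l * F i j l =
      \sum_i \sum_j \sum_l v 0 i * u 0 j * w 0 l * F j i l.
    rewrite exchange_big; apply: eq_bigr => i _; apply: eq_bigr => j _; apply: eq_bigr => l _.
    by move: (F j i l) => z; ring.
  have ent (X1 X2 X3 X4 : V) : (X1 - X2 + X3 - X4) 0 m = X1 0 m - X2 0 m + X3 0 m - X4 0 m by rewrite !mxE.
  rewrite /W ent.
  rewrite [DGam x a b d 0 m]mxE [DGam x b a d 0 m]mxE [Gamv x a _ 0 m]mxE [Gamv x b _ 0 m]mxE.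
  rewrite (EP a b d) (EP b a d) (EC a b d) (EC b a d) (sw b a d) (sw b a d (fun i j l => \sum_s _)).
  rewrite -!sumrN -!big_split; apply: eq_bigr => i _ /=.
  rewrite -!sumrN -!big_split; apply: eq_bigr => j _ /=.
  rewrite -!sumrN -!big_split; apply: eq_bigr => l _ /=.
  rewrite /riemann_up sumrB -/(P i j l) -/(P j i l).
  by move: (P i j l) (P j i l) (\sum_s C m i s * _) (\sum_s C m j s * _) => *; ring.
clearbody W.
transitivity (\sum_i \sum_j \sum_k \sum_l \sum_m a 0 i * b 0 j * c 0 k * d 0 l * (g x m k * riemann_up g i j l m x)).
  apply: eq_bigr => i _; apply: eq_bigr => j _; apply: eq_bigr => k _; apply: eq_bigr => l _.
  rewrite /riemann mulr_sumr; apply: eq_bigr => m _; congr (_ * (_ * _)).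
  by rewrite -[in LHS](cm_sym cm Ux) mxE.
transitivity (\sum_m \sum_k \sum_i \sum_j \sum_l a 0 i * b 0 j * c 0 k * d 0 l * (g x m k * riemann_up g i j l m x)); last first.
  apply: eq_bigr => m _; apply: eq_bigr => k _; rewrite HW !mulr_suml; apply: eq_bigr => i _.
  rewrite !mulr_suml; apply: eq_bigr => j _; rewrite !mulr_suml; apply: eq_bigr => l _.
  by move: (riemann_up _ _ _ _ _ _) (g _ _ _) => *; ring.
under eq_bigr => i _ do under eq_bigr => j _ do under eq_bigr => k _ do rewrite exchange_big /=.
under eq_bigr => i _ do under eq_bigr => j _ do rewrite exchange_big /=.
under eq_bigr => i _ do rewrite exchange_big /=.
rewrite exchange_big; apply: eq_bigr => m _ /=.
under eq_bigr => i _ do rewrite exchange_big /=.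
by rewrite exchange_big.
Qed.

(** With q = c' and Z = H', the left side is the second-order part of the energy density of c + H in
    coordinates. The right side splits it into the square of the covariant derivative of H, the
    curvature term, and the derivative along the geodesic c of g(c', Gamma(H, H)). *)
Lemma energy_identity x q H Z : U x ->
  2^-1 * bil (D2g x H) q q + 2 * bil (Dg x H) q Z + bil (g x) Z Z =
  bil (g x) (Z + Gamv x q H) (Z + Gamv x q H) + rm x H q q H +
  bil (g x) q (Gamv x q (Gamv x H H) + (DGam x q H H + Gamv x Z H + Gamv x H Z)).
Proof.
move=> Ux; rewrite (D2g_compat _ _ Ux) (rmE _ _ _ _ Ux) (Dg_compat cm _ _ _ Ux).
rewrite (GamvC cm q H Ux) (GamvC cm Z H Ux).
have DC (X Y : V) : DGam x H X Y = DGam x H Y X.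
  have E k i j : grad_along (christoffel g k i j) x H = grad_along (christoffel g k j i) x H.
    have ge y : U y -> christoffel g k i j y = christoffel g k j i y.
      by move=> Uy; exact: (christoffel_sym (cm_open cm) (cm_sym cm) k i j Uy).
    have pe l := partial_eq_on (cm_open cm) ge l Ux.
    by rewrite /grad_along; apply: eq_bigr => l _; rewrite (pe l).
  apply/rowP => k; rewrite [LHS]mxE [RHS]mxE exchange_big; apply: eq_bigr => i _; apply: eq_bigr => j _.
  by rewrite (E k j i); move: (grad_along _ _ _) => z; ring.
rewrite (DC q H).
have sy u v : bil (g x) u v = bil (g x) v u by exact: (chart_bilC cm _ _ Ux).
rewrite !(bilDl, bilDr, bilNl, bilNr).
rewrite !(sy _ q) (sy (Gamv x H q) Z).
move: (bil _ _ _) (bil _ _ (Gamv x H (Gamv x H q))) (bil _ _ (DGam x H H q)) => *.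
by ring.
Qed.

Lemma rmDa x a a' b c d : rm x (a + a') b c d = rm x a b c d + rm x a' b c d.
Proof.
rewrite /rm -big_split; apply: eq_bigr => i _ /=; rewrite -big_split; apply: eq_bigr => j _ /=.
rewrite -big_split; apply: eq_bigr => k _ /=; rewrite -big_split; apply: eq_bigr => l _ /=.
by rewrite [(a + a') 0 i]mxE; move: (riemann _ _ _ _ _ _) => z; ring.
Qed.

Lemma rmDb x a b b' c d : rm x a (b + b') c d = rm x a b c d + rm x a b' c d.
Proof.
rewrite /rm -big_split; apply: eq_bigr => i _ /=; rewrite -big_split; apply: eq_bigr => j _ /=.
rewrite -big_split; apply: eq_bigr => k _ /=; rewrite -big_split; apply: eq_bigr => l _ /=.
by rewrite [(b + b') 0 j]mxE; move: (riemann _ _ _ _ _ _) => z; ring.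
Qed.

Lemma rmDc x a b c c' d : rm x a b (c + c') d = rm x a b c d + rm x a b c' d.
Proof.
rewrite /rm -big_split; apply: eq_bigr => i _ /=; rewrite -big_split; apply: eq_bigr => j _ /=.
rewrite -big_split; apply: eq_bigr => k _ /=; rewrite -big_split; apply: eq_bigr => l _ /=.
by rewrite [(c + c') 0 k]mxE; move: (riemann _ _ _ _ _ _) => z; ring.
Qed.

Lemma rmDd x a b c d d' : rm x a b c (d + d') = rm x a b c d + rm x a b c d'.
Proof.
rewrite /rm -big_split; apply: eq_bigr => i _ /=; rewrite -big_split; apply: eq_bigr => j _ /=.
rewrite -big_split; apply: eq_bigr => k _ /=; rewrite -big_split; apply: eq_bigr => l _ /=.
by rewrite [(d + d') 0 l]mxE; move: (riemann _ _ _ _ _ _) => z; ring.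
Qed.

Lemma rmZ x (s t u v : R) a b c d :
  rm x (s *: a) (t *: b) (u *: c) (v *: d) = s * t * u * v * rm x a b c d.
Proof.
rewrite /rm mulr_sumr; apply: eq_bigr => i _; rewrite mulr_sumr; apply: eq_bigr => j _.
rewrite mulr_sumr; apply: eq_bigr => k _; rewrite mulr_sumr; apply: eq_bigr => l _.
rewrite [(s *: a) 0 i]mxE [(t *: b) 0 j]mxE [(u *: c) 0 k]mxE [(v *: d) 0 l]mxE.
by move: (riemann _ _ _ _ _ _) => z; ring.
Qed.

Local Notation N := (n.+1%:R : R).

Lemma rm_sum_le (F : 'I_n.+1 -> 'I_n.+1 -> 'I_n.+1 -> 'I_n.+1 -> R) (K : R) a b c d :
  (forall i j k l, `|F i j k l| <= K) -> 0 <= K ->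
  `|\sum_i \sum_j \sum_k \sum_l a 0 i * b 0 j * c 0 k * d 0 l * F i j k l|
    <= N ^+ 4 * K * `|a| * `|b| * `|c| * `|d|.
Proof.
move=> HF K0; have -> : N ^+ 4 * K * `|a| * `|b| * `|c| * `|d| =
   N * (N * (N * (N * (`|a| * `|b| * `|c| * `|d| * K)))) by ring.
do 4 (apply: sum_norm_le => ?); rewrite !normrM.
by do 4 (apply: ler_pM => //; rewrite ?mulr_ge0 ?rv_coord_le //).
Qed.

Record curv_ball x0 (r K : R) : Prop := CurvBall {
  cb_r : 0 < r; cb_K : 0 < K;
  cb_rm : forall y a b c d, `|y - x0| < r -> `|rm y a b c d| <= K * `|a| * `|b| * `|c| * `|d|;
  cb_rmL : forall y z a b c d, `|y - x0| < r -> `|z - x0| < r ->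
    `|rm z a b c d - rm y a b c d| <= K * `|z - y| * `|a| * `|b| * `|c| * `|d| }.

Lemma curv_ball_exists x0 : U x0 -> exists r K, curv_ball x0 r K.
Proof.
move=> Ux; pose F (j : 'I_n.+1 * 'I_n.+1 * 'I_n.+1 * 'I_n.+1) := riemann g j.1.1.1 j.1.1.2 j.1.2 j.2.
have sF j : smooth_on U (F j) := smooth_riemann (cm_open cm) (cm_smooth cm) (chart_unit cm) _ _ _ _.
have [r [K [r0 K0 H]]] := family_taylor cm Ux sF.
exists r, (N ^+ 4 * K); split=> //; first by rewrite mulr_gt0 // exprn_gt0.
  move=> y a b c d yr; apply: rm_sum_le (ltW K0) => i j k l.
  by have [_ /(_ (i, j, k, l)) + _ _] := H y yr.
move=> y z a b c d yr zr.
have -> : rm z a b c d - rm y a b c d =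
   \sum_i \sum_j \sum_k \sum_l a 0 i * b 0 j * c 0 k * d 0 l * (riemann g i j k l z - riemann g i j k l y).
  rewrite /rm -sumrB; apply: eq_bigr => i _; rewrite -sumrB; apply: eq_bigr => j _.
  rewrite -sumrB; apply: eq_bigr => k _; rewrite -sumrB; apply: eq_bigr => l _.
  by rewrite -mulrBr.
rewrite -(mulrA (N ^+ 4)); apply: rm_sum_le; last by rewrite mulr_ge0 // ltW.
move=> i j k l; have [_ _ _ /(_ (z - y))] := H y yr.
by rewrite (addrC y) subrK => /(_ zr (i, j, k, l)) [].
Qed.

Lemma ler_pM3 (a1 a2 a3 b1 b2 b3 : R) : 0 <= a1 -> 0 <= a2 -> 0 <= a3 ->
  a1 <= b1 -> a2 <= b2 -> a3 <= b3 -> a1 * a2 * a3 <= b1 * b2 * b3.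
Proof. by move=> *; apply: ler_pM => //; rewrite ?mulr_ge0 //; exact: ler_pM. Qed.

Lemma window_real_bound (X g1 g2 g3 D1 D2 D3 E1 E2 E3 K m w : R) :
  X - (g1 + 2 * g2 + g3) - (D1 + 2 * D2 + D3) - 2^-1 * (E1 + 2 * E2 + E3) <= K * m ^+ 3 * (w + 2) * (w + 2) ->
  D3 <= K * m * (2 * m) * (2 * m) -> 2^-1 * E2 <= 2 * K * m ^+ 2 * w * (2 * m) ->
  2^-1 * E3 <= 2 * K * m ^+ 2 * (2 * m) * (2 * m) -> K * m ^+ 3 * m <= K * m ^+ 3 ->
  X <= g1 + (D1 + 2 * g2) + (2^-1 * E1 + 2 * D2 + g3) + K * (12 + 8 * w + (w + 2) ^+ 2) * m ^+ 3.
Proof.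
have e1 : K * m * (2 * m) * (2 * m) = 4 * (K * m ^+ 3) by ring.
have e2 : 2 * K * m ^+ 2 * w * (2 * m) = 4 * (K * m ^+ 3 * w) by ring.
have e3 : 2 * K * m ^+ 2 * (2 * m) * (2 * m) = 8 * (K * m ^+ 3 * m) by ring.
have e4 : K * (12 + 8 * w + (w + 2) ^+ 2) * m ^+ 3 =
  12 * (K * m ^+ 3) + 8 * (K * m ^+ 3 * w) + K * m ^+ 3 * (w + 2) * (w + 2) by ring.
by rewrite e1 e2 e3 e4; lra.
Qed.

Section Window.
Variables (x0 : V) (r lam K : R).
Hypothesis gb : good_ball U g x0 r lam K.

Lemma D2g_le y h u v : `|y - x0| < r -> `|y + h - x0| < r -> `|h| <= 1 ->
  2^-1 * `|bil (D2g y h) u v| <= 2 * K * `|h| ^+ 2 * `|u| * `|v|.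
Proof.
move=> yr hr h1; have hE : y + h - y = h by rewrite addrC addKr.
have A1 := gb_g2 gb u v yr hr; have A2 := gb_g3 gb u v yr hr; rewrite !hE in A1 A2.
have -> : 2^-1 * `|bil (D2g y h) u v| = `|2^-1 * bil (D2g y h) u v| by rewrite normrM ger0_norm.
set A := bil (g _) u v - _ - _ in A1; rewrite -/A in A2.
have -> : 2^-1 * bil (D2g y h) u v = A - (A - 2^-1 * bil (D2g y h) u v) by rewrite opprB addrC subrK.
apply: le_trans (ler_normB _ _) _; apply: le_trans (lerD A1 A2) _.
have K0 := gb_K gb; rewrite -mulrDl -mulrDl ler_wpM2r // ler_wpM2r //.
have -> : 2 * K * `|h| ^+ 2 = K * `|h| ^+ 2 + K * `|h| ^+ 2 by ring.
by rewrite lerD2l ler_wpM2l ?(ltW K0) // exprS ler_piMl ?exprn_ge0.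
Qed.

(** Cubic in the size m of the displacement; the coefficient collects the discarded terms of
    [window_real_bound]. *)
Definition window_error (w m : R) : R := K * (12 + 8 * w + (w + 2) ^+ 2) * m ^+ 3.

Lemma window_density c q H Z (w m : R) : `|c - x0| < r -> `|c + H - x0| < r ->
  `|H| <= m -> `|Z| <= 2 * m -> m <= 1 -> `|q| <= w ->
  bil (g (c + H)) (q + Z) (q + Z) <= bil (g c) q q + (bil (Dg c H) q q + 2 * bil (g c) q Z)
     + (2^-1 * bil (D2g c H) q q + 2 * bil (Dg c H) q Z + bil (g c) Z Z) + window_error w m.
Proof.
move=> cr hr Hm Zm m1 qw; have K0 := gb_K gb; have Uc := gb_U gb cr.
have m0 : 0 <= m by exact: le_trans (normr_ge0 _) Hm.
have w0 : 0 <= w by exact: le_trans (normr_ge0 _) qw.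
have hE : c + H - c = H by rewrite addrC addKr.
have G3 := gb_g3 gb (q + Z) (q + Z) cr hr; rewrite hE in G3.
have symM (P : 'M[R]_n.+1) u v : P^T = P -> bil P u v = bil P v u by exact: bilC.
have sg := cm_sym cm Uc.
have gs i j y : U y -> g y i j = g y j i by move=> Uy; rewrite -[in LHS](cm_sym cm Uy) mxE.
have sD : (Dg c H)^T = Dg c H.
  apply/matrixP => i j; rewrite [LHS]mxE !mxE; apply: eq_bigr => l _.
  by rewrite (partial_eq_on (cm_open cm) (gs j i) l Uc).
have sD2 : (D2g c H)^T = D2g c H.
  apply/matrixP => i j; rewrite [LHS]mxE !mxE; apply: eq_bigr => l _.
  have ge y : U y -> grad_along (fun y => g y j i) y H = grad_along (fun y => g y i j) y H.
    by move=> Uy; apply: eq_bigr => l' _; rewrite (partial_eq_on (cm_open cm) (gs j i) l' Uy).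
  by rewrite (partial_eq_on (cm_open cm) ge l Uc).
have h1 : `|H| <= 1 by exact: le_trans Hm m1.
have Km : K * `|H| <= K * m by rewrite ler_wpM2l ?(ltW K0).
have K2 : 2 * K * `|H| ^+ 2 <= 2 * K * m ^+ 2.
  by rewrite ler_wpM2l ?mulr_ge0 ?(ltW K0) // lerXn2r // nnegrE.
have K3 : K * `|H| ^+ 3 <= K * m ^+ 3 by rewrite ler_wpM2l ?(ltW K0) // lerXn2r // nnegrE.
have p1 : 0 <= K * `|H| by rewrite mulr_ge0 ?(ltW K0).
have p2 : 0 <= 2 * K * `|H| ^+ 2 by rewrite !mulr_ge0 ?(ltW K0) ?exprn_ge0.
have p3 : 0 <= K * `|H| ^+ 3 by rewrite mulr_ge0 ?(ltW K0) ?exprn_ge0.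
have qZ : `|q + Z| <= w + 2.
  apply: le_trans (ler_normD _ _) _; apply: lerD => //; apply: le_trans Zm _.
  by rewrite ler_piMr.
have B1 := le_trans (gb_Dg gb H Z Z cr) (ler_pM3 p1 (normr_ge0 Z) (normr_ge0 Z) Km Zm Zm).
have B2 := le_trans (D2g_le q Z cr hr h1) (ler_pM3 p2 (normr_ge0 q) (normr_ge0 Z) K2 qw Zm).
have B3 := le_trans (D2g_le Z Z cr hr h1) (ler_pM3 p2 (normr_ge0 Z) (normr_ge0 Z) K2 Zm Zm).
have B4 := ler_pM3 p3 (normr_ge0 (q + Z)) (normr_ge0 (q + Z)) K3 qZ qZ.
have m4 : K * m ^+ 3 * m <= K * m ^+ 3 by rewrite ler_piMr // mulr_ge0 ?(ltW K0) ?exprn_ge0.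
have sq (P : 'M[R]_n.+1) : P^T = P -> bil P (q + Z) (q + Z) = bil P q q + 2 * bil P q Z + bil P Z Z.
  by move=> sP; rewrite bilDl !bilDr (bilC Z q sP) mulr2n mulrDl mul1r !addrA.
have G3' := le_trans (ler_norm _) (le_trans G3 B4).
rewrite (sq _ sg) (sq _ sD) (sq _ sD2) in G3'.
apply: (window_real_bound G3' (le_trans (ler_norm _) B1) (le_trans _ B2) (le_trans _ B3) m4).
  by rewrite ler_wpM2l // ler_norm.
by rewrite ler_wpM2l // ler_norm.
Qed.

(* Endpoint terms: by [energy_identity] the first-order part of the energy density and the
   boundary part of the second-order one integrate to the variation of [boundary_term]. *)
Definition boundary_term c q H : R := 2 * bil (g c) q H + bil (g c) q (Gamv c H H).

(** The end displacements are interpolated linearly in the chart, so no field along c has to be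
    constructed. The majorant h of the energy has the form that [below_energy] expects. *)
Lemma energy_window (c p : R -> V) xi0 xi1 (w m e Bd : R) :
  (forall t : R, 0 <= t <= 1 -> [/\ `|c t - x0| < r, chart_geodesic g c p t, `|p t| <= w &
     bil (g (c t)) (p t) (p t) = e]) ->
  `|xi0| <= m -> `|xi1| <= m -> m <= 1 ->
  let H (t : R) := xi0 + t *: (xi1 - xi0) in let Z := xi1 - xi0 in
  (forall t : R, 0 <= t <= 1 -> `|c t + H t - x0| < r) ->
  (forall t : R, 0 <= t <= 1 -> bil (g (c t)) (Z + Gamv (c t) (p t) (H t)) (Z + Gamv (c t) (p t) (H t))
     + rm (c t) (H t) (p t) (p t) (H t) <= Bd) ->
  exists h dh : R -> R, (forall t : R, 0 <= t <= 1 -> [/\ is_derive t 1 (fun t : R => c t + H t) (p t + Z), is_derive t 1 h (dh t) &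
      bil (g (c t + H t)) (p t + Z) (p t + Z) <= dh t]) /\
    h 1 - h 0 = e + (boundary_term (c 1) (p 1) xi1 - boundary_term (c 0) (p 0) xi0) + (Bd + window_error w m).
Proof.
move=> Hc x0m x1m m1 H Z HY HB.
pose C := Bd + window_error w m.
pose Phi t := boundary_term (c t) (p t) (H t).
pose dPhi t := 2 * bil (g (c t)) (p t) (Gamv (c t) (p t) (H t) + Z) +
  bil (g (c t)) (p t) (Gamv (c t) (p t) (Gamv (c t) (H t) (H t)) +
    (DGam (c t) (p t) (H t) (H t) + Gamv (c t) Z (H t) + Gamv (c t) (H t) Z)).
have dH t : is_derive (t : R) 1 H Z by exact: is_derive_line.
exists (fun t => (e + C) * t + Phi t), (fun t => (e + C) + dPhi t); split; last first.
  rewrite /Phi /H scale1r scale0r addr0 [xi0 + _]addrC subrK /C.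
  by move: (boundary_term _ _ _) (boundary_term _ _ _) => *; ring.
move=> t t01; have [cr gc pw pe] := Hc t t01; have Uc := gb_U gb cr.
have [dc dp] := gc.
split; first exact: is_deriveD.
  apply: dD; first by apply: dEq (dZ _ (dI t)) _; rewrite mulr1.
  apply: dD.
    exact: (dZ 2 (chart_geodesic_bil cm Uc gc (dH t))).
  exact: (chart_geodesic_bil cm Uc gc (is_derive_Gamv Uc dc (dH t) (dH t))).
have Hm : `|H t| <= m.
  have -> : H t = (1 - t) *: xi0 + t *: xi1.
    by rewrite /H scalerBr scalerBl scale1r addrA [_ - _]addrAC.
  move: t01 => /andP[t0 t1]; apply: le_trans (ler_normD _ _) _.
  rewrite !normrZ (ger0_norm t0) (ger0_norm (x := 1 - t)) ?subr_ge0 //.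
  have t1' : 0 <= 1 - t by rewrite subr_ge0.
  have -> : m = (1 - t) * m + t * m by rewrite -mulrDl subrK mul1r.
  by apply: lerD; exact: ler_wpM2l.
have Zm : `|Z| <= 2 * m by apply: le_trans (ler_normB _ _) _; rewrite mulr2n mulrDl mul1r; exact: lerD.
apply: le_trans (window_density cr (HY t t01) Hm Zm m1 pw) _.
rewrite (energy_identity _ _ _ Uc) pe (Dg_compat cm _ _ _ Uc) /dPhi /C.
have := HB t t01.
rewrite (GamvC cm (H t) (p t) Uc) (chart_bilC cm (Gamv _ _ _) (p t) Uc) [bil _ _ (_ + Z)]bilDr.
move: (bil (g (c t)) (Z + _) _) (rm _ _ _ _ _) (bil (g (c t)) (p t) (Gamv (c t) (p t) (H t)))
  (bil (g (c t)) (p t) Z) (bil (g (c t)) (p t) _) (window_error w m); clear; move=> *; lra.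
Qed.

End Window.
End CurvatureForm.

Section SecondOrder.
Context {R : realType}.

Lemma first_order_near {n : nat} (f : R -> 'rV[R]_n.+1) e (nu : R) : is_derive (0 : R) 1 f e -> 0 < nu ->
  \forall x \near (0 : R), `|f x - f 0 - x *: e| <= nu * `|x|.
Proof.
move=> [df <-] nu0; have := df; rewrite /derivable => cv.
have H := (cvgrPdist_le (F := (0 : R)^') (FF := dnbhs_filter _) _ _).1 cv nu nu0.
have : \forall x \near (0 : R), x != 0 -> `|'D_1 f 0 - x^-1 *: ((f \o shift 0) (x *: (1 : R)) - f 0)| <= nu.
  exact: H.
apply: filterS => x; have [->|x0] := eqVneq x 0.
  by move=> _; rewrite subrr scale0r subr0 !normr0 mulr0.
move=> /(_ isT) B; have -> : f x - f 0 - x *: 'D_1 f 0 = - (x *: ('D_1 f 0 - x^-1 *: ((f \o shift 0) (x *: (1 : R)) - f 0))).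
  rewrite scalerBr scalerA mulfV // scale1r opprB /= addr0.
  by rewrite (_ : x%:A = x) // [LHS]/=; exact: mulr1.
by rewrite normrN normrZ mulrC ler_wpM2r.
Qed.

Lemma near_dist_R (y e : R) : 0 < e -> \forall z \near y, `|y - z| < e.
Proof. by move=> e0; apply/nbhs_ballP; exists e => //= z; rewrite -ball_normE. Qed.

Lemma second_order_near (phi psi : R -> R) (nu : R) :
  (\forall x \near (0 : R), is_derive (x : R) 1 phi (psi x)) -> is_derive (0 : R) 1 psi 0 -> 0 < nu ->
  \forall x \near (0 : R), `|phi x - phi 0 - x * psi 0| <= nu * x ^+ 2.
Proof.
move=> dphi dpsi nu0.
have dv : is_derive (0 : R) 1 (fun x => \row_(i < 1) psi x : 'rV[R]_1) 0.
  by apply/is_derive_rv => i; rewrite mxE (_ : (fun s => _) = psi) //; apply/funext => s; rewrite mxE.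
have N1 := first_order_near dv nu0.
have [r1 r10 H1] := nbhs_R_ex N1; have [r2 r20 H2] := nbhs_R_ex dphi.
have : \forall x \near (0 : R), `|x - 0| < Num.min r1 r2.
  by apply: filterS (near_dist_R 0 (_ : 0 < Num.min r1 r2)) => [x|]; rewrite ?lt_min ?r10 // distrC.
apply: filterS => x; rewrite lt_min => /andP[x1 x2].
pose F t := phi (x * t + 0) - t * (x * psi 0).
have dF t : 0 <= t <= 1 -> is_derive (t : R) 1 F (x * psi (x * t + 0) - x * psi 0).
  move=> /andP[t0 t1]; apply: dB; last by apply: dEq (dM (dI t) (dC (x * psi 0) t)) _; rewrite mul1r mulr0 addr0.
  apply: dAffine; apply: H2; rewrite addr0 subr0 normrM (ger0_norm t0).
  by apply: le_lt_trans x2; rewrite subr0 ler_piMr.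
have H := derive_bounded ler01 dF (K := nu * x ^+ 2).
have -> : phi x - phi 0 - x * psi 0 = F 1 - F 0.
  by rewrite /F mulr1 mulr0 !addr0 mul1r mul0r subr0 addrAC.
apply: le_trans (H _) _; last by rewrite subr0 mulr1.
move=> t /andP[t0 t1]; rewrite addr0 -mulrBr normrM.
have xt : `|x * t - 0| < r1.
  by rewrite subr0 normrM (gtr0_norm t0); apply: le_lt_trans x1; rewrite subr0 ler_piMr // ltW.
have B := le_trans (rv_coord_le _ 0) (H1 _ xt); rewrite !mxE mulr0 subr0 normrM (gtr0_norm t0) in B.
have -> : x ^+ 2 = `|x| * `|x| by rewrite -expr2 real_normK ?num_real.
rewrite mulrCA ler_wpM2l //; apply: le_trans B _.
by rewrite ler_wpM2l ?(ltW nu0) // ler_piMr // ltW.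
Qed.

End SecondOrder.

Lemma window_sum {R : realType} (X a b c d A B C D E : R) : a <= A -> b <= A -> c <= B -> B <= C -> X - d <= E -> E <= D ->
  X + a + (b + c) <= d + D + 2 * A + C.
Proof. by move=> *; lra. Qed.

Lemma window_sum5 {R : realType} (a b c d e f A B C D E : R) : a <= A -> b <= B -> c <= C -> d <= D -> e - f <= E ->
  a + (b + (c + (d + e))) <= f + (A + B + C + D + E).
Proof. by move=> *; lra. Qed.

(** * Error estimates for the variation over one short piece of a geodesic *)

Section WindowEstimates.
Context {R : realType} {n : nat}.
Local Notation V := 'rV[R]_n.+1.
Variables (U : set V) (g : V -> 'M[R]_n.+1).
Hypothesis cm : chart_metric U g.
Implicit Types (x y z u v w p q a b c d H Z e : V).
Local Notation Gamv := (Gamv g).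
Local Notation Dg := (Dg g).
Local Notation rm := (rm g).

Lemma Gamv0l x v : Gamv x 0 v = 0.
Proof. by have := GamvZl g x 0 0 v; rewrite !scale0r. Qed.

Lemma Gamv0r x v : Gamv x v 0 = 0.
Proof. by have := GamvZr g x 0 v 0; rewrite !scale0r. Qed.

Lemma DGam0 x u v : DGam g x 0 u v = 0.
Proof.
apply/rowP => k; rewrite [LHS]mxE [RHS]mxE big1 // => i _; rewrite big1 // => j _.
rewrite (_ : grad_along _ _ _ = 0) ?mul0r // /grad_along big1 // => l _.
by rewrite [X in X * _]mxE mul0r.
Qed.

(** In coordinates the geodesic s is displaced by x v - (x^2 / 2) Gamma(v, v) up to higher order;
    the term with Gamma(H, H) in [boundary_term] cancels exactly this second-order part. *)
Lemma boundary_near c q (s v : R -> V) (nu : R) : U c ->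
  (\forall x \near (0 : R), is_derive (x : R) 1 s (v x)) ->
  is_derive (0 : R) 1 v (- Gamv c (v 0) (v 0)) -> s 0 = c -> 0 < nu ->
  \forall x \near (0 : R), `|boundary_term g c q (s x - c) - 2 * x * bil (g c) q (v 0)| <= nu * x ^+ 2.
Proof.
move=> Uc ds dv s0 nu0.
have cst z (t : R) : is_derive (t : R) 1 (fun=> z) (0 : V) by exact: is_derive_cst.
have dxi : \forall x \near (0 : R), is_derive (x : R) 1 (fun x : R => s x - c) (v x).
  apply: filterS ds => x dx; have := is_deriveB dx (cst c x); by rewrite subr0.
have dbil (f : R -> V) (t : R) (df : V) : is_derive t 1 f df ->
    is_derive t 1 (fun x : R => bil (g c) q (f x)) (bil (g c) q df).
  move=> Hf; have := is_derive_bil cm (c := fun=> c) Uc (cst c t) (cst q t) Hf.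
  by rewrite (Dg_compat cm _ _ _ Uc) !Gamv0l !bil0l !bil0r !add0r.
have dG (f h : R -> V) (t : R) (df dh : V) : is_derive t 1 f df -> is_derive t 1 h dh ->
    is_derive t 1 (fun x : R => Gamv c (f x) (h x)) (Gamv c df (h t) + Gamv c (f t) dh).
  move=> Hf Hh; have := is_derive_Gamv cm (c := fun=> c) Uc (cst c t) Hf Hh.
  by rewrite DGam0 add0r.
pose phi (x : R) := boundary_term g c q (s x - c).
pose psi (x : R) := 2 * bil (g c) q (v x) + bil (g c) q (Gamv c (v x) (s x - c) + Gamv c (s x - c) (v x)).
have dphi : \forall x \near (0 : R), is_derive (x : R) 1 phi (psi x).
  by apply: filterS dxi => x dx; exact: (dD (dZ 2 (dbil _ _ _ dx)) (dbil _ _ _ (dG _ _ _ _ _ dx dx))).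
have xi0 : is_derive (0 : R) 1 (fun x : R => s x - c) (v 0) by exact: nbhs_singleton dxi.
have dpsi : is_derive (0 : R) 1 psi 0.
  have D1 := dZ 2 (dbil _ _ _ dv).
  have D2 := dbil _ _ _ (is_deriveD (dG _ _ _ _ _ dv xi0) (dG _ _ _ _ _ xi0 dv)).
  apply: dEq (dD D1 D2) _; rewrite s0 subrr Gamv0l Gamv0r add0r addr0 bilNr bilDr.
  by move: (bil _ _ _) => z; ring.
have := second_order_near dphi dpsi nu0; apply: filterS => x.
rewrite /phi s0 subrr /boundary_term bil0r Gamv0l bil0r mulr0 addr0 subr0.
by rewrite /psi s0 subrr Gamv0l Gamv0r addr0 bil0r addr0 [2 * x]mulrC -mulrA.
Qed.

Variables (x0 : V) (r lam K r' K' : R).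
Hypothesis gb : good_ball U g x0 r lam K.
Hypothesis cb : curv_ball g x0 r' K'.

Section Estimate.
Variables (B : R).
Hypotheses (KB : K <= B) (KB' : K' <= B) (B1 : 1 <= B).

(** In [window_second_order], [A1] to [A7] bound eh' - e, Z, W - s1 e, W - s2 e, W, the difference
    of Christoffel terms Gamv x p W - s1 ga, and the remainder y, up to factors tau and eta. *)
Let A1 := B ^+ 3 + 1.
Let A2 := B + 1 + A1.
Let A3 := A1 + A2.
Let A4 := A3 + B.
Let A5 := B + A4.
Let A6 := B * B * A3 + B * B ^+ 3 * B + B * B * B * B.
Let A7 := 2 + A6.
Definition window_const : R := B * B * B * B + 2 * (B * B * A7) + B * A7 * A7 +
  (B * A4 * B * B * A5 + B * B * B * B * A4 + 2 * (B * B * B ^+ 3 * B * B) + B * B * B * B * B * B).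

Lemma B_ge0 : 0 <= B. Proof. exact: le_trans ler01 B1. Qed.

Lemma norm_cat a b (s t : R) : `|a| <= s -> `|b| <= t -> `|a + b| <= s + t.
Proof. by move=> h1 h2; apply: le_trans (ler_normD _ _) _; exact: lerD. Qed.

Lemma norm_catR (a b s t : R) : `|a| <= s -> `|b| <= t -> `|a + b| <= s + t.
Proof. by move=> h1 h2; apply: le_trans (ler_normD _ _) _; exact: lerD. Qed.

Lemma Gam_le y u v (s t : R) : `|y - x0| < r -> `|u| <= s -> `|v| <= t -> `|Gamv y u v| <= B * s * t.
Proof.
move=> yr us vt; apply: le_trans (gb_Gam gb u v yr) _; have K0 := ltW (gb_K gb).
exact: ler_pM3.
Qed.

(** The field is s e with e nearly parallel, known through its end values s1 eh' and s2 eh. Its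
    covariant derivative over the rescaled window is tau e up to the remainder y. Metric and
    curvature are frozen at the right end u2, so that the windows add up like a Riemann sum. *)
Lemma window_second_order x u1 u2 p p1 p2 e eh eh' (s1 s2 t tau eta : R) :
  [/\ `|x - x0| < r, `|u1 - x0| < r, `|u2 - x0| < r, `|x - x0| < r' & `|u2 - x0| < r'] ->
  [/\ `|p| <= B, `|p1| <= B & `|p2| <= B] ->
  [/\ `|x - u1| <= B * tau & `|x - u2| <= B * tau] ->
  [/\ `|p - p1| <= B ^+ 3 * tau & `|p - p2| <= B ^+ 3 * tau] ->
  `|e| <= B -> tau = s2 - s1 -> 0 <= s1 -> 0 < tau -> s2 <= 1 -> tau <= eta -> eta <= 1 -> 0 <= t <= 1 ->
  `|eh - e| <= eta * tau -> `|eh' - e - tau *: Gamv u1 p1 e| <= eta * tau ->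
  forall Z W, Z = s2 *: eh - s1 *: eh' -> W = s1 *: eh' + t *: Z ->
  bil (g x) (Z + Gamv x (tau *: p) W) (Z + Gamv x (tau *: p) W) + rm x W (tau *: p) (tau *: p) W
  <= tau ^+ 2 * (bil (g u2) e e + s2 ^+ 2 * rm u2 e p2 p2 e + window_const * eta).
Proof.
move=> [xr u1r u2r xr' u2r'] [pB p1B p2B] [xu1 xu2] [pp1 pp2] eB tE s10 t0 s21 te e1 /andP[t00 t01] h1 h2 Z W Zdef Wdef.
have B0 := B_ge0; have K0 := ltW (gb_K gb); have K0' := ltW (cb_K cb).
have tau0 := ltW t0; have eta0 : 0 <= eta by exact: le_trans te.
have s11 : s1 <= 1 by apply: le_trans s21; rewrite -subr_ge0 -tE.
have s20 : 0 <= s2 by apply: le_trans s10 _; rewrite -subr_ge0 -tE.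
have tau1 : tau <= 1 by exact: le_trans te e1.
have sc (k s : R) v : 0 <= k <= 1 -> `|v| <= s -> `|k *: v| <= s.
  move=> /andP[k0 k1] vs; rewrite normrZ (ger0_norm k0); apply: le_trans vs.
  by rewrite ler_piMl.
have i1 : 0 <= s1 <= 1 by rewrite s10 s11. have i2 : 0 <= s2 <= 1 by rewrite s20 s21.
have it : 0 <= t <= 1 by rewrite t00 t01.
have et : eta * tau <= 1 * tau by rewrite ler_wpM2r.
set ga := Gamv u1 p1 e in h2; pose a := eh' - e.
have gaB : `|ga| <= B ^+ 3 by apply: le_trans (Gam_le u1r p1B eB) _; rewrite -expr2 -exprSr.
have aA : `|a| <= A1 * tau.
  have -> : a = tau *: ga + (a - tau *: ga) by rewrite addrC subrK.
  rewrite mulrDl; apply: norm_cat; last exact: le_trans h2 et.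
  by rewrite normrZ gtr0_norm // mulrC ler_wpM2r.
have ZE : Z = tau *: e + (s2 *: (eh - e) - s1 *: a).
  rewrite Zdef /a tE !scalerBr scalerBl; move: (s2 *: eh) (s1 *: eh') (s2 *: e) (s1 *: e) => *.
  by apply/rowP => k; rewrite !mxE; ring.
have ZA : `|Z| <= A2 * tau.
  rewrite ZE /A2 !mulrDl -addrA; apply: norm_cat; first by rewrite normrZ gtr0_norm // mulrC ler_wpM2r.
  apply: norm_cat; first by apply: sc i2 _; exact: le_trans h1 et.
  by rewrite normrN; apply: sc i1 _; rewrite -mulrDl.
have V1 : `|W - s1 *: e| <= A3 * tau.
  have -> : W - s1 *: e = s1 *: a + t *: Z.
    by rewrite Wdef /a scalerBr addrAC.
  by rewrite mulrDl; apply: norm_cat; exact: sc.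
have V2 : `|W - s2 *: e| <= A4 * tau.
  have -> : W - s2 *: e = (W - s1 *: e) + - (tau *: e).
    by rewrite tE scalerBl opprB addrA subrK.
  rewrite mulrDl; apply: norm_cat => //; by rewrite normrN normrZ gtr0_norm // mulrC ler_wpM2r.
have A10 : 0 <= A1 by rewrite addr_ge0 // exprn_ge0.
have A20 : 0 <= A2 by rewrite addr_ge0 // addr_ge0.
have A30 : 0 <= A3 by exact: addr_ge0.
have A40 : 0 <= A4 by exact: addr_ge0.
have A60 : 0 <= A6 by rewrite !addr_ge0 // !mulr_ge0 // exprn_ge0.
have W5 : `|W| <= A5.
  have -> : W = s2 *: e + (W - s2 *: e) by rewrite addrC subrK.
  by apply: norm_cat; [exact: sc|apply: le_trans V2 _; rewrite ler_piMr].
pose y := (s2 *: (eh - e) - s1 *: (a - tau *: ga)) + tau *: (Gamv x p W - s1 *: ga).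
have YE : Z + Gamv x (tau *: p) W = tau *: e + y.
  rewrite GamvZl ZE /y /a; move: (Gamv x p W) (ga : V) => X1 X2.
  by apply/rowP => k; rewrite !mxE; ring.
have dG : `|Gamv x p W - s1 *: ga| <= A6 * tau.
  have -> : Gamv x p W - s1 *: ga = Gamv x p (W - s1 *: e) + s1 *: (Gamv x (p - p1) e) + s1 *: (Gamv x p1 e - ga).
    rewrite GamvBr GamvBl GamvZr !scalerBr; move: (Gamv x p W) (s1 *: Gamv x p e) (s1 *: Gamv x p1 e) (s1 *: ga) => *.
    by apply/rowP => k; rewrite !mxE; ring.
  rewrite /A6 !mulrDl; apply: norm_cat; first apply: norm_cat.
  - by apply: le_trans (Gam_le xr pB V1) _; rewrite mulrA.
  - apply: sc i1 _; apply: le_trans (Gam_le xr pp1 eB) _.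
    by rewrite le_eqVlt; apply/orP; left; apply/eqP; ring.
  - apply: sc i1 _; apply: le_trans (gb_GamL gb p1 e u1r xr) _.
    have -> : B * B * B * B * tau = B * (B * tau) * B * B by ring.
    by apply: ler_pM => //; rewrite ?mulr_ge0 //; apply: ler_pM3.
have yA : `|y| <= A7 * eta * tau.
  have -> : A7 * eta * tau = (eta * tau + eta * tau) + A6 * eta * tau by rewrite /A7; ring.
  apply: norm_cat; first apply: norm_cat.
  - exact: sc.
  - by rewrite normrN; apply: sc.
  - rewrite normrZ gtr0_norm // mulrC ler_wpM2r //; apply: le_trans dG _; exact: ler_wpM2l.
clearbody y.
have P1 : bil (g x) (Z + Gamv x (tau *: p) W) (Z + Gamv x (tau *: p) W) <=
    tau ^+ 2 * (bil (g u2) e e + (B * B * B * B + 2 * (B * B * A7) + B * A7 * A7) * eta).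
  rewrite YE !(bilDl, bilDr) !(bilZl, bilZr).
  have Q1 : bil (g x) e y <= B * B * (A7 * eta * tau).
    by apply: le_trans (ler_norm _) _; apply: le_trans (gb_up gb e y xr) _; exact: ler_pM3.
  have Q2 : bil (g x) y e <= B * (A7 * eta * tau) * B.
    by apply: le_trans (ler_norm _) _; apply: le_trans (gb_up gb y e xr) _; exact: ler_pM3.
  have Q3 : bil (g x) y y <= B * (A7 * eta * tau) * (A7 * eta * tau).
    by apply: le_trans (ler_norm _) _; apply: le_trans (gb_up gb y y xr) _; exact: ler_pM3.
  have Q4 : bil (g x) e e - bil (g u2) e e <= B * (B * tau) * B * B.
    apply: le_trans (ler_norm _) _; apply: le_trans (gb_gL gb e e u2r xr) _.
    by apply: ler_pM => //; rewrite ?mulr_ge0 //; exact: ler_pM3.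
  have ee : eta * eta <= eta by rewrite ler_piMl.
  have A70 : 0 <= A7 by rewrite addr_ge0.
  have S1 : B * (A7 * eta * tau) * (A7 * eta * tau) <= tau ^+ 2 * (B * A7 * A7 * eta).
    have -> : B * (A7 * eta * tau) * (A7 * eta * tau) = tau ^+ 2 * (B * A7 * A7 * (eta * eta)) by ring.
    by rewrite ler_wpM2l ?sqr_ge0 // ler_wpM2l // !mulr_ge0.
  have S2 : tau ^+ 2 * (B * (B * tau) * B * B) <= tau ^+ 2 * (B * B * B * B * eta).
    rewrite ler_wpM2l ?sqr_ge0 //; have -> : B * (B * tau) * B * B = B * B * B * B * tau by ring.
    by rewrite ler_wpM2l // !mulr_ge0.
  have S3 := ler_wpM2l tau0 Q1; have S4 := ler_wpM2l tau0 Q2; have S5 := ler_wpM2l (sqr_ge0 tau) Q4.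
  have F1 : tau * (B * B * (A7 * eta * tau)) = tau ^+ 2 * (B * B * A7 * eta) by ring.
  have F2 : tau * (B * (A7 * eta * tau) * B) = tau ^+ 2 * (B * B * A7 * eta) by ring.
  rewrite F1 in S3; rewrite F2 in S4; rewrite mulrBr in S5.
  have -> : tau ^+ 2 * (bil (g u2) e e + (B * B * B * B + 2 * (B * B * A7) + B * A7 * A7) * eta) =
    tau ^+ 2 * bil (g u2) e e + tau ^+ 2 * (B * B * B * B * eta) + 2 * (tau ^+ 2 * (B * B * A7 * eta)) +
    tau ^+ 2 * (B * A7 * A7 * eta) by ring.
  have -> : tau * (tau * bil (g x) e e) = tau ^+ 2 * bil (g x) e e by ring.
  exact: (window_sum S3 S4 Q3 S1 S5 S2).
have P2 : rm x W (tau *: p) (tau *: p) W <= tau ^+ 2 * (s2 ^+ 2 * rm u2 e p2 p2 e +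
   (B * A4 * B * B * A5 + B * B * B * B * A4 + 2 * (B * B * B ^+ 3 * B * B) + B * B * B * B * B * B) * eta).
  have -> : rm x W (tau *: p) (tau *: p) W = tau ^+ 2 * rm x W p p W.
    by have := rmZ g x 1 tau tau 1 W p p W; rewrite !scale1r mul1r mulr1 -expr2.
  rewrite ler_wpM2l ?sqr_ge0 //; pose W2 := s2 *: e; pose D := W - W2; pose d := p - p2.
  have -> : s2 ^+ 2 * rm u2 e p2 p2 e = rm u2 W2 p2 p2 W2.
    by have := rmZ g u2 s2 1 1 s2 e p2 p2 e; rewrite !scale1r !mulr1 -expr2.
  have W2B : `|W2| <= B by exact: sc.
  have q1 : rm x W p p W = rm x D p p W + rm x W2 p p W by rewrite -rmDa subrK.
  have q2 : rm x W2 p p W = rm x W2 p p D + rm x W2 p p W2 by rewrite -rmDd subrK.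
  have q3 : rm x W2 p p W2 = rm x W2 d p W2 + rm x W2 p2 p W2 by rewrite -rmDb subrK.
  have q4 : rm x W2 p2 p W2 = rm x W2 p2 d W2 + rm x W2 p2 p2 W2 by rewrite -rmDc subrK.
  have rl (v1 v2 v3 v4 : V) (s t' u v : R) : `|v1| <= s -> `|v2| <= t' -> `|v3| <= u -> `|v4| <= v ->
      rm x v1 v2 v3 v4 <= B * s * t' * u * v.
    move=> as' bt cu fv; apply: le_trans (ler_norm _) _; apply: le_trans (cb_rm cb v1 v2 v3 v4 xr') _.
    by apply: ler_pM3; rewrite ?mulr_ge0 //; exact: ler_pM3.
  have R1 := rl _ _ _ _ _ _ _ _ V2 pB pB W5; have R2 := rl _ _ _ _ _ _ _ _ W2B pB pB V2.
  have R3 := rl _ _ _ _ _ _ _ _ W2B pp2 pB W2B; have R4 := rl _ _ _ _ _ _ _ _ W2B p2B pp2 W2B.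
  have R5 : rm x W2 p2 p2 W2 - rm u2 W2 p2 p2 W2 <= B * (B * tau) * B * B * B * B.
    apply: le_trans (ler_norm _) _; apply: le_trans (cb_rmL cb W2 p2 p2 W2 u2r' xr') _.
    by apply: ler_pM3; rewrite ?mulr_ge0 //; apply: ler_pM3; rewrite ?mulr_ge0 //; exact: ler_pM.
  rewrite q1 q2 q3 q4.
  have A50 : 0 <= A5 by exact: addr_ge0.
  have -> : (B * A4 * B * B * A5 + B * B * B * B * A4 + 2 * (B * B * B ^+ 3 * B * B) + B * B * B * B * B * B) * eta
     = (B * A4 * B * B * A5) * eta + (B * B * B * B * A4) * eta + (B * B * B ^+ 3 * B * B) * eta
       + (B * B * B ^+ 3 * B * B) * eta + (B * B * B * B * B * B) * eta by ring.
  have up (X Y Q : R) : X <= Q -> Q = Y * tau -> 0 <= Y -> X <= Y * eta.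
    by move=> XQ QE Y0; apply: le_trans XQ _; rewrite QE; exact: ler_wpM2l.
  have T1 := up _ (B * A4 * B * B * A5) _ R1 ltac:(ring) ltac:(by rewrite !mulr_ge0).
  have T2 := up _ (B * B * B * B * A4) _ R2 ltac:(ring) ltac:(by rewrite !mulr_ge0).
  have T3 := up _ (B * B * B ^+ 3 * B * B) _ R3 ltac:(ring) ltac:(by rewrite !mulr_ge0 // exprn_ge0).
  have T4 := up _ (B * B * B ^+ 3 * B * B) _ R4 ltac:(ring) ltac:(by rewrite !mulr_ge0 // exprn_ge0).
  have T5 := up _ (B * B * B * B * B * B) _ R5 ltac:(ring) ltac:(by rewrite !mulr_ge0).
  exact: (window_sum5 T1 T2 T3 T4 T5).
apply: le_trans (lerD P1 P2) _; rewrite -mulrDr le_eqVlt; apply/orP; left; apply/eqP.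
by rewrite /window_const; move: (bil _ _ _) (rm _ _ _ _ _) => *; ring.
Qed.

Definition frame_const : R := B * B ^+ 3 * B ^+ 3 + B * B ^+ 3 * B * B + B * B ^+ 2 * B * B.

(** One Euler step of parallel transport from u2 back to u1 gives a frame that is orthonormal up to
    O(tau^2), and [orthonormalize] repairs it at a cost of the same order. *)
Lemma near_parallel u1 u2 p1 (E : 'M[R]_n.+1) (tau : R) :
  `|u1 - x0| < r -> `|u2 - x0| < r -> `|p1| <= B -> 0 <= tau -> tau <= 1 ->
  `|u2 - u1 - tau *: p1| <= B ^+ 3 * tau ^+ 2 -> `|u2 - u1| <= B * tau ->
  (forall k, `|row k E| <= B) -> E *m g u2 *m E^T = 1%:M ->
  n.+1%:R ^+ 2 * (frame_const * tau ^+ 2) <= 2^-1 ->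
  exists E' : 'M[R]_n.+1, E' *m g u1 *m E'^T = 1%:M /\
    forall k, `|row k E' - row k E - tau *: Gamv u1 p1 (row k E)|
      <= n.+1%:R * (2 * n.+1%:R ^+ 4 * (frame_const * tau ^+ 2) * (B + B ^+ 3)).
Proof.
move=> u1r u2r p1B t0 t1 u12 u12' EB EE small; have B0 := B_ge0; have K0 := ltW (gb_K gb).
have U1 := gb_U gb u1r.
pose F : 'M[R]_n.+1 := \matrix_k (row k E + tau *: Gamv u1 p1 (row k E)).
pose P := F *m g u1 *m F^T.
have Ps : P^T = P by rewrite /P !trmx_mul trmxK (cm_sym cm U1) mulmxA.
have GB k : `|Gamv u1 p1 (row k E)| <= B ^+ 3.
  by apply: le_trans (Gam_le u1r p1B (EB k)) _; rewrite -expr2 -exprSr.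
have GB' k : `|tau *: Gamv u1 p1 (row k E)| <= B ^+ 3.
  by rewrite normrZ (ger0_norm t0); apply: le_trans (GB k); rewrite ler_piMl.
have B3 : 0 <= B ^+ 3 by rewrite exprn_ge0.
have Pe k l : `|P k l - (k == l)%:R| <= frame_const * tau ^+ 2.
  have -> : P k l - (k == l)%:R = bil (g u1) (row k F) (row l F) - bil (g u2) (row k E) (row l E).
    by rewrite -(bil_rowE (g u1) F k l) -(bil_rowE (g u2) E k l) EE [1%:M k l]mxE.
  rewrite !rowK; move: (GB k) (GB l) (EB k) (EB l); move: (row k E) (row l E) => a b Ga Gb aB bB.
  pose d := u2 - u1 - tau *: p1; pose er := bil (g u2) a b - bil (g u1) a b - bil (Dg u1 (u2 - u1)) a b.
  have -> : bil (g u1) (a + tau *: Gamv u1 p1 a) (b + tau *: Gamv u1 p1 b) - bil (g u2) a b =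
    tau ^+ 2 * bil (g u1) (Gamv u1 p1 a) (Gamv u1 p1 b) - bil (Dg u1 d) a b - er.
    have -> : bil (Dg u1 d) a b = bil (Dg u1 (u2 - u1)) a b - tau * bil (Dg u1 p1) a b.
      rewrite !(Dg_compat cm _ _ _ U1) /d !GamvBl !GamvZl !bilDl !bilDr !bilNl !bilNr !bilZl !bilZr.
      by move: (bil (g u1) (Gamv u1 p1 a) b) (bil (g u1) a (Gamv u1 p1 b)) => *; ring.
    rewrite /er (Dg_compat cm p1 _ _ U1) !(bilDl, bilDr) !(bilZl, bilZr).
    move: (bil (g u1) (Gamv u1 p1 a) b) (bil (g u1) a (Gamv u1 p1 b)) (bil (Dg _ _) _ _) (bil (g u2) _ _) (bil (g u1) a b).
    by move: (bil _ (Gamv _ _ _) (Gamv _ _ _)) => *; ring.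
  have -> : frame_const * tau ^+ 2 = B * B ^+ 3 * B ^+ 3 * tau ^+ 2 + B * (B ^+ 3 * tau ^+ 2) * B * B
     + B * (B * tau) ^+ 2 * B * B by rewrite /frame_const; ring.
  apply: norm_catR; first apply: norm_catR.
  - rewrite normrM (ger0_norm (sqr_ge0 tau)) mulrC ler_wpM2r ?sqr_ge0 //.
    by apply: le_trans (gb_up gb _ _ u1r) _; exact: ler_pM3.
  - rewrite normrN; apply: le_trans (gb_Dg gb d a b u1r) _.
    by apply: ler_pM3; rewrite ?mulr_ge0 //; exact: ler_pM.
  - rewrite normrN; apply: le_trans (gb_g2 gb a b u1r u2r) _.
    apply: ler_pM3; rewrite ?mulr_ge0 ?exprn_ge0 //; apply: ler_pM => //; rewrite ?exprn_ge0 //.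
    by rewrite lerXn2r // nnegrE // mulr_ge0.
have fc0 : 0 <= frame_const * tau ^+ 2.
  by rewrite mulr_ge0 ?sqr_ge0 // /frame_const !addr_ge0 // !mulr_ge0 // exprn_ge0.
have [S [SP Se]] := orthonormalize Ps fc0 small Pe.
exists (S *m F); split; first by rewrite trmx_mul mulmxA -(mulmxA S) -(mulmxA S).
move=> k; have -> : row k (S *m F) - row k E - tau *: Gamv u1 p1 (row k E) = row k ((S - 1%:M) *m F).
  by rewrite mulmxBl mul1mx linearB /= [row k F]rowK opprD addrA.
have nn : 0 <= 2 * n.+1%:R ^+ 4 * (frame_const * tau ^+ 2) by rewrite mulr_ge0 // mulr_ge0 // exprn_ge0.
apply: rv_norm_le; first by rewrite mulr_ge0 // mulr_ge0 // addr_ge0.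
move=> j; rewrite mxE; apply: mulmx_entry_le => [i l|i l|].
- by rewrite !mxE; exact: Se.
- apply: le_trans (_ : `|row i F| <= _); first by have := rv_coord_le (row i F) l; rewrite [row i F 0 l]mxE.
  by rewrite rowK; apply: norm_cat.
- exact: nn.
Qed.

End Estimate.
End WindowEstimates.

Lemma scaled_near {R : realType} {n : nat} (X e : 'rV[R]_n.+1) (x nu : R) : `|X - x *: e| <= nu * `|x| -> 0 <= nu ->
  exists2 eh, `|eh - e| <= nu & X = x *: eh.
Proof.
have [->|x0] := eqVneq x 0.
  rewrite scale0r subr0 normr0 mulr0 normr_le0 => /eqP -> nu0; exists e; rewrite ?subrr ?normr0 //.
  by rewrite scale0r.
move=> H _; exists (x^-1 *: X); last by rewrite scalerA mulfV // scale1r.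
have -> : x^-1 *: X - e = x^-1 *: (X - x *: e) by rewrite scalerBr scalerA mulVf // scale1r.
by rewrite normrZ normfV mulrC ler_pdivrMr // normr_gt0.
Qed.

Lemma cauchy_schwarz_legs {R : realType} (L1 L2 X1 X2 t1 t2 : R) : 0 < t1 -> 0 < t2 ->
  L1 ^+ 2 <= t1 * X1 -> L2 ^+ 2 <= t2 * X2 -> (L1 + L2) ^+ 2 <= (t1 + t2) * (X1 + X2).
Proof.
move=> t10 t20 H1 H2; have p : 0 < t1 * t2 by exact: mulr_gt0.
have s0 : 0 <= t1 + t2 by rewrite ltW // addr_gt0.
rewrite -(ler_pM2l p).
have A1 := ler_wpM2l (mulr_ge0 (ltW t20) s0) H1; have A2 := ler_wpM2l (mulr_ge0 (ltW t10) s0) H2.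
have -> : t1 * t2 * ((t1 + t2) * (X1 + X2)) = t2 * (t1 + t2) * (t1 * X1) + t1 * (t1 + t2) * (t2 * X2) by ring.
apply: le_trans (lerD A1 A2); rewrite -subr_ge0.
have -> : t2 * (t1 + t2) * L1 ^+ 2 + t1 * (t1 + t2) * L2 ^+ 2 - t1 * t2 * (L1 + L2) ^+ 2 = (t2 * L1 - t1 * L2) ^+ 2 by ring.
exact: sqr_ge0.
Qed.

(** The 3 in (C + 3) eta counts the two boundary terms and the window error [we]. *)
Lemma window_arith {R : realType} (E tau l2 b1 b2 g1 g2 s1 s2 ep Q C eta we : R) :
  0 < tau -> 0 <= eta -> 0 <= s1 -> s1 <= 1 -> 0 <= s2 -> s2 <= 1 ->
  E <= tau ^+ 2 * l2 + (tau * b2 - tau * b1) + (ep ^+ 2 * (tau ^+ 2 * (1 + Q + C * eta)) + we) ->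
  `|b2 - 2 * (s2 * ep) * g2| <= eta * tau * (s2 * ep) ^+ 2 ->
  `|b1 - 2 * (s1 * ep) * g1| <= eta * tau * (s1 * ep) ^+ 2 ->
  we <= eta * tau ^+ 2 * ep ^+ 2 ->
  E <= tau * (tau * l2 + 2 * ep * (s2 * g2 - s1 * g1) + ep ^+ 2 * (tau * (1 + Q + (C + 3) * eta))).
Proof.
move=> t0 eta0 s10 s11 s20 s21 HE H2 H1 Hw.
have K s : 0 <= s -> s <= 1 -> eta * tau * (s * ep) ^+ 2 <= eta * tau * ep ^+ 2.
  move=> p q; rewrite ler_wpM2l ?mulr_ge0 // ?(ltW t0) // exprMn ler_piMl ?sqr_ge0 //.
  by rewrite expr_le1.
have A2 := le_trans (ler_norm _) (le_trans H2 (K _ s20 s21)).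
rewrite distrC in H1; have A1 := le_trans (ler_norm _) (le_trans H1 (K _ s10 s11)).
have B2 := ler_wpM2l (ltW t0) A2; have B1 := ler_wpM2l (ltW t0) A1.
have e1 : tau * (eta * tau * ep ^+ 2) = eta * tau ^+ 2 * ep ^+ 2 by ring.
rewrite e1 in B1 B2.
have -> : tau * (tau * l2 + 2 * ep * (s2 * g2 - s1 * g1) + ep ^+ 2 * (tau * (1 + Q + (C + 3) * eta))) =
  tau ^+ 2 * l2 + (tau * (2 * (s2 * ep) * g2) - tau * (2 * (s1 * ep) * g1)) + ep ^+ 2 * (tau ^+ 2 * (1 + Q + C * eta))
  + 3 * (eta * tau ^+ 2 * ep ^+ 2) by ring.
rewrite !mulrBr in B1 B2.
move: HE Hw B1 B2; move: (eta * tau ^+ 2 * ep ^+ 2) (ep ^+ 2 * _) (tau ^+ 2 * l2) (tau * b1) (tau * b2)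
  (tau * (2 * (s2 * ep) * g2)) (tau * (2 * (s1 * ep) * g1)); clear => *; lra.
Qed.

Section FrameTrace.
Context {R : realType} {n : nat}.
Local Notation V := 'rV[R]_n.+1.
Variables (U : set V) (g : V -> 'M[R]_n.+1).
Hypothesis cm : chart_metric U g.

Lemma frame_inverse x (E : 'M[R]_n.+1) : U x -> E *m g x *m E^T = 1%:M -> E^T *m E = invmx (g x).
Proof.
move=> Ux EE; have := mulmx1C EE; rewrite mulmxA => H.
by rewrite -[LHS]mulmx1 -(mulmxV (chart_unit cm Ux)) mulmxA H mul1mx.
Qed.

Lemma frame_ricci x p (E : 'M[R]_n.+1) : U x -> E *m g x *m E^T = 1%:M ->
  \sum_k rm g x (row k E) p p (row k E) = - bil (ricci g x) p p.
Proof.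
move=> Ux EE; have G := frame_inverse Ux EE.
have EG i l : \sum_k E k i * E k l = invmx (g x) i l.
  by rewrite -G mxE; apply: eq_bigr => k _; rewrite mxE.
transitivity (\sum_j \sum_h p 0 j * p 0 h * \sum_i \sum_l invmx (g x) i l * riemann g i j h l x).
  rewrite /rm; under eq_bigr => k _ do rewrite exchange_big /=.
  rewrite exchange_big; apply: eq_bigr => j _ /=.
  under eq_bigr => k _ do rewrite exchange_big /=.
  rewrite exchange_big; apply: eq_bigr => h _ /=.
  under eq_bigr => k _ do under eq_bigr => i _ do under eq_bigr => l _ do rewrite !mxE.
  rewrite exchange_big mulr_sumr; apply: eq_bigr => i _ /=.
  rewrite exchange_big mulr_sumr; apply: eq_bigr => l _ /=.
  rewrite -EG mulr_suml mulr_sumr; apply: eq_bigr => k _.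
  by move: (riemann _ _ _ _ _ _) => z; ring.
rewrite bilE -sumrN; apply: eq_bigr => j _; rewrite -sumrN; apply: eq_bigr => h _.
rewrite -mulrN mxE -sumrN; congr (_ * _); apply: eq_bigr => i _; rewrite -sumrN; apply: eq_bigr => l _.
rewrite (riemann_anti12_at (cm_open cm) (cm_smooth cm) (chart_unit cm) Ux i j h l).
by rewrite mulrN.
Qed.

End FrameTrace.

(** * Summation of the second variation along a geodesic *)

Section SecondVariation.
Context {R : realType} {n : nat} {M : topologicalType}.
Local Notation V := 'rV[R]_n.+1.
Variables (A : smooth_atlas R n M) (g : riemannian_metric A).
Hypothesis Mh : hausdorff_space M.
Hypothesis gcomp : complete_metric g.
Implicit Types (a : chart_index A) (p q m x y z : M) (c : R -> M).

(** Some chart at the common point; by [gram_change] any other gives the same value. *)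
Definition ip c (t : R) c' (t' : R) : R :=
  let a := sval (cid (chart_cover A (c t))) in
  bil (metric g a (chart a (c t))) (vel a c t) (vel a c' t').

Lemma ipE a c (t : R) c' (t' : R) : geodesic g c -> geodesic g c' -> c t = c' t' -> chart_dom a (c t) ->
  ip c t c' t' = bil (metric g a (chart a (c t))) (vel a c t) (vel a c' t').
Proof. by move=> g1 g2 e ha; rewrite /ip; case: cid => b hb /=; exact: (gram_change g1 g2 e ha hb). Qed.

(** The frame is given by geodesics instead of vectors, so that statements along [ga] mention no
    chart. *)
Definition geodesic_frame m (sg : 'I_n.+1 -> R -> M) : Prop :=
  (forall k, geodesic g (sg k) /\ sg k 0 = m) /\ forall k l, ip (sg k) 0 (sg l) 0 = (k == l)%:R.

Lemma geodesic_frameP a m (E : 'M[R]_n.+1) : chart_dom a m -> E *m metric g a (chart a m) *m E^T = 1%:M ->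
  geodesic_frame m (fun k => geo gcomp a m (row k E)).
Proof.
move=> am EE; split=> [k|k l]; first by have [] := geoP gcomp (row k E) am.
have [g1 e1 v1] := geoP gcomp (row k E) am; have [g2 e2 v2] := geoP gcomp (row l E) am.
have ag : chart_dom a (geo gcomp a m (row k E) 0) by rewrite e1.
by rewrite (ipE g1 g2 (etrans e1 (esym e2)) ag) v1 v2 e1 -bil_rowE EE mxE.
Qed.

Variables (ga : R -> M) (l2 : R) (rho Hf : R -> R).
Hypothesis gga : geodesic g ga.
Hypothesis sga : has_speed2 g ga l2.
Hypothesis rhoE : forall a (s : R), chart_dom a (ga s) ->
  rho s = - bil (ricci (metric g a) (chart a (ga s))) (vel a ga s) (vel a ga s).

(* The squared length is divided by [s2 - s1], so that by Cauchy-Schwarz the bounds of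
   consecutive steps add up. *)
Definition vstep (eta s1 s2 : R) : Prop := forall sg, geodesic_frame (ga s2) sg ->
  exists sg' (B : 'I_n.+1 -> R), [/\ geodesic_frame (ga s1) sg',
    \sum_k B k <= Hf s2 - Hf s1 + eta * (s2 - s1) &
    exists2 ep0 : R, 0 < ep0 & forall k (ep : R), `|ep| < ep0 ->
      exists L, reach g (sg' k (s1 * ep)) (sg k (s2 * ep)) L /\
        L ^+ 2 <= (s2 - s1) * ((s2 - s1) * l2
          + 2 * ep * (s2 * ip (sg k) 0 ga s2 - s1 * ip (sg' k) 0 ga s1) + ep ^+ 2 * B k)].

(** The frame at b is common to both steps, so the terms with [ip] telescope; the squared lengths
    combine by [cauchy_schwarz_legs]. *)
Lemma vstep_trans (eta a b c : R) : a < b -> b < c -> vstep eta a b -> vstep eta b c -> vstep eta a c.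
Proof.
move=> ab bc H1 H2 sg fg; have [sg1 [B1 [f1 S1 [e1 e10 L1]]]] := H2 sg fg.
have [sg2 [B2 [f2 S2 [e2 e20 L2]]]] := H1 sg1 f1.
exists sg2, (fun k => B2 k + B1 k); split=> //.
  rewrite big_split /=; apply: le_trans (lerD S2 S1) _.
  by move: (Hf a) (Hf b) (Hf c) => *; rewrite le_eqVlt; apply/orP; left; apply/eqP; ring.
exists (Num.min e1 e2); first by rewrite lt_min e10.
move=> k ep; rewrite lt_min => /andP[E1 E2].
have [La [Ra Ia]] := L1 k ep E1; have [Lb [Rb Ib]] := L2 k ep E2.
exists (Lb + La); split; first exact: reach_trans Rb Ra.
have p1 : 0 < b - a by rewrite subr_gt0. have p2 : 0 < c - b by rewrite subr_gt0.
apply: le_trans (cauchy_schwarz_legs p1 p2 Ib Ia) _.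
move: (ip (sg k) _ _ _) (ip (sg1 k) _ _ _) (ip (sg2 k) _ _ _) (B1 k) (B2 k); clear => *.
by rewrite le_eqVlt; apply/orP; left; apply/eqP; ring.
Qed.

(** The two points are joined by a minimal geodesic, whose energy is compared with that of the
    interpolated displacement of the piece [s1, s2] of [ga], rescaled to [0, 1]. *)
Lemma window_leg q a (r lam K w rh r' K' B s1 s2 tau eta : R) (sg sg' : R -> M) :
  local_pkg g q a r lam K w rh -> curv_ball (metric g a) (chart a q) r' K' -> K <= B -> K' <= B -> 1 <= B ->
  tau = s2 - s1 -> 0 <= s1 -> 0 < tau -> s2 <= 1 -> tau <= eta -> eta <= 1 ->
  (forall s : R, s1 <= s <= s2 -> [/\ inball q a rh (ga s), `|chart a (ga s) - chart a q| < r' &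
     `|vel a ga s| <= B]) ->
  geodesic g sg -> geodesic g sg' -> sg 0 = ga s2 -> sg' 0 = ga s1 ->
  `|vel a sg 0| <= B -> bil (metric g a (chart a (ga s2))) (vel a sg 0) (vel a sg 0) = 1 -> `|vel a sg' 0| <= B ->
  `|vel a sg' 0 - vel a sg 0 - tau *: Gamv (metric g a) (chart a (ga s1)) (vel a ga s1) (vel a sg 0)| <= eta / 2 * tau ->
  \forall ep \near (0 : R), exists L, reach g (sg' (s1 * ep)) (sg (s2 * ep)) L /\
    L ^+ 2 <= tau * (tau * l2 + 2 * ep * (s2 * ip sg 0 ga s2 - s1 * ip sg' 0 ga s1)
      + ep ^+ 2 * (tau * (1 + s2 ^+ 2 * rm (metric g a) (chart a (ga s2)) (vel a sg 0) (vel a ga s2) (vel a ga s2) (vel a sg 0)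
            + (window_const B + 3) * eta))).
Proof.
move=> lp cb KB KB' B1 tE s10 t0 s21 te e1 Hs gs gs' sg0 sg0' vB v1 vB' vpar.
have cm := chart_cm g a; have gb := lp_gb lp; have r0 := gb_r gb; have K0 := gb_K gb.
have r44 : r / 4 + r / 4 <= r.
  have H (z : R) : 0 < z -> z / 4 + z / 4 <= z by move=> *; lra.
  exact: H r0.
have eta0 : 0 < eta by exact: lt_le_trans te.
have s12 : s1 <= s2 by rewrite -subr_ge0 -tE ltW.
have B0 : 0 <= B by exact: le_trans ler01 B1.
have tau1 : tau <= 1 by exact: le_trans te e1.
have s11 : s1 <= 1 by exact: le_trans s21.
have s20 : 0 <= s2 by exact: le_trans s12.
set u1 := chart a (ga s1) in vpar *; set u2 := chart a (ga s2) in v1 *.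
set p1 := vel a ga s1 in vpar *; set p2 := vel a ga s2.
set e := vel a sg 0 in vB v1 vpar *; set e' := vel a sg' 0 in vB' vpar *.
have m1 : s1 <= s1 <= s2 by rewrite lexx s12.
have m2 : s1 <= s2 <= s2 by rewrite lexx s12.
have [i1 c1 p1B] := Hs s1 m1; have [i2 c2 p2B] := Hs s2 m2.
have [a1 u1h] := i1; have [a2 u2h] := i2.
have rhr : rh < r.
  by apply: le_lt_trans (lp_rhor lp) _; rewrite ltr_pdivrMr // ltr_pMr // ltr1n.
have inr m : inball q a rh m -> `|chart a m - chart a q| < r by move=> [_ h]; exact: lt_trans h rhr.
have U1 : chart_cod a u1 by exact: chart_codI. have U2 : chart_cod a u2 by exact: chart_codI.
have as0 : chart_dom a (sg 0) by rewrite sg0. have as0' : chart_dom a (sg' 0) by rewrite sg0'.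
have lip (f df : R -> V) (Kc : R) : (forall s, s1 <= s <= s2 -> is_derive (s : R) 1 f (df s) /\ `|df s| <= Kc) ->
    forall s s', s1 <= s <= s2 -> s1 <= s' <= s2 -> `|f s - f s'| <= Kc * tau.
  move=> H s s' hs hs'; have Kc0 : 0 <= Kc by have [_ h] := H s hs; exact: le_trans (normr_ge0 _) h.
  wlog ss : s s' hs hs' / s' <= s.
    move=> W; have [ss|ss] := leP s' s; first exact: W.
    by rewrite distrC; apply: W => //; exact: ltW.
  apply: le_trans (_ : Kc * (s - s') <= _).
    apply: (rv_derive_bounded ss (dc := df)) => // z.
      by move=> /andP[z1 z2]; case: (H z); rewrite // (le_trans _ z1) ?(le_trans z2) //; [case/andP: hs|case/andP: hs'].
    move=> /andP[z1 z2]; case: (H z) => //; rewrite (le_trans _ (ltW z1)) ?(le_trans (ltW z2)) //; [by case/andP: hs|by case/andP: hs'].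
  rewrite ler_wpM2l // tE; apply: lerB; [by case/andP: hs|by case/andP: hs'].
have uL := lip (chart a \o ga) (vel a ga) B (fun s hs => let: And3 h _ hb := Hs s hs in conj (geodesic_derive gga (proj1 h)) hb).
have B3 : B * B * B = B ^+ 3 by rewrite -expr2 -exprSr.
have pL : forall s s', s1 <= s <= s2 -> s1 <= s' <= s2 -> `|vel a ga s - vel a ga s'| <= B ^+ 3 * tau.
  apply: (lip (vel a ga) (fun s => - Gamv (metric g a) (chart a (ga s)) (vel a ga s) (vel a ga s)) (B ^+ 3)) => s hs.
  have [h _ hb] := Hs s hs; split; first by have [_] := geodesic_chart gga (proj1 h).
  by rewrite normrN -B3; exact: (Gam_le gb KB (inr _ h) hb hb).
(* Mm |ep| will bound the end displacements, and kap is then the coefficient of |ep|^3 in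
   [window_error]. *)
pose Mm := B + 1; pose kap := K * (12 + 8 * B + (B + 2) ^+ 2) * Mm ^+ 3.
have Mm0 : 0 < Mm by exact: ltr_wpDl.
have kap0 : 0 < kap.
  by rewrite /kap !mulr_gt0 ?exprn_gt0 // ltr_wpDr ?sqr_ge0 // ltr_wpDr // mulr_ge0.
have near_scale (P : R -> Prop) (k : R) : (\forall x \near (0 : R), P x) -> \forall x \near (0 : R), P (k * x).
  move=> H; have cv : (fun x : R => k * x) @ (0 : R) --> (0 : R).
    by rewrite -[X in _ --> X](mulr0 k); exact: mulrl_continuous.
  exact: cv _ H.
have et0 : 0 < eta * tau by exact: mulr_gt0.
have h2 : 0 < eta / 2 * tau by rewrite mulr_gt0 // divr_gt0.
have N1 := near_scale _ s2 (first_order_near (geodesic_derive gs as0) et0).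
have N1' := near_scale _ s1 (first_order_near (geodesic_derive gs' as0') h2).
have dnear (c : R -> M) : geodesic g c -> chart_dom a (c 0) ->
    \forall x \near (0 : R), is_derive (x : R) 1 (chart a \o c) (vel a c x).
  move=> gc ac; have := near_dom (t := 0) (geodesic_cts gc) ac.
  apply: filterS => x hx; exact: (geodesic_derive gc hx).
have [_ dv2] := geodesic_chart gs as0; have [_ dv1] := geodesic_chart gs' as0'.
have z2 : (chart a \o sg) 0 = u2 by rewrite /= sg0.
have z1 : (chart a \o sg') 0 = u1 by rewrite /= sg0'.
rewrite z2 in dv2; rewrite z1 in dv1.
have N2 := near_scale _ s2 (boundary_near cm p2 U2 (dnear _ gs as0) dv2 z2 et0).
have N2' := near_scale _ s1 (boundary_near cm p1 U1 (dnear _ gs' as0') dv1 z1 et0).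
have nin (c : R -> M) (k : R) : geodesic g c -> inball q a rh (c 0) -> \forall x \near (0 : R), inball q a rh (c (k * x)).
  move=> gc ic; have H : \forall x \near (0 : R), inball q a rh (c x) by exact: (geodesic_cts gc (x := 0) (open_inball ic)).
  exact: (near_scale _ k H).
have N3 := nin sg s2 gs ltac:(by rewrite sg0); have N3' := nin sg' s1 gs' ltac:(by rewrite sg0').
(* In this order: displacements at most 1, displacements that stay in the ball, and a window error
   of at most eta tau^2 ep^2. *)
pose de := Num.min (Num.min (Mm^-1) (r / 4 / Mm)) (eta * tau ^+ 2 / kap).
have de0 : 0 < de by rewrite /de !lt_min invr_gt0 Mm0 !divr_gt0 // mulr_gt0 // exprn_gt0.
have N4 := near_dist_R 0 de0.
have fI (P Q : set R) : nbhs (0 : R) P -> nbhs (0 : R) Q -> nbhs (0 : R) (P `&` Q) by move=> *; exact: filterI.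
have NN := fI _ _ (fI _ _ N1 N1') (fI _ _ (fI _ _ N2 N2') (fI _ _ (fI _ _ N3 N3') N4)).
apply: filterS NN => ep [[F1 F1'] [[F2 F2'] [[F3 F3'] F4]]].
rewrite sub0r normrN /de !lt_min in F4; move: F4 => /andP[/andP[F4 F5] F6].
pose m := Mm * `|ep|; have m0 : 0 <= m by rewrite mulr_ge0 // ltW.
have mle : m <= 1 by rewrite /m mulrC -ler_pdivlMr // div1r ltW.
have mr : m < r / 4 by rewrite /m mulrC -ltr_pdivlMr.
have we : window_error K B m <= eta * tau ^+ 2 * ep ^+ 2.
  have -> : window_error K B m = kap * `|ep| * ep ^+ 2.
    rewrite /window_error /m /kap exprMn -[in RHS](real_normK (num_real ep)).
    by move: `|ep| => z; ring.
  by rewrite ler_wpM2r ?sqr_ge0 // mulrC -ler_pdivlMr // ltW.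
have [eh ehe X2] := scaled_near F1 (ltW et0); have [eh' ehe' X1] := scaled_near F1' (ltW h2).
rewrite /= sg0 -/u2 in X2; rewrite /= sg0' -/u1 in X1.
set xi1 := chart a (sg (s2 * ep)) - u2 in X2; set xi0 := chart a (sg' (s1 * ep)) - u1 in X1.
pose Z := s2 *: eh - s1 *: eh'.
have ZE : xi1 - xi0 = ep *: Z by rewrite X2 X1 /Z scalerBr !scalerA ![ep * _]mulrC.
have tri4 (X1' X2' X3' X4' : V) : X1' - X2' - X4' = (X1' - X3') + (X3' - X2' - X4') by rewrite !addrA subrK.
have par : `|eh' - e - tau *: Gamv (metric g a) u1 p1 e| <= eta * tau.
  have -> : eh' - e - tau *: Gamv (metric g a) u1 p1 e = (eh' - e') + (e' - e - tau *: Gamv (metric g a) u1 p1 e).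
    exact: tri4.
  have -> : eta * tau = eta / 2 * tau + eta / 2 * tau by rewrite -mulrDl -splitr.
  exact: norm_cat.
have nle (s : R) (v v' : V) (z : R) : 0 <= s <= 1 -> `|v| <= B -> `|v' - v| <= z -> z <= 1 -> `|(s * ep) *: v'| <= m.
  move=> /andP[q1 q2] vB1 vv zz; rewrite normrZ normrM (ger0_norm q1) /m mulrC.
  apply: ler_pM; rewrite ?mulr_ge0 //.
    have -> : v' = v + (v' - v) by rewrite addrC subrK.
    by apply: norm_cat => //; exact: le_trans vv zz.
  by rewrite ler_piMl.
have et1 : eta * tau <= 1 by rewrite mulr_ile1 ?(ltW eta0) ?(ltW t0).
have x1m : `|xi1| <= m by rewrite X2; apply: nle vB ehe et1; rewrite s20 s21.
have x0m : `|xi0| <= m.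
  rewrite X1; apply: nle vB' ehe' _; first by rewrite s10 s11.
  by rewrite mulr_ile1 ?(ltW t0) // ?divr_ge0 ?(ltW eta0) // ler_pdivrMr // mul1r; apply: le_trans e1 _; rewrite ler1n.
pose gaf t := ga (tau * t + s1).
have hs t : 0 <= t <= 1 -> s1 <= tau * t + s1 <= s2.
  move=> /andP[q1 q2]; rewrite lerDr mulr_ge0 ?(ltW t0) //= -lerBrDr -tE ler_piMr // ltW //.
have ggaf : geodesic g gaf by exact: geodesic_affine.
have vgaf t : 0 <= t <= 1 -> vel a gaf t = tau *: vel a ga (tau * t + s1).
  by move=> /hs h; have [[h1 _] _ _] := Hs _ h; exact: (vel_affine gga h1).
have Hc t : 0 <= t <= 1 -> [/\ `|(chart a \o gaf) t - chart a q| < r,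
     chart_geodesic (metric g a) (chart a \o gaf) (vel a gaf) t, `|vel a gaf t| <= B &
     bil (metric g a ((chart a \o gaf) t)) (vel a gaf t) (vel a gaf t) = tau ^+ 2 * l2].
  move=> ht; have [h1 _ hb] := Hs _ (hs t ht); have [ha _] := h1; split.
  - exact: inr.
  - exact: geodesic_chart.
  - by rewrite vgaf // normrZ (gtr0_norm t0); apply: le_trans hb; rewrite ler_piMl.
  - by have sgaf := has_speed2_affine (k := tau) (b := s1) gga sga; exact: (sgaf a t ha).
have xx : xi0 + (xi1 - xi0) = xi1 by rewrite [LHS]addrC subrK.
have HY t : 0 <= t <= 1 -> `|(chart a \o gaf) t + (xi0 + t *: (xi1 - xi0)) - chart a q| < r.
  move=> ht; have [[_ h1] _ _] := Hs _ (hs t ht); rewrite addrA.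
  have q4 (v : V) : `|v| <= m -> `|chart a (gaf t) + v - chart a q| < r.
    move=> vm; rewrite addrAC; apply: le_lt_trans (ler_normD _ _) _.
    have hr := lp_rhor lp; move: (lt_le_trans h1 hr) (le_lt_trans vm mr).
    by move=> X1' X2'; exact: lt_le_trans (ltrD X1' X2') r44.
  apply: segment_in_ball ht; first exact: q4.
  have -> : (chart a \o gaf) t + xi0 + (xi1 - xi0) = (chart a \o gaf) t + xi1 by rewrite -addrA xx.
  exact: q4.
have HB t : 0 <= t <= 1 ->
   bil (metric g a ((chart a \o gaf) t)) ((xi1 - xi0) + Gamv (metric g a) ((chart a \o gaf) t) (vel a gaf t) (xi0 + t *: (xi1 - xi0)))
     ((xi1 - xi0) + Gamv (metric g a) ((chart a \o gaf) t) (vel a gaf t) (xi0 + t *: (xi1 - xi0)))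
   + rm (metric g a) ((chart a \o gaf) t) (xi0 + t *: (xi1 - xi0)) (vel a gaf t) (vel a gaf t) (xi0 + t *: (xi1 - xi0))
   <= ep ^+ 2 * (tau ^+ 2 * (1 + s2 ^+ 2 * rm (metric g a) u2 e p2 p2 e + window_const B * eta)).
  move=> ht; rewrite (vgaf t ht) /=; have hst := hs t ht; have [h1 hc hb] := Hs _ hst.
  pose W := s1 *: eh' + t *: Z.
  have -> : xi0 + t *: (xi1 - xi0) = ep *: W.
    have lin (k1 k2 k3 : R) (X Y : V) : (k1 * k2) *: X + k3 *: (k2 *: Y) = k2 *: (k1 *: X + k3 *: Y).
      by rewrite scalerDr !scalerA [k2 * k1]mulrC [k2 * k3]mulrC.
    by rewrite ZE X1; exact: lin.
  rewrite ZE GamvZr -scalerDr bilZl bilZr.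
  have -> (x q' : V) : rm (metric g a) x (ep *: W) q' q' (ep *: W) = ep * ep * rm (metric g a) x W q' q' W.
    by have := rmZ (metric g a) x ep 1 1 ep W q' q' W; rewrite !scale1r !mulr1.
  rewrite mulrA -mulrDr -expr2 ler_wpM2l ?sqr_ge0 //.
  have [xr u1r] := (inr _ h1, inr _ i1); have u2r := inr _ i2.
  have := @window_second_order _ _ _ _ _ _ _ _ _ _ gb cb B KB KB' B1 (chart a (ga (tau * t + s1))) u1 u2
     (vel a ga (tau * t + s1)) p1 p2 e eh eh' s1 s2 t tau eta.
  move=> wso; have := wso _ _ _ _ vB tE s10 t0 s21 te e1 ht ehe par Z W (erefl _) (erefl _).
  have s11' : s1 <= s1 <= s2 by rewrite lexx /=; exact: le_trans (proj1 (andP hst)) (proj2 (andP hst)).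
  have s22' : s1 <= s2 <= s2 by rewrite lexx andbT; exact: le_trans (proj1 (andP hst)) (proj2 (andP hst)).
  have xr' : `|chart a (ga (tau * t + s1)) - chart a q| < r' by [].
  have [_ u2r' hp1] := Hs _ s11'; have [_ u2r'' hp2] := Hs _ s22'.
  rewrite v1; apply.
  - exact: And5 xr u1r u2r xr' u2r''.
  - exact: And3 hb hp1 hp2.
  - exact: conj (uL _ _ hst s11') (uL _ _ hst s22').
  - exact: conj (pL _ _ hst s11') (pL _ _ hst s22').
have [h [dh [Hh hE]]] := energy_window cm gb Hc x0m x1m mle HY HB.
have [c [E [gc sc d0 d1 be]]] := minimal_geodesic Mh gcomp lp F3' F3.
have addsub (X Y : V) : X + (Y - X) = Y by rewrite addrC subrK.
have gaf0 : (chart a \o gaf) 0 = u1 by rewrite /gaf /= mulr0 add0r.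
have gaf1 : (chart a \o gaf) 1 = u2 by rewrite /gaf /= mulr1 tE subrK.
have xE0 : (chart a \o gaf) 0 + (xi0 + 0 *: (xi1 - xi0)) = chart a (sg' (s1 * ep)).
  by rewrite gaf0 scale0r addr0; exact: addsub.
have xE1 : (chart a \o gaf) 1 + (xi0 + 1 *: (xi1 - xi0)) = chart a (sg (s2 * ep)).
  by rewrite gaf1 scale1r xx; exact: addsub.
have EE : E <= h 1 - h 0.
  have mgc := @minimal_geodesic_curve _ _ _ _ _ _ _ _ _ _ _ h dh (fun t => (chart a \o gaf) t + (xi0 + t *: (xi1 - xi0))) (fun t => vel a gaf t + (xi1 - xi0)) be.
  apply: mgc; [|exact: xE0|exact: xE1] => t ht.
  by have [k1 k2 k3] := Hh t ht; exact: And4 (HY t ht) k1 k2 k3.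
have E0 := has_speed2_ge0 sc.
exists (Num.sqrt E); split.
  by apply: reach_leg; exists c, E; rewrite sqr_sqrtr // sqrtr_ge0.
rewrite sqr_sqrtr //.
have btZ (x p xi : V) : boundary_term (metric g a) x (tau *: p) xi = tau * boundary_term (metric g a) x p xi.
  by rewrite /boundary_term !bilZl; ring.
have z01 : (0 : R) <= (0 : R) <= 1 by apply/andP; split; [exact: lexx|exact: ler01].
have o01 : (0 : R) <= (1 : R) <= 1 by apply/andP; split; [exact: ler01|exact: lexx].
have gv0 : vel a gaf 0 = tau *: p1 by rewrite (vgaf 0 z01) mulr0 add0r.
have gv1 : vel a gaf 1 = tau *: p2 by rewrite (vgaf 1 o01) mulr1 tE subrK.
rewrite hE gaf0 gaf1 gv0 gv1 !btZ in EE.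
rewrite (ipE gs gga sg0 as0) (ipE gs' gga sg0' as0') sg0 sg0' -/u1 -/u2 -/p1 -/p2 -/e -/e'.
rewrite (chart_bilC cm e p2 U2) (chart_bilC cm e' p1 U1).
exact: (window_arith t0 (ltW eta0) s10 s11 s20 s21 EE F2 F2' we).
Qed.

Hypothesis l20 : 0 <= l2.
(** [Hf] stands for an integral of n + 1 + s^2 rho, the trace of the second variation for the fields
    s e_k. Only an upper bound by its increments on short intervals is asked for. *)
Hypothesis HfP : forall t eta : R, 0 <= t <= 1 -> 0 < eta -> exists2 de : R, 0 < de &
  forall s1 s2, 0 <= s1 -> s1 < s2 -> s2 <= 1 -> `|s1 - t| < de -> `|s2 - t| < de ->
  (s2 - s1) * (n.+1%:R + s2 ^+ 2 * rho s2) <= Hf s2 - Hf s1 + eta * (s2 - s1).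

(** Summed over an orthonormal frame, the curvature terms frozen at s2 become rho s2 by
    [frame_ricci], and [HfP] bounds the total. *)
Lemma vstep_local (eta t0 : R) : 0 < eta -> 0 <= t0 <= 1 -> exists2 de : R, 0 < de &
  forall s1 s2, 0 <= s1 -> s1 < s2 -> s2 <= 1 -> `|s1 - t0| < de -> `|s2 - t0| < de -> vstep eta s1 s2.
Proof.
move=> eta0 t01; have [a [r [lam [K [w [rh lp]]]]]] := local_pkg_exists g (ga t0).
have gb := lp_gb lp; have aq := lp_dom lp; have cm := chart_cm g a.
have [r' [K' cb]] := curv_ball_exists cm (chart_codI aq).
have K0 := gb_K gb; have K0' := cb_K cb; have l0 := gb_lam gb; have r0 := gb_r gb; have r0' := cb_r cb.
have rh0 := lp_rho0 lp.
have rhr : rh < r.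
  by apply: le_lt_trans (lp_rhor lp) _; rewrite ltr_pdivrMr // ltr_pMr // ltr1n.
pose B := K + K' + 1 + l2 / lam + lam^-1.
have lp0 : 0 <= l2 / lam by rewrite divr_ge0 // ltW.
have lm0 : 0 < lam^-1 by rewrite invr_gt0.
have KB : K <= B by rewrite /B -!addrA lerDl !addr_ge0 // ltW.
have KB' : K' <= B by rewrite /B -!addrA [K + _]addrC -!addrA lerDl !addr_ge0 // ltW.
have B1 : 1 <= B by rewrite /B; move: (l2 / lam) (lam^-1) lp0 lm0 => *; lra.
have PB : 1 + l2 / lam <= B by rewrite /B; move: (l2 / lam) (lam^-1) lp0 lm0 => *; lra.
have EB : 1 + lam^-1 <= B by rewrite /B; move: (l2 / lam) (lam^-1) lp0 lm0 => *; lra.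
have sqb (x y : R) : 0 <= x -> x ^+ 2 <= y -> x <= 1 + y by move=> x0 xy; nra.
pose N : R := n.+1%:R; have N0 : 0 < N by rewrite ltr0n.
pose C := window_const B; pose fc := frame_const B; pose FA := N * (2 * N ^+ 4 * fc * (B + B ^+ 3)).
have C3 : 0 < `|C| + 3 by rewrite ltr_wpDl.
(* The errors (C + 3) eta' of the N fields must add up to at most eta / 2. *)
pose eta' := Num.min 1 (eta / 2 / (N * (`|C| + 3))).
have eta'0 : 0 < eta' by rewrite lt_min ltr01 !divr_gt0 // mulr_gt0.
have eta'1 : eta' <= 1 by rewrite ge_min lexx.
have eta'C : N * (`|C| + 3) * eta' <= eta / 2 by rewrite mulrC -ler_pdivlMr ?mulr_gt0 // ge_min lexx orbT.
have fA0 : 0 < `|FA| + 1 by rewrite ltr_wpDl.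
have fc0 : 0 < N ^+ 2 * `|fc| + 1 by rewrite ltr_wpDl // mulr_ge0 // exprn_ge0 // ltW.
(* The second entry keeps the transport error FA tau^2 below (eta' / 2) tau; the third is the
   smallness that [near_parallel] asks for. *)
pose tm := Num.min eta' (Num.min (eta' / 2 / (`|FA| + 1)) (2^-1 / (N ^+ 2 * `|fc| + 1))).
have tm0 : 0 < tm.
  have x1 : 0 < eta' / 2 / (`|FA| + 1) by rewrite !divr_gt0.
  have x2 : 0 < 2^-1 / (N ^+ 2 * `|fc| + 1) by rewrite divr_gt0 // invr_gt0.
  by rewrite /tm lt_min eta'0 /= lt_min x1 x2.
have [d1 d10 H1] := HfP t01 (divr_gt0 eta0 (ltr0Sn R 1)).
pose rm1 := Num.min rh r'; have rm10 : 0 < rm1 by rewrite lt_min rh0.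
have im : inball (ga t0) a rm1 (ga t0) by split; rewrite ?subrr ?normr0.
have [d2 d20 H2] := nbhs_R_ex (geodesic_cts gga (x := t0) (open_inball im)).
exists (Num.min (Num.min d1 d2) (tm / 2)); first by rewrite !lt_min d10 d20 divr_gt0.
move=> s1 s2 s10 s12 s21; rewrite !lt_min => /andP[/andP[e1 f1] h1] /andP[/andP[e2 f2] h2] sg fg.
pose tau := s2 - s1; have tau0 : 0 < tau by rewrite subr_gt0.
have tle : tau <= tm.
  have -> : tau = (s2 - t0) - (s1 - t0) by rewrite /tau opprB addrA subrK.
  apply: le_trans (ler_norm _) _; apply: le_trans (ler_normB _ _) _; rewrite [tm]splitr.
  by apply: lerD; exact: ltW.
have [t1 [t2 t3]] : tau <= eta' /\ tau <= eta' / 2 / (`|FA| + 1) /\ tau <= 2^-1 / (N ^+ 2 * `|fc| + 1).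
  by move: tle; rewrite /tm le_min => /andP[-> ]; rewrite le_min => /andP[-> ->].
have tau1 : tau <= 1 by exact: le_trans t1 eta'1.
have Hs (s : R) : s1 <= s <= s2 -> [/\ inball (ga t0) a rh (ga s), `|chart a (ga s) - chart a (ga t0)| < r' &
     `|vel a ga s| <= B].
  move=> /andP[q1 q2]; have st : `|s - t0| < d2.
    move: f1 f2; rewrite !ltr_norml => /andP[a1 a2] /andP[b1 b2]; apply/andP; split.
      by apply: lt_le_trans a1 _; rewrite lerD2r.
    by apply: le_lt_trans b2; rewrite lerD2r.
  have [ha hr] := H2 s st; move: hr; rewrite lt_min => /andP[hr1 hr2]; split=> //.
  apply: le_trans PB; apply: sqb => //; rewrite ler_pdivlMr // mulrC.
  have := gb_low gb (vel a ga s) (lt_trans hr1 rhr); by rewrite (sga ha).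
have m1 : s1 <= s1 <= s2 by rewrite lexx ltW. have m2 : s1 <= s2 <= s2 by rewrite lexx ltW.
have [i1 _ p1B] := Hs s1 m1; have [i2 _ p2B] := Hs s2 m2.
have [a1 u1h] := i1; have [a2 u2h] := i2.
have u1r := lt_trans u1h rhr; have u2r := lt_trans u2h rhr.
have B0 : 0 <= B by exact: le_trans ler01 B1.
set u1 := chart a (ga s1) in u1r u1h; set u2 := chart a (ga s2) in u2r u2h.
have [fg1 fg2] := fg.
pose E : 'M[R]_n.+1 := \matrix_k vel a (sg k) 0.
have rE k : row k E = vel a (sg k) 0 by rewrite rowK.
have asg k : chart_dom a (sg k 0) by have [_ ->] := fg1 k.
have gsg k l : bil (metric g a u2) (vel a (sg k) 0) (vel a (sg l) 0) = (k == l)%:R.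
  have [gk ek] := fg1 k; have [gl el] := fg1 l.
  by rewrite -(fg2 k l) (ipE gk gl (etrans ek (esym el)) (asg k)) ek.
have EE : E *m metric g a u2 *m E^T = 1%:M.
  by apply/matrixP => k l; rewrite bil_rowE !rE gsg mxE.
have eB k : `|row k E| <= B.
  apply: le_trans EB; apply: sqb => //; rewrite -[lam^-1]div1r ler_pdivlMr // mulrC.
  by have := gb_low gb (row k E) u2r; rewrite -/u2 rE gsg eqxx.
have u12 : `|u2 - u1| <= B * tau.
  apply: (rv_derive_bounded (ltW s12) (c := chart a \o ga) (dc := vel a ga) (K := B)) => [t ht|t /andP[z1 z2]|//].
    by have [[ha _] _ _] := Hs t ht; exact: (geodesic_derive gga ha).
  by have [_ _ ?] := Hs t ltac:(by rewrite !ltW).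
have pL s : s1 <= s <= s2 -> `|vel a ga s - vel a ga s1| <= B ^+ 3 * tau.
  move=> /andP[q1 q2]; apply: le_trans (_ : B ^+ 3 * (s - s1) <= _); last first.
    by rewrite ler_wpM2l ?exprn_ge0 // lerD2r.
  apply: (rv_derive_bounded q1 (dc := fun s => - Gamv (metric g a) (chart a (ga s)) (vel a ga s) (vel a ga s))) => [t|t|].
  - move=> /andP[z1 z2]; have [[ha _] _ _] := Hs t ltac:(by rewrite z1 (le_trans z2)).
    by have [_] := geodesic_chart gga ha.
  - move=> /andP[z1 z2]; have [[ha hb] _ hv] := Hs t ltac:(by rewrite (ltW z1) (le_trans (ltW z2))).
    by rewrite normrN (_ : B ^+ 3 = B * B * B) ?(exprSr B 2) ?expr2 //; exact: (Gam_le gb KB (lt_trans hb rhr) hv hv).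
  - by rewrite exprn_ge0.
have u12' : `|u2 - u1 - tau *: vel a ga s1| <= B ^+ 3 * tau ^+ 2.
  pose F (s : R) := chart a (ga s) - (0 + s *: vel a ga s1).
  have -> : u2 - u1 - tau *: vel a ga s1 = F s2 - F s1.
    rewrite /F /tau !add0r scalerBl; move: (s2 *: _) (s1 *: _) => X Y.
    by apply/rowP => j; rewrite !mxE; ring.
  rewrite (_ : B ^+ 3 * tau ^+ 2 = (B ^+ 3 * tau) * (s2 - s1)); last by rewrite expr2 mulrA.
  apply: (rv_derive_bounded (ltW s12) (dc := fun s => vel a ga s - vel a ga s1)) => [t ht|t /andP[z1 z2]|].
  - have [[ha _] _ _] := Hs t ht; exact: (is_deriveB (geodesic_derive gga ha) (is_derive_line 0 _ t)).
  - by apply: pL; rewrite !ltW.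
  - by rewrite mulr_ge0 ?exprn_ge0 // ltW.
have small : N ^+ 2 * (fc * tau ^+ 2) <= 2^-1.
  apply: le_trans (_ : (N ^+ 2 * `|fc| + 1) * tau <= _); last by rewrite mulrC -ler_pdivlMr.
  apply: le_trans (_ : N ^+ 2 * `|fc| * tau <= _); last by rewrite ler_wpM2r ?(ltW tau0) // lerDl.
  rewrite mulrA.
  apply: le_trans (_ : N ^+ 2 * `|fc| * tau ^+ 2 <= _).
    by rewrite ler_wpM2r ?sqr_ge0 // ler_wpM2l ?exprn_ge0 ?(ltW N0) // ler_norm.
  rewrite ler_wpM2l ?mulr_ge0 ?exprn_ge0 ?(ltW N0) // expr2 ler_piMr // ltW //.
have [E' [EE' par]] := near_parallel cm gb KB B1 u1r u2r p1B (ltW tau0) tau1 u12' u12 eB EE small.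
have fg' := geodesic_frameP a1 EE'.
exists (fun k => geo gcomp a (ga s1) (row k E')).
exists (fun k => tau * (1 + s2 ^+ 2 * rm (metric g a) u2 (vel a (sg k) 0) (vel a ga s2) (vel a ga s2) (vel a (sg k) 0)
            + (C + 3) * eta')); split; first exact: fg'.
  rewrite -mulr_sumr !big_split /= sumr_const card_ord -mulr_sumr sumr_const card_ord.
  rewrite (eq_bigr (fun k => rm (metric g a) u2 (row k E) (vel a ga s2) (vel a ga s2) (row k E))); last first.
    by move=> k _; rewrite rE.
  rewrite (frame_ricci cm (vel a ga s2) (chart_codI a2) EE) -(rhoE a2).
  have HH := H1 s1 s2 s10 s12 s21 e1 e2.
  have : tau * ((C + 3) * eta' *+ n.+1) <= tau * (eta / 2).
    rewrite ler_wpM2l ?(ltW tau0) //; apply: le_trans eta'C; rewrite -mulr_natl mulrA ler_wpM2r ?(ltW eta'0) //.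
    by rewrite ler_wpM2l ?(ltW N0) // lerD2r ler_norm.
  rewrite mulrDr; move: HH; rewrite -/tau -/N; move: (tau * (_ *+ _)) (tau * (_ + _)) (Hf s1) (Hf s2) => X Y h1' h2'.
  have -> : eta * tau = eta / 2 * tau + tau * (eta / 2) by field.
  by move: (eta / 2 * tau) (tau * (eta / 2)) => *; lra.
have B' k : `|row k E'| <= B.
  apply: le_trans EB; apply: sqb => //; rewrite -[lam^-1]div1r ler_pdivlMr // mulrC.
  by have := gb_low gb (row k E') u1r; rewrite -bil_rowE EE' mxE eqxx.
have NN : \forall ep \near (0 : R), forall k, exists L,
    reach g (geo gcomp a (ga s1) (row k E') (s1 * ep)) (sg k (s2 * ep)) L /\
        L ^+ 2 <= tau * (tau * l2
          + 2 * ep * (s2 * ip (sg k) 0 ga s2 - s1 * ip (geo gcomp a (ga s1) (row k E')) 0 ga s1)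
          + ep ^+ 2 * (tau * (1 + s2 ^+ 2 * rm (metric g a) u2 (vel a (sg k) 0) (vel a ga s2) (vel a ga s2) (vel a (sg k) 0)
            + (C + 3) * eta'))).
  apply: (@filter_forall _ _ (fun k ep => exists L,
    reach g (geo gcomp a (ga s1) (row k E') (s1 * ep)) (sg k (s2 * ep)) L /\
        L ^+ 2 <= tau * (tau * l2
          + 2 * ep * (s2 * ip (sg k) 0 ga s2 - s1 * ip (geo gcomp a (ga s1) (row k E')) 0 ga s1)
          + ep ^+ 2 * (tau * (1 + s2 ^+ 2 * rm (metric g a) u2 (vel a (sg k) 0) (vel a ga s2) (vel a ga s2) (vel a (sg k) 0)
            + (C + 3) * eta')))) _ (nbhs_filter (0 : R))) => k.
  have [gk ek] := fg1 k; have [gk' ek' vk'] := geoP gcomp (row k E') a1.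
  apply: (window_leg lp cb KB KB' B1 erefl s10 tau0 s21 t1 eta'1 Hs gk gk' ek ek').
  - by rewrite -rE.
  - by rewrite gsg eqxx.
  - by rewrite vk'.
  - rewrite vk' -rE -/u1; apply: le_trans (par k) _.
    have -> : n.+1%:R * (2 * n.+1%:R ^+ 4 * (frame_const B * (s2 - s1) ^+ 2) * (B + B ^+ 3)) = FA * tau * tau.
      by rewrite /FA /fc -/tau -/N; ring.
    rewrite ler_wpM2r ?(ltW tau0) //; apply: le_trans (_ : (`|FA| + 1) * tau <= _).
      by rewrite ler_wpM2r ?(ltW tau0) //; apply: le_trans (ler_norm _) _; rewrite lerDl.
    by rewrite mulrC -ler_pdivlMr.
have [ep0 ep00 HN] := nbhs_R_ex NN; exists ep0 => // k ep hep.
by apply: HN; rewrite subr0.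
Qed.

(** The fields s e_k vanish at s = 0, so all broken paths start at [ga 0] and the boundary term
    there disappears. *)
Lemma second_variation (eta : R) sg : 0 < eta -> geodesic_frame (ga 1) sg ->
  exists (B : 'I_n.+1 -> R), \sum_k B k <= Hf 1 - Hf 0 + eta /\
    exists2 ep0 : R, 0 < ep0 & forall k (ep : R), `|ep| < ep0 -> exists L, reach g (ga 0) (sg k ep) L /\
        L ^+ 2 <= l2 + 2 * ep * ip (sg k) 0 ga 1 + ep ^+ 2 * B k.
Proof.
move=> eta0 fg.
have V01 : vstep eta 0 1.
  apply: interval_chain => [a b c _ ab bc _ H1 H2|t t01]; first exact: vstep_trans H1 H2.
  exact: vstep_local.
have [sg' [B [[f1 _] SB [ep0 ep00 H]]]] := V01 sg fg.
exists B; split; first by rewrite subr0 mulr1 in SB.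
exists ep0 => // k ep hep; have [L [RL HL]] := H k ep hep; exists L.
have [_ e0] := f1 k; rewrite mul0r e0 mul1r in RL; split=> //.
by move: HL; rewrite subr0 !mul1r mul0r subr0.
Qed.

End SecondVariation.

(** * Curvature operators in dimension four *)

Section Eigenvalues.
Context {R : realType} {n : nat}.
Local Notation m := n.+1.
Implicit Types (S O G E : 'M[R]_m) (d : 'rV[R]_m) (i j k : 'I_m).

Lemma spectral_sorted S : S^T = S -> exists O d,
  [/\ O *m O^T = 1%:M, O *m S *m O^T = diag_mx d & forall i j, (i <= j)%N -> d 0 i <= d 0 j].
Proof.
move=> Ss; have [T [d [OO OS]]] := spectral Ss.
pose t := [tuple d 0 i | i < m].
have ps : perm_eq (sort <=%R t) t by rewrite perm_sort.
have /perm.tuple_permP[p pE] := ps.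
pose q i := perm.fun_of_perm.body p i.
have qi : injective q by move=> i j; exact: perm.perm_inj.
have dE i : nth 0 (sort <=%R t) i = d 0 (q i).
  by rewrite pE -tnth_nth !tnth_mktuple.
have rE i : row i (\matrix_(i, j) T (q i) j) = row (q i) T by apply/rowP => j; rewrite !mxE.
exists (\matrix_(i, j) T (q i) j), (\row_i d 0 (q i)); split.
- apply/orthogonalE => i j; rewrite !rE; have /orthogonalE -> := OO.
  by rewrite (inj_eq qi).
- apply/matrixP => i j; rewrite bil_rowE !rE -bil_rowE OS !mxE (inj_eq qi).
  by case: eqP => [->|].
- move=> i j ij; rewrite !mxE -!dE; apply: le_sorted_leq_nth => //; first exact: sort_le_sorted.
  + by rewrite inE size_sort size_tuple.
  + by rewrite inE size_sort size_tuple.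
Qed.

Lemma char_poly_orthogonal S O : O *m O^T = 1%:M -> char_poly (O *m S *m O^T) = char_poly S.
Proof.
move=> OO; pose P := map_mx (@polyC R) O; pose P' := map_mx (@polyC R) O^T.
have PP : P *m P' = 1%:M by rewrite -map_mxM OO map_mx1.
have -> : char_poly (O *m S *m O^T) = \det (P *m char_poly_mx S *m P').
  rewrite /char_poly /char_poly_mx !map_mxM mulmxBr mulmxBl; congr (\det (_ - _)).
  by rewrite mul_mx_scalar -scalemxAl PP scalemx1.
by rewrite !det_mulmx mulrAC -det_mulmx PP det1 mul1r.
Qed.

Lemma eigenvalues_diag S O d s : O *m O^T = 1%:M -> O *m S *m O^T = diag_mx d ->
  (forall i j, (i <= j)%N -> d 0 i <= d 0 j) ->
  ordered_eigenvalues S s <-> s = [tuple d 0 i | i < m].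
Proof.
move=> OO OS ds.
have cS : char_poly S = \prod_(z <- [tuple d 0 i | i < m]) ('X - z%:P).
  rewrite -(char_poly_orthogonal S OO) OS char_poly_trig ?diag_mx_is_trig // big_tuple.
  by apply: eq_bigr => i _; rewrite tnth_mktuple mxE eqxx.
have st : sorted <=%R [tuple d 0 i | i < m].
  apply/(sortedP 0) => i; rewrite size_tuple => im; have im' := ltnW im.
  have E (k : 'I_m) : [tuple d 0 i | i < m]`_k = d 0 k by rewrite -tnth_nth tnth_mktuple.
  by have := E (Ordinal im); have := E (Ordinal im') => /= -> ->; apply: ds => /=.
split=> [[ss cs]|->]; last by split.
by apply: le_sorted_eq => //; apply: prod_XsubC_eq; rewrite -cs cS.
Qed.

Lemma trace_orthogonal S O : O *m O^T = 1%:M -> \tr (O *m S *m O^T) = \tr S.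
Proof. by move=> OO; rewrite mxtrace_mulC mulmxA (mulmx1C OO) mul1mx. Qed.

Lemma frobenius_orthogonal S O : O *m O^T = 1%:M ->
  \sum_i \sum_j (O *m S *m O^T) i j ^+ 2 = \sum_i \sum_j S i j ^+ 2.
Proof.
have trE (T : 'M[R]_m) : \sum_i \sum_j T i j ^+ 2 = \tr (T *m T^T).
  by apply: eq_bigr => i _; rewrite mxE; apply: eq_bigr => j _; rewrite mxE.
move=> OO; have OO' := mulmx1C OO; rewrite !trE !trmx_mul trmxK.
have -> : O *m S *m O^T *m (O *m (S^T *m O^T)) = O *m (S *m (O^T *m O) *m S^T *m O^T).
  by rewrite !mulmxA.
by rewrite OO' mulmx1 mulmxA; exact: trace_orthogonal.
Qed.

Lemma sum_sqr_diag d : \sum_i \sum_j (diag_mx d i j) ^+ 2 = \sum_i d 0 i ^+ 2.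
Proof.
apply: eq_bigr => i _; rewrite (bigD1 i) //= big1 ?addr0 => [|j ji]; first by rewrite mxE eqxx.
by rewrite mxE eq_sym (negbTE ji) expr0n.
Qed.

End Eigenvalues.

Lemma two_smallestE {R : realType} {n : nat} (S O : 'M[R]_n.+2) (d : 'rV[R]_n.+2) : O *m O^T = 1%:M ->
  O *m S *m O^T = diag_mx d -> (forall i j : 'I_n.+2, (i <= j)%N -> d 0 i <= d 0 j) ->
  two_smallest_nonneg S <-> 0 <= d 0 (inord 0) + d 0 (inord 1).
Proof.
move=> OO OS ds.
have E k : (k < n.+2)%N -> [tuple d 0 i | i < n.+2]`_k = d 0 (inord k).
  by move=> km; rewrite -[k in LHS](inordK km) -tnth_nth tnth_mktuple.
split=> [[s /(eigenvalues_diag _ OO OS ds) ->]|h]; first by rewrite !E.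
exists [tuple d 0 i | i < n.+2]; first by apply/(eigenvalues_diag _ OO OS ds).
by rewrite !E.
Qed.

Section SmallSums.
Context {R : realType}.

Lemma sum3 (F : 'I_3 -> R) : \sum_i F i = F (inord 0) + F (inord 1) + F (inord 2).
Proof.
rewrite !big_ord_recr big_ord0 /= add0r; congr (F _ + F _ + F _); apply: val_inj; by rewrite /= inordK.
Qed.

Lemma sum4 (F : 'I_4 -> R) : \sum_i F i = F (inord 0) + F (inord 1) + F (inord 2) + F (inord 3).
Proof.
rewrite !big_ord_recr big_ord0 /= add0r; congr (F _ + F _ + F _ + F _); apply: val_inj; by rewrite /= inordK.
Qed.

Lemma sum4_lt (F : 'I_4 -> 'I_4 -> R) : \sum_(i < 4) \sum_(j < 4 | (i < j)%N) F i j =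
  F (inord 0) (inord 1) + F (inord 0) (inord 2) + F (inord 0) (inord 3)
  + F (inord 1) (inord 2) + F (inord 1) (inord 3) + F (inord 2) (inord 3).
Proof.
under eq_bigr => i _ do rewrite big_mkcond /=.
by rewrite !sum4 !inordK //= !add0r !addr0 !addrA.
Qed.

(** For eigenvalues l0 <= l1 <= l2 <= l3, half of the difference is (l0 + l1)(l1 + l2 + l3) + (l2 l3
    - l1^2), and l0 + l1 >= 0 forces l1 >= 0. *)
Lemma ricci_norm_le (S : 'M[R]_4) : S^T = S -> two_smallest_nonneg S ->
  \sum_i \sum_j S i j ^+ 2 <= (\tr S) ^+ 2.
Proof.
move=> Ss tS; have [T [d [OO OS ds]]] := spectral_sorted Ss.
move/(two_smallestE OO OS ds): tS => tS.
rewrite -(frobenius_orthogonal S OO) -(trace_orthogonal S OO) OS sum_sqr_diag mxtrace_diag !sum4.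
have d12 : d 0 (inord 1) <= d 0 (inord 2) by apply: ds; rewrite !inordK.
have d23 : d 0 (inord 2) <= d 0 (inord 3) by apply: ds; rewrite !inordK.
have d01 : d 0 (inord 0) <= d 0 (inord 1) by apply: ds; rewrite !inordK.
move: (d 0 _) (d 0 _) (d 0 _) (d 0 _) tS d01 d12 d23 => a b c e h0 h1 h2 h3.
have c0 : 0 <= c by lra.
have H1 : 0 <= (e + c) * (c + b + a) by apply: mulr_ge0 => //; lra.
have H2 : 0 <= b * a - c ^+ 2.
  by rewrite subr_ge0 expr2; apply: ler_pM => //; lra.
lra.
Qed.

(** All pairwise sums of eigenvalues are nonnegative. A diagonal entry is a convex combination of
    eigenvalues, each at most the trace. For the norm, 3 (tr S)^2 - |S|^2 is twice the sum of the
    three products of pairwise sums; equality holds for eigenvalues -1, 1, 1. *)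
Lemma block_bounds (S : 'M[R]_3) : S^T = S -> two_smallest_nonneg S ->
  [/\ forall r, S r r <= \tr S, 0 <= \tr S & \sum_i \sum_j S i j ^+ 2 <= 3 * (\tr S) ^+ 2].
Proof.
move=> Ss tS; have [T [d [OO OS ds]]] := spectral_sorted Ss.
move/(two_smallestE OO OS ds): tS => tS.
have d12 : d 0 (inord 1) <= d 0 (inord 2) by apply: ds; rewrite !inordK.
have d01 : d 0 (inord 0) <= d 0 (inord 1) by apply: ds; rewrite !inordK.
have tE : \tr S = d 0 (inord 0) + d 0 (inord 1) + d 0 (inord 2).
  by rewrite -(trace_orthogonal S OO) OS mxtrace_diag sum3.
split.
- move=> r; have SE : S = T^T *m diag_mx d *m T.
    by rewrite -OS !mulmxA (mulmx1C OO) mul1mx -mulmxA (mulmx1C OO) mulmx1.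
  have OO' : \sum_i T i r ^+ 2 = 1.
    have := congr1 (fun Y : 'M[R]_3 => Y r r) (mulmx1C OO).
    by rewrite !mxE eqxx => H; apply: etrans H; apply: eq_bigr => i _; rewrite !mxE expr2.
  have -> : S r r = \sum_i d 0 i * T i r ^+ 2.
    rewrite SE mxE; apply: eq_bigr => i _; rewrite mxE (bigD1 i) //= big1 ?addr0 => [|j ji].
      by rewrite !mxE eqxx mulr1n expr2 mulrA; congr (_ * _); rewrite mulrC.
    by rewrite !mxE (negbTE ji) mulr0n mulr0.
  move: OO'; rewrite tE !sum3.
  have := sqr_ge0 (T (inord 0) r); have := sqr_ge0 (T (inord 1) r); have := sqr_ge0 (T (inord 2) r).
  move: (d 0 _) (d 0 _) (d 0 _) (_ ^+ 2) (_ ^+ 2) (_ ^+ 2) tS d01 d12 => a b c p2 p1 p0 h0 h1 h2 q2 q1 q0 q.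
  have H0 : 0 <= p0 * (b + c) by apply: mulr_ge0 => //; lra.
  have H1 : 0 <= p1 * (a + c) by apply: mulr_ge0 => //; lra.
  have H2 : 0 <= p2 * (a + b) by apply: mulr_ge0 => //; lra.
  have E : c + b + a = (c + b + a) * (p2 + p1 + p0) by rewrite q mulr1.
  by rewrite E; lra.
- by rewrite tE; lra.
- rewrite -(frobenius_orthogonal S OO) OS sum_sqr_diag tE sum3.
  move: (d 0 _) (d 0 _) (d 0 _) tS d01 d12 => a b c h0 h1 h2.
  have H1 : 0 <= (a + b) * (b + c) by apply: mulr_ge0; lra.
  have H2 : 0 <= (a + b) * (a + c) by apply: mulr_ge0; lra.
  have H3 : 0 <= (a + c) * (b + c) by apply: mulr_ge0; lra.
  lra.
Qed.

End SmallSums.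

(** * Algebraic curvature tensors in an orthonormal four-frame *)

Section AlgebraicCurvature.
Context {R : realType}.
Variable r : 'I_4 -> 'I_4 -> 'I_4 -> 'I_4 -> R.
Hypothesis a12 : forall i j k l, r i j k l = - r j i k l.
Hypothesis a34 : forall i j k l, r i j k l = - r i j l k.
Hypothesis pr : forall i j k l, r i j k l = r k l i j.
Hypothesis bia : forall i j k l, r i j k l + r j l k i + r l i k j = 0.

Definition frame_block (sg : R) : 'M[R]_3 := \matrix_(p, t)
    (2^-1 * (r ord0 (lift ord0 p) ord0 (lift ord0 t) + sg * r ord0 (lift ord0 p) (dual_fst t) (dual_snd t)
       + sg * r (dual_fst p) (dual_snd p) ord0 (lift ord0 t)
       + sg ^+ 2 * r (dual_fst p) (dual_snd p) (dual_fst t) (dual_snd t))).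
Definition frame_ric : 'M[R]_4 := \matrix_(i, k) \sum_j r i j k j.

Let e k : 'I_4 := inord k.
Let lift_e k : (k < 3)%N -> lift ord0 (inord k : 'I_3) = e k.+1.
Proof. by move=> h; apply: val_inj; rewrite /= /bump /= !inordK. Qed.
Let ord0_e : ord0 = e 0. Proof. by apply: val_inj; rewrite /= inordK. Qed.
Let fst_e : (dual_fst (inord 0) = e 2) * (dual_fst (inord 1) = e 3) * (dual_fst (inord 2) = e 1).
Proof. by rewrite /dual_fst !inordK. Qed.
Let snd_e : (dual_snd (inord 0) = e 3) * (dual_snd (inord 1) = e 1) * (dual_snd (inord 2) = e 2).
Proof. by rewrite /dual_snd !inordK. Qed.

Let z12 i k l : r i i k l = 0.
Proof. by have := a12 i i k l => h; lra. Qed.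
Let z34 i j k : r i j k k = 0.
Proof. by have := a34 i j k k => h; lra. Qed.

(** Together, [n12], [n34] and [npr] rewrite every component to one of the 21 whose pairs are
    increasing and ordered lexicographically; then [field] and [lra] can compare them. *)
Let n12 := (fun k l => a12 (e 1) (e 0) k l, fun k l => a12 (e 2) (e 0) k l, fun k l => a12 (e 3) (e 0) k l,
  fun k l => a12 (e 2) (e 1) k l, fun k l => a12 (e 3) (e 1) k l, fun k l => a12 (e 3) (e 2) k l).
Let n34 := (fun k l => a34 k l (e 1) (e 0), fun k l => a34 k l (e 2) (e 0), fun k l => a34 k l (e 3) (e 0),
  fun k l => a34 k l (e 2) (e 1), fun k l => a34 k l (e 3) (e 1), fun k l => a34 k l (e 3) (e 2)).
Let npr := (pr (e 0) (e 2) (e 0) (e 1), pr (e 0) (e 3) (e 0) (e 1), pr (e 1) (e 2) (e 0) (e 1),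
  pr (e 1) (e 3) (e 0) (e 1), pr (e 2) (e 3) (e 0) (e 1), pr (e 0) (e 3) (e 0) (e 2), pr (e 1) (e 2) (e 0) (e 2),
  (pr (e 1) (e 3) (e 0) (e 2), pr (e 2) (e 3) (e 0) (e 2), pr (e 1) (e 2) (e 0) (e 3),
  pr (e 1) (e 3) (e 0) (e 3), pr (e 2) (e 3) (e 0) (e 3), pr (e 1) (e 3) (e 1) (e 2), pr (e 2) (e 3) (e 1) (e 2),
  pr (e 2) (e 3) (e 1) (e 3))).

Let blockE sg p t (P T : nat) : p = inord P -> t = inord T -> (P < 3)%N -> (T < 3)%N ->
  frame_block sg p t = 2^-1 * (r (e 0) (e P.+1) (e 0) (e T.+1) + sg * r (e 0) (e P.+1) (dual_fst t) (dual_snd t)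
       + sg * r (dual_fst p) (dual_snd p) (e 0) (e T.+1)
       + sg ^+ 2 * r (dual_fst p) (dual_snd p) (dual_fst t) (dual_snd t)).
Proof. by move=> -> -> hP hT; rewrite mxE !lift_e // ord0_e. Qed.

Let B := (fun sg => @blockE sg _ _ 0 0 erefl erefl erefl erefl, fun sg => @blockE sg _ _ 0 1 erefl erefl erefl erefl,
  fun sg => @blockE sg _ _ 0 2 erefl erefl erefl erefl, fun sg => @blockE sg _ _ 1 0 erefl erefl erefl erefl,
  fun sg => @blockE sg _ _ 1 1 erefl erefl erefl erefl, fun sg => @blockE sg _ _ 1 2 erefl erefl erefl erefl,
  fun sg => @blockE sg _ _ 2 0 erefl erefl erefl erefl, fun sg => @blockE sg _ _ 2 1 erefl erefl erefl erefl,
  fun sg => @blockE sg _ _ 2 2 erefl erefl erefl erefl).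

Let ricE i k : frame_ric i k = r i (e 0) k (e 0) + r i (e 1) k (e 1) + r i (e 2) k (e 2) + r i (e 3) k (e 3).
Proof. by rewrite mxE sum4. Qed.

Lemma frame_block_sym sg : (frame_block sg)^T = frame_block sg.
Proof.
apply/matrixP => p t; rewrite !mxE (pr ord0 (lift ord0 t) ord0) (pr ord0 (lift ord0 t) (dual_fst p)).
rewrite (pr (dual_fst t) (dual_snd t) ord0) (pr (dual_fst t) (dual_snd t) (dual_fst p)).
by ring.
Qed.

Lemma frame_ric_sym : frame_ric^T = frame_ric.
Proof. by apply/matrixP => i k; rewrite !mxE; apply: eq_bigr => j _; exact: pr. Qed.

Let trE sg : \tr (frame_block sg) = frame_block sg (inord 0) (inord 0) + frame_block sg (inord 1) (inord 1)
  + frame_block sg (inord 2) (inord 2).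
Proof. exact: sum3. Qed.
Let ricTr : \tr frame_ric = frame_ric (e 0) (e 0) + frame_ric (e 1) (e 1) + frame_ric (e 2) (e 2) + frame_ric (e 3) (e 3).
Proof. exact: sum4. Qed.

(** The part proportional to [sg] is the first Bianchi sum, so both blocks have trace R / 4. *)
Lemma frame_block_trace sg : sg ^+ 2 = 1 -> \tr (frame_block sg) = \tr frame_ric / 4.
Proof.
move=> sg2; rewrite trE ricTr !B !ricE sg2 !fst_e !snd_e /=.
have := bia (e 0) (e 1) (e 2) (e 3).
rewrite !(n12, n34) ?npr ?z12 ?z34 => bi; apply: subr0_eq; rewrite -[RHS](mulr0 sg) -[X in _ = _ * X]bi.
by field.
Qed.

(** By [block_bounds] the trace minus the first diagonal entry is nonnegative for both blocks. In
    the sum of the two the components with four distinct indices cancel, and four sectional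
    curvatures remain. *)
Lemma frame_isotropic : two_smallest_nonneg (frame_block 1) -> two_smallest_nonneg (frame_block (-1)) ->
  0 <= \tr frame_ric /\
  0 <= r (e 0) (e 2) (e 0) (e 2) + r (e 0) (e 3) (e 0) (e 3) + r (e 1) (e 2) (e 1) (e 2) + r (e 1) (e 3) (e 1) (e 3).
Proof.
move=> /(block_bounds (frame_block_sym _)) [A1 A2 _] /(block_bounds (frame_block_sym _)) [C1 _ _]; split.
  by move: A2; rewrite frame_block_trace ?expr1n // => H; lra.
move: (A1 (inord 0)) (C1 (inord 0)); rewrite !trE !B !fst_e !snd_e /= !(n12, n34) ?npr.
move=> H1 H2; lra.
Qed.

(** The two mixed blocks contribute half of the squared norm of the trace-free Ricci tensor, that is
    |Rc|^2 / 2 - R^2 / 8. *)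
Lemma frame_norm : \sum_(i < 4) \sum_(j < 4 | (i < j)%N) \sum_(k < 4) \sum_(l < 4 | (k < l)%N) r i j k l ^+ 2 =
  \sum_i \sum_j (frame_block 1) i j ^+ 2 + \sum_i \sum_j (frame_block (-1)) i j ^+ 2
  + (\sum_i \sum_j frame_ric i j ^+ 2) / 2 - (\tr frame_ric) ^+ 2 / 8.
Proof.
under eq_bigr => i _ do under eq_bigr => j _ do rewrite sum4_lt.
rewrite sum4_lt ricTr !sum3 !sum4 !B !ricE !fst_e !snd_e /= !(n12, n34) ?npr ?z12 ?z34.
by field.
Qed.

(** The bounds add up to (3/16 + 3/16 + 1/2 - 1/8) R^2 = (3/4) R^2. *)
Lemma frame_norm_le : two_smallest_nonneg (frame_block 1) -> two_smallest_nonneg (frame_block (-1)) ->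
  two_smallest_nonneg frame_ric ->
  \sum_(i < 4) \sum_(j < 4 | (i < j)%N) \sum_(k < 4) \sum_(l < 4 | (k < l)%N) r i j k l ^+ 2 <= (\tr frame_ric) ^+ 2.
Proof.
move=> /(block_bounds (frame_block_sym _)) [_ _ A3] /(block_bounds (frame_block_sym _)) [_ _ C3].
move/(ricci_norm_le frame_ric_sym); rewrite frame_norm; move: A3 C3.
rewrite !frame_block_trace ?sqrrN ?expr1n // => A3 C3 H.
have := sqr_ge0 (\tr frame_ric); lra.
Qed.

(** An identity: the sum is s^2 / 2 + (a - b)^2 / 2 + q (R - 2 s) / 2, where q = a + b is the
    isotropic curvature sum. The last term is nonnegative because s <= 0 <= R. *)
Lemma frame_reaction (s : R) : s = frame_ric (e 0) (e 0) + frame_ric (e 1) (e 1) -> s <= 0 ->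
  0 <= \tr frame_ric ->
  0 <= r (e 0) (e 2) (e 0) (e 2) + r (e 0) (e 3) (e 0) (e 3) + r (e 1) (e 2) (e 1) (e 2) + r (e 1) (e 3) (e 1) (e 3) ->
  s ^+ 2 / 2 <= \sum_k frame_ric k k * (r k (e 0) k (e 0) + r k (e 1) k (e 1)).
Proof.
move=> sE s0 R0 H0; set q := (X in 0 <= X) in H0.
set a := r (e 0) (e 2) (e 0) (e 2) + r (e 1) (e 2) (e 1) (e 2).
set b := r (e 0) (e 3) (e 0) (e 3) + r (e 1) (e 3) (e 1) (e 3).
have -> : \sum_k frame_ric k k * (r k (e 0) k (e 0) + r k (e 1) k (e 1)) =
    s ^+ 2 / 2 + (a - b) ^+ 2 / 2 + q * (\tr frame_ric - 2 * s) / 2.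
  rewrite sE /q /a /b ricTr sum4 -!/(e _) !ricE !(n12, n34) ?npr ?z12 ?z34.
  by field.
have H1 : 0 <= q * (\tr frame_ric - 2 * s) by apply: mulr_ge0 => //; lra.
have := sqr_ge0 (a - b); lra.
Qed.

End AlgebraicCurvature.

(** * Second covariant derivatives along geodesics *)

Section Jets.
Context {R : realType}.
Implicit Types (f h : R -> R) (a b c : R).

(** Second-order jet at 0; the second derivative is asked for at the point 0 only, which is all that
    the fields available here provide. *)
Definition jet2 f a b c : Prop :=
  f 0 = a /\ exists f1 : R -> R, [/\ \forall s \near (0 : R), is_derive (s : R) 1 f (f1 s), f1 0 = b & is_derive (0 : R) 1 f1 c].

Lemma jet2_eq f a b c a' b' c' : jet2 f a b c -> a = a' -> b = b' -> c = c' -> jet2 f a' b' c'.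
Proof. by move=> H <- <- <-. Qed.

Lemma jet2_poly a b c : jet2 (fun s => a + s * b + s ^+ 2 * c) a b (2 * c).
Proof.
split; first by rewrite mul0r expr0n mul0r !addr0.
exists (fun s => b + 2 * s * c); split.
- apply: filterE => s; apply: (dEq (dD (dD (dC a s) (dM (dI s) (dC b s))) (dM (dX2 (dI s)) (dC c s)))).
  by ring.
- by rewrite mulr0 mul0r addr0.
- apply: (dEq (dD (dC b 0) (dM (dM (dC 2 0) (dI 0)) (dC c 0)))); by ring.
Qed.

Lemma jet2D f h a b c a' b' c' : jet2 f a b c -> jet2 h a' b' c' ->
  jet2 (fun s => f s + h s) (a + a') (b + b') (c + c').
Proof.
move=> [f0 [f1 [Hf b1 c1]]] [h0 [h1 [Hh b2 c2]]]; split; first by rewrite f0 h0.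
exists (fun s => f1 s + h1 s); split; [|by rewrite b1 b2|exact: dD].
by apply: filterS2 Hf Hh => s; exact: dD.
Qed.

Lemma jet2M f h a b c a' b' c' : jet2 f a b c -> jet2 h a' b' c' ->
  jet2 (fun s => f s * h s) (a * a') (b * a' + a * b') (c * a' + 2 * b * b' + a * c').
Proof.
move=> [f0 [f1 [Hf b1 c1]]] [h0 [h1 [Hh b2 c2]]]; split; first by rewrite f0 h0.
have d0 := nbhs_singleton Hf; have d0' := nbhs_singleton Hh.
exists (fun s => f1 s * h s + f s * h1 s); split.
- by apply: filterS2 Hf Hh => s; exact: dM.
- by rewrite f0 h0 b1 b2.
- apply: (dEq (dD (dM c1 d0') (dM d0 c2))).
  by rewrite f0 h0 b1 b2; ring.
Qed.

Lemma jet2Z f k a b c : jet2 f a b c -> jet2 (fun s => k * f s) (k * a) (k * b) (k * c).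
Proof.
move=> [f0 [f1 [Hf b1 c1]]]; split; first by rewrite f0.
exists (fun s => k * f1 s); split; [|by rewrite b1|exact: dZ].
by apply: filterS Hf => s; exact: dZ.
Qed.

Lemma near_sign f : {for 0, continuous f} -> 0 < f 0 -> exists2 r : R, 0 < r & forall s : R, `|s| < r -> 0 < f s.
Proof.
move=> cf f0; have H : \forall s \near (0 : R), 0 < f s by exact: (@cvgr_gt R R (nbhs (0 : R)) _ f (f 0) cf 0 f0).
have [r r0 hr] := nbhs_R_ex H; exists r => // s sr; apply: hr; by rewrite subr0.
Qed.

Lemma jet2_min f b c : jet2 f 0 b c -> (\forall s \near (0 : R), 0 <= f s) -> b = 0 /\ 0 <= c.
Proof.
move=> [f0 [f1 [Hf b1 c1]]] Hp.
have [r r0 hr] := nbhs_R_ex (filterI Hf Hp).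
have HD s : `|s| < r -> is_derive (s : R) 1 f (f1 s) by move=> sr; have [] := hr s; rewrite ?subr0.
have HP s : `|s| < r -> 0 <= f s by move=> sr; have [] := hr s; rewrite ?subr0.
have key (sg : R) : sg ^+ 2 = 1 -> ~ (exists2 e : R, 0 < e & forall s, 0 < s < e -> sg * f1 (sg * s) < 0).
  move=> sg2 [e e0 he]; pose t := Num.min (e / 2) (r / 2).
  have t0 : 0 < t by rewrite lt_min !divr_gt0.
  have te : t < e by rewrite gt_min; apply/orP; left; rewrite ltr_pdivrMr // ltr_pMr // ltr1n.
  have tr : t < r by rewrite gt_min; apply/orP; right; rewrite ltr_pdivrMr // ltr_pMr // ltr1n.
  have nsg : `|sg| = 1 by apply/eqP; rewrite -sqrp_eq1 // real_normK ?num_real // sg2.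
  have lt s : 0 <= s <= t -> `|sg * s| < r.
    by move=> /andP[s0 s1]; rewrite normrM nsg mul1r ger0_norm //; exact: le_lt_trans tr.
  have D s : 0 <= s <= t -> is_derive (s : R) 1 (fun z : R => f (sg * z)) (sg * f1 (sg * s)).
    move=> hs; have H : is_derive (sg * s + 0) 1 f (f1 (sg * s)) by rewrite addr0; exact: HD (lt _ hs).
    have := dAffine H; rewrite (_ : (fun z : R => f (sg * z + 0)) = fun z => f (sg * z)) //.
    by apply/funext => z; rewrite addr0.
  have [z /andP[z0 zt]] := MVT_closed t0 D.
  rewrite mulr0 f0 !subr0 => E; have h1 := HP _ (lt t ltac:(by rewrite (ltW t0) lexx)).
  have h2 : sg * f1 (sg * z) < 0 by apply: he; rewrite z0; exact: lt_trans te.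
  by move: h1; rewrite E leNgt pmulr_llt0 // h2.
have cf1 := is_derive_cts c1.
have no (sg : R) : sg ^+ 2 = 1 -> 0 <= sg * b.
  move=> sg2; rewrite leNgt; apply/negP => sb; apply: (key sg sg2).
  have cg : {for 0, continuous (fun s => - (sg * f1 s))}.
    by apply: is_derive_cts; apply: dN; apply: dZ; exact: c1.
  have [|e e0 he] := near_sign cg; first by rewrite b1 oppr_gt0.
  exists e => // s /andP[s0 se]; rewrite -oppr_gt0; apply: he.
  have nsg : `|sg| = 1 by apply/eqP; rewrite -sqrp_eq1 // real_normK ?num_real // sg2.
  by rewrite normrM nsg mul1r gtr0_norm.
have b0 : b = 0.
  by have := no 1 (expr1n _ _); have := no (-1) ltac:(by rewrite sqrrN expr1n) => *; lra.
split=> //; rewrite leNgt; apply/negP => c0; apply: (key 1 (expr1n _ _)).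
pose F1 (s : R) : 'rV[R]_1 := \row_i f1 s.
have dF : is_derive (0 : R) 1 F1 (\row_i c).
  apply/is_derive_rv => i; rewrite (_ : (fun s => _) = f1) ?mxE //; by apply/funext => s; rewrite mxE.
have c2 : 0 < - c / 2 by rewrite divr_gt0 // oppr_gt0.
have [e e0 he] := nbhs_R_ex (first_order_near dF c2).
exists e => // s /andP[s0 se]; have /= := he s; rewrite subr0 gtr0_norm // => /(_ se).
move/(le_trans (rv_coord_le _ 0)); rewrite !mxE b1 b0 subr0 !mul1r => /ler_normlP[_ H].
have : 0 < s * - c by rewrite mulr_gt0 // oppr_gt0.
by move: H; lra.
Qed.

End Jets.

(** * Covariant derivatives of 2-tensors along curves *)

Section CovariantDerivatives.
Context {R : realType} {n : nat}.
Local Notation V := 'rV[R]_n.+1.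
Variables (U : set V) (g : V -> 'M[R]_n.+1).
Hypothesis cm : chart_metric U g.
Implicit Types (F : 'I_n.+1 -> 'I_n.+1 -> V -> R) (x v w : V).

Definition tensor_mx F x : 'M[R]_n.+1 := \matrix_(i, j) F i j x.
Definition cov_along F x v : 'M[R]_n.+1 := \matrix_(i, j) \sum_m v 0 m * cov_deriv2 g F m i j x.
Definition cov2_along F x v w : 'M[R]_n.+1 :=
  \matrix_(i, j) \sum_k \sum_m v 0 k * w 0 m * cov_deriv3 g (cov_deriv2 g F) k m i j x.
Definition connection_mx x v : 'M[R]_n.+1 := \matrix_(i, b) \sum_m v 0 m * christoffel g b m i x.

Lemma Gamv_connection x v w : Gamv g x v w = w *m connection_mx x v.
Proof.
apply/rowP => k; rewrite !mxE exchange_big; apply: eq_bigr => i _ /=; rewrite mxE big_distrr /=.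
by apply: eq_bigr => m _; ring.
Qed.

Lemma cov_alongE F x v : cov_along F x v = (\matrix_(i, j) grad_along (F i j) x v)
  - connection_mx x v *m tensor_mx F x - tensor_mx F x *m (connection_mx x v)^T.
Proof.
apply/matrixP => i j; rewrite !mxE.
under eq_bigr => m _ do rewrite /cov_deriv2 !mulrBr.
rewrite !sumrB; congr (_ - _ - _).
- under eq_bigr => m _ do rewrite big_distrr /=.
  rewrite exchange_big; apply: eq_bigr => b _ /=; rewrite !mxE big_distrl /=.
  by apply: eq_bigr => m _; rewrite mulrA.
- under eq_bigr => m _ do rewrite big_distrr /=.
  rewrite exchange_big; apply: eq_bigr => b _ /=; rewrite !mxE big_distrr /=.
  apply: eq_bigr => m _; move: (v 0 m) (christoffel _ _ _ _ _) (F i b x) => y z t; by ring.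
Qed.

Lemma bil_cov_along F x v X Y : bil (\matrix_(i, j) grad_along (F i j) x v) X Y =
  bil (cov_along F x v) X Y + bil (tensor_mx F x) (Gamv g x v X) Y + bil (tensor_mx F x) X (Gamv g x v Y).
Proof.
rewrite cov_alongE !Gamv_connection !bil_mxB; set T := tensor_mx F x; set C := connection_mx x v.
have -> : bil (C *m T) X Y = bil T (X *m C) Y by rewrite /bil !mulmxA.
have -> : bil (T *m C^T) X Y = bil T X (Y *m C) by rewrite /bil trmx_mul !mulmxA.
by move: (bil _ _ _) (bil _ _ _) (bil _ _ _) => *; ring.
Qed.

Lemma is_derive_tensor F (c X Y : R -> V) (t : R) dc dX dY : (forall i j, smooth_on U (F i j)) -> U (c t) ->
  is_derive t 1 c dc -> is_derive t 1 X dX -> is_derive t 1 Y dY ->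
  is_derive t 1 (fun s => bil (tensor_mx F (c s)) (X s) (Y s))
    (bil (cov_along F (c t) dc) (X t) (Y t) + bil (tensor_mx F (c t)) (dX + Gamv g (c t) dc (X t)) (Y t)
     + bil (tensor_mx F (c t)) (X t) (dY + Gamv g (c t) dc (Y t))).
Proof.
move=> sF Uc Hc /is_derive_rv HX /is_derive_rv HY.
rewrite (_ : (fun s => _) = fun s => \sum_i \sum_j X s 0 i * Y s 0 j * F i j (c s)); last first.
  apply/funext => s; rewrite bilE; apply: eq_bigr => i _; apply: eq_bigr => j _; by rewrite mxE.
apply: dEq.
  by apply: dSum => i; apply: dSum => j; exact: (dM (dM (HX i) (HY j)) (smooth_curve (cm_open cm) (sF i j) Uc Hc)).
rewrite bilDl bilDr; have := bil_cov_along F (c t) dc (X t) (Y t).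
set B1 := bil _ _ _; set B2 := bil _ _ _; set B3 := bil _ _ _; set B4 := bil _ _ _ => HB.
transitivity (bil (tensor_mx F (c t)) dX (Y t) + bil (tensor_mx F (c t)) (X t) dY + B1); last first.
  by rewrite HB {HB}; move: B2 B3 B4 (bil _ _ _) (bil _ _ _) => *; ring.
rewrite /B1 !bilE -!big_split; apply: eq_bigr => i _ /=; rewrite -!big_split; apply: eq_bigr => j _ /=.
by rewrite !mxE -mulrDl.
Qed.

Lemma cov_along_sum F x w : cov_along F x w = \sum_m w 0 m *: tensor_mx (cov_deriv2 g F m) x.
Proof. by apply/matrixP => i j; rewrite mxE summxE; apply: eq_bigr => m _; rewrite !mxE. Qed.

Lemma bil_summx (I : finType) (T : I -> 'M[R]_n.+1) (X Y : V) : bil (\sum_m T m) X Y = \sum_m bil (T m) X Y.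
Proof. by rewrite /bil mulmx_sumr mulmx_suml summxE. Qed.

Lemma bil_cov_sum F x w X Y : bil (cov_along F x w) X Y = \sum_m w 0 m * bil (tensor_mx (cov_deriv2 g F m) x) X Y.
Proof. by rewrite cov_along_sum bil_summx; apply: eq_bigr => m _; rewrite bil_mxZ. Qed.

(** [cov_deriv3] also corrects the index of the inner derivative; the last term takes this
    correction back. *)
Lemma cov_along_cov F x v w : \sum_m w 0 m *: cov_along (cov_deriv2 g F m) x v =
  cov2_along F x v w + cov_along F x (Gamv g x v w).
Proof.
apply/matrixP => i j; rewrite summxE !mxE.
under eq_bigr => m _ do rewrite !mxE big_distrr /=.
rewrite exchange_big /=.
have -> : \sum_m Gamv g x v w 0 m * cov_deriv2 g F m i j x =
   \sum_k \sum_m v 0 k * w 0 m * \sum_b christoffel g b k m x * cov_deriv2 g F b i j x.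
  under eq_bigr => b _ do rewrite mxE big_distrl /=.
  rewrite exchange_big; apply: eq_bigr => k _ /=; under eq_bigr => b _ do rewrite big_distrl /=.
  rewrite exchange_big; apply: eq_bigr => m _ /=; rewrite big_distrr; apply: eq_bigr => b _ /=.
  by move: (christoffel _ _ _ _ _) (cov_deriv2 _ _ _ _ _ _) => y z; ring.
rewrite -big_split; apply: eq_bigr => k _ /=; rewrite -big_split; apply: eq_bigr => m _ /=.
rewrite /cov_deriv3 [in LHS]/cov_deriv2.
move: (partial _ _ _) (\sum_b _) (\sum_b _) (\sum_b _) => *; ring.
Qed.

Lemma is_derive_cov_along F (c w X Y : R -> V) (t : R) dc dw dX dY : (forall i j, smooth_on U (F i j)) -> U (c t) ->
  is_derive t 1 c dc -> is_derive t 1 w dw -> is_derive t 1 X dX -> is_derive t 1 Y dY ->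
  dw + Gamv g (c t) dc (w t) = 0 -> dX + Gamv g (c t) dc (X t) = 0 -> dY + Gamv g (c t) dc (Y t) = 0 ->
  is_derive t 1 (fun s => bil (cov_along F (c s) (w s)) (X s) (Y s)) (bil (cov2_along F (c t) dc (w t)) (X t) (Y t)).
Proof.
move=> sF Uc Hc /is_derive_rv Hw HX HY ew eX eY.
rewrite (_ : (fun s => _) = fun s => \sum_m w s 0 m * bil (tensor_mx (cov_deriv2 g F m) (c s)) (X s) (Y s)); last first.
  by apply/funext => s; rewrite bil_cov_sum.
have sT m i j : smooth_on U (cov_deriv2 g F m i j).
  exact: (smooth_cov_deriv2 (cm_open cm) (cm_smooth cm) (chart_unit cm) sF).
apply: dEq; first by apply: dSum => m; exact: (dM (Hw m) (is_derive_tensor (sT m) Uc Hc HX HY)).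
rewrite eX eY; under eq_bigr => m _ do rewrite bil0l bil0r !addr0.
rewrite big_split /= -bil_cov_sum.
have := congr1 (fun T => bil T (X t) (Y t)) (cov_along_cov F (c t) dc (w t)).
rewrite /= bil_summx bil_mxD; under [in LHS]eq_bigr => m _ do rewrite bil_mxZ.
move=> ->; have -> : dw = - Gamv g (c t) dc (w t) by apply/eqP; rewrite -addr_eq0 ew.
have -> : bil (cov_along F (c t) (- Gamv g (c t) dc (w t))) (X t) (Y t) = - bil (cov_along F (c t) (Gamv g (c t) dc (w t))) (X t) (Y t).
  by rewrite !bil_cov_sum -sumrN; apply: eq_bigr => m _; rewrite mxE mulNr.
by rewrite addrC addrK.
Qed.

(* A field along [c] whose first two covariant derivatives vanish at 0; unlike a parallel
   field it needs no differential equation to be solved. *)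
Definition second_parallel (c p X dX : R -> V) (E : V) : Prop :=
  [/\ X 0 = E, \forall s \near (0 : R), is_derive (s : R) 1 X (dX s), dX 0 + Gamv g (c 0) (p 0) (X 0) = 0 &
      is_derive (0 : R) 1 (fun s => dX s + Gamv g (c s) (p s) (X s)) 0].

Lemma second_parallel_exists (c p : R -> V) E : U (c 0) -> chart_geodesic g c p 0 ->
  exists X dX, second_parallel c p X dX E.
Proof.
move=> U0 [dc dp]; pose a := - Gamv g (c 0) (p 0) E.
have affd (s : R) (k l : V) : is_derive s 1 (fun z : R => k + z *: l) l.
  apply/is_derive_rv => i; rewrite (_ : (fun z => _) = fun z : R => k 0 i + z * l 0 i); last first.
    by apply/funext => z; rewrite !mxE.
  apply: (dEq (dD (dC _ _) (dM (dI _) (dC _ _)))); by ring.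
have D1 := is_derive_Gamv cm U0 dc dp (affd 0 E a).
move: D1; set b' := (X in is_derive _ _ _ X -> _) => D1.
(* b' is the derivative at 0 of the Christoffel term of E + s a; the quadratic term of the field
   contributes b to the derivative of its covariant derivative and cancels it. *)
pose b := - b'.
exists (fun s => E + s *: a + (s ^+ 2 / 2) *: b), (fun s => a + s *: b); split.
- by rewrite scale0r expr0n mul0r scale0r !addr0.
- apply: filterE => s; apply/is_derive_rv => i.
  rewrite (_ : (fun z => _) = fun z : R => E 0 i + z * a 0 i + z ^+ 2 / 2 * b 0 i); last first.
    by apply/funext => z; rewrite !mxE.
  apply: (dEq (dD (dD (dC _ _) (dM (dI _) (dC _ _))) (dM (dM (dX2 (dI _)) (dC _ _)) (dC _ _)))).
  by rewrite !mxE; field.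
- by rewrite scale0r expr0n mul0r !scale0r !addr0 addNr.
- have D2 : is_derive (0 : R) 1 (fun s : R => (s ^+ 2 / 2) *: b) 0.
    apply/is_derive_rv => i; rewrite (_ : (fun z => _) = fun z : R => z ^+ 2 / 2 * b 0 i); last first.
      by apply/funext => z; rewrite !mxE.
    apply: (dEq (dM (dM (dX2 (dI _)) (dC _ _)) (dC _ _))).
    by rewrite !(mulr0, mul0r, addr0) mxE.
  have D3 : is_derive (0 : R) 1 (fun s => Gamv g (c s) (p s) ((s ^+ 2 / 2) *: b)) 0.
    have := is_derive_Gamv cm U0 dc dp D2.
    have e0 : (0 : R) ^+ 2 / 2 *: b = 0 by rewrite expr0n mul0r scale0r.
    have G0 x v : Gamv g x v 0 = 0 by rewrite -[X in Gamv _ _ _ X](scale0r (0 : V)) GamvZr scale0r.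
    have DG0 x v w : DGam g x v w 0 = 0.
      by apply/rowP => k; rewrite !mxE big1 // => i _; rewrite big1 // => j _; rewrite mxE mulr0.
    by rewrite e0 DG0 !G0 !addr0.
  have /is_derive_rv H1 := affd 0 a b; move/is_derive_rv: D1 => H2; move/is_derive_rv: D3 => H3.
  apply/is_derive_rv => i; rewrite (_ : (fun s => _) = fun s : R => (a + s *: b) 0 i +
     (Gamv g (c s) (p s) (E + s *: a) 0 i + Gamv g (c s) (p s) ((s ^+ 2 / 2) *: b) 0 i)); last first.
    have mxD2 (u v w : V) : (u + (v + w)) 0 i = u 0 i + (v 0 i + w 0 i) by rewrite !mxE.
    by apply/funext => s; rewrite GamvDr; exact: mxD2.
  apply: (dEq (dD (H1 i) (dD (H2 i) (H3 i)))).
  by rewrite /b !mxE addr0 addNr.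
Qed.

(** The covariant derivatives of X and Y vanish at 0 together with their first derivatives, so up to
    second order only the derivatives of the tensor are seen. *)
Lemma tensor_jet F (c p X dX Y dY : R -> V) (E E' : V) : (forall i j, smooth_on U (F i j)) ->
  (\forall s \near (0 : R), U (c s) /\ chart_geodesic g c p s) ->
  second_parallel c p X dX E -> second_parallel c p Y dY E' ->
  jet2 (fun s => bil (tensor_mx F (c s)) (X s) (Y s)) (bil (tensor_mx F (c 0)) E E')
    (bil (cov_along F (c 0) (p 0)) E E') (bil (cov2_along F (c 0) (p 0) (p 0)) E E').
Proof.
move=> sF Hc [X0 HX eX DX] [Y0 HY eY DY]; split; first by rewrite X0 Y0.
have [U0 [dc0 dp0]] := nbhs_singleton Hc; have dX0 := nbhs_singleton HX; have dY0 := nbhs_singleton HY.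
exists (fun s => bil (cov_along F (c s) (p s)) (X s) (Y s)
   + bil (tensor_mx F (c s)) (dX s + Gamv g (c s) (p s) (X s)) (Y s)
   + bil (tensor_mx F (c s)) (X s) (dY s + Gamv g (c s) (p s) (Y s))); split.
- apply: filterS3 Hc HX HY => s [Us [dc _]] hx hy.
  exact: (is_derive_tensor sF Us dc hx hy).
- by rewrite eX eY bil0l bil0r !addr0 X0 Y0.
- have ep : - Gamv g (c 0) (p 0) (p 0) + Gamv g (c 0) (p 0) (p 0) = 0 by exact: addNr.
  have D1 := is_derive_cov_along sF U0 dc0 dp0 dX0 dY0 ep eX eY.
  apply: (dEq (dD (dD D1 (is_derive_tensor sF U0 dc0 DX dY0)) (is_derive_tensor sF U0 dc0 dX0 DY))).
  rewrite eX eY !add0r; have G0 v : Gamv g (c 0) v 0 = 0 by rewrite -[X in Gamv _ _ _ X](scale0r 0) GamvZr scale0r.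
  by rewrite !G0 !bil0l !bil0r !addr0 X0 Y0.
Qed.

Lemma cov_metric x m i j : U x -> cov_deriv2 g (fun i j y => g y i j) m i j x = 0.
Proof.
move=> Ux; rewrite /cov_deriv2 (metric_compatible (cm_open cm) (cm_sym cm) (chart_unit cm) m i j Ux).
by move: (\sum_b _) (\sum_b _) => a b; ring.
Qed.

Lemma cov_along_metric x v : U x -> cov_along (fun i j y => g y i j) x v = 0.
Proof.
by move=> Ux; apply/matrixP => i j; rewrite !mxE big1 // => m _; rewrite cov_metric // mulr0.
Qed.

Lemma cov2_along_metric x v w : U x -> cov2_along (fun i j y => g y i j) x v w = 0.
Proof.
move=> Ux; apply/matrixP => i j; rewrite !mxE big1 // => k _; rewrite big1 // => m _.
have Z b i' j' : cov_deriv2 g (fun i j y => g y i j) b i' j' x = 0 by exact: cov_metric.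
rewrite /cov_deriv3 (partial_eq_on (cm_open cm) (g := fun=> 0)) => [|y Uy|//]; last exact: cov_metric.
rewrite !big1 ?subr0 => [|b _|b _|b _]; rewrite ?Z ?mulr0 //.
have hd : derivable (fun=> 0 : R) x (delta_mx 0 k) by exact: derivable_cst.
have [_ e1] := partialP hd; have [_ e2] : is_derive x (delta_mx 0 k : V) (fun=> 0 : R) 0 by exact: is_derive_cst.
by rewrite -e1 e2 mulr0.
Qed.

End CovariantDerivatives.

(** * Symmetries and traces of the curvature tensor in a frame *)

Section FrameCurvature.
Context {R : realType} {n : nat}.
Local Notation V := 'rV[R]_n.+1.
Variables (U : set V) (g : V -> 'M[R]_n.+1).
Hypothesis cm : chart_metric U g.
Implicit Types (x a b c d : V) (E : 'M[R]_n.+1).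

Lemma riemann_bianchi_at i j k l x : U x ->
  riemann g i j k l x + riemann g j l k i x + riemann g l i k j x = 0.
Proof.
move=> Ux; rewrite /riemann -!big_split big1 // => m _ /=; rewrite -!mulrDr.
have sy p q r y : U y -> christoffel g p q r y = christoffel g p r q y.
  by move=> Uy; exact: (christoffel_sym (cm_open cm) (cm_sym cm) p q r Uy).
have P p q r s : partial p (christoffel g q r s) x = partial p (christoffel g q s r) x.
  by apply: (partial_eq_on (cm_open cm)) => // y; exact: sy.
suff -> : riemann_up g i j l m x + riemann_up g j l i m x + riemann_up g l i j m x = 0 by rewrite mulr0.
have S e1 e2 e3 : \sum_p christoffel g m e1 p x * christoffel g p e2 e3 x = \sum_p christoffel g m e1 p x * christoffel g p e3 e2 x.
  by apply: eq_bigr => p _; rewrite (sy p e2 e3).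
rewrite /riemann_up !sumrB (P i m l j) (P j m l i) (P l m j i) (S i l j) (S j l i) (S l j i).
move: (partial _ _ _) (partial _ _ _) (partial _ _ _) (\sum_p _) (\sum_p _) (\sum_p _) => *; ring.
Qed.

Lemma sum4_swap (F : 'I_n.+1 -> 'I_n.+1 -> 'I_n.+1 -> 'I_n.+1 -> R) :
  \sum_i \sum_j \sum_k \sum_l F i j k l = \sum_i \sum_j \sum_k \sum_l F k l i j.
Proof.
under eq_bigr => i _ do rewrite exchange_big /=.
rewrite exchange_big /=; apply: eq_bigr => k _.
under eq_bigr => i _ do rewrite exchange_big /=.
by rewrite exchange_big.
Qed.

Lemma sum4_cycle (F : 'I_n.+1 -> 'I_n.+1 -> 'I_n.+1 -> 'I_n.+1 -> R) :
  \sum_i \sum_j \sum_k \sum_l F i j k l = \sum_i \sum_j \sum_k \sum_l F j l k i.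
Proof.
rewrite [RHS]exchange_big /=; apply: eq_bigr => i _.
under [RHS]eq_bigr => j _ do rewrite exchange_big /=.
rewrite [RHS]exchange_big /=; apply: eq_bigr => j _.
by rewrite [RHS]exchange_big.
Qed.

Lemma rm_anti12 x a b c d : U x -> rm g x a b c d = - rm g x b a c d.
Proof.
move=> Ux; rewrite /rm exchange_big -sumrN; apply: eq_bigr => i _ /=; rewrite -sumrN; apply: eq_bigr => j _.
rewrite -sumrN; apply: eq_bigr => k _; rewrite -sumrN; apply: eq_bigr => l _.
rewrite (riemann_anti12_at (cm_open cm) (cm_smooth cm) (chart_unit cm) Ux j i).
by move: (riemann _ _ _ _ _ _) => z; ring.
Qed.

Lemma rm_pair x a b c d : U x -> rm g x a b c d = rm g x c d a b.
Proof.
move=> Ux; rewrite /rm sum4_swap; apply: eq_bigr => i _; apply: eq_bigr => j _.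
apply: eq_bigr => k _; apply: eq_bigr => l _.
rewrite (riemann_pair_at (cm_open cm) (cm_smooth cm) (cm_sym cm) (chart_unit cm) Ux k l).
by move: (riemann _ _ _ _ _ _) => z; ring.
Qed.

Lemma rm_anti34 x a b c d : U x -> rm g x a b c d = - rm g x a b d c.
Proof. by move=> Ux; rewrite (rm_pair a b c d Ux) (rm_pair a b d c Ux); exact: rm_anti12. Qed.

Lemma rm_bianchi x a b c d : U x -> rm g x a b c d + rm g x b d c a + rm g x d a c b = 0.
Proof.
move=> Ux; rewrite /rm [X in _ + X + _]sum4_cycle [X in _ + X]sum4_cycle [X in _ + X]sum4_cycle -!big_split big1 // => i _ /=.
rewrite -!big_split big1 // => j _ /=; rewrite -!big_split big1 // => k _ /=; rewrite -!big_split big1 // => l _ /=.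
have := riemann_bianchi_at i j k l Ux.
move: (riemann _ _ _ _ _ _) (riemann _ _ _ _ _ _) (riemann _ _ _ _ _ _) => p q s H.
transitivity (a 0 i * b 0 j * c 0 k * d 0 l * (s + q + p)); last by rewrite H mulr0.
by ring.
Qed.

Lemma riemann_frame_rm x E i j k l : riemann_frame g x E i j k l = rm g x (row i E) (row j E) (row k E) (row l E).
Proof.
by apply: eq_bigr => i' _; apply: eq_bigr => j' _; apply: eq_bigr => k' _; apply: eq_bigr => l' _; rewrite !mxE.
Qed.

Lemma ricci_frame_rm x E a b : U x -> E *m g x *m E^T = 1%:M ->
  bil (ricci g x) a b = \sum_k rm g x a (row k E) b (row k E).
Proof.
move=> Ux EE; have G := frame_inverse cm Ux EE.
have EG i l : \sum_k E k i * E k l = invmx (g x) i l.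
  by rewrite -G mxE; apply: eq_bigr => k _; rewrite mxE.
rewrite bilE /rm [RHS]exchange_big /=; apply: eq_bigr => i _; rewrite [RHS]exchange_big /=.
under [RHS]eq_bigr => j _ do rewrite exchange_big /=.
rewrite [RHS]exchange_big /=; apply: eq_bigr => k _.
rewrite mxE big_distrr; apply: eq_bigr => j _ /=; rewrite big_distrr /= exchange_big; apply: eq_bigr => l _ /=.
rewrite -EG big_distrl big_distrr /=; apply: eq_bigr => m _; rewrite !mxE.
by move: (riemann _ _ _ _ _ _) => z; ring.
Qed.

Lemma bil_ricciC x a b E : U x -> E *m g x *m E^T = 1%:M -> bil (ricci g x) a b = bil (ricci g x) b a.
Proof.
by move=> Ux EE; rewrite !(ricci_frame_rm _ _ Ux EE); apply: eq_bigr => k _; exact: rm_pair.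
Qed.

Lemma scalar_frame x E : U x -> E *m g x *m E^T = 1%:M -> scalar_curvature g x = \tr (ricci_frame g x E).
Proof.
move=> Ux EE; have G := frame_inverse cm Ux EE.
rewrite /ricci_frame mxtrace_mulC mulmxA G /scalar_curvature.
have gs := cm_sym cm Ux; have gis : (invmx (g x))^T = invmx (g x) by rewrite trmx_inv gs.
apply: eq_bigr => i _; rewrite mxE; apply: eq_bigr => k _.
rewrite -!bil_delta; congr (_ * _); exact: (bil_ricciC _ _ Ux EE).
Qed.

End FrameCurvature.

Section FourDimensional.
Context {R : realType}.
Local Notation V := 'rV[R]_4.
Variables (U : set V) (g : V -> 'M[R]_4) (x : V) (E : 'M[R]_4).
Hypothesis cm : chart_metric U g.
Hypothesis Ux : U x.
Hypothesis EE : E *m g x *m E^T = 1%:M.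
Local Notation r := (riemann_frame g x E).

Let a12 i j k l : r i j k l = - r j i k l. Proof. by rewrite !riemann_frame_rm; exact: (rm_anti12 cm). Qed.
Let a34 i j k l : r i j k l = - r i j l k. Proof. by rewrite !riemann_frame_rm; exact: (rm_anti34 cm). Qed.
Let pr i j k l : r i j k l = r k l i j. Proof. by rewrite !riemann_frame_rm; exact: (rm_pair cm). Qed.
Let bia i j k l : r i j k l + r j l k i + r l i k j = 0. Proof. by rewrite !riemann_frame_rm; exact: (rm_bianchi cm). Qed.

Lemma ricci_frameE : ricci_frame g x E = frame_ric r.
Proof.
apply/matrixP => i k; rewrite bil_rowE (ricci_frame_rm cm _ _ Ux EE) mxE.
by apply: eq_bigr => j _; rewrite riemann_frame_rm.
Qed.

Lemma ricci_frame_sym : (ricci_frame g x E)^T = ricci_frame g x E.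
Proof. by rewrite ricci_frameE; exact: (frame_ric_sym pr). Qed.

Lemma isotropic_consequences : two_smallest_nonneg (block_A g x E) -> two_smallest_nonneg (block_C g x E) ->
  0 <= \tr (ricci_frame g x E) /\ 0 <= r (inord 0) (inord 2) (inord 0) (inord 2)
    + r (inord 0) (inord 3) (inord 0) (inord 3) + r (inord 1) (inord 2) (inord 1) (inord 2)
    + r (inord 1) (inord 3) (inord 1) (inord 3).
Proof. by move=> hA hC; rewrite ricci_frameE; exact: (frame_isotropic a12 a34 pr bia hA hC). Qed.

Lemma Rm_norm_le : two_smallest_nonneg (block_A g x E) -> two_smallest_nonneg (block_C g x E) ->
  two_smallest_nonneg (ricci_frame g x E) -> Rm_norm g x E <= scalar_curvature g x.
Proof.
move=> hA hC hR; have [R0 _] := isotropic_consequences hA hC.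
rewrite (scalar_frame cm Ux EE); rewrite ricci_frameE in R0 hR *.
rewrite -(ger0_norm R0) -sqrtr_sqr /Rm_norm; apply: ler_wsqrtr.
exact: (frame_norm_le a12 a34 pr bia hA hC hR).
Qed.

Lemma ricci_reaction (s : R) : s = ricci_frame g x E (inord 0) (inord 0) + ricci_frame g x E (inord 1) (inord 1) ->
  s <= 0 -> 0 <= \tr (ricci_frame g x E) ->
  0 <= r (inord 0) (inord 2) (inord 0) (inord 2)
    + r (inord 0) (inord 3) (inord 0) (inord 3) + r (inord 1) (inord 2) (inord 1) (inord 2)
    + r (inord 1) (inord 3) (inord 1) (inord 3) ->
  s ^+ 2 / 2 <= \sum_k ricci_frame g x E k k * (r k (inord 0) k (inord 0) + r k (inord 1) k (inord 1)).
Proof. rewrite ricci_frameE; exact: (frame_reaction a12 a34). Qed.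

End FourDimensional.

(** The assumption concerns oriented frames only. Changing the sign of the first vector reverses the
    orientation and leaves the four sectional curvatures unchanged. *)
Lemma isotropic_frame {R : realType} (g : 'rV[R]_4 -> 'M[R]_4) (U : set 'rV[R]_4) (x : 'rV[R]_4) :
  chart_metric U g -> U x ->
  (forall E, oriented_orthonormal (g x) E ->
     two_smallest_nonneg (block_A g x E) /\ two_smallest_nonneg (block_C g x E)) ->
  forall E : 'M[R]_4, E *m g x *m E^T = 1%:M ->
  0 <= scalar_curvature g x /\
  0 <= riemann_frame g x E (inord 0) (inord 2) (inord 0) (inord 2)
    + riemann_frame g x E (inord 0) (inord 3) (inord 0) (inord 3)
    + riemann_frame g x E (inord 1) (inord 2) (inord 1) (inord 2)
    + riemann_frame g x E (inord 1) (inord 3) (inord 1) (inord 3).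
Proof.
move=> cm Ux nic E EE.
have pos E' : E' *m g x *m E'^T = 1%:M -> 0 < \det E' -> 0 <= scalar_curvature g x /\
  0 <= riemann_frame g x E' (inord 0) (inord 2) (inord 0) (inord 2)
    + riemann_frame g x E' (inord 0) (inord 3) (inord 0) (inord 3)
    + riemann_frame g x E' (inord 1) (inord 2) (inord 1) (inord 2)
    + riemann_frame g x E' (inord 1) (inord 3) (inord 1) (inord 3).
  move=> EE' dE'; have [hA hC] := nic E' (conj EE' dE'); rewrite (scalar_frame cm Ux EE').
  exact: (isotropic_consequences cm Ux EE' hA hC).
have [dE|dE|d0] := ltgtP 0 (\det E); first exact: pos.
  pose D : 'M[R]_4 := diag_mx (\row_i (if i == 0 then -1 else 1)).
  have Drow (F : 'M[R]_4) i : row i (D *m F) = (if i == 0 then -1 else 1) *: row i F.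
    by apply/rowP => j; rewrite /D mul_diag_mx !mxE.
  have DD : D *m D^T = 1%:M.
    rewrite tr_diag_mx mulmx_diag; apply/matrixP => i j; rewrite !mxE.
    by case: ifP => _; rewrite ?mulrNN mulr1.
  have EE' : D *m E *m g x *m (D *m E)^T = 1%:M.
    rewrite trmx_mul !mulmxA -[D *m E *m g x]mulmxA -[D *m _ *m E^T]mulmxA mulmxA.
    by rewrite -(mulmxA D (E *m g x)) EE mulmx1 DD.
  have dD : \det D = -1.
    by rewrite det_diag !big_ord_recl big_ord0 !mxE /= !mulr1.
  have [|H1 H2] := pos _ EE'; first by rewrite det_mulmx dD mulN1r oppr_gt0.
  split=> //; move: H2; rewrite !riemann_frame_rm !Drow.
  have Z (c : R) (v w : 'rV[R]_4) : c * c = 1 -> rm g x (c *: v) w (c *: v) w = rm g x v w v w.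
    by move=> cc; have := rmZ g x c 1 c 1 v w v w; rewrite !scale1r !mulr1 cc mul1r.
  have e10 (k : nat) : (0 < k < 4)%N -> ((inord k : 'I_4) == 0) = false.
    by move=> /andP[k0 k4]; apply/negbTE; rewrite -val_eqE /= inordK // -lt0n.
  have e00 : ((inord 0 : 'I_4) == 0) = true by rewrite -val_eqE /= inordK.
  rewrite e00 !e10 //= !scale1r.
  by rewrite !Z // mulrNN mulr1.
have := congr1 determinant EE; rewrite !det_mulmx -d0 mul0r mul0r det1 => /esym/eqP.
by rewrite oner_eq0.
Qed.

(** * The soliton potential along geodesics *)

Lemma hessian_sum {R : realType} {n : nat} (v : 'rV[R]_n.+1) (D2 : 'I_n.+1 -> 'I_n.+1 -> R)
  (G : 'I_n.+1 -> 'I_n.+1 -> 'I_n.+1 -> R) (D1 : 'I_n.+1 -> R) :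
  \sum_i ((- (\row_k \sum_i \sum_j G k i j * v 0 i * v 0 j)) 0 i * D1 i + v 0 i * \sum_j v 0 j * D2 j i) =
  bil (\matrix_(i, j) (D2 i j - \sum_k G k i j * D1 k)) v v.
Proof.
rewrite bilE; under [RHS]eq_bigr => i _ do under eq_bigr => j _ do rewrite mxE mulrBr.
under [RHS]eq_bigr => i _ do rewrite sumrB; rewrite sumrB big_split /= addrC; congr (_ + _).
  under eq_bigr => i _ do rewrite big_distrr /=.
  rewrite exchange_big /=; apply: eq_bigr => i _; apply: eq_bigr => j _; by ring.
under eq_bigr => k _ do rewrite !mxE mulNr big_distrl /=; rewrite sumrN; congr (- _).
under [RHS]eq_bigr => i _ do under eq_bigr => j _ do rewrite big_distrr /=.
rewrite exchange_big /=; apply: eq_bigr => i _; rewrite [RHS]exchange_big /=; apply: eq_bigr => k _.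
by rewrite big_distrl /=; apply: eq_bigr => j _; ring.
Qed.

Lemma bil_polarize {R : realType} {n : nat} (S S' J : 'M[R]_n.+1) :
  (forall u v, bil S u v = bil S v u) -> (forall u v, bil S' u v = bil S' v u) ->
  (forall w, bil S' (w *m J) (w *m J) = bil S w w) -> forall u v, bil S' (u *m J) (v *m J) = bil S u v.
Proof.
move=> sS sS' Q u v; have := Q (u + v); rewrite mulmxDl !bilDl !bilDr !Q (sS v u) (sS' (v *m J) (u *m J)).
by move: (bil _ _ _) (bil _ _ _) (bil _ _ _) (bil _ _ _) => *; lra.
Qed.

Section Potential.
Context {R : realType} {n : nat} {M : topologicalType}.
Local Notation V := 'rV[R]_n.+1.
Variables (A : smooth_atlas R n M) (g : riemannian_metric A) (f : M -> R).
Hypothesis gcomp : complete_metric g.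
Hypothesis fs : smooth_function A f.
Hypothesis sol : forall (a : chart_index A) x, chart_cod a x ->
  ricci (metric g a) x + hessian (metric g a) (f \o chart_inv a) x = 0.
Implicit Types (a b : chart_index A) (p q : M) (c : R -> M).

Local Notation chart_pot a := (f \o chart_inv a).

Lemma is_derive_potential a c (t : R) : geodesic g c -> chart_dom a (c t) ->
  is_derive t 1 (f \o c) (\sum_i vel a c t 0 i * partial i (chart_pot a) (chart a (c t))).
Proof.
move=> gc ac; have H := smooth_curve (c := chart a \o c) (cm_open (chart_cm g a)) (@fs a) (chart_codI ac) (geodesic_derive gc ac).
apply: near_eq_is_derive H; apply: filterS (near_dom (geodesic_cts gc) ac) => s as_ /=.
by rewrite chartK.
Qed.

Definition potential_slope c (t : R) : R := derive1 (f \o c) t.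

Lemma potential_slopeE a c (t : R) : geodesic g c -> chart_dom a (c t) ->
  potential_slope c t = \sum_i vel a c t 0 i * partial i (chart_pot a) (chart a (c t)).
Proof. by move=> gc ac; rewrite /potential_slope derive1E; have [] := is_derive_potential gc ac. Qed.

(** Along a geodesic the second derivative of f is its Hessian on the velocity, which the soliton
    equation turns into - Rc. This makes the curvature term of the second variation integrable. *)
Lemma is_derive_slope a c (t : R) : geodesic g c -> chart_dom a (c t) ->
  is_derive t 1 (potential_slope c) (- bil (ricci (metric g a) (chart a (c t))) (vel a c t) (vel a c t)).
Proof.
move=> gc ac; have [du dv] := geodesic_chart gc ac; have Uc := chart_codI ac.
have oU := cm_open (chart_cm g a).
have H : is_derive t 1 (fun s => \sum_i vel a c s 0 i * partial i (chart_pot a) ((chart a \o c) s))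
   (\sum_i ((- Gamv (metric g a) (chart a (c t)) (vel a c t) (vel a c t)) 0 i * partial i (chart_pot a) (chart a (c t)) +
     vel a c t 0 i * \sum_j vel a c t 0 j * partial j (partial i (chart_pot a)) (chart a (c t)))).
  move/is_derive_rv: dv => dv.
  have D i : is_derive t 1 (fun s => partial i (chart_pot a) ((chart a \o c) s))
      (\sum_j vel a c t 0 j * partial j (partial i (chart_pot a)) (chart a (c t))).
    exact: (smooth_curve oU (smooth_partial i (@fs a)) Uc du).
  by apply: dSum => i; exact: (dM (dv i) (D i)).
have E : - bil (ricci (metric g a) (chart a (c t))) (vel a c t) (vel a c t) =
   bil (hessian (metric g a) (chart_pot a) (chart a (c t))) (vel a c t) (vel a c t).
  have /eqP := sol Uc; rewrite addrC addr_eq0 => /eqP ->.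
  by rewrite -[in RHS]scaleN1r bil_mxZ mulN1r.
rewrite E; apply: near_eq_is_derive (dEq H _).
  apply: filterS (near_dom (geodesic_cts gc) ac) => s as_; exact/esym/potential_slopeE.
exact: (hessian_sum (vel a c t) (fun i j => partial i (partial j (chart_pot a)) (chart a (c t)))
  (fun k i j => christoffel (metric g a) k i j (chart a (c t))) (fun k => partial k (chart_pot a) (chart a (c t)))).
Qed.

Lemma ricci_sym a p u v : chart_dom a p -> bil (ricci (metric g a) (chart a p)) u v = bil (ricci (metric g a) (chart a p)) v u.
Proof.
move=> ap; have Up := chart_codI ap; have cm := chart_cm g a.
rewrite !bilE exchange_big; apply: eq_bigr => i _; apply: eq_bigr => j _ /=.
have -> : ricci (metric g a) (chart a p) i j = ricci (metric g a) (chart a p) j i.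
  have H k l : ricci (metric g a) (chart a p) k l = - hessian (metric g a) (chart_pot a) (chart a p) k l.
    by have /eqP := sol Up; rewrite addr_eq0 => /eqP ->; rewrite mxE.
  have E1 := partialC (cm_open cm) i j (@fs a) Up.
  have E2 : \sum_k christoffel (metric g a) k i j (chart a p) * partial k (chart_pot a) (chart a p) =
            \sum_k christoffel (metric g a) k j i (chart a p) * partial k (chart_pot a) (chart a p).
    by apply: eq_bigr => k _; rewrite (christoffel_sym (cm_open cm) (cm_sym cm) k i j Up).
  by rewrite !H [hessian _ _ _ i j]mxE [hessian _ _ _ j i]mxE E1 E2.
by rewrite (mulrC (u 0 _)).
Qed.

(** Tensoriality without transforming Christoffel symbols: - Rc(w, w) is the second derivative of f
    along the geodesic with velocity w, a number that involves no chart. Polarization gives the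
    bilinear form. *)
Lemma ricci_transition a b p u v : chart_dom a p -> chart_dom b p ->
  bil (ricci (metric g b) (chart b p)) (u *m 'J (transition a b) (chart a p)) (v *m 'J (transition a b) (chart a p)) =
  bil (ricci (metric g a) (chart a p)) u v.
Proof.
move=> ap bp; set J := 'J _ _.
have Q w : bil (ricci (metric g b) (chart b p)) (w *m J) (w *m J) = bil (ricci (metric g a) (chart a p)) w w.
  have [gc c0 v0] := geoP gcomp w ap; set c := geo gcomp a p w in gc c0 v0.
  have ac : chart_dom a (c 0) by rewrite c0. have bc : chart_dom b (c 0) by rewrite c0.
  have [_ e1] := is_derive_slope gc ac; have [_ e2] := is_derive_slope gc bc.
  by move: e2; rewrite e1 (vel_change gc ac bc) v0 c0 => /oppr_inj.
have sa u' v' := ricci_sym u' v' ap; have sb u' v' := ricci_sym u' v' bp.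
exact: (bil_polarize sa sb Q).
Qed.

(** Cauchy-Schwarz for the velocity and the gradient w of f. *)
Lemma slope_le a c (t l2 : R) : geodesic g c -> has_speed2 g c l2 -> chart_dom a (c t) ->
  grad_norm_sq (metric g a) (chart_pot a) (chart a (c t)) <= 1 -> potential_slope c t ^+ 2 <= l2.
Proof.
move=> gc sc ac G1; have cm := chart_cm g a; have Uc := chart_codI ac; set x := chart a (c t) in G1 *.
pose df : V := \row_i partial i (chart_pot a) x; pose w := df *m invmx (metric g a x).
have gs := cm_sym cm Uc; have gu := chart_unit cm Uc; have gis : (invmx (metric g a x))^T = invmx (metric g a x) by rewrite trmx_inv gs.
have bw v : bil (metric g a x) w v = \sum_i v 0 i * partial i (chart_pot a) x.
  by rewrite /bil /w mulmxKV // mxE; apply: eq_bigr => i _; rewrite !mxE mulrC.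
have ww : bil (metric g a x) w w = grad_norm_sq (metric g a) (chart_pot a) x.
  rewrite bw /grad_norm_sq exchange_big; apply: eq_bigr => i _ /=; rewrite mxE big_distrl.
  by apply: eq_bigr => j _ /=; rewrite mxE [_ * invmx _ _ _]mulrC.
rewrite (potential_slopeE gc ac) -/x -bw.
have pos v : 0 <= bil (metric g a x) v v by exact: (chart_bil_ge0 cm _ Uc).
have := bil_CS w (vel a c t) gs pos; rewrite (sc _ _ ac) ww => H; apply: le_trans H _.
by rewrite ler_piMl // (has_speed2_ge0 sc).
Qed.

Lemma slope_increment c (t eta : R) : geodesic g c -> 0 < eta -> exists2 de : R, 0 < de &
  forall s1 s2, s1 < s2 -> `|s1 - t| < de -> `|s2 - t| < de ->
  (s2 - s1) * (derive1 (potential_slope c) s2 - eta) <= potential_slope c s2 - potential_slope c s1.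
Proof.
move=> gc eta0.
have D s : is_derive (s : R) 1 (potential_slope c) (derive1 (potential_slope c) s).
  have [a as_] := chart_cover A (c s); have H := is_derive_slope gc as_.
  by apply: (dEq H); rewrite derive1E; have [_ ->] := H.
have C : {for t, continuous (derive1 (potential_slope c))}.
  have [a at_] := chart_cover A (c t); have cm := chart_cm g a.
  have E : \forall s \near t, - bil (tensor_mx (fun i j y => ricci (metric g a) y i j) ((chart a \o c) s)) (vel a c s) (vel a c s)
     = derive1 (potential_slope c) s.
    apply: filterS (near_dom (geodesic_cts gc) at_) => s as_.
    rewrite derive1E; have [_ ->] := is_derive_slope gc as_; congr (- bil _ _ _).
    by apply/matrixP => i j; rewrite mxE.
  have [du dv] := geodesic_chart gc at_.
  have H := dN (is_derive_tensor cm (smooth_ricci (cm_open cm) (cm_smooth cm) (chart_unit cm)) (chart_codI at_) du dv dv).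
  exact: is_derive_cts (near_eq_is_derive E H).
have e2 : 0 < eta / 2 by rewrite divr_gt0.
have N : \forall s \near t, `|derive1 (potential_slope c) t - derive1 (potential_slope c) s| < eta / 2.
  exact: ((cvgrPdist_lt (F := nbhs t) (FF := nbhs_filter t) _ _).1 C _ e2).
have [de de0 Hd] := nbhs_R_ex N; exists de => // s1 s2 s12 h1 h2.
have [z /andP[z1 z2] ->] := MVT_closed s12 (fun s _ => D s).
rewrite mulrC ler_wpM2r ?subr_ge0 ?(ltW s12) //.
have zt : `|z - t| < de.
  move: h1 h2; rewrite !ltr_norml => /andP[h1 h1'] /andP[h2 h2']; apply/andP; split; lra.
have key (x y w e : R) : `|x - y| < e / 2 -> `|x - w| < e / 2 -> w - e <= y.
  rewrite !ltr_norml => /andP[? ?] /andP[? ?]; lra.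
exact: key (Hd _ zt) (Hd _ h2).
Qed.

End Potential.

Section UpperSemicontinuous.
Context {R : realType} {T : topologicalType}.

(** The sets of points of K at which W is at least W v generate a filter; a cluster point of it in K
    is a maximum. *)
Lemma usc_max (K : set T) (W : T -> R) : compact K -> K !=set0 ->
  (forall v, K v -> forall z, W v < z -> \forall w \near v, W w < z) ->
  exists2 v, K v & forall w, K w -> W w <= W v.
Proof.
move=> cK [k0 Kk0] usc; pose B v := [set w | K w /\ W v <= W w].
have FF : ProperFilter (filter_from K B).
  apply: filter_from_proper; last by move=> v Kv; exists v; split.
  apply: filter_from_filter; first by exists k0.
  move=> v w Kv Kw; have [vw|wv] := leP (W v) (W w).
    by exists w => // x [Kx h]; split; split=> //; exact: le_trans h.
  by exists v => // x [Kx h]; split; split=> //; apply: le_trans h; exact: ltW.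
have FK : filter_from K B K by exists k0 => // x [].
have [v [Kv clv]] := cK _ FF FK; exists v => // w Kw; rewrite leNgt; apply/negP => vw.
have [x [[_ h1] h2]] := clv (B w) [set x | W x < W w] ltac:(by exists w) (usc v Kv _ vw).
by move: h2; rewrite /= ltNge h1.
Qed.

End UpperSemicontinuous.

(** * The sum of the two lowest Ricci eigenvalues *)

Section PairForm.
Context {R : realType} {n : nat}.
Implicit Types (G S E : 'M[R]_n.+1) (X Y : 'rV[R]_n.+1).

Definition pair_area G X Y : R := bil G X X * bil G Y Y - bil G X Y ^+ 2.
(* [S] acts on the bivector of X and Y by [pair_form], whose square norm is [pair_area]: these
   are homogeneous, so that the pair need not be orthonormal. *)
Definition pair_form S G X Y : R := bil S X X * bil G Y Y + bil S Y Y * bil G X X - 2 * bil S X Y * bil G X Y.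

Lemma orthonormal_frame_exists G : G^T = G -> (forall v : 'rV[R]_n.+1, v != 0 -> 0 < bil G v v) ->
  exists E, E *m G *m E^T = 1%:M.
Proof.
move=> Gs Gp; have [T [d [TT TG]]] := spectral Gs.
have d0 i : 0 < d 0 i.
  have -> : d 0 i = bil G (row i T) (row i T) by rewrite -bil_rowE TG mxE eqxx.
  apply: Gp; apply/eqP => Ti; have /orthogonalE/(_ i i) := TT.
  by rewrite Ti bil0l eqxx => /esym/eqP; rewrite oner_eq0.
pose D : 'M[R]_n.+1 := diag_mx (\row_i (Num.sqrt (d 0 i))^-1); exists (D *m T).
have -> : D *m T *m G *m (D *m T)^T = D *m (T *m G *m T^T) *m D^T by rewrite trmx_mul !mulmxA.
rewrite TG tr_diag_mx !mulmx_diag; apply/matrixP => i j; rewrite !mxE; case: eqP => // ->.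
have s0 : Num.sqrt (d 0 j) != 0 by rewrite gt_eqF // sqrtr_gt0.
have : d 0 j = Num.sqrt (d 0 j) * Num.sqrt (d 0 j) by rewrite -expr2 sqr_sqrtr // ltW.
move: s0; move: (d 0 j) (Num.sqrt (d 0 j)) => w t t0 ->; rewrite ?mulr1n.
by field.
Qed.

Lemma bil_frame S G E X Y : E *m G *m E^T = 1%:M ->
  bil S X Y = bil (E *m S *m E^T) (X *m G *m E^T) (Y *m G *m E^T).
Proof.
move=> EE; have H : G *m E^T *m E = 1%:M by apply: mulmx1C; rewrite mulmxA.
have HX Z : Z *m G *m E^T *m E = Z by rewrite -!mulmxA [G *m _]mulmxA H mulmx1.
rewrite /bil; have -> : X *m G *m E^T *m (E *m S *m E^T) *m (Y *m G *m E^T)^T =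
  (X *m G *m E^T *m E) *m S *m (Y *m G *m E^T *m E)^T by rewrite [in RHS]trmx_mul !mulmxA.
by rewrite !HX.
Qed.

End PairForm.

Section LowestPair.
Context {R : realType}.
Implicit Types (G S E : 'M[R]_4) (X Y : 'rV[R]_4) (z : R).

(** The first clause says that a frame attains z as the sum of the two lowest eigenvalues relative
    to G; the second is the variational inequality on bivectors, valid for pairs that are not
    orthonormal. *)
Definition lowest_pair G S z : Prop :=
  (exists E d, [/\ E *m G *m E^T = 1%:M, E *m S *m E^T = diag_mx d,
      (forall i j : 'I_4, (i <= j)%N -> d 0 i <= d 0 j) & d 0 (inord 0) + d 0 (inord 1) = z]) /\
  forall X Y, z * pair_area G X Y <= pair_form S G X Y.

(** By Lagrange's identity the difference is a sum over i < j of (x_i y_j - x_j y_i)^2 with weight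
    the i-th plus the j-th eigenvalue minus (a + b), which is nonnegative. *)
Lemma diag_pair_form (a b c d x0 x1 x2 x3 y0 y1 y2 y3 : R) : a <= b -> b <= c -> c <= d ->
  (a + b) * ((x0 * x0 + x1 * x1 + x2 * x2 + x3 * x3) * (y0 * y0 + y1 * y1 + y2 * y2 + y3 * y3)
     - (x0 * y0 + x1 * y1 + x2 * y2 + x3 * y3) ^+ 2) <=
  (a * x0 * x0 + b * x1 * x1 + c * x2 * x2 + d * x3 * x3) * (y0 * y0 + y1 * y1 + y2 * y2 + y3 * y3)
  + (a * y0 * y0 + b * y1 * y1 + c * y2 * y2 + d * y3 * y3) * (x0 * x0 + x1 * x1 + x2 * x2 + x3 * x3)
  - 2 * (a * x0 * y0 + b * x1 * y1 + c * x2 * y2 + d * x3 * y3) * (x0 * y0 + x1 * y1 + x2 * y2 + x3 * y3).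
Proof.
move=> ab bc cd.
have P (k s : R) : 0 <= k -> 0 <= k * s ^+ 2 by move=> k0; rewrite mulr_ge0 // sqr_ge0.
have h1 : 0 <= c - b by lra. have h2 : 0 <= d - b by lra. have h3 : 0 <= c - a by lra.
have h4 : 0 <= d - a by lra. have h5 : 0 <= c + d - a - b by lra.
have := P _ (x0 * y2 - x2 * y0) h1; have := P _ (x0 * y3 - x3 * y0) h2; have := P _ (x1 * y2 - x2 * y1) h3.
have := P _ (x1 * y3 - x3 * y1) h4; have := P _ (x2 * y3 - x3 * y2) h5.
lra.
Qed.

Lemma lowest_pair_exists G S : G^T = G -> (forall v : 'rV[R]_4, v != 0 -> 0 < bil G v v) -> S^T = S ->
  exists z, lowest_pair G S z.
Proof.
move=> Gs Gp Ss; have [E0 EE0] := orthonormal_frame_exists Gs Gp.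
have Ss0 : (E0 *m S *m E0^T)^T = E0 *m S *m E0^T by rewrite !trmx_mul trmxK Ss mulmxA.
have [T [d [TT TS ds]]] := spectral_sorted Ss0; pose E := T *m E0.
have cE (Q : 'M[R]_4) : E *m Q *m E^T = T *m (E0 *m Q *m E0^T) *m T^T by rewrite /E trmx_mul !mulmxA.
have EE : E *m G *m E^T = 1%:M by rewrite cE EE0 mulmx1.
have ES : E *m S *m E^T = diag_mx d by rewrite cE.
exists (d 0 (inord 0) + d 0 (inord 1)); split; first by exists E, d.
move=> X Y; rewrite /pair_area /pair_form.
have FG X' Y' : bil G X' Y' = bil 1%:M (X' *m G *m E^T) (Y' *m G *m E^T) by rewrite (bil_frame G X' Y' EE) EE.
have FS X' Y' : bil S X' Y' = bil (diag_mx d) (X' *m G *m E^T) (Y' *m G *m E^T) by rewrite (bil_frame S X' Y' EE) ES.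
rewrite !FG !FS; move: (X *m G *m E^T) (Y *m G *m E^T) => x y.
have D1 (u v : 'rV[R]_4) : bil 1%:M u v = u 0 (inord 0) * v 0 (inord 0) + u 0 (inord 1) * v 0 (inord 1)
    + u 0 (inord 2) * v 0 (inord 2) + u 0 (inord 3) * v 0 (inord 3).
  by rewrite /bil mulmx1 mxE sum4 !mxE.
have D2 (u v : 'rV[R]_4) : bil (diag_mx d) u v = d 0 (inord 0) * u 0 (inord 0) * v 0 (inord 0)
    + d 0 (inord 1) * u 0 (inord 1) * v 0 (inord 1)
    + d 0 (inord 2) * u 0 (inord 2) * v 0 (inord 2) + d 0 (inord 3) * u 0 (inord 3) * v 0 (inord 3).
  rewrite /bil mul_mx_diag mxE sum4 !mxE.
  by move: (u 0 _) (u 0 _) (u 0 _) (u 0 _) => u0 u1 u2 u3; ring.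
rewrite !D1 !D2; apply: diag_pair_form; apply: ds; by rewrite !inordK.
Qed.

Lemma lowest_pair_le G S z E : lowest_pair G S z -> E *m G *m E^T = 1%:M ->
  z <= bil S (row (inord 0) E) (row (inord 0) E) + bil S (row (inord 1) E) (row (inord 1) E).
Proof.
move=> [_ H] EE; have := H (row (inord 0) E) (row (inord 1) E).
rewrite /pair_area /pair_form -(bil_rowE G) -(bil_rowE G E (inord 1) (inord 1)) -(bil_rowE G E (inord 0) (inord 1)).
rewrite EE !mxE !eqxx; have -> : (inord 0 == inord 1 :> 'I_4) = false by rewrite -val_eqE /= !inordK.
by rewrite /= mulr0 subr0 !mulr1 expr0n /= subr0 mulr1.
Qed.

(** A pair that is orthonormal up to eta has area within 4 eta of 1, so the variational inequality
    survives with an error linear in eta. *)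
Lemma lower_estimate (L C eta s11 s22 s11' s22' s12' g11 g22 g12 : R) : 0 <= C -> 0 <= eta -> eta <= 1 ->
  `|s11' - s11| <= eta -> `|s22' - s22| <= eta -> `|s11'| <= C -> `|s22'| <= C -> `|s12'| <= C ->
  `|g11 - 1| <= eta -> `|g22 - 1| <= eta -> `|g12| <= eta ->
  L * (g11 * g22 - g12 ^+ 2) <= s11' * g22 + s22' * g11 - 2 * s12' * g12 ->
  L <= s11 + s22 + eta * (2 + 4 * C + 4 * `|L|).
Proof.
move=> C0 e0 e1 a1 a2 c1 c2 c3 b1 b2 b3 H.
have M (x y X Y : R) : `|x| <= X -> `|y| <= Y -> x * y <= X * Y.
  by move=> hx hy; apply: le_trans (ler_norm _) _; rewrite normrM; exact: ler_pM.
have p1 := M _ _ _ _ c1 b2; have p2 := M _ _ _ _ c2 b1.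
have p3 := M (- s12') g12 C eta ltac:(by rewrite normrN) b3.
have J : `|1 - (g11 * g22 - g12 ^+ 2)| <= 4 * eta.
  have -> : 1 - (g11 * g22 - g12 ^+ 2) = - (g11 - 1) - (g22 - 1) - (g11 - 1) * (g22 - 1) + g12 * g12 by ring.
  have q1 : `|(g11 - 1) * (g22 - 1)| <= eta * 1.
    by rewrite normrM; apply: ler_pM => //; exact: le_trans e1.
  have q2 : `|g12 * g12| <= eta * 1 by rewrite normrM; apply: ler_pM => //; exact: le_trans e1.
  move: b1 b2 q1 q2; move: (g11 - 1) (g22 - 1) => u v; move: (u * v) (g12 * g12) => w t.
  by rewrite !ler_norml => /andP[? ?] /andP[? ?] /andP[? ?] /andP[? ?]; apply/andP; split; lra.
have p4 := M L _ _ _ (lexx _) J.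
move: a1 a2; rewrite !ler_norml => /andP[a1 a1'] /andP[a2 a2'].
lra.
Qed.

End LowestPair.

Section LowestRicci.
Context {R : realType} {M : topologicalType}.
Local Notation V := 'rV[R]_4.
Variables (A : smooth_atlas R 3 M) (g : riemannian_metric A) (f : M -> R).
Hypothesis gcomp : complete_metric g.
Hypothesis fs : smooth_function A f.
Hypothesis sol : forall (a : chart_index A) x, chart_cod a x ->
  ricci (metric g a) x + hessian (metric g a) (f \o chart_inv a) x = 0.
Implicit Types (a b : chart_index A) (p q : M) (c : R -> M).

Local Notation met a q := (metric g a (chart a q)).
Local Notation ric a q := (ricci (metric g a) (chart a q)).

Lemma ricci_mx_sym a q : chart_dom a q -> (ric a q)^T = ric a q.
Proof. by move=> aq; apply/matrixP => i j; rewrite mxE -!bil_delta; exact: (ricci_sym fs sol). Qed.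

Lemma lowest_transition a b q z z' : chart_dom a q -> chart_dom b q ->
  lowest_pair (met b q) (ric b q) z -> lowest_pair (met a q) (ric a q) z' -> z <= z'.
Proof.
move=> aq bq zb [[E [d [EE ES ds <-]]] _].
pose J := 'J (transition a b) (chart a q).
have rJ i : row i (E *m J) = row i E *m J by rewrite row_mul.
have EJ : (E *m J) *m met b q *m (E *m J)^T = 1%:M.
  apply/matrixP => i j; rewrite bil_rowE !rJ (bil_transition g _ _ aq bq) -bil_rowE EE //.
have := lowest_pair_le zb EJ; rewrite !rJ !(ricci_transition gcomp fs sol _ _ aq bq) -!bil_rowE ES.
by rewrite !mxE !eqxx.
Qed.

(** By [lowest_transition] one number serves all charts at q; 0 is the default of [xget]. *)
Definition lowest q : R :=
  xget 0 [set z | forall a, chart_dom a q -> lowest_pair (met a q) (ric a q) z].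

Lemma lowestP a q : chart_dom a q -> lowest_pair (met a q) (ric a q) (lowest q).
Proof.
have ex b : chart_dom b q -> exists z, lowest_pair (met b q) (ric b q) z.
  move=> bq; have cm := chart_cm g b; have Uq := chart_codI bq.
  exact: (lowest_pair_exists (cm_sym cm Uq) (cm_pos cm Uq) (ricci_mx_sym bq)).
have [b bq] := chart_cover A q; have [z zb] := ex b bq.
have H : exists z, forall a, chart_dom a q -> lowest_pair (met a q) (ric a q) z.
  exists z => a' aq; have [z' za] := ex a' aq.
  suff -> : z = z' by [].
  apply/eqP; rewrite eq_le (lowest_transition aq bq zb za) /=.
  exact: (lowest_transition bq aq za zb).
by move=> aq; exact: (xgetPex 0 H).
Qed.

(** An optimal frame at the nearby point y is nearly orthonormal at q and serves as a trial pair
    there, so [lowest q] exceeds [lowest y] by little. This half of continuity is what the existence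
    of a maximum of minus [lowest] requires. *)
Lemma lowest_lsc q z : z < lowest q -> \forall y \near q, z < lowest y.
Proof.
move=> zL; have [a aq] := chart_cover A q; have cm := chart_cm g a; have Uq := chart_codI aq.
have [r [lam [K gb]]] := good_ball_exists cm Uq.
have r0 := gb_r gb; have l0 := gb_lam gb.
pose L := lowest q; pose KS := \sum_i \sum_j `|ric a q i j|.
have KSle i j : `|ric a q i j| <= KS.
  rewrite /KS (bigD1 i) //= (bigD1 j) //= -addrA lerDl addr_ge0 //; first by apply: sumr_ge0.
  by apply: sumr_ge0 => k _; apply: sumr_ge0.
have KS0 : 0 <= KS by apply: le_trans (KSle 0 0).
pose C := 4 * (4 * KS) * lam^-1; have C0 : 0 <= C by rewrite !mulr_ge0 // invr_ge0 ltW.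
pose D := 2 + 4 * C + 4 * `|L|; have D0 : 0 < D by rewrite /D; have := normr_ge0 L; lra.
pose eta := Num.min 1 ((L - z) / (2 * D)).
have eta0 : 0 < eta by rewrite lt_min ltr01 divr_gt0 ?mulr_gt0 // subr_gt0.
have eta1 : eta <= 1 by rewrite ge_min lexx.
have etaD : eta * D < L - z.
  have : eta <= (L - z) / (2 * D) by rewrite ge_min lexx orbT.
  rewrite ler_pdivlMr ?mulr_gt0 // => h; have : 0 < L - z by rewrite subr_gt0.
  have : 0 < eta * D by exact: mulr_gt0.
  by move: h; rewrite mulrCA; lra.
(* Entries that differ by de change the forms on rows of E by at most 4 (4 de) / lam = eta, because
   products of norms of rows are at most 1 / lam. *)
pose de := eta * lam / 16; have de0 : 0 < de by rewrite divr_gt0 // mulr_gt0.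
have near_entries (F : 'I_4 -> 'I_4 -> V -> R) : (forall i j, smooth_on (chart_cod a) (F i j)) ->
   \forall y \near q, forall i j, `|F i j (chart a q) - F i j (chart a y)| < de.
  move=> sF; have H : \forall x \near chart a q, forall i j, `|F i j (chart a q) - F i j x| < de.
    apply: (@filter_forall _ _ (fun i x => forall j, `|F i j (chart a q) - F i j x| < de) _ (nbhs_filter _)) => i.
    apply: (@filter_forall _ _ (fun j x => `|F i j (chart a q) - F i j x| < de) _ (nbhs_filter _)) => j.
    exact: ((cvgrPdist_lt (F := nbhs (chart a q)) (FF := nbhs_filter _) _ _).1 (smooth_continuous (sF i j) Uq) _ de0).
  exact: (chart_continuous aq H).
have N1 := near_entries _ (cm_smooth cm).
have N2 := near_entries _ (smooth_ricci (cm_open cm) (cm_smooth cm) (chart_unit cm)).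
have N3 : \forall y \near q, chart_dom a y by apply: open_nbhs_nbhs; split => //; exact: chart_dom_open.
have N4 : \forall y \near q, `|chart a y - chart a q| < r.
  have ci : (fun x : V => x) @ nbhs (chart a q) --> chart a q by exact: cvg_id.
  exact: (chart_continuous aq ((cvgrPdistC_lt (F := nbhs (chart a q)) (FF := nbhs_filter _) _ _).1 ci _ r0)).
have fI (P Q : set M) : nbhs q P -> nbhs q Q -> nbhs q (P `&` Q) by move=> ? ?; exact: filterI.
have NN := fI _ _ (fI _ _ N1 N2) (fI _ _ N3 N4).
apply: filterS NN => y [[h1 h2] [ay yr]].
have [[E [d [EE ES ds dE]]] _] := lowestP ay; have [_ HL] := lowestP aq.
have {}HL := HL (row (inord 0) E) (row (inord 1) E); rewrite /pair_area /pair_form in HL.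
have rE i : `|row i E| ^+ 2 <= lam^-1.
  rewrite -[lam^-1]div1r ler_pdivlMr // mulrC; apply: le_trans (gb_low gb _ yr) _.
  by rewrite -bil_rowE EE mxE eqxx.
have rEE i j : `|row i E| * `|row j E| <= lam^-1.
  have := sqr_ge0 (`|row i E| - `|row j E|); have := rE i; have := rE j.
  by move: (`|row i E|) (`|row j E|) => x' y'; lra.
have small (B B' : 'M[R]_4) i j : (forall i j, `|B i j - B' i j| < de) ->
  `|bil B (row i E) (row j E) - bil B' (row i E) (row j E)| <= eta.
  move=> hB; rewrite -bil_mxB; apply: le_trans (bil_norm_le (K := de) _ _ _) _.
    by move=> k l; rewrite !mxE ltW.
  rewrite -mulrA; apply: le_trans (_ : 4 * (4 * de) * lam^-1 <= _).
    by rewrite ler_wpM2l // !mulr_ge0 // ltW.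
  by rewrite /de le_eqVlt; apply/orP; left; apply/eqP; field; rewrite gt_eqF.
have bound i j : `|bil (ric a q) (row i E) (row j E)| <= C.
  apply: le_trans (bil_norm_le (K := KS) _ _ KSle) _.
  by rewrite -mulrA ler_wpM2l // !mulr_ge0.
have dk k : bil (ric a y) (row k E) (row k E) = d 0 k by rewrite -bil_rowE ES mxE eqxx.
have g1 k : bil (met a y) (row k E) (row k E) = 1 by rewrite -bil_rowE EE mxE eqxx.
have g0 : bil (met a y) (row (inord 0) E) (row (inord 1) E) = 0.
  rewrite -bil_rowE EE mxE; have -> // : (inord 0 == inord 1 :> 'I_4) = false by rewrite -val_eqE /= !inordK.
have B1 k : `|bil (met a q) (row k E) (row k E) - 1| <= eta by rewrite -(g1 k); exact: small h1.
have B2 : `|bil (met a q) (row (inord 0) E) (row (inord 1) E)| <= eta.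
  by rewrite -[bil _ _ _]subr0 -g0; exact: small h1.
have B3 k : `|bil (ric a q) (row k E) (row k E) - d 0 k| <= eta by rewrite -(dk k); exact: small h2.
have := lower_estimate C0 (ltW eta0) eta1 (B3 _) (B3 _) (bound _ _) (bound _ _) (bound _ _) (B1 _) (B1 _) B2 HL.
by rewrite dE -/L -/D; move: etaD; rewrite -/L; move: (eta * D) => w; lra.
Qed.

End LowestRicci.

(** * The elliptic equation in an orthonormal frame *)

Section FrameLaplacian.
Context {R : realType} {n : nat}.
Local Notation V := 'rV[R]_n.+1.
Variables (U : set V) (g : V -> 'M[R]_n.+1) (f : V -> R) (x : V) (E : 'M[R]_n.+1).
Hypothesis cm : chart_metric U g.
Hypothesis fs : smooth_on U f.
Hypothesis Ux : U x.
Hypothesis EE : E *m g x *m E^T = 1%:M.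
Implicit Types (v w : V).

Local Notation hess_fun := (fun (i j : 'I_n.+1) (y : V) => hessian g f y i j).

Lemma sum_inverse_frame (C : 'I_n.+1 -> 'I_n.+1 -> R) :
  \sum_k \sum_m invmx (g x) k m * C k m = \sum_p \sum_k \sum_m E p k * E p m * C k m.
Proof.
have G := frame_inverse cm Ux EE.
rewrite [RHS]exchange_big; apply: eq_bigr => k _ /=; rewrite [RHS]exchange_big; apply: eq_bigr => m _ /=.
rewrite -G mxE big_distrl; apply: eq_bigr => p _ /=; by rewrite mxE.
Qed.

Lemma bil_hess_rm (H : 'M[R]_n.+1) v w u u' :
  bil H v w * rm g x v u w u' = \sum_j \sum_l u 0 j * u' 0 l *
    \sum_k \sum_i v 0 k * v 0 i * (\sum_m \sum_a w 0 m * w 0 a * (H i a * riemann g k j m l x)).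
Proof.
transitivity (\sum_j \sum_l u 0 j * u' 0 l * (bil H v w * \sum_k \sum_m v 0 k * w 0 m * riemann g k j m l x)).
  have -> : rm g x v u w u' = \sum_j \sum_l u 0 j * u' 0 l * (\sum_k \sum_m v 0 k * w 0 m * riemann g k j m l x).
    rewrite /rm exchange_big; apply: eq_bigr => j _ /=.
    under eq_bigr => k _ do rewrite exchange_big /=.
    rewrite exchange_big; apply: eq_bigr => l _ /=; rewrite big_distrr; apply: eq_bigr => k _ /=.
    rewrite big_distrr; apply: eq_bigr => m _ /=; by move: (riemann _ _ _ _ _ _) => z; ring.
  rewrite big_distrr; apply: eq_bigr => j _ /=; rewrite big_distrr; apply: eq_bigr => l _ /=.
  by rewrite mulrCA.
apply: eq_bigr => j _; apply: eq_bigr => l _; congr (_ * _).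
rewrite bilE big_distrlr /= exchange_big; apply: eq_bigr => k _ /=; apply: eq_bigr => i _.
rewrite big_distrlr /= exchange_big [RHS]big_distrr; apply: eq_bigr => m _ /=; rewrite [RHS]big_distrr; apply: eq_bigr => a _ /=.
by move: (riemann _ _ _ _ _ _) => z; ring.
Qed.

(** The traces in [hessian_laplacian_at] are taken in the frame E, where the second term will be
    diagonal. *)
Lemma frame_laplacian v : (forall y, U y -> ricci g y + hessian g f y = 0) ->
  \sum_k bil (cov2_along g hess_fun x (row k E) (row k E)) v v =
  \sum_k (\sum_i E k i * partial i f x) * bil (cov_along g hess_fun x (row k E)) v v
  - 2 * \sum_k \sum_l bil (hessian g f x) (row k E) (row l E) * rm g x (row k E) v (row l E) v.
Proof.
move=> sol; have L j l := hessian_laplacian_at (cm_open cm) (cm_smooth cm) (cm_sym cm) (chart_unit cm) fs Ux sol j l.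
have L' j l : v 0 j * v 0 l * (\sum_k \sum_i invmx (g x) k i * cov_deriv3 g (cov_deriv2 g hess_fun) k i j l x) =
  v 0 j * v 0 l * (\sum_m \sum_a invmx (g x) m a * (partial a f x * cov_deriv2 g hess_fun m j l x))
  - 2 * (v 0 j * v 0 l * \sum_k \sum_i invmx (g x) k i * \sum_m \sum_a invmx (g x) m a *
     (hessian g f x i a * riemann g k j m l x)).
  by rewrite L; move: (\sum_k _) (\sum_k _) (v 0 j) (v 0 l) => y z p q; ring.
transitivity (\sum_j \sum_l v 0 j * v 0 l * (\sum_k \sum_i invmx (g x) k i * cov_deriv3 g (cov_deriv2 g hess_fun) k i j l x)).
  under [RHS]eq_bigr => j _ do under eq_bigr => l _ do rewrite sum_inverse_frame big_distrr /=.
  under [RHS]eq_bigr => j _ do rewrite exchange_big /=.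
  rewrite [RHS]exchange_big /=; apply: eq_bigr => p _; rewrite bilE; apply: eq_bigr => j _; apply: eq_bigr => l _.
  congr (_ * _); rewrite mxE; apply: eq_bigr => k _; apply: eq_bigr => m _; by rewrite !mxE.
under eq_bigr => j _ do under eq_bigr => l _ do rewrite L'.
under eq_bigr => j _ do rewrite sumrB; rewrite sumrB; congr (_ - _).
  under eq_bigr => j _ do under eq_bigr => l _ do rewrite sum_inverse_frame big_distrr /=.
  under eq_bigr => j _ do rewrite exchange_big /=.
  rewrite exchange_big /=; apply: eq_bigr => p _; rewrite bilE big_distrr; apply: eq_bigr => j _ /=.
  rewrite big_distrr; apply: eq_bigr => l _ /=; rewrite [RHS]mulrCA; congr (_ * _).
  rewrite mxE big_distrlr /= exchange_big; apply: eq_bigr => i _ /=; apply: eq_bigr => m _ /=.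
  rewrite mxE; move: (partial _ _ _) (cov_deriv2 _ _ _ _ _ _) => y z; by ring.
under eq_bigr => j _ do rewrite -mulr_sumr; rewrite -mulr_sumr; congr (_ * _).
transitivity (\sum_j \sum_l v 0 j * v 0 l * \sum_p \sum_q \sum_k \sum_i E p k * E p i *
   \sum_m \sum_a E q m * E q a * (hessian g f x i a * riemann g k j m l x)).
  apply: eq_bigr => j _; apply: eq_bigr => l _; congr (_ * _).
  rewrite sum_inverse_frame; apply: eq_bigr => p _.
  rewrite [RHS]exchange_big; apply: eq_bigr => k _ /=; rewrite [RHS]exchange_big; apply: eq_bigr => i _ /=.
  by rewrite -big_distrr /= sum_inverse_frame.
under eq_bigr => j _ do under eq_bigr => l _ do rewrite big_distrr /=.
under eq_bigr => j _ do rewrite exchange_big /=.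
rewrite exchange_big; apply: eq_bigr => p _ /=.
under eq_bigr => j _ do under eq_bigr => l _ do rewrite big_distrr /=.
under eq_bigr => j _ do rewrite exchange_big /=.
rewrite exchange_big; apply: eq_bigr => q _ /=; rewrite bil_hess_rm.
apply: eq_bigr => j _; apply: eq_bigr => l _; congr (_ * _); apply: eq_bigr => k _; apply: eq_bigr => i _.
by rewrite !mxE; congr (_ * _); apply: eq_bigr => m _; apply: eq_bigr => a _; rewrite !mxE.
Qed.

Lemma frame_expansion v : v = \sum_k bil (g x) (row k E) v *: row k E.
Proof.
have G := frame_inverse cm Ux EE; have gs := cm_sym cm Ux.
have -> : \sum_k bil (g x) (row k E) v *: row k E = (v *m g x *m E^T) *m E.
  apply/rowP => j; rewrite summxE mxE; apply: eq_bigr => k _; rewrite (chart_bilC cm _ _ Ux) !mxE; congr (_ * _).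
  rewrite /bil mxE; apply: eq_bigr => i _; by rewrite !mxE.
by rewrite -mulmxA G mulmxK // (chart_unit cm).
Qed.

Lemma frame_parseval v : \sum_k bil (g x) (row k E) v ^+ 2 = bil (g x) v v.
Proof.
have sumE (c : 'I_n.+1 -> R) (u : V) : bil (g x) u (\sum_k c k *: row k E) = \sum_k c k * bil (g x) u (row k E).
  by rewrite /bil linear_sum mulmx_sumr summxE /=; apply: eq_bigr => k _; rewrite linearZ /= -scalemxAr mxE.
have := congr1 (bil (g x) v) (frame_expansion v); rewrite sumE => ->.
by apply: eq_bigr => k _; rewrite (chart_bilC cm v _ Ux) expr2.
Qed.

Lemma frame_differential v : \sum_k (\sum_i E k i * partial i f x) * bil (g x) (row k E) v = \sum_i v 0 i * partial i f x.
Proof.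
rewrite {2}[v]frame_expansion; under [RHS]eq_bigr => i _ do rewrite summxE big_distrl /=.
rewrite [RHS]exchange_big; apply: eq_bigr => k _ /=; rewrite big_distrl; apply: eq_bigr => i _ /=.
by rewrite !mxE; move: (partial _ _ _) (bil _ _ _) => y z; ring.
Qed.

End FrameLaplacian.

(** * First and second derivative tests at the maximum *)

Section MaxTest.
Context {R : realType}.

(** If L is negative, - L r^2 <= - L r'^2 <= u, so a lower bound r for the cut-off is enough;
    otherwise both terms are nonnegative. *)
Lemma barrier_nonneg (L J Q u r r' : R) : L * J <= Q -> 0 <= J -> 0 <= r -> r <= r' -> 0 <= u ->
  - L * r' ^+ 2 <= u -> 0 <= u * J + Q * r ^+ 2.
Proof.
move=> LQ J0 r0 rr u0 H; have r2 : r ^+ 2 <= r' ^+ 2 by rewrite lerXn2r // nnegrE // (le_trans r0).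
have q0 := sqr_ge0 r; have h1 : L * J * r ^+ 2 <= Q * r ^+ 2 by rewrite ler_wpM2r.
have [L0|L0] := leP 0 L.
  have h2 : 0 <= L * J * r ^+ 2 by rewrite !mulr_ge0.
  have h3 : 0 <= u * J by rewrite mulr_ge0.
  by move: (Q * _) (L * J * _) h1 h2 => *; lra.
have h4 : - L * r ^+ 2 <= u by apply: le_trans H; rewrite ler_wpM2l // oppr_ge0 ltW.
have h5 : - L * r ^+ 2 * J <= u * J by rewrite ler_wpM2r.
by move: h1 h5; rewrite [L * J * _]mulrAC mulNr mulNr; move: (Q * _) (L * _ * J) (u * J) => *; lra.
Qed.

(** The function in the last hypothesis vanishes at 0, so its first derivative is 0 and its second
    is nonnegative. The resulting bounds are the derivatives at 0 of u s^2 / r^2 for r = s - 2 k e -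
    B e^2: first 4 u k / s, then u (24 k^2 + 4 s B) / s^2. *)
Lemma pair_jet (h1 h2 h12 g1 g2 g12 r : R -> R) (a1 b1 c1 a2 b2 c2 b12 c12 u s k B : R) :
  jet2 h1 a1 b1 c1 -> jet2 h2 a2 b2 c2 -> jet2 h12 0 b12 c12 ->
  jet2 g1 1 0 0 -> jet2 g2 1 0 0 -> jet2 g12 0 0 0 -> jet2 r s (- 2 * k) (- 2 * B) ->
  0 < s -> a1 + a2 = u ->
  (\forall e \near (0 : R), 0 <= u * s ^+ 2 * (g1 e * g2 e - g12 e * g12 e)
     + (- (h1 e * g2 e) + - (h2 e * g1 e) + 2 * (h12 e * g12 e)) * (r e * r e)) ->
  b1 + b2 = 4 * u * k / s /\ (c1 + c2) * s ^+ 2 <= u * (24 * k ^+ 2 + 4 * s * B).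
Proof.
move=> H1 H2 H12 G1 G2 G12 Hr s0 uE N.
have N1 (F : R -> R) a b c : jet2 F a b c -> jet2 (fun e => - F e) (- a) (- b) (- c).
  move=> HF; have := jet2Z (-1) HF; rewrite !mulN1r; by rewrite (_ : (fun e => -1 * F e) = fun e => - F e) //; apply/funext => e; rewrite mulN1r.
have JJ := jet2Z (u * s ^+ 2) (jet2D (jet2M G1 G2) (N1 _ _ _ _ (jet2M G12 G12))).
have QQ := jet2D (jet2D (N1 _ _ _ _ (jet2M H1 G2)) (N1 _ _ _ _ (jet2M H2 G1))) (jet2Z 2 (jet2M H12 G12)).
have FF := jet2D JJ (jet2M QQ (jet2M Hr Hr)).
have Z : jet2 (fun e => u * s ^+ 2 * (g1 e * g2 e - g12 e * g12 e)
     + (- (h1 e * g2 e) + - (h2 e * g1 e) + 2 * (h12 e * g12 e)) * (r e * r e)) 0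
     (- (b1 + b2) * s ^+ 2 + 4 * u * k * s) (- (c1 + c2) * s ^+ 2 + 8 * (b1 + b2) * s * k - u * (8 * k ^+ 2 - 4 * s * B)).
  by apply: (jet2_eq FF); rewrite -uE; ring.
have [e1 e2] := jet2_min Z N; have sn : s != 0 by rewrite gt_eqF.
have bE : b1 + b2 = 4 * u * k / s.
  apply: (mulIf (mulf_neq0 sn sn)); move: e1; rewrite mulNr addrC => /eqP; rewrite subr_eq0 => /eqP.
  rewrite expr2 => <-; by field.
split=> //; move: e2; rewrite bE; have -> : 8 * (4 * u * k / s) * s * k = 32 * u * k ^+ 2 by field.
by move: (c1 + c2) => C e3; lra.
Qed.

End MaxTest.

(** * The maximum principle *)

Section MaximumPrinciple.
Context {R : realType} {M : topologicalType}.
Local Notation V := 'rV[R]_4.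
Variables (A : smooth_atlas R 3 M) (g : riemannian_metric A) (f : M -> R).
Hypothesis Mh : hausdorff_space M.
Hypothesis gcomp : complete_metric g.
Hypothesis fs : smooth_function A f.
Hypothesis sol : forall (a : chart_index A) x, chart_cod a x ->
  ricci (metric g a) x + hessian (metric g a) (f \o chart_inv a) x = 0.
Hypothesis nrm : normalized_soliton g f.
Hypothesis nic : nonneg_isotropic_curvature g.
Implicit Types (a b : chart_index A) (p q : M) (c : R -> M) (v w : V).

Local Notation met a q := (metric g a (chart a q)).
Local Notation ric a q := (ricci (metric g a) (chart a q)).
Local Notation hess_fun b := (fun (i j : 'I_4) (y : V) => hessian (metric g b) (f \o chart_inv b) y i j).
Local Notation met_fun b := (fun (i j : 'I_4) (y : V) => metric g b y i j).

Lemma scalar_curvature_ge0 a x : chart_cod a x -> 0 <= scalar_curvature (metric g a) x.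
Proof.
move=> Ux; have cm := chart_cm g a; have [E EE] := orthonormal_frame_exists (cm_sym cm Ux) (cm_pos cm Ux).
by have [] := isotropic_frame cm Ux (fun E => nic Ux) EE.
Qed.

Lemma grad_norm_ge0 a x : chart_cod a x -> 0 <= grad_norm_sq (metric g a) (f \o chart_inv a) x.
Proof.
move=> Ux; have cm := chart_cm g a; have [E EE] := orthonormal_frame_exists (cm_sym cm Ux) (cm_pos cm Ux).
pose F k m : R := partial k (f \o chart_inv a) x * partial m (f \o chart_inv a) x.
have -> : grad_norm_sq (metric g a) (f \o chart_inv a) x = \sum_k \sum_m invmx (metric g a x) k m * F k m.
  by apply: eq_bigr => k _; apply: eq_bigr => m _; rewrite mulrA.
rewrite (sum_inverse_frame cm Ux EE); apply: sumr_ge0 => r _.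
have -> : \sum_k \sum_m E r k * E r m * F k m = (\sum_k E r k * partial k (f \o chart_inv a) x) ^+ 2.
  rewrite expr2 big_distrlr /=; apply: eq_bigr => k _; apply: eq_bigr => m _.
  by rewrite /F; move: (partial _ _ _) (partial _ _ _) => y z; ring.
exact: sqr_ge0.
Qed.

Lemma lowest_reaction b q E (d : V) : chart_dom b q -> E *m met b q *m E^T = 1%:M -> E *m ric b q *m E^T = diag_mx d ->
  d 0 (inord 0) + d 0 (inord 1) <= 0 ->
  (d 0 (inord 0) + d 0 (inord 1)) ^+ 2 / 2 <=
  \sum_k d 0 k * (rm (metric g b) (chart b q) (row k E) (row (inord 0) E) (row k E) (row (inord 0) E)
                + rm (metric g b) (chart b q) (row k E) (row (inord 1) E) (row k E) (row (inord 1) E)).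
Proof.
move=> bq EE ES d0; have cm := chart_cm g b; have Uq := chart_codI bq.
have [R0 K0] := isotropic_frame cm Uq (fun E => nic Uq) EE.
rewrite (scalar_frame cm Uq EE) in R0.
have dE k : ricci_frame (metric g b) (chart b q) E k k = d 0 k by rewrite /ricci_frame ES mxE eqxx.
have := ricci_reaction cm Uq EE (erefl _); rewrite !dE => /(_ d0 R0 K0) H; apply: le_trans H _.
rewrite le_eqVlt; apply/orP; left; apply/eqP; apply: eq_bigr => k _.
by rewrite dE !riemann_frame_rm.
Qed.

Let slope := potential_slope f.

(** The derivative of 4 s + s^2 (slope + l) is 4 + s^2 slope' + 2 s (slope + l). The shift by l
    makes the last term nonnegative, and dropping it integrates the curvature term by parts. *)
Lemma variation_weight (c : R -> M) (l t eta : R) : geodesic g c -> (forall s, 0 <= slope c s + l) ->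
  0 <= t <= 1 -> 0 < eta -> exists2 de : R, 0 < de & forall s1 s2, 0 <= s1 -> s1 < s2 -> s2 <= 1 ->
  `|s1 - t| < de -> `|s2 - t| < de ->
  (s2 - s1) * (4 + s2 ^+ 2 * derive1 (slope c) s2) <=
  (4 * s2 + s2 ^+ 2 * (slope c s2 + l)) - (4 * s1 + s1 ^+ 2 * (slope c s1 + l)) + eta * (s2 - s1).
Proof.
move=> gc pos t01 eta0; have [de de0 H] := slope_increment fs sol t gc eta0; exists de => // s1 s2 s10 s12 s21 h1 h2.
have := H s1 s2 s12 h1 h2; have := pos s1; rewrite -/slope.
move: (derive1 _ _) (slope c s1) (slope c s2) => D p1 p2 P1 HD.
have s20 : 0 <= s2 by rewrite (le_trans s10) // ltW.
have q1 : 0 <= (s2 - s1) * (s2 + s1) * (p1 + l).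
  by rewrite !mulr_ge0 // ?subr_ge0 ?(ltW s12) // addr_ge0.
have q2 : s2 ^+ 2 * ((s2 - s1) * (D - eta)) <= s2 ^+ 2 * (p2 - p1) by rewrite ler_wpM2l // sqr_ge0.
have q3 : s2 ^+ 2 * (eta * (s2 - s1)) <= 1 * (eta * (s2 - s1)).
  rewrite ler_wpM2r ?mulr_ge0 ?subr_ge0 ?(ltW s12) ?(ltW eta0) //.
  by rewrite expr_le1.
lra.
Qed.

Lemma tensor_hess b x : tensor_mx (hess_fun b) x = hessian (metric g b) (f \o chart_inv b) x.
Proof. by apply/matrixP => i j; rewrite mxE. Qed.

Lemma tensor_met b x : tensor_mx (met_fun b) x = metric g b x.
Proof. by apply/matrixP => i j; rewrite mxE. Qed.

Lemma bil_hess b x v w : chart_cod b x -> bil (tensor_mx (hess_fun b) x) v w = - bil (ricci (metric g b) x) v w.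
Proof.
move=> Ux; rewrite tensor_hess; have /eqP := sol Ux; rewrite addr_eq0 => /eqP ->.
by rewrite -[X in - bil X _ _]scaleN1r bil_mxZ mulN1r opprK.
Qed.

Section MaxPoint.
Variables (a : chart_index A) (p : M) (v : V) (rho2 : R).
Hypothesis ap : chart_dom a p.
Let l2 := bil (met a p) v v.
Let ga := geo gcomp a p v.
Let q := ga 1.
Let u := - lowest g q.
Let s := rho2 - l2.
Hypothesis s0 : 0 < s.
Hypothesis u0 : 0 < u.
Hypothesis max : forall w, bil (met a p) w w <= rho2 ->
  - lowest g (geo gcomp a p w 1) * (rho2 - bil (met a p) w w) ^+ 2 <= u * s ^+ 2.

Let gga : geodesic g ga. Proof. by have [] := geoP gcomp v ap. Qed.
Let ga0 : ga 0 = p. Proof. by have [] := geoP gcomp v ap. Qed.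

(* The broken path of squared length at most [L ^+ 2] from p is replaced by a tangent vector at p. *)
Lemma competitor_bound (c : R -> M) (kap B ep : R) L : reach g p (c ep) L ->
  L ^+ 2 <= l2 + 2 * ep * kap + ep ^+ 2 * B -> 0 <= s - 2 * ep * kap - ep ^+ 2 * B ->
  exists2 r' : R, s - 2 * ep * kap - ep ^+ 2 * B <= r' & - lowest g (c ep) * r' ^+ 2 <= u * s ^+ 2.
Proof.
move=> rL LL r0; have /(leg_geo Mh gcomp _ _ ap)[L0 [w wL wE]] := hopf_rinow Mh gcomp ap rL.
have H : bil (met a p) w w <= l2 + 2 * ep * kap + ep ^+ 2 * B by exact: le_trans LL.
exists (rho2 - bil (met a p) w w); first by move: H; rewrite /s; lra.
rewrite -wE; apply: max; apply: le_trans H _; move: r0; rewrite /s; lra.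
Qed.

(** Maximality of v gives lowest >= - u s^2 / r^2 along sg, and the value of Rc on the pair (X, Y),
    divided by the area, is at least lowest, with equality at 0. So the smooth function tested by
    [pair_jet] is nonnegative and vanishes at 0. *)
Lemma barrier_jets b E (d : V) (B kap ep0 : R) k (sg : R -> M) :
  chart_dom b q -> E *m met b q *m E^T = 1%:M -> E *m ric b q *m E^T = diag_mx d ->
  d 0 (inord 0) + d 0 (inord 1) = lowest g q ->
  geodesic g sg -> sg 0 = q -> vel b sg 0 = row k E -> 0 < ep0 ->
  (forall ep, `|ep| < ep0 -> exists L, reach g p (sg ep) L /\ L ^+ 2 <= l2 + 2 * ep * kap + ep ^+ 2 * B) ->
  let hh i := bil (cov_along (metric g b) (hess_fun b) (chart b q) (row k E)) (row i E) (row i E) in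
  let hh2 i := bil (cov2_along (metric g b) (hess_fun b) (chart b q) (row k E) (row k E)) (row i E) (row i E) in
  hh (inord 0) + hh (inord 1) = 4 * u * kap / s /\
  (hh2 (inord 0) + hh2 (inord 1)) * s ^+ 2 <= u * (24 * kap ^+ 2 + 4 * s * B).
Proof.
move=> bq EE ES dE gs sg0 vs ep00 Hc hh hh2; have cm := chart_cm g b; have Uq := chart_codI bq.
have bs : chart_dom b (sg 0) by rewrite sg0.
pose c := chart b \o sg; pose P := vel b sg.
have c0 : c 0 = chart b q by rewrite /c /= sg0.
have U0 : chart_cod b (c 0) by rewrite c0.
have NC : \forall e \near (0 : R), chart_cod b (c e) /\ chart_geodesic (metric g b) c P e.
  apply: filterS (near_dom (geodesic_cts gs) bs) => e he; split; [exact: chart_codI|exact: geodesic_chart].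
have [X [dX HX]] := second_parallel_exists cm (row (inord 0) E) U0 (geodesic_chart gs bs).
have [Y [dY HY]] := second_parallel_exists cm (row (inord 1) E) U0 (geodesic_chart gs bs).
have sh : forall i j, smooth_on (chart_cod b) (hess_fun b i j).
  exact: (smooth_hessian (cm_open cm) (cm_smooth cm) (chart_unit cm) (@fs b)).
have hJ Z dZ Z' dZ' e e' := @tensor_jet _ _ _ _ cm (hess_fun b) c P Z dZ Z' dZ' e e' sh NC.
have gJ Z dZ Z' dZ' e e' := @tensor_jet _ _ _ _ cm (met_fun b) c P Z dZ Z' dZ' e e' (cm_smooth cm) NC.
have H1 := hJ _ _ _ _ _ _ HX HX; have H2 := hJ _ _ _ _ _ _ HY HY; have H12 := hJ _ _ _ _ _ _ HX HY.
have G1 := gJ _ _ _ _ _ _ HX HX; have G2 := gJ _ _ _ _ _ _ HY HY; have G12 := gJ _ _ _ _ _ _ HX HY.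
rewrite c0 /P vs in H1 H2 H12 G1 G2 G12.
have z0 (y y' : V) : bil (0 : 'M[R]_4) y y' = 0 by rewrite /bil mulmx0 mul0mx mxE.
have n01 : (inord 0 == inord 1 :> 'I_4) = false by rewrite -val_eqE /= !inordK.
have hii i : bil (tensor_mx (hess_fun b) (chart b q)) (row i E) (row i E) = - d 0 i.
  by rewrite (bil_hess _ _ Uq) -bil_rowE ES mxE eqxx.
have h01 : bil (tensor_mx (hess_fun b) (chart b q)) (row (inord 0) E) (row (inord 1) E) = 0.
  by rewrite (bil_hess _ _ Uq) -bil_rowE ES mxE n01 oppr0.
have gii i : bil (metric g b (chart b q)) (row i E) (row i E) = 1 by rewrite -bil_rowE EE mxE eqxx.
have g01 : bil (metric g b (chart b q)) (row (inord 0) E) (row (inord 1) E) = 0 by rewrite -bil_rowE EE mxE n01.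
rewrite (hii (inord 0)) in H1; rewrite (hii (inord 1)) in H2; rewrite h01 in H12.
rewrite (cov_along_metric cm _ Uq) (cov2_along_metric cm _ _ Uq) !z0 tensor_met in G1 G2 G12.
rewrite (gii (inord 0)) in G1; rewrite (gii (inord 1)) in G2; rewrite g01 in G12.
have Hr : jet2 (fun e => s + e * (- 2 * kap) + e ^+ 2 * (- B)) s (- 2 * kap) (- 2 * B).
  by apply: (jet2_eq (jet2_poly _ _ _)) => //; ring.
have uE : - d 0 (inord 0) + - d 0 (inord 1) = u by rewrite /u -dE opprD.
apply: (pair_jet H1 H2 H12 G1 G2 G12 Hr s0 uE).
have N3 : \forall e \near (0 : R), `|e| < ep0.
  have := near_dist_R (0 : R) ep00; apply: filterS => e; by rewrite sub0r normrN.
have N4 : \forall e \near (0 : R), 0 < s + e * (- 2 * kap) + e ^+ 2 * (- B).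
  have [fr0 [r1 [D1 _ _]]] := Hr; have C := is_derive_cts (nbhs_singleton D1).
  have f00 : 0 < s + 0 * (- 2 * kap) + 0 ^+ 2 * (- B) by rewrite fr0.
  have [r r0 hr] := near_sign C f00.
  have := near_dist_R (0 : R) r0; apply: filterS => e; rewrite sub0r normrN; exact: hr.
have NB := near_dom (geodesic_cts gs) bs.
apply: filterS3 NB N3 N4 => e be e1 e2; have Ue : chart_cod b (c e) by exact: chart_codI.
have [L [rL LL]] := Hc e e1.
have rE : s + e * (- 2 * kap) + e ^+ 2 * (- B) = s - 2 * e * kap - e ^+ 2 * B by ring.
rewrite rE in e2 *; have [r' rr' Hr'] := competitor_bound rL LL (ltW e2).
have [_ LJ] := lowestP gcomp fs sol be; have {}LJ := LJ (X e) (Y e).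
rewrite -[chart b (sg e)]/(c e) in LJ.
rewrite !(bil_hess _ _ Ue) !tensor_met.
have J0 : 0 <= pair_area (metric g b (c e)) (X e) (Y e).
  rewrite /pair_area subr_ge0; apply: bil_CS; first exact: (cm_sym cm Ue).
  by move=> w; exact: (chart_bil_ge0 cm _ Ue).
have us0 : 0 <= u * s ^+ 2 by rewrite mulr_ge0 ?sqr_ge0 ?(ltW u0).
have := barrier_nonneg LJ J0 (ltW e2) rr' us0 Hr'; rewrite /pair_area /pair_form.
move: (bil (ricci _ _) (X e) (X e)) (bil (ricci _ _) (Y e) (Y e)) (bil (ricci _ _) (X e) (Y e)) => y1 y2 y3.
move: (bil _ (X e) (X e)) (bil _ (Y e) (Y e)) (bil _ (X e) (Y e)) => y4 y5 y6.
have fin (us r w1 w2 w3 w4 w5 w6 : R) : 0 <= us * (w4 * w5 - w6 ^+ 2) + (w1 * w5 + w2 * w4 - 2 * w3 * w6) * r ^+ 2 ->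
  0 <= us * (w4 * w5 - w6 * w6) + (- (- w1 * w5) + - (- w2 * w4) + 2 * (- w3 * w6)) * (r * r) by lra.
exact: fin.
Qed.

(** The derivatives from [barrier_jets], summed over the frame, enter the elliptic equation: the
    first derivatives give the drift term, the second ones bound the Laplacian from above, and the
    reaction bounds it from below. *)
Lemma max_point_bound (l : R) : 0 <= l -> l ^+ 2 = l2 -> u * s ^+ 2 <= 24 * l2 + 4 * s * (5 + l).
Proof.
move=> l0 lE; have [b bq] := chart_cover A q; have cm := chart_cm g b; have Uq := chart_codI bq.
have [[E [d [EE ES ds dE]]] _] := lowestP gcomp fs sol bq.
have sga : has_speed2 g ga l2 by exact: (@geo_speed2 _ _ _ _ g gcomp a p v ap).
have sl t : - l <= slope ga t /\ slope ga t <= l.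
  have [a' at'] := chart_cover A (ga t); have Ut := chart_codI at'.
  have G1 : grad_norm_sq (metric g a') (f \o chart_inv a') (chart a' (ga t)) <= 1.
    by have := nrm Ut; have := scalar_curvature_ge0 Ut; lra.
  have := slope_le fs gga sga at' G1; rewrite -lE -/slope => H.
  have := ler_sqrt; have : `|slope ga t| <= `|l| by rewrite -ler_sqr ?nnegrE // !real_normK ?num_real.
  by rewrite (ger0_norm l0) ler_norml => /andP[].
have pos t : 0 <= slope ga t + l by have [] := sl t; lra.
pose Hf t := 4 * t + t ^+ 2 * (slope ga t + l).
have rhoE a' t : chart_dom a' (ga t) -> derive1 (slope ga) t =
   - bil (ricci (metric g a') (chart a' (ga t))) (vel a' ga t) (vel a' ga t).
  by move=> at'; rewrite derive1E; have [_ ->] := is_derive_slope fs sol gga at'.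
have l20 : 0 <= l2 by rewrite -lE sqr_ge0.
have HfP t eta : 0 <= t <= 1 -> 0 < eta -> exists2 de : R, 0 < de &
  forall s1 s2, 0 <= s1 -> s1 < s2 -> s2 <= 1 -> `|s1 - t| < de -> `|s2 - t| < de ->
  (s2 - s1) * (4%:R + s2 ^+ 2 * derive1 (slope ga) s2) <= Hf s2 - Hf s1 + eta * (s2 - s1).
  exact: variation_weight.
have fr := geodesic_frameP gcomp bq EE; pose sg k := geo gcomp b q (row k E).
(* Taking eta = 1 here adds 1 to the increment 4 + slope + l of [Hf]; hence the 5 + l in the
   conclusion. *)
have [B [sumB [ep0 ep00 HB]]] := second_variation Mh gcomp gga sga rhoE l20 HfP ltr01 fr.
have gsg k : [/\ geodesic g (sg k), sg k 0 = q & vel b (sg k) 0 = row k E] := geoP gcomp (row k E) bq.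
pose kap k := ip g (sg k) 0 ga 1.
have kE k : kap k = bil (met b q) (row k E) (vel b ga 1).
  have [g1 e1 v1] := gsg k; have bs : chart_dom b (sg k 0) by rewrite e1.
  by rewrite /kap (ipE g1 gga e1 bs) v1 e1.
pose hh k i := bil (cov_along (metric g b) (hess_fun b) (chart b q) (row k E)) (row i E) (row i E).
pose hh2 k i := bil (cov2_along (metric g b) (hess_fun b) (chart b q) (row k E) (row k E)) (row i E) (row i E).
have J k : hh k (inord 0) + hh k (inord 1) = 4 * u * kap k / s /\
  (hh2 k (inord 0) + hh2 k (inord 1)) * s ^+ 2 <= u * (24 * kap k ^+ 2 + 4 * s * B k).
  have [g1 e1 v1] := gsg k; apply: (barrier_jets bq EE ES dE g1 e1 v1 ep00) => ep he.
  by have := HB k ep he; rewrite ga0.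
pose df k := \sum_i E k i * partial i (f \o chart_inv b) (chart b q).
pose rr k i := rm (metric g b) (chart b q) (row k E) (row i E) (row k E) (row i E).
have lap i : \sum_k hh2 k i = \sum_k df k * hh k i + 2 * \sum_k d 0 k * rr k i.
  have := frame_laplacian cm (@fs b) Uq EE (row i E) (sol (a := b)); rewrite -/df => ->.
  have -> : \sum_k \sum_l bil (hessian (metric g b) (f \o chart_inv b) (chart b q)) (row k E) (row l E)
      * rm (metric g b) (chart b q) (row k E) (row i E) (row l E) (row i E) = - \sum_k d 0 k * rr k i.
    rewrite -sumrN; apply: eq_bigr => k _; rewrite (bigD1 k) //= big1 ?addr0 => [|j jk].
      by rewrite -tensor_hess (bil_hess _ _ Uq) -bil_rowE ES mxE eqxx mulr1n mulNr.
    by rewrite -tensor_hess (bil_hess _ _ Uq) -bil_rowE ES mxE eq_sym (negbTE jk) mulr0n oppr0 mul0r.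
  by rewrite mulrN opprK.
have k2 : \sum_k kap k ^+ 2 = l2.
  under eq_bigr => k _ do rewrite kE.
  by rewrite (frame_parseval cm Uq EE); exact: (sga b 1 bq).
have kdf : \sum_k df k * kap k = slope ga 1.
  under eq_bigr => k _ do rewrite kE.
  by rewrite /df (frame_differential _ cm Uq EE) /slope (potential_slopeE fs gga bq).
have dneg : d 0 (inord 0) + d 0 (inord 1) = - u by rewrite dE /u opprK.
have rea : u ^+ 2 / 2 <= \sum_k d 0 k * (rr k (inord 0) + rr k (inord 1)).
  by have := lowest_reaction bq EE ES ltac:(by rewrite dneg oppr_le0 ltW); rewrite dneg sqrrN.
have S2 : \sum_k (hh2 k (inord 0) + hh2 k (inord 1)) = 4 * u / s * slope ga 1 + 2 * \sum_k d 0 k * (rr k (inord 0) + rr k (inord 1)).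
  rewrite big_split /= !lap -kdf; have sn : s != 0 by rewrite gt_eqF.
  have -> : 4 * u / s * (\sum_k df k * kap k) = \sum_k df k * hh k (inord 0) + \sum_k df k * hh k (inord 1).
    rewrite big_distrr -big_split; apply: eq_bigr => k _ /=; rewrite -mulrDr; have [-> _] := J k; by field.
  have -> : \sum_k d 0 k * (rr k (inord 0) + rr k (inord 1)) = \sum_k d 0 k * rr k (inord 0) + \sum_k d 0 k * rr k (inord 1).
    by rewrite -big_split; apply: eq_bigr => k _; rewrite mulrDr.
  by move: (\sum_k _) (\sum_k _) (\sum_k _) (\sum_k _) => *; ring.
have S1 : (\sum_k (hh2 k (inord 0) + hh2 k (inord 1))) * s ^+ 2 <= u * (24 * l2 + 4 * s * \sum_k B k).
  rewrite -k2 big_distrl !mulr_sumr -big_split mulr_sumr; apply: ler_sum => k _; by have [_] := J k.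
have HfE : Hf 1 - Hf 0 = 4 + (slope ga 1 + l) by rewrite /Hf; move: (slope ga 1) (slope ga 0) => *; ring.
rewrite HfE in sumB.
have sn : s != 0 by rewrite gt_eqF.
move: rea S1; rewrite S2; move: sumB; move: (\sum_k B k) (\sum_k d 0 k * _) (slope ga 1) => SB Q F1 h1 h2 h3.
have h4 : s ^+ 2 * (u ^+ 2 / 2) <= s ^+ 2 * Q by rewrite ler_wpM2l // sqr_ge0.
have e1 : (4 * u / s * F1 + 2 * Q) * s ^+ 2 = 4 * u * s * F1 + 2 * (s ^+ 2 * Q) by field.
(* The slope [F1] now has the coefficient 4 u s on both sides of the inequality, from the drift term
   and from the second variation, and cancels. *)
have h5 : u * (4 * s * SB) <= u * (4 * s * (5 + l + F1)).
  by rewrite ler_wpM2l ?(ltW u0) // ler_wpM2l ?mulr_ge0 ?(ltW s0) //; move: h1; lra.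
have : u * (u * s ^+ 2) <= u * (24 * l2 + 4 * s * (5 + l)).
  move: h3 h4 h5; rewrite e1; lra.
by rewrite ler_pM2l.
Qed.

End MaxPoint.

Lemma lowest_ge0 p : 0 <= lowest g p.
Proof.
rewrite leNgt; apply/negP => up; have [a ap] := chart_cover A p; have cm := chart_cm g a; have Up := chart_codI ap.
pose G := met a p; pose U := - lowest g p; have U0 : 0 < U by rewrite oppr_gt0.
(* The bound at the maximum yields U rho^4 <= 44 rho^2 + 4 rho^3 <= 48 rho^3, where 44 = 24 + 4 * 5;
   this contradicts U rho = U + 48. *)
pose rho := 1 + 48 / U; have rho1 : 1 <= rho by rewrite lerDl divr_ge0 // ltW.
have rho0 : 0 < rho by exact: lt_le_trans rho1.
pose K := [set w : V | bil G w w <= rho ^+ 2].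
pose W w := - lowest g (geo gcomp a p w 1) * (rho ^+ 2 - bil G w w) ^+ 2.
have Gp : forall w : V, w != 0 -> 0 < bil G w w by exact: (cm_pos cm Up).
have Gge w : 0 <= bil G w w by exact: (chart_bil_ge0 cm _ Up).
have KK0 : K !=set0 by exists 0; rewrite /K /= bil0l sqr_ge0.
have usc w : K w -> forall z, W w < z -> \forall w' \near w, W w' < z.
  move=> Kw z Wz; pose phi := (rho ^+ 2 - bil G w w) ^+ 2; have phi0 : 0 <= phi by exact: sqr_ge0.
  (* U1 may be negative. The semicontinuous factor is first replaced by the constant U1 + e, which
     uses only that the square is nonnegative; what remains is continuous. *)
  pose U1 := - lowest g (geo gcomp a p w 1); pose e := (z - U1 * phi) / (phi + 1).
  have e0 : 0 < e by rewrite divr_gt0 ?subr_gt0 // ltr_wpDl.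
  have h1 : (U1 + e) * phi < z.
    have : e * (phi + 1) = z - U1 * phi by rewrite /e mulfVK // gt_eqF // ltr_wpDl.
    by move: e0; lra.
  have N1 : \forall w' \near w, - lowest g (geo gcomp a p w' 1) < U1 + e.
    have lt : lowest g (geo gcomp a p w 1) - e < lowest g (geo gcomp a p w 1) by rewrite ltrBlDr ltrDl.
    have N := @geo_cts _ _ _ _ _ Mh gcomp a p ap w _ (lowest_lsc gcomp fs sol lt).
    have H w' : lowest g (geo gcomp a p w 1) - e < lowest g (geo gcomp a p w' 1) ->
       - lowest g (geo gcomp a p w' 1) < U1 + e by rewrite /U1; lra.
    exact: (@filterS _ _ (nbhs_filter w) _ _ H N).
  have C0 : (fun w' : V => bil G w' w') @ nbhs w --> bil G w w by exact: bil_cts.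
  have C1 : (fun w' : V => rho ^+ 2 - bil G w' w') @ nbhs w --> rho ^+ 2 - bil G w w by exact: (cvgB (cvg_cst _) C0).
  have C2 : (fun w' : V => (U1 + e) * ((rho ^+ 2 - bil G w' w') * (rho ^+ 2 - bil G w' w'))) @ nbhs w -->
      (U1 + e) * ((rho ^+ 2 - bil G w w) * (rho ^+ 2 - bil G w w)).
    exact: (cvgM (cvg_cst _) (cvgM C1 C1)).
  have N2 : \forall w' \near w, (U1 + e) * ((rho ^+ 2 - bil G w' w') * (rho ^+ 2 - bil G w' w')) < z.
    exact: (@cvgr_lt R V (nbhs w) _ _ _ C2 z h1).
  have H w' : - lowest g (geo gcomp a p w' 1) < U1 + e ->
     (U1 + e) * ((rho ^+ 2 - bil G w' w') * (rho ^+ 2 - bil G w' w')) < z -> W w' < z.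
    move=> a1 a2; apply: le_lt_trans a2; rewrite /W -expr2; apply: ler_wpM2r; [exact: sqr_ge0|exact: ltW].
  exact: (@filterS2 _ _ (nbhs_filter w) _ _ _ H N1 N2).
have [v Kv vmax] := usc_max (@bil_ball_compact _ _ G (rho ^+ 2) Gp) KK0 usc.
(* A vector of zero length whose image under exp is p: its value U rho^4 bounds the maximum from
   below. *)
have /(leg_geo Mh gcomp _ _ ap)[_ [w0 w0E w0p]] := leg_refl gcomp p (lexx (0 : R)).
have w00 : bil G w0 w0 = 0 by apply/eqP; rewrite eq_le Gge andbT; move: w0E; rewrite expr0n.
have Wv : U * rho ^+ 4 <= W v.
  have := vmax w0; rewrite /K /= w00 sqr_ge0 => /(_ isT); rewrite /W w00 subr0 w0p -exprM; exact.
have Wv0 : 0 < W v by apply: lt_le_trans Wv; rewrite mulr_gt0 // exprn_gt0.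
pose s := rho ^+ 2 - bil G v v.
have sge : 0 <= s by rewrite subr_ge0.
have sn : s != 0 by apply/eqP => s0; move: Wv0; rewrite /W -/s s0 expr0n mulr0 ltxx.
have s0 : 0 < s by rewrite lt0r sn.
have u0 : 0 < - lowest g (geo gcomp a p v 1).
  by move: Wv0; rewrite /W -/s pmulr_lgt0 // exprn_gt0.
pose l := Num.sqrt (bil G v v).
have lE : l ^+ 2 = bil G v v by rewrite sqr_sqrtr.
have l0 : 0 <= l by exact: sqrtr_ge0.
have lr : l <= rho by rewrite -ler_sqr ?nnegrE ?(ltW rho0) // lE.
have := max_point_bound ap s0 u0 (fun w => vmax w) l0 lE; rewrite -/G -/s => H.
have {}H : U * rho ^+ 4 <= 24 * bil G v v + 4 * s * (5 + l) by exact: le_trans Wv H.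
have Kv' : bil G v v <= rho ^+ 2 := Kv.
have h1 : s * (5 + l) <= rho ^+ 2 * (5 + rho).
  apply: ler_pM => //; rewrite ?addr_ge0 //; last by rewrite lerD2l.
  by rewrite /s lerBlDr lerDl.
have h2 : U * rho ^+ 4 <= 44 * rho ^+ 2 + 4 * rho ^+ 3.
  have -> : 44 * rho ^+ 2 + 4 * rho ^+ 3 = 24 * rho ^+ 2 + 4 * (rho ^+ 2 * (5 + rho)) by ring.
  have fin (P s1 l1 b1 r1 : R) : P <= 24 * b1 + 4 * s1 * (5 + l1) -> s1 * (5 + l1) <= r1 ^+ 2 * (5 + r1) ->
    b1 <= r1 ^+ 2 -> P <= 24 * r1 ^+ 2 + 4 * (r1 ^+ 2 * (5 + r1)) by lra.
  exact: (fin _ _ _ _ _ H h1 Kv').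
have h3 : 44 * rho ^+ 2 <= 44 * rho ^+ 3 by rewrite ler_wpM2l // exprS ler_peMl // sqr_ge0.
have h4 : rho ^+ 3 * (U * rho) <= rho ^+ 3 * 48 by move: h2 h3; rewrite !exprS expr0; lra.
have h5 : U * rho <= 48 by move: h4; rewrite ler_pM2l // exprn_gt0.
have h6 : U * rho = U + 48 by rewrite /rho mulrDr mulr1 mulrCA mulfV ?mulr1 // gt_eqF.
by move: h5; rewrite h6; lra.
Qed.

End MaximumPrinciple.

Theorem corollary1p1 (R : realType) (M : topologicalType)
    (M_hausdorff : hausdorff_space M)
    (M_second_countable : @second_countable M)
    (M_connected : connected [set: M])
    (A : smooth_atlas R 3 M) (A_oriented : oriented_atlas A)
    (g : riemannian_metric A) (f : M -> R)
    (g_soliton : gradient_steady_soliton g f)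
    (g_normalized : normalized_soliton g f)
    (g_NIC : nonneg_isotropic_curvature g) :
  two_nonneg_ricci g /\
  forall (a : chart_index A) (x : 'rV[R]_4) (E : 'M[R]_4),
    chart_cod a x -> oriented_orthonormal (metric g a x) E ->
    Rm_norm (metric g a) x E <= scalar_curvature (metric g a) x /\
    scalar_curvature (metric g a) x <= 1.
Proof.
have [gcomp fs sol] := g_soliton.
have two : two_nonneg_ricci g.
  move=> a x E Ux [EE _]; have cm := chart_cm g a; have [p ap px] := Ux; subst x.
  (* Rotating the frame by T makes Rc diagonal with increasing entries; the first two then form a
     trial pair for [lowest]. *)
  have [T [d [TT TS ds]]] := spectral_sorted (ricci_frame_sym cm Ux EE).
  apply/(two_smallestE TT TS ds).
  have FF : (T *m E) *m metric g a (chart a p) *m (T *m E)^T = 1%:M.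
    have -> : (T *m E) *m metric g a (chart a p) *m (T *m E)^T = T *m (E *m metric g a (chart a p) *m E^T) *m T^T.
      by rewrite trmx_mul !mulmxA.
    by rewrite EE mulmx1.
  have := lowest_pair_le (lowestP gcomp fs sol ap) FF.
  have dE k : bil (ricci (metric g a) (chart a p)) (row k (T *m E)) (row k (T *m E)) = d 0 k.
    rewrite -bil_rowE; have -> : T *m E *m ricci (metric g a) (chart a p) *m (T *m E)^T = diag_mx d.
      by rewrite -TS /ricci_frame trmx_mul !mulmxA.
    by rewrite mxE eqxx.
  by rewrite !dE; apply: le_trans; exact: (lowest_ge0 M_hausdorff gcomp fs sol g_normalized g_NIC).
split=> // a x E Ux oE; have [EE _] := oE; have cm := chart_cm g a; have [hA hC] := g_NIC a x E Ux oE.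
split; first exact: (Rm_norm_le cm Ux EE hA hC (two a x E Ux oE)).
have := g_normalized a x Ux; have := @grad_norm_ge0 _ _ _ g f a x Ux; lra.
Qed.
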